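(* Let $n\ge1$. (1) (Vector-valued Hölder inequality.) Let $p,q,r\in(0,\infty]$ satisfy $\frac1p+\frac1q=\frac1r$. Then there is a constant $C$ depending only on $n,p,q,r$ such that, for every measure space and all $\vec f\in (L^p)^n$ and $\vec g\in(L^q)^n$ on it, $$\|x\mapsto\vec f(x)\cdot\vec g(x)\|_{L^r_x}\le C\,\big\|(x,y)\mapsto\vec f(x)\cdot\vec g(y)\big\|_{L^p_x(L^q_y)}.$$ (2) (Vector-valued Kato–Ponce inequality.) Let $p_k,q_k\in(1,\infty]$ and $r\in(\frac12,\infty]$ satisfy $\frac1r=\frac1{p_k}+\frac1{q_k}$ for $k=0,1$, and let $s>d(\frac1r-1)_+$ or $s\in2\mathbb N$. Let $D^s$ be either of the operators $(-\triangle)^{s/2}$ or $(I-\triangle)^{s/2}$ on $\mathbb R^d$. Then there is a constant $C$ depending only on $n,d,s,r,p_0,p_1,q_0,q_1$ such that for all $\vec f,\vec g\in\mathscr S(\mathbb R^d)^n$, $$\|x\mapsto D^s(\vec f\cdot\vec g)(x)\|_{L^r_x}\le C\Big(\big\|(x,y)\mapsto D^s\vec f(x)\cdot\vec g(y)\big\|_{L^{p_0}_x(L^{q_0}_y)}+\big\|(x,y)\mapsto\vec f(x)\cdot D^s\vec g(y)\big\|_{L^{p_1}_x(L^{q_1}_y)}\Big).$$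
   Context: All functions are real-valued (so vectors of $n$ functions are $\mathbb R^n$-valued functions); $\vec u\cdot\vec v=\sum_{i=1}^nu_iv_i$; $\mathscr S(\mathbb R^d)$ is the space of Schwartz functions on $\mathbb R^d$, and $\vec f\cdot\vec g=\sum_{i=1}^n f_ig_i$ pointwise. $D^s$ acts componentwise on vectors; $(-\triangle)^{s/2}$ and $(I-\triangle)^{s/2}$ are the Fourier multiplier operators with symbols $|2\pi\xi|^s$ and $(1+|2\pi\xi|^2)^{s/2}$. $t_+=\max(t,0)$. In (2) all $L^p$ norms are over $\mathbb R^d$ with Lebesgue measure. The iterated norm is $\|h\|_{L^p_x(L^q_y)}=\big\|x\mapsto\|h(x,\cdot)\|_{L^q}\big\|_{L^p}$. For exponents in $(0,1)$, $\|f\|_{L^p}=(\int|f|^p)^{1/p}$ is a quasi-norm. *)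

(* Defs.v *)
From HB Require Import structures.
From mathcomp Require Import all_boot all_order all_algebra.
From mathcomp Require Import complex.
From mathcomp Require Import all_classical all_reals all_analysis.

Set Implicit Arguments.
Unset Strict Implicit.
Unset Printing Implicit Defensive.

Import Order.TTheory GRing.Theory Num.Theory.
Import numFieldNormedType.Exports.

Local Open Scope classical_set_scope.
Local Open Scope ring_scope.

(* R^d is 'rV[R]_d, so that the library's topology and derivatives apply.
   Its sigma-algebra is the product (Borel) one, generated by the coordinates.
   Beware that the library's norm on 'rV[R]_d is the sup norm; the Euclidean
   norm is [enorm] below. *)

Section measurable_rV.
Variables (R : realType) (n : nat).

Definition rV_coord (i : 'I_n) (x : 'rV[R]_n) : R := x ord0 i.

Let rV_set0 : g_sigma_preimage rV_coord set0.
Proof. exact: sigma_algebra0. Qed.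

Let rV_setC A : g_sigma_preimage rV_coord A -> g_sigma_preimage rV_coord (~` A).
Proof. exact: sigma_algebraC. Qed.

Let rV_bigcup (F : (set 'rV[R]_n)^nat) :
  (forall i, g_sigma_preimage rV_coord (F i)) ->
  g_sigma_preimage rV_coord (\bigcup_i F i).
Proof. exact: sigma_algebra_bigcup. Qed.

HB.instance Definition _ := @isMeasurable.Build default_measure_display
  'rV[R]_n (g_sigma_preimage rV_coord) rV_set0 rV_setC rV_bigcup.

End measurable_rV.

Lemma measurable_rV_coord (R : realType) n (i : 'I_n) :
  measurable_fun [set: 'rV[R]_n] (rV_coord i).
Proof.
move=> _ Y mY; rewrite setTI; apply: sub_sigma_algebra => /=.
rewrite -bigcup_seq/=; exists i => /=; first by rewrite mem_index_enum.
by exists Y => //; rewrite setTI.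
Qed.

Lemma measurable_fun_rVP d (T : measurableType d) (R : realType) n
    (f : T -> 'rV[R]_n) :
  (forall i, measurable_fun [set: T] (fun x => f x ord0 i)) ->
  measurable_fun [set: T] f.
Proof.
move=> mf.
suff : g_sigma_preimage (fun i => @rV_coord R n i \o f) `<=` measurable.
  by rewrite g_sigma_preimage_comp => prefS _ A mA; apply: prefS; exists A.
apply: smallest_sub; first exact: sigma_algebra_measurable.
case: n => [|n] in f mf *; first by rewrite big_ord0.
rewrite -bigcup_mkord_ord; apply: bigcup_sub => i Ii.
by move=> A [B mB <-]; exact: mf.
Qed.

Definition rV_cons (R : realType) n (p : R * 'rV[R]_n) : 'rV[R]_n.+1 :=
  row_mx (p.1%:M : 'rV[R]_1) p.2.

Lemma rV_cons0 (R : realType) n (p : R * 'rV[R]_n) :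
  rV_cons p ord0 ord0 = p.1.
Proof.
have := row_mxEl (p.1%:M : 'rV[R]_1) p.2 ord0 ord0.
by rewrite [RHS]mxE eqxx mulr1n => <-; congr fun_of_matrix; exact: val_inj.
Qed.

Lemma rV_consS (R : realType) n (p : R * 'rV[R]_n) (i : 'I_n) :
  rV_cons p ord0 (lift ord0 i) = p.2 ord0 i.
Proof.
have <- := row_mxEr (p.1%:M : 'rV[R]_1) p.2 ord0 i.
by congr fun_of_matrix; exact: val_inj.
Qed.

Lemma measurable_rV_cons (R : realType) n :
  measurable_fun [set: R * 'rV[R]_n] (@rV_cons R n).
Proof.
apply: measurable_fun_rVP => i; case: (unliftP ord0 i) => [j|] ->.
- under eq_fun do rewrite rV_consS.
  exact: (measurableT_comp (measurable_rV_coord j) measurable_snd).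
- under eq_fun do rewrite rV_cons0.
  exact: measurable_fst.
Qed.

Section lebesgue_rV_succ.
Variables (R : realType) (n : nat).
Variable m : {sigma_finite_measure set 'rV[R]_n -> \bar R}.

Definition lebesgue_rV_succ : set 'rV[R]_n.+1 -> \bar R :=
  pushforward (@lebesgue_measure R \x m)%E (@rV_cons R n).

Let succ0 : lebesgue_rV_succ set0 = 0%E.
Proof. by rewrite /lebesgue_rV_succ /pushforward preimage_set0 measure0. Qed.

Let succ_ge0 A : (0 <= lebesgue_rV_succ A)%E.
Proof.
exact: (measure_ge0 (@lebesgue_measure R \x m)%E (@rV_cons R n @^-1` A)).
Qed.

Let succ_sigma_additive : semi_sigma_additive lebesgue_rV_succ.
Proof.
move=> F mF tF mUF; rewrite /lebesgue_rV_succ /pushforward preimage_bigcup.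
apply: measure_semi_sigma_additive.
- by move=> k; rewrite -[X in measurable X]setTI; exact: measurable_rV_cons.
- apply/trivIsetP => /= i j _ _ ij; rewrite -preimage_setI.
  by move/trivIsetP : tF => /(_ _ _ _ _ ij) ->//; rewrite preimage_set0.
- rewrite -preimage_bigcup -[X in measurable X]setTI.
  exact: measurable_rV_cons.
Qed.

HB.instance Definition _ := isMeasure.Build _ _ _ lebesgue_rV_succ
  succ0 succ_ge0 succ_sigma_additive.

Let uncons (x : 'rV[R]_n.+1) : R * 'rV[R]_n :=
  (x ord0 ord0, \row_i x ord0 (lift ord0 i)).

Let consK : cancel (@rV_cons R n) uncons.
Proof.
move=> [a u]; rewrite /uncons rV_cons0; congr pair.
by apply/rowP => i; rewrite mxE rV_consS.
Qed.

Let measurable_uncons : measurable_fun [set: 'rV[R]_n.+1] uncons.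
Proof.
apply/measurable_fun_pair; first exact: (measurable_rV_coord ord0).
apply: measurable_fun_rVP => i; under eq_fun do rewrite mxE.
exact: (measurable_rV_coord (lift ord0 i)).
Qed.

Let succ_sigma_finite : sigma_finite setT lebesgue_rV_succ.
Proof.
have /sigma_finiteP[F [TF ndF Foo]] := sigma_finiteT (@lebesgue_measure R).
have /sigma_finiteP[G [TG ndG Goo]] := sigma_finiteT m.
exists (fun k => uncons @^-1` (F k `*` G k)).
  rewrite -preimage_bigcup (_ : \bigcup_i _ = setT)//.
  rewrite -setXTT TF TG predeqE => -[x y]; split.
    by move=> [k _ []/= ? ?]; split; exists k.
  move=> [/= [k _ Fkx] [l _ Gly]]; exists (maxn k l) => //; split.
  - by move: x Fkx; exact/subsetPset/ndF/leq_maxl.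
  - by move: y Gly; exact/subsetPset/ndG/leq_maxr.
move=> k; have [? ?] := Foo k; have [? ?] := Goo k; split.
  rewrite -[X in measurable X]setTI; apply: measurable_uncons => //.
  exact: measurableX.
rewrite /lebesgue_rV_succ /pushforward -comp_preimage.
rewrite (_ : _ @^-1` _ = F k `*` G k).
  by rewrite product_measure1E// lte_mul_pinfty// ge0_fin_numE.
by rewrite (_ : _ \o _ = id)//; apply/funext => x; exact: consK.
Qed.

HB.instance Definition _ := Measure_isSigmaFinite.Build _ _ _ lebesgue_rV_succ
  succ_sigma_finite.

End lebesgue_rV_succ.

(* The d-fold product of [lebesgue_measure]; see [lebesgue_rV_box]. *)
Fixpoint lebesgue_rV (R : realType) (d : nat) :
    {sigma_finite_measure set 'rV[R]_d -> \bar R} :=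
  match d with
  | 0%N => @dirac _ 'rV[R]_0 0 R
  | n.+1 => lebesgue_rV_succ (lebesgue_rV R n)
  end.

Lemma lebesgue_rV_box (R : realType) d (A : 'I_d -> set R) :
  (forall i, measurable (A i)) ->
  lebesgue_rV R d [set x | forall i, A i (x ord0 i)] =
  (\prod_(i < d) lebesgue_measure (A i))%E.
Proof.
elim: d A => [|d ih] A mA.
  by rewrite big_ord0 /= /dirac indicE mem_set//= => -[].
rewrite big_ord_recl -(ih (fun i => A (lift ord0 i)))//=.
rewrite /lebesgue_rV_succ /pushforward -product_measure1E//.
- congr product_measure1; apply/seteqP; split => -[a u] /=.
  + move=> H; split; first by have := H ord0; rewrite rV_cons0.
    by move=> i; have := H (lift ord0 i); rewrite rV_consS.
  + move=> [Aa Au] i; case: (unliftP ord0 i) => [j|] ->.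
      by rewrite rV_consS; exact: Au.
    by rewrite rV_cons0.
- exact: mA.
rewrite [X in measurable X](_ : _ =
    \bigcap_(i in [set: 'I_d]) (@rV_coord R d i @^-1` A (lift ord0 i))).
  apply: fin_bigcap_measurable => [|i _]; first exact: finite_finset.
  by rewrite -[X in measurable X]setTI; exact: measurable_rV_coord.
by apply/seteqP; split => [x Ax i _|x Ax i]; exact: Ax.
Qed.

(* Used for exponents p in ]0, +oo], whereas the library's LfunType assumes
   1 <= p. *)
Definition inLp d (T : measurableType d) (R : realType)
    (mu : {measure set T -> \bar R}) (p : \bar R) (f : T -> R) : Prop :=
  measurable_fun [set: T] f /\ finite_norm mu p f.

(* The norm of L^p_x(L^q_y). *)
Definition iter_Lnorm d1 d2 (T1 : measurableType d1) (T2 : measurableType d2)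
    (R : realType) (mu : {measure set T1 -> \bar R})
    (nu : {measure set T2 -> \bar R}) (p q : \bar R) (h : T1 -> T2 -> R)
    : \bar R :=
  Lnorm mu p (fun x => Lnorm nu q (fun y => (h x y)%:E)).

(* (x, y) |-> f(x) . g(y) for R^n-valued f and g, given by their components. *)
Definition vdot (T1 T2 : Type) (R : realType) n
    (f : 'I_n -> T1 -> R) (g : 'I_n -> T2 -> R) (x : T1) (y : T2) : R :=
  \sum_(i < n) f i x * g i y.

Section fourier.
Variables (R : realType) (d : nat).
Implicit Types (x y xi : 'rV[R]_d) (F : 'rV[R]_d -> R[i]) (s : R).

Definition partial (i : 'I_d) (f : 'rV[R]_d -> R) : 'rV[R]_d -> R :=
  'D_(delta_mx ord0 i : 'rV[R]_d) f.

(* Iterated partial derivatives, in an arbitrary order. *)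
Definition partials (l : seq 'I_d) (f : 'rV[R]_d -> R) : 'rV[R]_d -> R :=
  foldr partial f l.

(* Smoothness is stated as differentiability of all iterated partial
   derivatives. *)
Definition schwartz (f : 'rV[R]_d -> R) : Prop :=
  (forall (l : seq 'I_d) x, differentiable (partials l f) x) /\
  (forall (a : 'I_d -> nat) (l : seq 'I_d), exists M : R, forall x,
     `|(\prod_(i < d) x ord0 i ^+ a i) * partials l f x| <= M).

Definition edot x y : R := \sum_(i < d) x ord0 i * y ord0 i.

Definition enorm x : R := Num.sqrt (edot x x).

Definition expi (t : R) : R[i] := (cos t +i* sin t)%C.

Definition cintegral F : R[i] :=
  ((\int[lebesgue_rV R d]_x complex.Re (F x)) +i*
   (\int[lebesgue_rV R d]_x complex.Im (F x)))%C.

Definition fourier F xi : R[i] :=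
  cintegral (fun x => F x * expi (- (2 * pi * edot x xi))).

Definition inv_fourier F x : R[i] :=
  cintegral (fun xi => F xi * expi (2 * pi * edot x xi)).

(* Only used for real even symbols m and real functions f, for which the
   inverse transform is already real-valued. *)
Definition multiplier (m : 'rV[R]_d -> R) (f : 'rV[R]_d -> R) x : R :=
  complex.Re
    (inv_fourier (fun xi => (m xi)%:C%C * fourier (fun y => (f y)%:C%C) xi) x).

(* (-\triangle)^(s/2) *)
Definition riesz_op s : ('rV[R]_d -> R) -> 'rV[R]_d -> R :=
  multiplier (fun xi => enorm ((2 * pi) *: xi) `^ s).

(* (I-\triangle)^(s/2) *)
Definition bessel_op s : ('rV[R]_d -> R) -> 'rV[R]_d -> R :=
  multiplier (fun xi => (1 + enorm ((2 * pi) *: xi) ^+ 2) `^ (s / 2)).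

End fourier.

(* Main.v *)
Require Import Defs.
From HB Require Import structures.
From mathcomp Require Import all_boot all_order all_algebra.
From mathcomp Require Import complex ring lra.
From mathcomp Require Import all_classical all_reals all_analysis.
From mathcomp Require Import measurable_realfun ess_sup_inf.

Set Implicit Arguments.
Unset Strict Implicit.
Unset Printing Implicit Defensive.

Import Order.TTheory GRing.Theory Num.Theory.
Import numFieldNormedType.Exports.

Local Open Scope classical_set_scope.
Local Open Scope ring_scope.

(* Both parts come from one linear-algebra fact: for a quasi-norm N on R^n,
   greedily choosing near-minimizers of N on sup-norm unit vectors gives a basis
   e_i with dual basis phi_i such that |phi_i(w)| N(e_i) <= C N(w), where C
   depends only on n and on the quasi-norm constant.  With N(v) = ||v.g||_q one
   has f.g = sum_i phi_i(f) (e_i.g), and scalar Hoelder gives (1).  For (2) this is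
   done twice, for v |-> ||v.g||_q0 and then, in the resulting coordinates, for a
   small perturbation of a |-> ||a.Dg||_q1, so that both terms of the scalar
   Kato-Ponce inequality are controlled simultaneously.
   The scalar inequality follows from a pointwise bound of D(fg) - f Dg - g Df by
   M_u(Df) M_v(g) + M(f) M(Dg), where M_u h = (M |h|^u)^(1/u) and M is a dyadic
   maximal function with a product kernel.  For the Bessel operator it comes from
   a Littlewood-Paley decomposition: the commutator gains in the low-high terms,
   and in the high-high terms one interpolates a trivial bound with Young's
   trilinear inequality, 1/u + 1/v = 1 + lam with d lam < s (when s is even these
   terms need no cancellation between scales).  The pointwise bound is transported
   to the Riesz operator by dilating and letting the scale tend to infinity. *)

(** * Integration over R^d *)

(** Obstacle in (2): the two terms on the right measure v by two unrelated norms, and no basis of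
    R^n is greedy for both. The adapted basis is therefore made to control sup norms as well: its
    vectors have sup norm 1, and its dual functionals are bounded by a constant times the sup norm.
    Once the first basis is normalised so that the functions e_i.g have L^q0 norm at most 1, passing
    to any second adapted basis costs only a constant in the first term. The second norm may be
    degenerate, and its finiteness is never established. Adding eps |a| bounds it below on unit
    vectors, which suffices for near-minimizers, and the constants do not depend on eps.

    Origin of the condition on s: two factors at frequency 2^j produce output at every frequency
    2^(j-t). There the operator gains 2^(-ts), while the trilinear inequality loses 2^(t d lam),
    with 1/u + 1/v = 1 + lam. Boundedness of M_u and M_v requires u < p0 and v < q0, hence lam > 1/r
    - 1. Such a lam >= 0 with d lam < s exists exactly when s > d (1/r - 1)_+. *)

Section lebesgue_affine.
Variable R : realType.
Implicit Types a b : R.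

Definition affine a b : measurableTypeR R -> measurableTypeR R :=
  fun x => a * x + b.

Lemma measurable_affine a b : measurable_fun [set: measurableTypeR R] (affine a b).
Proof. by apply: measurable_funD => //; apply: measurable_funM. Qed.

Definition affine_measure a b (a0 : 0 <= a) :
  {measure set (measurableTypeR R) -> \bar R}.
Proof.
refine (mscale (NngNum a0) (pushforward (@lebesgue_measure R) (affine a b))).
exact: measurable_affine.
Defined.

(** The scaled pushforward is a measure that gives half-open intervals their length, and this
    determines Lebesgue measure. *)
Lemma lebesgue_measure_affine a b (A : set (measurableTypeR R)) :
  0 < a -> measurable A ->
  (a%:E * pushforward (@lebesgue_measure R) (affine a b) A)%E =
  lebesgue_measure A.
Proof.
move=> a0 mA.
have a0' : (0 <= a)%R by exact: ltW.
pose nu := affine_measure b a0'.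
have -> : lebesgue_measure A = nu A.
  apply: lebesgue_measure_unique => // _ [[u v]] _ <-.
  rewrite /nu /affine_measure/= /mscale/= /pushforward.
  rewrite (_ : _ @^-1` _ = `](u - b) / a, (v - b) / a]%classic); last first.
    rewrite /affine; apply/seteqP; split => x /=; rewrite !in_itv/= ler_pdivlMr// ltr_pdivrMr//.
      by move=> /andP[? ?]; apply/andP; split; rewrite mulrC; lra.
    by rewrite (mulrC x a) => /andP[? ?]; apply/andP; split; lra.
  rewrite !lebesgue_measure_itv/= !lte_fin.
  rewrite ltr_pM2r ?invr_gt0// ltrD2r.
  case: ifPn => uv; last by rewrite mule0.
  rewrite -!EFinD -EFinM; congr EFin.
  by rewrite -mulrBl mulrC -mulrA mulVf ?gt_eqF// mulr1; ring.
by [].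
Qed.

Lemma ge0_integral_affine_pos a b (f : R -> \bar R) : 0 < a ->
  measurable_fun [set: R] f -> (forall x, 0 <= f x)%E ->
  (\int[lebesgue_measure]_x f (a * x + b)%R =
   (a^-1)%:E * \int[lebesgue_measure]_x f x)%E.
Proof.
move=> a0 mf f0.
have a0' : (0 <= a)%R by exact: ltW.
pose nu := affine_measure b a0'.
have -> : (\int[lebesgue_measure]_x f x = \int[nu]_x f x)%E.
  apply: eq_measure_integral => A mA _; rewrite /nu /affine_measure/= /mscale/=.
  exact/esym/lebesgue_measure_affine.
rewrite /nu /affine_measure ge0_integral_mscale//= ge0_integral_pushforward//=; last exact: measurable_affine.
by rewrite muleA -EFinM mulVf ?gt_eqF// mul1e.
Qed.

Lemma ge0_integral_opp (f : R -> \bar R) :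
  measurable_fun [set: R] f -> (forall x, 0 <= f x)%E ->
  (\int[lebesgue_measure]_x f (- x)%R = \int[lebesgue_measure]_x f x)%E.
Proof.
move=> mf f0.
rewrite -[LHS]/(\int[lebesgue_measure]_(x in (-%R : R -> measurableTypeR R) @^-1` setT)
   (f \o (-%R : R -> measurableTypeR R)) x)%E.
rewrite -ge0_integral_pushforward//.
by apply: eq_measure_integral => A mA _; exact: lebesgue_measureN.
Qed.

Lemma ge0_integral_affine a b (f : R -> \bar R) : a != 0 ->
  measurable_fun [set: R] f -> (forall x, 0 <= f x)%E ->
  (\int[lebesgue_measure]_x f (a * x + b)%R =
   (`|a|^-1)%:E * \int[lebesgue_measure]_x f x)%E.
Proof.
move=> a0 mf f0; case: (ltgtP a 0) a0 => // a0 _.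
  rewrite ltr0_norm// -(ge0_integral_affine_pos b)// ?oppr_gt0//.
  have mg : measurable_fun [set: R] (fun x => f (- a * x + b)).
    by apply: measurableT_comp => //; exact: measurable_affine.
  rewrite -(@ge0_integral_opp (fun x => f (- a * x + b)))//.
  by apply: eq_integral => x _; rewrite mulrNN.
by rewrite gtr0_norm// ge0_integral_affine_pos.
Qed.

End lebesgue_affine.

Section integral_rV.
Variable R : realType.
Local Notation mu := (@lebesgue_measure R).

Lemma ge0_integral_rV0 (f : 'rV[R]_0 -> \bar R) :
  measurable_fun [set: 'rV[R]_0] f -> (forall x, 0 <= f x)%E ->
  (\int[lebesgue_rV R 0]_x f x = f 0%R)%E.
Proof. by move=> mf f0; rewrite /= integral_dirac// diracT mul1e. Qed.

(** The measure is the image of a product measure under [rV_cons], so this is Tonelli. Facts about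
    R^d are derived from it by peeling off one coordinate at a time. *)
Lemma ge0_integral_rVS d (f : 'rV[R]_d.+1 -> \bar R) :
  measurable_fun [set: 'rV[R]_d.+1] f -> (forall x, 0 <= f x)%E ->
  (\int[lebesgue_rV R d.+1]_x f x =
   \int[mu]_t \int[lebesgue_rV R d]_x f (rV_cons (t, x)))%E.
Proof.
move=> mf f0.
transitivity (\int[(mu \x lebesgue_rV R d)%E]_z f (rV_cons z))%E; last first.
  rewrite fubini_tonelli1//.
  by apply: measurableT_comp => //; exact: measurable_rV_cons.
rewrite -(@preimage_setT _ _ (@rV_cons R d)).
have mc : measurable_fun [set: measurableTypeR R * 'rV[R]_d] (@rV_cons R d).
  exact: measurable_rV_cons.
rewrite -[RHS](@ge0_integral_pushforward _ _ (measurableTypeR R * 'rV[R]_d)%type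
  _ R (@rV_cons R d) mc _ setT f)//.
Qed.

Local Opaque lebesgue_rV.

Lemma measurable_rV_affine d (a : R) (v : 'rV[R]_d) :
  measurable_fun [set: 'rV[R]_d] (fun x => a *: x + v).
Proof.
apply: measurable_fun_rVP => i; under eq_fun do rewrite !mxE.
apply: measurable_funD => //; apply: measurable_funM => //.
exact: measurable_rV_coord.
Qed.

Lemma rV_cons_affine d (a b t : R) (v x : 'rV[R]_d) :
  a *: rV_cons (t, x) + rV_cons (b, v) = rV_cons (a * t + b, a *: x + v).
Proof.
apply/rowP => i; rewrite [LHS]mxE [X in X + _]mxE.
case: (unliftP ord0 i) => [j|] ->; last by rewrite !rV_cons0.
by rewrite !rV_consS/= [RHS]mxE [X in _ = X + _]mxE.
Qed.

Lemma rV_consE d (v : 'rV[R]_d.+1) :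
  v = rV_cons (v ord0 ord0, \row_i v ord0 (lift ord0 i)).
Proof.
apply/rowP => i; case: (unliftP ord0 i) => [j|] ->.
  by rewrite rV_consS mxE.
by rewrite rV_cons0.
Qed.

Lemma measurable_rV_cons_fst d (f : 'rV[R]_d.+1 -> \bar R) t :
  measurable_fun setT f -> measurable_fun setT (fun x => f (rV_cons (t, x))).
Proof.
move=> mf; apply: measurableT_comp => //.
by apply: measurableT_comp; [exact: measurable_rV_cons|exact: measurable_pair1].
Qed.

Lemma measurable_integral_rV_cons d (f : 'rV[R]_d.+1 -> \bar R) :
  measurable_fun setT f -> (forall x, 0 <= f x)%E ->
  measurable_fun setT
    (fun t => \int[lebesgue_rV R d]_x f (rV_cons (t, x)))%E.
Proof.
move=> mf f0; apply: (measurable_fun_fubini_tonelli_F (f \o @rV_cons R d)) => //=.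
by apply: measurableT_comp => //; exact: measurable_rV_cons.
Qed.

Lemma ge0_integral_rV_affine d (a : R) (v : 'rV[R]_d) (f : 'rV[R]_d -> \bar R) :
  a != 0 -> measurable_fun [set: 'rV[R]_d] f -> (forall x, 0 <= f x)%E ->
  (\int[lebesgue_rV R d]_x f (a *: x + v)%R =
   (`|a| ^- d)%:E * \int[lebesgue_rV R d]_x f x)%E.
Proof.
move=> a0; elim: d v f => [|d ih] v f mf f0.
  rewrite !ge0_integral_rV0//; last first.
    by apply: measurableT_comp => //; exact: measurable_rV_affine.
  by rewrite expr0 invr1 mul1e; congr f; apply/rowP => -[].
rewrite [in LHS]ge0_integral_rVS//; last first.
  by apply: measurableT_comp => //; exact: measurable_rV_affine.
rewrite ge0_integral_rVS//.
rewrite (rV_consE v); set b := v _ _; set w := \row_i _.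
transitivity (\int[mu]_t ((`|a| ^- d)%:E *
  \int[lebesgue_rV R d]_x f (rV_cons ((a * t + b)%R, x))))%E.
  apply: eq_integral => t _.
  under eq_integral => x _ do rewrite rV_cons_affine.
  rewrite (ih w (fun x => f (rV_cons (a * t + b, x))))//.
  exact: measurable_rV_cons_fst.
have mI := measurable_integral_rV_cons mf f0.
pose g t := (\int[lebesgue_rV R d]_x f (rV_cons (t, x)))%E.
have g0 t : (0 <= g t)%E by apply: integral_ge0.
have mg : measurable_fun setT (fun t => g (a * t + b)).
  by apply: (measurableT_comp mI); exact: measurable_affine.
rewrite -[LHS]/(\int[mu]_t ((`|a| ^- d)%:E * g (a * t + b)%R))%E.
have k0 : (0 <= (`|a| ^- d)%:E)%E by rewrite lee_fin invr_ge0 exprn_ge0.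
apply: (etrans (ge0_integralZl mu measurableT mg (fun t _ => g0 (a * t + b)) k0)).
rewrite (ge0_integral_affine b a0 mI g0).
by rewrite muleA -EFinM exprS invfM mulrC.
Qed.

End integral_rV.

Notation intg mu f := (mu.-integrable setT (EFin \o f)).

Lemma ge0_intZl d (T : measurableType d) (R : realType)
    (mu : {measure set T -> \bar R}) (f : T -> \bar R) (k : R) :
  measurable_fun setT f -> (forall x, 0 <= f x)%E -> 0 <= k ->
  (\int[mu]_x (k%:E * f x) = k%:E * \int[mu]_x f x)%E.
Proof. by move=> mf f0 k0; rewrite ge0_integralZl. Qed.

Section real_integral.
Context d (T : measurableType d) (R : realType).
Variable mu : {measure set T -> \bar R}.
Implicit Types (f g h k : T -> R) (c B : R).

Lemma intg_measurable f : intg mu f -> measurable_fun setT f.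
Proof. by case/integrableP => /measurable_EFinP. Qed.

Lemma dom_intg f g : measurable_fun setT f -> (forall x, `|f x| <= g x) ->
  intg mu g -> intg mu f.
Proof.
move=> mf fg ig; apply: (le_integrable measurableT _ _ ig).
  exact/measurable_EFinP.
by move=> x _ /=; rewrite lee_fin (le_trans (fg x))// ler_norm.
Qed.

Lemma intgZ c f : intg mu f -> intg mu (fun x => c * f x).
Proof. by move=> fi; exact: (integrableZl measurableT c fi). Qed.

Lemma intgM f h B : intg mu f -> measurable_fun setT h ->
  (forall x, `|h x| <= B) -> intg mu (fun x => f x * h x).
Proof.
move=> fi mh hB; apply: (@dom_intg _ (fun x => B * `|f x|)).
- by apply: measurable_funM => //; exact: intg_measurable.
- by move=> x; rewrite normrM mulrC ler_wpM2r.
- by apply: intgZ; exact: integrable_norm.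
Qed.

Lemma intgD f g : intg mu f -> intg mu g -> intg mu (fun x => f x + g x).
Proof. by move=> fi gi; exact: (integrableD measurableT fi gi). Qed.

Lemma intgB f g : intg mu f -> intg mu g -> intg mu (fun x => f x - g x).
Proof. by move=> fi gi; exact: (integrableB measurableT fi gi). Qed.

Lemma intg_sum (I : Type) (s : seq I) (F : I -> T -> R) :
  (forall i, intg mu (F i)) -> intg mu (fun x => \sum_(i <- s) F i x).
Proof.
move=> Fi; elim: s => [|i s ih].
  by under eq_fun do rewrite big_nil; exact: integrable0.
by under eq_fun do rewrite big_cons; exact: intgD.
Qed.

Lemma intg_norm f : intg mu f -> intg mu (fun x => `|f x|).
Proof. by move=> fi; exact: integrable_norm. Qed.

Lemma RintZ c f : intg mu f -> \int[mu]_x (c * f x) = c * \int[mu]_x f x.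
Proof. by move=> fi; rewrite RintegralZl. Qed.

Lemma RintZr c f : intg mu f -> \int[mu]_x (f x * c) = (\int[mu]_x f x) * c.
Proof. by move=> fi; rewrite RintegralZr. Qed.

Lemma RintD f g : intg mu f -> intg mu g ->
  \int[mu]_x (f x + g x) = \int[mu]_x f x + \int[mu]_x g x.
Proof. by move=> fi gi; rewrite RintegralD. Qed.

Lemma RintB f g : intg mu f -> intg mu g ->
  \int[mu]_x (f x - g x) = \int[mu]_x f x - \int[mu]_x g x.
Proof. by move=> fi gi; rewrite RintegralB. Qed.

Lemma Rint_sum (I : Type) (s : seq I) (F : I -> T -> R) :
  (forall i, intg mu (F i)) ->
  \int[mu]_x (\sum_(i <- s) F i x) = \sum_(i <- s) \int[mu]_x F i x.
Proof.
move=> Fi; elim: s => [|i s ih].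
  rewrite big_nil -[RHS](mul0r (\int[mu]_x (cst 0 x))) -RintZ.
    by apply: eq_Rintegral => x _; rewrite big_nil mul0r.
  exact: integrable0.
rewrite big_cons -ih -RintD//; last exact: intg_sum.
by apply: eq_Rintegral => x _; rewrite big_cons.
Qed.

Lemma eq_Rint f g : f =1 g -> \int[mu]_x f x = \int[mu]_x g x.
Proof. by move=> fg; apply: eq_Rintegral => x _; exact: fg. Qed.

Lemma eq_intg f g : f =1 g -> intg mu f -> intg mu g.
Proof. by move=> /funext ->. Qed.

Lemma le_Rint f g : intg mu f -> intg mu g -> (forall x, f x <= g x) ->
  \int[mu]_x f x <= \int[mu]_x g x.
Proof. by move=> fi gi fg; apply: le_Rintegral. Qed.

Lemma ge0_Rint f : (forall x, 0 <= f x) -> 0 <= \int[mu]_x f x.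
Proof. by move=> f0; apply: Rintegral_ge0. Qed.

Lemma le_norm_Rint f g : intg mu f -> intg mu g -> (forall x, `|f x| <= g x) ->
  `|\int[mu]_x f x| <= \int[mu]_x g x.
Proof.
move=> fi gi fg; apply: (le_trans (le_normr_Rintegral measurableT fi)).
by apply: le_Rint => //; exact: intg_norm.
Qed.

Lemma EFin_Rint f : intg mu f ->
  ((\int[mu]_x f x)%:E = \int[mu]_x (f x)%:E)%E.
Proof. by move=> fi; rewrite fineK//; exact: integrable_fin_num. Qed.

Lemma intg_fin f : measurable_fun setT f -> (forall x, 0 <= f x) ->
  (\int[mu]_x (f x)%:E < +oo)%E -> intg mu f.
Proof.
move=> mf f0 fi; apply/integrableP; split; first exact/measurable_EFinP.
by under eq_integral => x _ do rewrite gee0_abs ?lee_fin//.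
Qed.

End real_integral.

Section real_fubini.
Context d1 d2 (T1 : measurableType d1) (T2 : measurableType d2) (R : realType).
Variables (m1 : {sigma_finite_measure set T1 -> \bar R})
          (m2 : {sigma_finite_measure set T2 -> \bar R}).
Implicit Type F : T1 * T2 -> R.

Section general.
Variable F : T1 * T2 -> R.
Hypothesis mF : measurable_fun setT F.
Hypothesis F2 : forall x, intg m2 (fun y => F (x, y)).
Hypothesis F1 : forall y, intg m1 (fun x => F (x, y)).
Hypothesis F12 : intg m1 (fun x => \int[m2]_y `|F (x, y)|).

Let iF : (m1 \x m2)%E.-integrable setT (EFin \o F).
Proof.
apply/integrable12ltyP; first exact/measurable_EFinP.
rewrite (eq_integral (fun x => (\int[m2]_y `|F (x, y)|)%:E)).
  by apply: integrable_lty.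
by move=> x _; rewrite (EFin_Rint (intg_norm (F2 x))).
Qed.

Lemma intg_Fubini1 : intg m1 (fun x => \int[m2]_y F (x, y)).
Proof.
rewrite (_ : EFin \o _ = fubini_F m2 (EFin \o F)).
  exact: integrable_fubini_F.
by apply/funext => x /=; rewrite EFin_Rint.
Qed.

Lemma intg_Fubini2 : intg m2 (fun y => \int[m1]_x F (x, y)).
Proof.
have mFs : measurable_fun setT (fun z : T2 * T1 => F (z.2, z.1)).
  apply: measurableT_comp => //.
  by apply/measurable_fun_pair => /=; [exact: measurable_snd|exact: measurable_fst].
have iFs : (m2 \x m1)%E.-integrable setT (EFin \o (fun z : T2 * T1 => F (z.2, z.1))).
  apply/integrable12ltyP; first exact/measurable_EFinP.
  have /integrable21ltyP := iF; apply; exact/measurable_EFinP.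
rewrite (_ : EFin \o _ = fubini_F m1 (EFin \o (fun z : T2 * T1 => F (z.2, z.1)))).
  exact: integrable_fubini_F.
by apply/funext => x /=; rewrite EFin_Rint.
Qed.

Lemma RFubini : \int[m1]_x \int[m2]_y F (x, y) = \int[m2]_y \int[m1]_x F (x, y).
Proof.
apply: EFin_inj; rewrite !EFin_Rint; [|exact: intg_Fubini2|exact: intg_Fubini1].
under eq_integral => x _ do rewrite EFin_Rint//.
rewrite (Fubini iF).
by apply: eq_integral => y _; rewrite EFin_Rint.
Qed.

End general.

Section dominated.
Variables (F : T1 * T2 -> R) (a : T1 -> R) (b : T2 -> R).
Hypothesis mF : measurable_fun setT F.
Hypothesis (ia : intg m1 a) (ib : intg m2 b).
Hypothesis Fab : forall x y, `|F (x, y)| <= a x * b y.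

Lemma dom_fub1 x : intg m2 (fun y => F (x, y)).
Proof.
apply: (@dom_intg _ _ _ _ _ (fun y => a x * b y)) => //; last exact: intgZ.
exact: (measurableT_comp mF (measurable_pair1 x)).
Qed.

Lemma dom_fub2 y : intg m1 (fun x => F (x, y)).
Proof.
apply: (@dom_intg _ _ _ _ _ (fun x => b y * a x)) => //.
- exact: (measurableT_comp mF (measurable_pair2 y)).
- by move=> x; rewrite mulrC.
- exact: intgZ.
Qed.

Lemma dom_fub12 : intg m1 (fun x => \int[m2]_y `|F (x, y)|).
Proof.
apply: (@dom_intg _ _ _ _ _ (fun x => (\int[m2]_y b y) * a x)).
- apply/measurable_EFinP.
  rewrite (_ : EFin \o _ = fubini_F m2 (EFin \o (fun z => `|F z|))).
    apply: measurable_fun_fubini_tonelli_F => [|z].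
      by apply/measurable_EFinP; exact: measurableT_comp.
    by rewrite lee_fin.
  by apply/funext => x /=; rewrite EFin_Rint//; apply: intg_norm; exact: dom_fub1.
- move=> x; rewrite ger0_norm; last by apply: ge0_Rint.
  rewrite mulrC -RintZ//; apply: le_Rint => //; last exact: intgZ.
  by apply: intg_norm; exact: dom_fub1.
- exact: intgZ.
Qed.

(** Domination by a product of two integrable functions supplies all the integrability hypotheses of
    Fubini at once. Exchanges of real integrals below are justified in this form. *)
Lemma RFubini_dom :
  \int[m1]_x \int[m2]_y F (x, y) = \int[m2]_y \int[m1]_x F (x, y).
Proof.
apply: RFubini => //; [exact: dom_fub1|exact: dom_fub2|exact: dom_fub12].
Qed.

Lemma intg_Fubini_dom : intg m1 (fun x => \int[m2]_y F (x, y)).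
Proof.
apply: intg_Fubini1 => //; [exact: dom_fub1|exact: dom_fub12].
Qed.

End dominated.
End real_fubini.

Section rV_measurable.
Variable R : realType.

(** The sigma-algebra is generated by the coordinates, not by the open sets, so an open set has to
    be written as a countable union of boxes with rational centres and radii 1/(n+1). *)
Lemma continuous_measurable_rV d (f : 'rV[R]_d -> R) :
  continuous f -> measurable_fun setT f.
Proof.
move=> cf; apply: (measurability _ (RGenOpens.measurableE R)) => //.
move=> _ [_ [a [b ->] <-]]; rewrite setTI.
have oU : open (f @^-1` `]a, b[%classic).
  by apply: open_comp => // x _; exact: cf.
set U := f @^-1` _ in oU *.
pose box (q : 'rV[rat]_d * nat) := [set x : 'rV[R]_d |
   forall i, `|x ord0 i - ratr (q.1 ord0 i)| < (q.2.+1%:R)^-1].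
(* [F q] is the box q if that box lies in U, and empty otherwise. *)
pose F q := [set x | box q x /\ box q `<=` U].
have -> : U = \bigcup_q F q.
  apply/seteqP; split => [x Ux|x [q _ [bx]]]; last exact.
  have /nbhs_ballP[e /= e0 xeU] := open_nbhs_nbhs (conj oU Ux).
  have [n ne] : exists n, (n.+1%:R)^-1 < e / 2.
    have e20 : 0 < e / 2 by rewrite divr_gt0.
    exists (Num.truncn (e / 2)^-1).
    rewrite invf_plt ?posrE//.
    exact: truncnS_gt.
  have n0 : (0 : R) < (n.+1%:R)^-1 by rewrite invr_gt0.
  have qx i : exists q : rat, ratr q \in `]x ord0 i - (n.+1%:R)^-1, x ord0 i + (n.+1%:R)^-1[.
    by apply: rat_in_itvoo; rewrite ltrBlDr -addrA ltrDl addr_gt0.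
  pose q : 'rV[rat]_d := \row_i projT1 (cid (qx i)).
  have bqx : box (q, n) x.
    move=> i; rewrite /= mxE; case: cid => r /=.
    rewrite in_itv/=; set e1 := _^-1 => /andP[? ?].
    by rewrite ltr_norml; apply/andP; split; lra.
  exists (q, n) => //; split => // y bqy; apply: xeU.
  split => // i j; rewrite (ord1 i) /ball/=.
  have := bqx j; have := bqy j => /=.
  move: ne; set r := _^-1; rewrite !ltr_norml => re /andP[? ?] /andP[? ?].
  by apply/andP; split; lra.
apply: countable_bigcupT_measurable; first exact: countableP.
move=> q; have [qU|qU] := pselect (box q `<=` U); last first.
  rewrite (_ : F q = set0)//; apply/seteqP; split => // x [_]; exact.
rewrite (_ : F q = \bigcap_(i in [set: 'I_d])
   (@rV_coord R d i @^-1` (ball (ratr (q.1 ord0 i) : R) (q.2.+1%:R)^-1))).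
  apply: fin_bigcap_measurable => [|i _]; first exact: finite_finset.
  rewrite -[X in measurable X]setTI; apply: measurable_rV_coord => //.
  exact: measurable_ball.
apply/seteqP; split => [x [bx _] i _|x bx].
  by rewrite /preimage/= /ball/= distrC; exact: bx.
split => // i; have := bx i Logic.I.
by rewrite /preimage/= /ball/= distrC.
Qed.

Lemma measurable_prodr d (T : measurableType d) (I : Type) (s : seq I)
    (F : I -> T -> R) : (forall i, measurable_fun setT (F i)) ->
  measurable_fun setT (fun x => \prod_(i <- s) F i x).
Proof.
move=> mF; elim: s => [|i s ih].
  by under eq_fun do rewrite big_nil; exact: measurable_cst.
by under eq_fun do rewrite big_cons; exact: measurable_funM.
Qed.

Lemma measurable_sumr d (T : measurableType d) (I : Type) (s : seq I)
    (F : I -> T -> R) : (forall i, measurable_fun setT (F i)) ->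
  measurable_fun setT (fun x => \sum_(i <- s) F i x).
Proof.
move=> mF; elim: s => [|i s ih].
  by under eq_fun do rewrite big_nil; exact: measurable_cst.
by under eq_fun do rewrite big_cons; exact: measurable_funD.
Qed.

Lemma ge0_integral_prod d (f : 'I_d -> R -> R) :
  (forall i, measurable_fun setT (f i)) -> (forall i t, 0 <= f i t) ->
  (\int[lebesgue_rV R d]_x (\prod_(i < d) f i (x ord0 i))%:E =
   \prod_(i < d) \int[lebesgue_measure]_t (f i t)%:E)%E.
Proof.
have mp n (g : 'I_n -> R -> R) : (forall i, measurable_fun setT (g i)) ->
    measurable_fun setT (fun x : 'rV[R]_n => \prod_(i < n) g i (x ord0 i)).
  move=> mg; apply: measurable_prodr => i.
  by apply: measurableT_comp => //; exact: measurable_rV_coord.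
elim: d f => [|d ih] f mf f0.
  have mE := (measurable_EFinP _ _).2 (mp _ f mf).
  rewrite [RHS]big_ord0 (ge0_integral_rV0 mE); first by rewrite /= big_ord0.
  by move=> x; rewrite /= big_ord0.
have mE := (measurable_EFinP _ _).2 (mp _ f mf).
rewrite (ge0_integral_rVS mE); last first.
  by move=> x; rewrite lee_fin prodr_ge0.
rewrite big_ord_recl -ih//.
set I := (X in (_ = _ * X)%E).
transitivity (\int[lebesgue_measure]_t ((f ord0 t)%:E * I))%E; last first.
  apply: (etrans (ge0_integralZr lebesgue_measure measurableT _ _ _)) => //.
  - by apply/measurable_EFinP; exact: mf.
  - by move=> t _; rewrite lee_fin.
  - by apply: integral_ge0 => x _; rewrite /= lee_fin; apply: prodr_ge0.
apply: eq_integral => t _.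
transitivity (\int[lebesgue_rV R d]_x ((f ord0 t)%:E *
   (\prod_(i < d) f (lift ord0 i) (x ord0 i))%:E))%E.
  apply: eq_integral => x _; rewrite /= big_ord_recl rV_cons0 -EFinM.
  by congr (_ * _)%:E; apply: eq_bigr => i _; rewrite rV_consS.
have mp' : measurable_fun setT (fun x : 'rV[R]_d =>
    (\prod_(i < d) f (lift ord0 i) (x ord0 i))%:E).
  apply/measurable_EFinP.
  by apply: (mp _ (fun i => f (lift ord0 i))) => i; exact: mf.
by apply: ge0_intZl => // x; rewrite lee_fin; apply: prodr_ge0.
Qed.

End rV_measurable.

Section oneDsqr_integral.
Variable R : realType.
Local Notation mu := (@lebesgue_measure R).

Lemma measurable_oneDsqrV : measurable_fun [set: R] (fun t : R => (1 + t ^+ 2)^-1).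
Proof. exact: (continuous_measurable_fun (@continuous_oneDsqrV R)). Qed.

Lemma integral_oneDsqrV : (\int[mu]_t ((1 + t ^+ 2)^-1)%:E = (@pi R)%:E)%E.
Proof.
have cf : continuous (fun t : R => (1 + t ^+ 2)^-1) by exact: continuous_oneDsqrV.
have f0 (t : R) : 0 <= (1 + t ^+ 2)^-1 by rewrite invr_ge0 addr_ge0// sqr_ge0.
rewrite ge0_symfun_integralT//; last by move=> x /=; rewrite sqrrN.
rewrite -set_itvcy (@ge0_continuous_FTC2y R _ (@atan R) 0 (pi / 2)).
- by rewrite atan0 sube0 -EFinM; congr EFin; field.
- by move=> x _; exact: f0.
- exact: continuous_subspaceT.
- exact: cvgy_atan.
- by move=> x _; exact: derivable_atan.
- by apply: cvg_at_right_filter; exact: continuous_atan.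
- by move=> x _; rewrite derive1_atan.
Qed.

Lemma integral_oneDnormV : (\int[mu]_t ((1 + `|t|) ^- 2)%:E < +oo)%E.
Proof.
apply: le_lt_trans (ltry (@pi R)); rewrite -integral_oneDsqrV.
apply: ge0_le_integral => //.
- apply/measurable_EFinP; apply: continuous_measurable_fun => t.
  apply: cvgV; first by rewrite expf_neq0// gt_eqF// ltr_pwDl.
  apply: (@cvg_comp _ _ _ (fun x => 1 + `|x|) (fun x => x ^+ 2)); last exact: exprn_continuous.
  by apply: cvgD; [exact: cvg_cst|exact: norm_continuous].
- by apply/measurable_EFinP; exact: measurable_oneDsqrV.
- move=> t _; rewrite lee_fin lef_pV2 ?posrE.
  + rewrite sqrrD expr1n mul1r real_normK ?num_real//.
    by rewrite lerD2r lerDl mulrn_wge0.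
  + by rewrite exprn_gt0// ltr_pwDl.
  + by rewrite ltr_pwDl// sqr_ge0.
Qed.
End oneDsqr_integral.

Section change_of_variable_rV.
Variables (R : realType) (d : nat).
Local Notation V := 'rV[R]_d.
Local Notation mu := (lebesgue_rV R d).
Implicit Types (f : V -> R) (x y v : V) (a : R).

Lemma intg_affine a v f : a != 0 -> intg mu f -> intg mu (fun x => f (a *: x + v)).
Proof.
move=> a0 fi; apply/integrableP; split.
  apply/measurable_EFinP; apply: measurableT_comp; last exact: measurable_rV_affine.
  exact: intg_measurable fi.
have mf : measurable_fun setT (fun x => `|(f x)%:E|%E).
  by apply: measurableT_comp => //; apply/measurable_EFinP; exact: (intg_measurable fi).
rewrite (@ge0_integral_rV_affine R d a v (fun x => `|(f x)%:E|%E))//.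
by apply: lte_mul_pinfty => //; case/integrableP: fi.
Qed.

Lemma Rint_affine a v f : a != 0 -> intg mu f ->
  \int[mu]_x f (a *: x + v) = `|a| ^- d * \int[mu]_x f x.
Proof.
move=> a0 fi; apply: EFin_inj.
rewrite EFinM !EFin_Rint//; last exact: (intg_affine v a0 fi).
have mf : measurable_fun setT (EFin \o f).
  by apply/measurable_EFinP; exact: (intg_measurable fi).
rewrite integralE [in RHS]integralE.
rewrite muleBr//; last first.
  apply: fin_num_adde_defl; rewrite fin_numN.
  exact: (integrable_neg_fin_num measurableT fi).
have := @ge0_integral_rV_affine R d a v _ a0 (measurable_funepos mf) (fun x => funepos_ge0 _ x).
have := @ge0_integral_rV_affine R d a v _ a0 (measurable_funeneg mf) (fun x => funeneg_ge0 _ x).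
move=> E1 E2; congr (_ - _)%E; [rewrite -E2|rewrite -E1].
  by apply: eq_integral => x _; rewrite !unlock.
by apply: eq_integral => x _; rewrite !unlock.
Qed.

Lemma intg_shift v f : intg mu f -> intg mu (fun x => f (x + v)).
Proof.
by move=> fi; apply: eq_intg (intg_affine v (oner_neq0 _) fi) => x /=; rewrite scale1r.
Qed.

Lemma Rint_shift v f : intg mu f -> \int[mu]_x f (x + v) = \int[mu]_x f x.
Proof.
move=> fi; have := Rint_affine v (oner_neq0 _) fi.
rewrite normr1 expr1n invr1 mul1r => <-.
by apply: eq_Rint => x; rewrite scale1r.
Qed.

Lemma Rint_reflect v f : intg mu f -> \int[mu]_x f (v - x) = \int[mu]_x f x.
Proof.
have N10 : (-1 : R) != 0 by rewrite oppr_eq0 oner_neq0.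
move=> fi; have := Rint_affine v N10 fi.
rewrite normrN1 expr1n invr1 mul1r => <-.
by apply: eq_Rint => x; rewrite scaleN1r addrC.
Qed.

Lemma intg_dil a f : a != 0 -> intg mu f -> intg mu (fun x => f (a *: x)).
Proof.
by move=> a0 fi; apply: eq_intg (intg_affine 0 a0 fi) => x /=; rewrite addr0.
Qed.

Lemma Rint_dil a f : a != 0 -> intg mu f ->
  \int[mu]_x f (a *: x) = `|a| ^- d * \int[mu]_x f x.
Proof.
move=> a0 fi; rewrite -(Rint_affine 0 a0 fi).
by apply: eq_Rint => x; rewrite addr0.
Qed.

Lemma measurable_rV_sub v : measurable_fun setT (fun x => v - x).
Proof.
rewrite (_ : (fun x => _) = (fun x => (-1) *: x + v)).
  exact: measurable_rV_affine.
by apply/funext => x; rewrite scaleN1r addrC.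
Qed.

Lemma measurable_comp_sub f v : measurable_fun setT f ->
  measurable_fun setT (fun x => f (v - x)).
Proof. by move=> mf; apply: (measurableT_comp mf); exact: measurable_rV_sub. Qed.

Lemma measurable_comp_affine f a v : measurable_fun setT f ->
  measurable_fun setT (fun x => f (a *: x + v)).
Proof. by move=> mf; apply: (measurableT_comp mf); exact: measurable_rV_affine. Qed.

Lemma measurable_comp_dil f a : measurable_fun setT f ->
  measurable_fun setT (fun x => f (a *: x)).
Proof.
move=> mf; under eq_fun do rewrite -[X in f X]addr0.
exact: measurable_comp_affine.
Qed.

Lemma measurable_comp_sub2 f : measurable_fun setT f ->
  measurable_fun setT (fun z : V * V => f (z.1 - z.2)).
Proof.
move=> mf; apply: (measurableT_comp mf); apply: measurable_fun_rVP => i.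
under eq_fun do rewrite !mxE.
apply: measurable_funB.
  exact: (measurableT_comp (measurable_rV_coord i) measurable_fst).
exact: (measurableT_comp (measurable_rV_coord i) measurable_snd).
Qed.

End change_of_variable_rV.

Lemma prodr_ege1 (R : realDomainType) (I : Type) (s : seq I) (P : pred I)
    (F : I -> R) : (forall i, P i -> 1 <= F i) -> 1 <= \prod_(i <- s | P i) F i.
Proof.
move=> F1; elim/big_rec: _ => // i y Pi y1.
by rewrite (le_trans y1)// ler_peMl ?F1// (le_trans ler01).
Qed.

Section weight.
Variables (R : realType) (d : nat).
Local Notation V := 'rV[R]_d.
Local Notation mu := (lebesgue_rV R d).
Implicit Types (x y : V) (a : R).

(** A product weight in place of 1 + |x|: it is submultiplicative, integrals of its powers factor
    into one-dimensional ones, and [wt^-2] is integrable in every dimension, so no exponent depends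
    on d. *)
Definition wt x : R := \prod_(i < d) (1 + `|x ord0 i|).

Lemma wt_ge1 x : 1 <= wt x.
Proof.
apply: prodr_ege1 => i _; by rewrite lerDl.
Qed.

Lemma wt_gt0 x : 0 < wt x. Proof. exact: lt_le_trans (wt_ge1 x). Qed.

Lemma wtN x : wt (- x) = wt x.
Proof. by apply: eq_bigr => i _; rewrite mxE normrN. Qed.

Lemma wt0 : wt 0 = 1.
Proof. by apply: big1 => i _; rewrite mxE normr0 addr0. Qed.

Lemma wtD x y : wt (x + y) <= wt x * wt y.
Proof.
rewrite /wt -big_split/=; apply: ler_prod => i _.
rewrite addr_ge0//= mxE mulrDl !mul1r mulrDr mulr1 -addrA lerD2l.
have := ler_normD (x ord0 i) (y ord0 i).
have : 0 <= `|x ord0 i| * `|y ord0 i| by rewrite mulr_ge0.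
lra.
Qed.

Lemma wtB x y : wt (x - y) <= wt x * wt y.
Proof. by rewrite (le_trans (wtD _ _))// wtN. Qed.

Lemma wt_coord x i : 1 + `|x ord0 i| <= wt x.
Proof.
rewrite /wt (bigD1 i)//= ler_peMr ?addr_ge0//.
by apply: prodr_ege1 => j _; rewrite lerDl.
Qed.

Lemma norm_coord_wt x i : `|x ord0 i| <= wt x.
Proof. by apply: le_trans (wt_coord x i); rewrite lerDr. Qed.

Lemma wt_dil_le1 a x : 0 <= a -> a <= 1 -> wt (a *: x) <= wt x.
Proof.
move=> a0 a1; apply: ler_prod => i _; rewrite addr_ge0//= mxE normrM lerD2l.
by rewrite ger0_norm// ler_piMl.
Qed.

Lemma wt_dil_ge1 a x : 1 <= a -> wt (a *: x) <= a ^+ d * wt x.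
Proof.
move=> a1; rewrite /wt -[X in a ^+ X]card_ord -prodr_const -big_split/=.
apply: ler_prod => i _; rewrite addr_ge0//= mxE normrM mulrDr mulr1.
by rewrite lerD// ger0_norm// (le_trans ler01 a1).
Qed.

Lemma measurable_wtV n : measurable_fun setT (fun x => wt x ^- n).
Proof.
under eq_fun do rewrite -exprVn.
apply: measurable_funX; rewrite /wt.
under eq_fun do rewrite -prodfV.
apply: measurable_prodr => i.
apply: (measurableT_comp (f := fun t : R => (1 + `|t|)^-1)); last exact: measurable_rV_coord.
apply: continuous_measurable_fun => t.
apply: cvgV; first by rewrite gt_eqF// ltr_pwDl.
by apply: cvgD; [exact: cvg_cst|exact: norm_continuous].
Qed.

Lemma wtV_gt0 x n : 0 < wt x ^- n. Proof. by rewrite invr_gt0 exprn_gt0// wt_gt0. Qed.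

Lemma wtV_ge0 x n : 0 <= wt x ^- n. Proof. exact/ltW/wtV_gt0. Qed.

Lemma wtV_le x m n : (m <= n)%N -> wt x ^- n <= wt x ^- m.
Proof.
move=> mn; rewrite lef_pV2 ?posrE ?exprn_gt0 ?wt_gt0//.
by rewrite ler_weXn2l// wt_ge1.
Qed.

Lemma wtV_le1 x n : wt x ^- n <= 1.
Proof. by rewrite (le_trans (wtV_le x (leq0n n)))// expr0 invr1. Qed.

Lemma intg_wt2 : intg mu (fun x => wt x ^- 2).
Proof.
apply: intg_fin => //; first exact: measurable_wtV.
  by move=> x; exact: wtV_ge0.
have -> : (\int[mu]_x (wt x ^- 2)%:E =
    \int[mu]_x (\prod_(i < d) (1 + `|x ord0 i|) ^- 2)%:E)%E.
  by apply: eq_integral => x _; rewrite /wt -prodrXl prodfV.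
rewrite (@ge0_integral_prod R d (fun _ t => (1 + `|t|) ^- 2)); last 2 first.
- move=> _; under eq_fun do rewrite -exprVn.
  apply: measurable_funX; apply: continuous_measurable_fun => t.
  apply: cvgV; first by rewrite gt_eqF// ltr_pwDl.
  by apply: cvgD; [exact: cvg_cst|exact: norm_continuous].
- by move=> _ t; rewrite invr_ge0 exprn_ge0// addr_ge0.
have I0 : (0 <= \int[@lebesgue_measure R]_t ((1 + `|t|) ^- 2)%:E)%E.
  by apply: integral_ge0 => t _; rewrite lee_fin invr_ge0 exprn_ge0// addr_ge0.
have : (\int[@lebesgue_measure R]_t ((1 + `|t|) ^- 2)%:E)%E \is a fin_num.
  by rewrite ge0_fin_numE// integral_oneDnormV.
move=> /fineK <-.
have -> : forall c : R, (\prod_(i < d) c%:E = (c ^+ d)%:E)%E.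
  move=> c; rewrite -[X in c ^+ X]card_ord -prodr_const.
  by elim/big_rec2: _ => // i x y _ ->; rewrite EFinM.
by rewrite ltry.
Qed.

Lemma intg_wt n : (2 <= n)%N -> intg mu (fun x => wt x ^- n).
Proof.
move=> n2; apply: (dom_intg (measurable_wtV n) _ intg_wt2) => x.
by rewrite ger0_norm ?wtV_ge0// wtV_le.
Qed.

Lemma wt_decay_intg (f : V -> R) (K : R) : measurable_fun setT f ->
  (forall x, `|f x| <= K * wt x ^- 2) -> intg mu f.
Proof. by move=> mf fK; apply: (dom_intg mf fK); apply: intgZ; exact: intg_wt2. Qed.

End weight.

Lemma normD_le (R : realType) (x y a b : R) :
  `|x| <= a -> `|y| <= b -> `|x + y| <= a + b.
Proof. by move=> xa yb; rewrite (le_trans (ler_normD x y))// lerD. Qed.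

Lemma normB_le (R : realType) (x y a b : R) :
  `|x| <= a -> `|y| <= b -> `|x - y| <= a + b.
Proof. by move=> xa yb; rewrite (le_trans (ler_normB x y))// lerD. Qed.

Lemma absM (R : realType) (x y : R) : `|x * y| = `|x| * `|y|.
Proof. exact: normrM. Qed.

Lemma norm_cos_le1 (R : realType) (x : R) : `|cos x| <= 1.
Proof. by rewrite ler_norml cos_geN1 cos_le1. Qed.

Lemma norm_sin_le1 (R : realType) (x : R) : `|sin x| <= 1.
Proof. by rewrite ler_norml sin_geN1 sin_le1. Qed.

Section real_convergence.
Context d (T : measurableType d) (R : realType).
Variable mu : {measure set T -> \bar R}.

Lemma Rint_cvg (f_ : nat -> T -> R) (f g : T -> R) :
  (forall n, measurable_fun setT (f_ n)) ->
  (forall x, f_ n x @[n --> \oo] --> f x) -> intg mu g ->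
  (forall n x, `|f_ n x| <= g x) ->
  intg mu f /\ \int[mu]_x f_ n x @[n --> \oo] --> \int[mu]_x f x.
Proof.
move=> mf cf ig fg.
have mf' : measurable_fun setT f.
  by apply: (measurable_fun_cvg (h := f_)) => // x _; exact: cf.
have f_g n x : (`|(f_ n x)%:E| <= (g x)%:E)%E by rewrite lee_fin.
have cfE : {ae mu, forall x, setT x -> (f_ n x)%:E @[n --> \oo] --> (EFin \o f) x}.
  by apply: aeW => x _; apply: cvg_EFin; [exact: nearW|exact: cf].
have [ig' _ cv] := @dominated_convergence _ T R mu setT measurableT
   (fun n x => (f_ n x)%:E) (EFin \o f) (EFin \o g)
   (fun n => (measurable_EFinP _ _).2 (mf n)) ((measurable_EFinP _ _).2 mf')
   cfE ig (aeW _ (fun x n _ => f_g n x)).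
split => //.
have ifn n : intg mu (f_ n) by exact: (dom_intg (mf n) (fg n) ig).
apply/fine_cvg; rewrite fineK; last exact: integrable_fin_num.
exact: cv.
Qed.

End real_convergence.

Lemma measurable_Rint d1 d2 (T1 : measurableType d1) (T2 : measurableType d2)
    (R : realType) (m2 : {sigma_finite_measure set T2 -> \bar R})
    (F : T1 * T2 -> R) :
  measurable_fun setT F -> (forall x, intg m2 (fun y => F (x, y))) ->
  measurable_fun setT (fun x => \int[m2]_y F (x, y)).
Proof.
move=> mF F2; apply/measurable_EFinP.
have mE : measurable_fun setT (EFin \o F) by exact/measurable_EFinP.
rewrite (_ : EFin \o _ = (fun x => fubini_F m2 (EFin \o F)^\+ x - fubini_F m2 (EFin \o F)^\- x)%E).
  apply: emeasurable_funB; apply: measurable_fun_fubini_tonelli_F => //.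
  - exact: measurable_funepos.
  - exact: measurable_funeneg.
apply/funext => x /=; rewrite EFin_Rint// integralE /fubini_F.
by congr (_ - _)%E; apply: eq_integral => y _; rewrite !unlock.
Qed.

Section fubini_rV_succ.
Variables (R : realType) (d : nat).
Local Notation mu := (@lebesgue_measure R).
Variables (F : 'rV[R]_d.+1 -> R) (a : R -> R) (b : 'rV[R]_d -> R).
Hypothesis mF : measurable_fun setT F.
Hypothesis (ia : intg mu a) (ib : intg (lebesgue_rV R d) b).
Hypothesis Fab : forall t x, `|F (rV_cons (t, x))| <= a t * b x.

Let ge0 (G : 'rV[R]_d.+1 -> R) : measurable_fun setT G -> (forall x, 0 <= G x) ->
  (forall t x, `|G (rV_cons (t, x))| <= a t * b x) ->
  [/\ intg (lebesgue_rV R d.+1) G, intg mu (fun t => \int[lebesgue_rV R d]_x G (rV_cons (t, x))) &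
  \int[lebesgue_rV R d.+1]_x G x =
  \int[mu]_t \int[lebesgue_rV R d]_x G (rV_cons (t, x))].
Proof.
move=> mG G0 Gab.
have mGc : measurable_fun setT (fun z : measurableTypeR R * 'rV[R]_d => G (rV_cons z)).
  by apply: (measurableT_comp mG); exact: measurable_rV_cons.
have iG t : intg (lebesgue_rV R d) (fun x => G (rV_cons (t, x))).
  exact: (@dom_fub1 _ _ _ _ _ _ _ a b mGc ib Gab t).
have iG2 : intg mu (fun t => \int[lebesgue_rV R d]_x G (rV_cons (t, x))).
  exact: (@intg_Fubini_dom _ _ _ _ _ mu (lebesgue_rV R d) _ a b mGc ia ib Gab).
have E : (\int[lebesgue_rV R d.+1]_x (G x)%:E =
    (\int[mu]_t \int[lebesgue_rV R d]_x G (rV_cons (t, x)))%:E)%E.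
  rewrite ge0_integral_rVS; [|exact/measurable_EFinP|by move=> x; rewrite lee_fin].
  rewrite EFin_Rint//; apply: eq_integral => t _.
  by rewrite EFin_Rint.
have iG3 : intg (lebesgue_rV R d.+1) G by apply: intg_fin => //; rewrite E ltry.
by split => //; apply: EFin_inj; rewrite EFin_Rint.
Qed.

Lemma Rint_rVS : intg (lebesgue_rV R d.+1) F /\
  \int[lebesgue_rV R d.+1]_x F x =
  \int[mu]_t \int[lebesgue_rV R d]_x F (rV_cons (t, x)).
Proof.
pose P x := Num.max (F x) 0; pose N x := Num.max (- F x) 0.
have FPN x : F x = P x - N x.
  by rewrite /P /N; case: (leP (F x) 0) => ?; case: (leP (- F x) 0) => ?; lra.
have PF x : `|P x| <= `|F x|.
  rewrite /P; case: (leP (F x) 0) => ?; by rewrite ?normr0.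
have NF x : `|N x| <= `|F x|.
  by rewrite /N; case: (leP (- F x) 0) => ?; rewrite ?normr0// normrN.
have mP : measurable_fun setT P by apply: measurable_maxr.
have mN : measurable_fun setT N by apply: measurable_maxr => //; exact: measurable_funN.
have P0 x : 0 <= P x by rewrite le_max lexx orbT.
have N0 x : 0 <= N x by rewrite le_max lexx orbT.
have [i1 i2 E1] := ge0 mP P0 (fun t x => le_trans (PF _) (Fab t x)).
have [i3 i4 E2] := ge0 mN N0 (fun t x => le_trans (NF _) (Fab t x)).
split.
  by apply: eq_intg (intgB i1 i3) => x /=; rewrite -FPN.
rewrite (eq_Rint _ FPN) RintB// E1 E2 -RintB//.
apply: eq_Rint => t; rewrite -RintB.
- by apply: eq_Rint => x; rewrite -FPN.
- apply: (@dom_fub1 _ _ _ _ _ _ (fun z => P (rV_cons z)) a b _ ib (fun t x => le_trans (PF _) (Fab t x)) t).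
  by apply: (measurableT_comp mP); exact: measurable_rV_cons.
- apply: (@dom_fub1 _ _ _ _ _ _ (fun z => N (rV_cons z)) a b _ ib (fun t x => le_trans (NF _) (Fab t x)) t).
  by apply: (measurableT_comp mN); exact: measurable_rV_cons.
Qed.

End fubini_rV_succ.

(** * The Fourier transform of exp(-|x|) *)

Section exp_transform.
Variable R : realType.
Local Notation mu := (@lebesgue_measure R).
Implicit Types b t x : R.

(** The summand 1 makes the integrand nonnegative, so that the fundamental theorem of calculus for
    nonnegative functions on a half-line applies. The cosine integral is recovered by subtracting
    half of [f 0]. *)
Let f b x : R := expR (- `|x|) * (1 + cos (b * x)).

Let f_ge0 b x : 0 <= f b x.
Proof. by rewrite mulr_ge0 ?expR_ge0//; have := cos_geN1 (b * x); lra. Qed.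

Let cexp : continuous (fun x : R => expR (- `|x|)).
Proof.
move=> x; apply: continuous_comp; last exact: continuous_expR.
by apply: cvgN; exact: norm_continuous.
Qed.

Let ccos b : continuous (fun x : R => cos (b * x)).
Proof.
move=> x; apply: continuous_comp; last exact: continuous_cos.
by apply: cvgM; [exact: cvg_cst|exact: cvg_id].
Qed.

Let cf b : continuous (f b).
Proof.
move=> x; apply: cvgM; first exact: cexp.
by apply: cvgD; [exact: cvg_cst|exact: ccos].
Qed.

Let F b x : R := expR (- x) * ((1 + b ^+ 2)^-1 * (b * sin (b * x) - cos (b * x)) - 1).

Let dF b x : is_derive x 1 (F b) (expR (- x) * (1 + cos (b * x))).
Proof.
have b0 : 1 + b ^+ 2 != 0 by rewrite gt_eqF// ltr_pwDl// sqr_ge0.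
rewrite /F.
have h1 : is_derive x 1 (fun x : R => b * x) b.
  have h := is_deriveZ b (is_derive_id x (1 : R)).
  by apply: is_derive_eq h _; rewrite /GRing.scale/= mulr1.
have h2 : is_derive x 1 (fun x => sin (b * x)) (cos (b * x) * b).
  by apply: (is_derive1_comp (f := sin)).
have h3 : is_derive x 1 (fun x => cos (b * x)) (- sin (b * x) * b).
  by apply: (is_derive1_comp (f := cos)).
have h4 : is_derive x 1 (fun x : R => expR (- x)) (expR (- x) * (- 1)).
  by apply: (is_derive1_comp (f := expR)).
have h5 := is_deriveZ b h2.
have h6 := is_deriveZ (1 + b ^+ 2)^-1 (is_deriveB h5 h3).
have h7 := is_deriveM h4 (is_deriveB h6 (is_derive_cst (1:R) x 1)).
apply: is_derive_eq h7 _; rewrite !fctE/= /GRing.scale/=.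
by field.
Qed.

Let Fy b : F b x @[x --> +oo] --> (0 : R).
Proof.
have c0 : 0 < 1 + b ^+ 2 by rewrite ltr_pwDl// sqr_ge0.
pose C := (1 + b ^+ 2)^-1 * (`|b| + 1) + 1.
have H x : `|F b x| <= C * expR (- x).
  have H1 : `|(1 + b ^+ 2)^-1 * (b * sin (b * x) - cos (b * x)) - 1| <= C.
    rewrite /C; apply normB_le; last by rewrite normr1.
    rewrite absM gtr0_norm ?invr_gt0// ler_pM2l ?invr_gt0//.
    apply normB_le; last exact: norm_cos_le1.
    by rewrite absM ler_piMr// norm_sin_le1.
  by rewrite /F absM (ger0_norm (expR_ge0 _)) mulrC ler_wpM2r ?expR_ge0.
apply: norm_cvg0; apply: (@squeeze_cvgr _ _ _ _ (cst 0) (fun x => C * expR (- x))).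
- by near=> x; rewrite normr_ge0 H.
- exact: cvg_cst.
- rewrite -[X in _ --> X](mulr0 C); apply: cvgM; first exact: cvg_cst.
  exact: cvgr_expR.
Unshelve. all: by end_near. Qed.

Let If b : (\int[mu]_x (f b x)%:E = (2 * (1 + (1 + b ^+ 2)^-1))%:E)%E.
Proof.
rewrite ge0_symfun_integralT//; last first.
  by move=> x /=; rewrite /f normrN mulrN cosN.
rewrite -set_itvcy (@ge0_continuous_FTC2y R _ (F b) 0 0).
- rewrite /F mulr0 sin0 cos0 oppr0 expR0 mulr0 sub0r mul1r mulrN1 -EFinB -EFinM.
  by congr EFin; ring.
- by move=> x _; exact: f_ge0.
- exact: continuous_subspaceT.
- exact: Fy.
- by move=> x _; apply/derivable1_diffP/derivable1_diffP; have [] := dF b x.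
- apply: cvg_at_right_filter.
  apply/differentiable_continuous/derivable1_diffP; by have [] := dF b 0.
- move=> x; rewrite in_itv/= andbT => x0; rewrite derive1E.
  have [_ ->] := dF b x.
  by rewrite /f gtr0_norm.
Qed.

Lemma intg_expNnorm : intg mu (fun x : R => expR (- `|x|)).
Proof.
have i0 : intg mu (f 0).
  apply: intg_fin; [exact: continuous_measurable_fun|exact: f_ge0|by rewrite If ltry].
apply: eq_intg (intgZ 2^-1 i0) => x /=.
by rewrite /f mul0r cos0 mulrCA -[1 + 1]/2 mulVf ?mulr1.
Qed.

Lemma intg_expNnormM (h : R -> R) : measurable_fun setT h ->
  (forall x, `|h x| <= 1) -> intg mu (fun x : R => expR (- `|x|) * h x).
Proof. by move=> mh h1; apply: (intgM intg_expNnorm mh h1). Qed.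

(** The Fourier transform of exp(-|x|), a Cauchy density of total mass 1. *)
Definition poisson (t : R) : R := 2 / (1 + (2 * pi * t) ^+ 2).

Lemma Rint_expNnorm_cos t :
  \int[mu]_x (expR (- `|x|) * cos (2 * pi * (t * x))) = poisson t.
Proof.
set b := 2 * pi * t.
have ib c : intg mu (f c).
  apply: intg_fin; [exact: continuous_measurable_fun|exact: f_ge0|by rewrite If ltry].
have Ib c : \int[mu]_x f c x = 2 * (1 + (1 + c ^+ 2)^-1).
  by apply: EFin_inj; rewrite EFin_Rint.
rewrite (_ : \int[mu]_x _ = \int[mu]_x (f b x - 2^-1 * f 0 x)); last first.
  apply: eq_Rint => x; rewrite /f mul0r cos0 /b !mulrA.
  by have -> : (1 + 1 : R) = 2 by []; field.
rewrite RintB//; last exact: intgZ.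
rewrite RintZ// !Ib expr0n/= addr0 invr1 /poisson -/b.
by have -> : (1 + 1 : R) = 2 by []; field; rewrite gt_eqF// ltr_pwDl// sqr_ge0.
Qed.

(** The nonnegative integrands with 1 + sin and 1 - sin are reflections of each other, so their
    integrals agree. *)
Lemma Rint_expNnorm_sin t :
  \int[mu]_x (expR (- `|x|) * sin (2 * pi * (t * x))) = 0.
Proof.
set I := \int[mu]_x _.
have mg : measurable_fun setT (fun x : R => sin (2 * pi * (t * x))).
  apply: continuous_measurable_fun => x; apply: continuous_comp; last exact: continuous_sin.
  by apply: cvgM; [exact: cvg_cst|apply: cvgM; [exact: cvg_cst|exact: cvg_id]].
have ig : intg mu (fun x : R => expR (- `|x|) * (1 + sin (2 * pi * (t * x)))).
  apply: intgM => //; first exact: intg_expNnorm.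
    by apply: measurable_funD.
  move=> x; rewrite ger0_norm; last by have := sin_geN1 (2 * pi * (t * x)); lra.
  by apply: (@le_trans _ _ (1 + 1)); rewrite // lerD2l sin_le1.
have ig' : intg mu (fun x : R => expR (- `|x|) * (1 - sin (2 * pi * (t * x)))).
  apply: intgM => //; first exact: intg_expNnorm.
    by apply: measurable_funB.
  move=> x; rewrite ger0_norm; last by have := sin_le1 (2 * pi * (t * x)); lra.
  by apply: (@le_trans _ _ (1 + 1)) => //; rewrite lerD2l; have := sin_geN1 (2 * pi * (t * x)); lra.
have E : \int[mu]_x (expR (- `|x|) * (1 + sin (2 * pi * (t * x)))) =
         \int[mu]_x (expR (- `|x|) * (1 - sin (2 * pi * (t * x)))).
  apply: EFin_inj; rewrite !EFin_Rint//.
  rewrite -(@ge0_integral_opp R (fun x => (expR (- `|x|) * (1 + sin (2 * pi * (t * x))))%:E)).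
  - by apply: eq_integral => x _; rewrite normrN !mulrN sinN.
  - by apply/measurable_EFinP; exact: (intg_measurable ig).
  - move=> y; have := sin_geN1 (2 * pi * (t * y)) => ?.
    by rewrite lee_fin mulr_ge0 ?expR_ge0//; lra.
have isn : intg mu (fun x : R => expR (- `|x|) * sin (2 * pi * (t * x))).
  apply: (intgM intg_expNnorm mg (B := 1)) => x.
  by rewrite ler_norml sin_geN1 sin_le1.
have E1 : \int[mu]_x (expR (- `|x|) * (1 + sin (2 * pi * (t * x)))) = \int[mu]_x expR (- `|x|) + I.
  by rewrite -RintD//; [apply: eq_Rint => x; rewrite mulrDr mulr1|exact: intg_expNnorm].
have E2 : \int[mu]_x (expR (- `|x|) * (1 - sin (2 * pi * (t * x)))) = \int[mu]_x expR (- `|x|) - I.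
  by rewrite -RintB//; [apply: eq_Rint => x; rewrite mulrBr mulr1|exact: intg_expNnorm].
by move: E; rewrite E1 E2; lra.
Qed.

End exp_transform.

(** * The Fourier transform *)

Section edot_theory.
Variables (R : realType) (d : nat).
Implicit Types (x y z : 'rV[R]_d) (a : R).

Lemma edotC x y : edot x y = edot y x.
Proof. by apply: eq_bigr => i _; rewrite mulrC. Qed.

Lemma edotDl x y z : edot (x + y) z = edot x z + edot y z.
Proof. by rewrite /edot -big_split/=; apply: eq_bigr => i _; rewrite mxE mulrDl. Qed.

Lemma edotZl a x z : edot (a *: x) z = a * edot x z.
Proof. by rewrite /edot mulr_sumr; apply: eq_bigr => i _; rewrite mxE mulrA. Qed.

Lemma edotNl x z : edot (- x) z = - edot x z.
Proof. by rewrite -scaleN1r edotZl mulN1r. Qed.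

Lemma edotBl x y z : edot (x - y) z = edot x z - edot y z.
Proof. by rewrite edotDl edotNl. Qed.

Lemma edotZr a x z : edot x (a *: z) = a * edot x z.
Proof. by rewrite edotC edotZl edotC. Qed.

Lemma edot_delta i x : edot (delta_mx ord0 i) x = x ord0 i.
Proof.
rewrite /edot (bigD1 i)//= mxE !eqxx mul1r big1 ?addr0// => j ji.
by rewrite mxE (negbTE ji) mul0r.
Qed.

Lemma measurable_edot : measurable_fun setT (fun z : 'rV[R]_d * 'rV[R]_d => edot z.1 z.2).
Proof.
apply: measurable_sumr => i; apply: measurable_funM.
  exact: (measurableT_comp (measurable_rV_coord i) measurable_fst).
exact: (measurableT_comp (measurable_rV_coord i) measurable_snd).
Qed.

Lemma measurable_edotl x : measurable_fun setT (fun y => edot x y).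
Proof. exact: (measurableT_comp measurable_edot (measurable_pair1 x)). Qed.

Lemma measurable_edotr x : measurable_fun setT (fun y => edot y x).
Proof. exact: (measurableT_comp measurable_edot (measurable_pair2 x)). Qed.

End edot_theory.

Lemma edot_cons (R : realType) d (t : R) (x : 'rV[R]_d) (v : 'rV[R]_d.+1) :
  edot v (rV_cons (t, x)) =
  v ord0 ord0 * t + edot (\row_i v ord0 (lift ord0 i)) x.
Proof.
rewrite /edot big_ord_recl rV_cons0; congr (_ + _); apply: eq_bigr => i _.
by rewrite rV_consS mxE.
Qed.

Lemma measurable_cos (R : realType) : measurable_fun setT (@cos R).
Proof. by apply: continuous_measurable_fun; exact: continuous_cos. Qed.

Section transform.
Variables (R : realType) (d : nat).
Local Notation V := 'rV[R]_d.
Local Notation mu := (lebesgue_rV R d).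
Implicit Types (f : V -> R) (x y xi : V) (th : R).

(** The real part of exp(-i th) times the Fourier transform of the real function f. The phases 0 and
    pi/2 give its real and imaginary parts, which keeps the whole analysis within real integrals. *)
Definition Tr f th xi : R := \int[mu]_y (f y * cos (2 * pi * edot y xi + th)).

Lemma intg_Tr f th xi : intg mu f ->
  intg mu (fun y => f y * cos (2 * pi * edot y xi + th)).
Proof.
move=> fi; apply: (intgM fi (B := 1)); last by move=> y; exact: norm_cos_le1.
apply: measurableT_comp; first exact: measurable_cos.
apply: measurable_funD => //; apply: measurable_funM => //; exact: measurable_edotr.
Qed.

Lemma TrD f th a xi : intg mu f ->
  Tr f (th + a) xi = cos a * Tr f th xi + sin a * Tr f (th + pi / 2) xi.
Proof.
move=> fi; rewrite /Tr -!RintZ ?intg_Tr// -RintD; last 2 first.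
- by apply: intgZ; exact: intg_Tr.
- by apply: intgZ; exact: intg_Tr.
apply: eq_Rint => y; rewrite !addrA cosDpihalf cosD; ring.
Qed.

Lemma Tr_le f th xi : intg mu f -> `|Tr f th xi| <= \int[mu]_y `|f y|.
Proof.
move=> fi; apply: le_norm_Rint; [exact: intg_Tr|exact: intg_norm|move=> y].
by rewrite absM ler_piMr// norm_cos_le1.
Qed.

Lemma measurable_Tr f (c : V -> R) : intg mu f -> measurable_fun setT c ->
  measurable_fun setT (fun xi => Tr f (c xi) xi).
Proof.
move=> fi mc.
apply: (@measurable_Rint _ _ _ _ R mu
  (fun z : V * V => f z.2 * cos (2 * pi * edot z.2 z.1 + c z.1))).
  apply: measurable_funM.
    by apply: (measurableT_comp (intg_measurable fi)); exact: measurable_snd.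
  apply: measurableT_comp; first exact: measurable_cos.
  apply: measurable_funD; last by apply: (measurableT_comp mc); exact: measurable_fst.
  apply: measurable_funM => //; under eq_fun do rewrite edotC.
  exact: measurable_edot.
by move=> xi; exact: (intg_Tr (c xi) xi fi).
Qed.

(* The real part of the inverse Fourier integrand at x. *)
Definition Cf f x xi : R := Tr f (- (2 * pi * edot x xi)) xi.

Lemma Cf_le f x xi : intg mu f -> `|Cf f x xi| <= \int[mu]_y `|f y|.
Proof. exact: Tr_le. Qed.

Lemma measurable_Cf f x : intg mu f -> measurable_fun setT (Cf f x).
Proof.
move=> fi; apply: measurable_Tr => //; apply: measurable_funN.
by apply: measurable_funM => //; exact: measurable_edotl.
Qed.

Lemma measurable_Cf2 f : intg mu f ->
  measurable_fun setT (fun z : V * V => Cf f z.1 z.2).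
Proof.
move=> fi.
rewrite (_ : (fun z => _) = (fun z : V * V =>
  cos (- (2 * pi * edot z.1 z.2)) * Tr f 0 z.2 +
  sin (- (2 * pi * edot z.1 z.2)) * Tr f (0 + pi / 2) z.2)); last first.
  by apply/funext => z; rewrite -TrD// add0r.
have me : measurable_fun setT (fun z : V * V => - (2 * pi * edot z.1 z.2)).
  apply: measurable_funN; apply: measurable_funM => //; exact: measurable_edot.
apply: measurable_funD; apply: measurable_funM.
- by apply: measurableT_comp me; exact: measurable_cos.
- apply: (measurableT_comp (f := Tr f 0)); last exact: measurable_snd.
  by apply: (measurable_Tr (c := cst 0)).
- apply: (measurableT_comp (f := @sin R)) me.
  by apply: continuous_measurable_fun; exact: continuous_sin.
- apply: (measurableT_comp (f := Tr f (0 + pi / 2))); last exact: measurable_snd.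
  by apply: (measurable_Tr (c := cst _)).
Qed.

End transform.

Section poisson_rV.
Variable R : realType.

(** The summability factor for Fourier inversion. Being a product over the coordinates, it has an
    explicit transform, a product of Poisson kernels. *)
Definition expn1 d (x : 'rV[R]_d) : R := expR (- \sum_(i < d) `|x ord0 i|).

Lemma expn1_cons d t (x : 'rV[R]_d) :
  expn1 (rV_cons (t, x)) = expR (- `|t|) * expn1 x.
Proof.
rewrite /expn1 big_ord_recl rV_cons0 opprD expRD.
by congr (_ * expR (- _)); apply: eq_bigr => i _; rewrite rV_consS.
Qed.

Lemma expn1_ge0 d (x : 'rV[R]_d) : 0 <= expn1 x. Proof. exact: expR_ge0. Qed.

Lemma expn1_le1 d (x : 'rV[R]_d) : expn1 x <= 1.
Proof. by rewrite expR_le1 oppr_le0 sumr_ge0. Qed.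

Lemma measurable_expn1 d : measurable_fun setT (@expn1 d).
Proof.
apply: measurableT_comp; first exact: measurable_expR.
apply: measurable_funN; apply: measurable_sumr => i.
by apply: measurableT_comp => //; exact: measurable_rV_coord.
Qed.

Lemma intg_expn1 d : intg (lebesgue_rV R d) (@expn1 d).
Proof.
elim: d => [|d ih].
  apply: (@wt_decay_intg _ _ _ 1); first exact: measurable_expn1.
  by move=> x; rewrite /wt big_ord0 expr1n invr1 mulr1 ger0_norm ?expn1_ge0// expn1_le1.
have [] // := @Rint_rVS R d _ (fun t => expR (- `|t|)) (@expn1 d)
  (@measurable_expn1 _) (@intg_expNnorm R) ih _.
by move=> t x; rewrite expn1_cons ger0_norm// mulr_ge0 ?expR_ge0 ?expn1_ge0.
Qed.

Definition poisson_rV d (t : 'rV[R]_d) : R := \prod_(i < d) poisson (t ord0 i).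

(** The free phase lets the induction close: the contribution of the coordinate peeled off is
    absorbed into th. *)
Lemma Rint_expn1_cos d (t : 'rV[R]_d) (th : R) :
  \int[lebesgue_rV R d]_x (expn1 x * cos (2 * pi * edot t x + th)) =
  cos th * poisson_rV t.
Proof.
elim: d t th => [|d ih] t th.
  rewrite /poisson_rV big_ord0 mulr1; apply: EFin_inj.
  rewrite EFin_Rint; last first.
    apply: intgM (@intg_expn1 0) _ _ => [|x]; last exact: norm_cos_le1.
    apply: measurableT_comp; first exact: measurable_cos.
    by apply: measurable_funD => //; apply: measurable_funM => //; exact: measurable_edotl.
  transitivity (\int[lebesgue_rV R 0]_x (cos th)%:E)%E.
    apply: eq_integral => x _.
    by rewrite /expn1 /edot !big_ord0 oppr0 expR0 mul1r mulr0 add0r.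
  by rewrite integral_cst//= diracT mule1.
have := @Rint_rVS R d (fun x => expn1 x * cos (2 * pi * edot t x + th))
  (fun t => expR (- `|t|)) (@expn1 d) _ (@intg_expNnorm R) (@intg_expn1 d) _.
case.
- apply: measurable_funM; first exact: measurable_expn1.
  apply: measurableT_comp; first exact: measurable_cos.
  by apply: measurable_funD => //; apply: measurable_funM => //; exact: measurable_edotl.
- move=> u x; rewrite expn1_cons absM (ger0_norm (mulr_ge0 _ _)) ?expR_ge0 ?expn1_ge0//.
  by rewrite ler_piMr ?norm_cos_le1// mulr_ge0 ?expR_ge0 ?expn1_ge0.
move=> _ ->.
set t' := \row_i t ord0 (lift ord0 i).
have E u : \int[lebesgue_rV R d]_x (expn1 (rV_cons (u, x)) *
    cos (2 * pi * edot t (rV_cons (u, x)) + th)) =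
  poisson_rV t' * (expR (- `|u|) * cos (2 * pi * (t ord0 ord0 * u) + th)).
  rewrite [RHS](_ : _ = expR (- `|u|) * (cos (2 * pi * (t ord0 ord0 * u) + th) * poisson_rV t')); last by ring.
  rewrite -ih -RintZ.
    apply: eq_Rint => x; rewrite expn1_cons -mulrA; congr (_ * (_ * cos _)).
    by rewrite edot_cons; ring.
  apply: intgM (@intg_expn1 d) _ _ => [|x]; last exact: norm_cos_le1.
  apply: measurableT_comp; first exact: measurable_cos.
  by apply: measurable_funD => //; apply: measurable_funM => //; exact: measurable_edotl.
apply: etrans; first by apply: eq_Rint => u; exact: E.
have mlin : measurable_fun setT (fun u : R => 2 * pi * (t ord0 ord0 * u)).
  by apply: measurable_funM => //; apply: measurable_funM.
have i1 : intg (@lebesgue_measure R) (fun u => expR (- `|u|) * cos (2 * pi * (t ord0 ord0 * u))).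
  apply: intg_expNnormM => [|u]; last exact: norm_cos_le1.
  by apply: measurableT_comp mlin; exact: measurable_cos.
have i2 : intg (@lebesgue_measure R) (fun u => expR (- `|u|) * sin (2 * pi * (t ord0 ord0 * u))).
  apply: intg_expNnormM => [|u]; last exact: norm_sin_le1.
  apply: measurableT_comp mlin.
  by apply: continuous_measurable_fun; exact: continuous_sin.
rewrite (_ : \int[lebesgue_measure]_x _ = \int[lebesgue_measure]_u
   (poisson_rV t' * cos th * (expR (- `|u|) * cos (2 * pi * (t ord0 ord0 * u))) -
    poisson_rV t' * sin th * (expR (- `|u|) * sin (2 * pi * (t ord0 ord0 * u))))); last first.
  by apply: eq_Rint => u; rewrite cosD; ring.
rewrite RintB; [|exact: intgZ|exact: intgZ].
rewrite !RintZ// Rint_expNnorm_cos Rint_expNnorm_sin /poisson_rV big_ord_recl.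
rewrite mulr0 subr0 (eq_bigr (fun i => poisson (t ord0 (lift ord0 i)))); first ring.
by move=> i _; rewrite mxE.
Qed.

Lemma poisson_ge0 (t : R) : 0 <= poisson t.
Proof. by rewrite divr_ge0// addr_ge0// sqr_ge0. Qed.

Lemma measurable_poisson : measurable_fun setT (@poisson R).
Proof.
apply: measurable_funM => //.
apply: (measurableT_comp (@measurable_oneDsqrV R) (g := fun t : R => 2 * pi * t)).
exact: measurable_funM.
Qed.

Lemma integral_poisson : (\int[@lebesgue_measure R]_t (poisson t)%:E = 1)%E.
Proof.
have p0 : 2 * pi != 0 :> R by rewrite gt_eqF// mulr_gt0// pi_gt0.
have mf : measurable_fun [set: R] (fun t : R => (2 * (1 + t ^+ 2)^-1)%:E).
  apply/measurable_EFinP; apply: measurable_funM => //; exact: measurable_oneDsqrV.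
have f0 (t : R) : (0 <= (2 * (1 + t ^+ 2)^-1)%:E)%E.
  by rewrite lee_fin mulr_ge0// invr_ge0 addr_ge0// sqr_ge0.
have := @ge0_integral_affine R (2 * pi) 0 _ p0 mf f0.
rewrite (_ : (\int[lebesgue_measure]_x (2 * (1 + x ^+ 2)^-1)%:E = (2 * pi)%:E)%E).
  rewrite -EFinM ger0_norm ?mulr_ge0 ?pi_ge0// mulVf// => <-.
  by apply: eq_integral => t _; rewrite addr0.
rewrite [RHS]EFinM -integral_oneDsqrV.
transitivity (\int[@lebesgue_measure R]_t (2%:E * ((1 + t ^+ 2)^-1)%:E))%E.
  by apply: eq_integral => t _; rewrite EFinM.
apply: ge0_intZl => //.
- by apply/measurable_EFinP; exact: measurable_oneDsqrV.
- by move=> t; rewrite lee_fin invr_ge0 addr_ge0// sqr_ge0.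
Qed.

Lemma poisson_rV_ge0 d (t : 'rV[R]_d) : 0 <= poisson_rV t.
Proof. by apply: prodr_ge0 => i _; exact: poisson_ge0. Qed.

Lemma measurable_poisson_rV d : measurable_fun setT (@poisson_rV d).
Proof.
apply: measurable_prodr => i; apply: (measurableT_comp measurable_poisson).
exact: measurable_rV_coord.
Qed.

Lemma integral_poisson_rV d :
  (\int[lebesgue_rV R d]_x (poisson_rV x)%:E = 1)%E.
Proof.
rewrite /poisson_rV (@ge0_integral_prod R d (fun _ => @poisson R)).
- by rewrite big1// => i _; exact: integral_poisson.
- by move=> _; exact: measurable_poisson.
- by move=> _; exact: poisson_ge0.
Qed.

Lemma intg_poisson_rV d : intg (lebesgue_rV R d) (@poisson_rV d).
Proof.
apply: intg_fin; [exact: measurable_poisson_rV|exact: poisson_rV_ge0|].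
by rewrite integral_poisson_rV ltry.
Qed.

End poisson_rV.

Section inversion.
Variables (R : realType) (d : nat).
Local Notation V := 'rV[R]_d.
Local Notation mu := (lebesgue_rV R d).

(** Abel summation: with the factor [expn1 (e n *: xi)] inserted, the integral tends to the left
    side by dominated convergence. By Fubini it also equals an average of h against a Poisson kernel
    of width [e n] around x, which tends to h x by continuity at x. *)
Lemma inversion (h : V -> R) (x : V) (B : R) :
  intg mu h -> (forall y, `|h y| <= B) -> {for x, continuous h} ->
  intg mu (Cf h x) -> \int[mu]_xi Cf h x xi = h x.
Proof.
move=> hi hB hx Gi.
have mh := intg_measurable hi.
pose e n : R := n.+1%:R^-1.
have e0 n : 0 < e n by rewrite invr_gt0.
have en0 n : e n != 0 by rewrite gt_eqF.
have ecvg : e n @[n --> \oo] --> (0 : R) by exact: cvg_harmonic.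
pose u n := \int[mu]_xi (Cf h x xi * expn1 (e n *: xi)).
have mE n : measurable_fun setT (fun xi : V => expn1 (e n *: xi)).
  by apply: measurable_comp_dil; exact: measurable_expn1.
have u1 : u n @[n --> \oo] --> \int[mu]_xi Cf h x xi.
  apply: (proj2 (@Rint_cvg _ _ R mu (fun n xi => Cf h x xi * expn1 (e n *: xi))
     (Cf h x) (fun xi => `|Cf h x xi|) _ _ _ _)).
  - by move=> n; apply: measurable_funM => //; exact: measurable_Cf.
  - move=> xi; rewrite -[X in _ --> X]mulr1; apply: cvgM; first exact: cvg_cst.
    have H : (- \sum_(i < d) `|(e n *: xi) ord0 i|) @[n --> \oo] --> (0 : R).
      have -> : (fun n => - \sum_(i < d) `|(e n *: xi) ord0 i|) =
          (fun n => e n * - \sum_(i < d) `|xi ord0 i|).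
        apply/funext => n; rewrite mulrN mulr_sumr; congr (- _).
        by apply: eq_bigr => i _; rewrite mxE absM gtr0_norm.
      rewrite -[X in _ --> X](mul0r (- \sum_(i < d) `|xi ord0 i|)).
      by apply: cvgM ecvg _; exact: cvg_cst.
    by rewrite -expR0 /expn1; exact: (cvg_comp _ _ H (@continuous_expR R 0)).
  - exact: intg_norm.
  - by move=> n xi; rewrite absM ler_piMr// ger0_norm ?expn1_ge0 ?expn1_le1.
have uE n : u n = \int[mu]_z (h (e n *: z + x) * poisson_rV z).
  transitivity (\int[mu]_xi \int[mu]_y (h y * cos (2 * pi * edot y xi +
       - (2 * pi * edot x xi)) * expn1 (e n *: xi))).
    by apply: eq_Rint => xi; rewrite RintZr//; exact: intg_Tr.
  have iE : intg mu (fun xi => expn1 (e n *: xi)) by apply: intg_dil => //; exact: intg_expn1.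
  rewrite (@RFubini_dom _ _ _ _ R mu mu (fun z : V * V => h z.2 *
     cos (2 * pi * edot z.2 z.1 + - (2 * pi * edot x z.1)) * expn1 (e n *: z.1))
     (fun xi => expn1 (e n *: xi)) (fun y => `|h y|)); first last.
  - move=> xi y /=; rewrite !absM mulrC (ger0_norm (expn1_ge0 _)) ler_wpM2l ?expn1_ge0//.
    by rewrite ler_piMr// norm_cos_le1.
  - exact: intg_norm.
  - exact: iE.
  - apply: measurable_funM; last by apply: (measurableT_comp (mE n)); exact: measurable_fst.
    apply: measurable_funM; first by apply: (measurableT_comp mh); exact: measurable_snd.
    apply: measurableT_comp; first exact: measurable_cos.
    apply: measurable_funD.
      apply: measurable_funM => //; under eq_fun do rewrite edotC; exact: measurable_edot.
    apply: measurable_funN; apply: measurable_funM => //.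
    by apply: (measurableT_comp (measurable_edotl x)); exact: measurable_fst.
  rewrite /=.
  pose Psi y := h y * poisson_rV ((e n)^-1 *: (y - x)).
  have iPsi : intg mu Psi.
    apply: (@dom_intg _ _ _ _ _ (fun y : V => B * poisson_rV ((e n)^-1 *: (y - x)))).
    - apply: measurable_funM => //.
      under eq_fun do rewrite scalerBr.
      by apply: measurable_comp_affine; exact: measurable_poisson_rV.
    - by move=> y; rewrite absM (ger0_norm (poisson_rV_ge0 _)) ler_wpM2r ?poisson_rV_ge0.
    - apply: intgZ; have := @intg_affine R d (e n)^-1 (- ((e n)^-1 *: x)) (@poisson_rV R d).
      rewrite invr_eq0 => /(_ (en0 n) (@intg_poisson_rV R d)).
      by apply: eq_intg => y /=; rewrite scalerBr.
  transitivity (\int[mu]_y ((e n) ^- d * Psi y)).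
    apply: eq_Rint => y.
    transitivity (\int[mu]_xi (h y * (expn1 (e n *: xi) *
        cos (2 * pi * edot ((e n)^-1 *: (y - x)) (e n *: xi) + 0)))).
      apply: eq_Rint => xi; rewrite -mulrA [X in _ * X]mulrC; congr (_ * (_ * cos _)).
      by rewrite edotZl edotZr mulKf// edotBl; ring.
    rewrite RintZ; last first.
      apply: (intgM iE (B := 1)) => [|xi]; last exact: norm_cos_le1.
      apply: measurableT_comp; first exact: measurable_cos.
      apply: measurable_funD => //; apply: measurable_funM => //.
      by apply: measurable_comp_dil; exact: measurable_edotl.
    have := @Rint_dil R d (e n) (fun xi => expn1 xi *
        cos (2 * pi * edot ((e n)^-1 *: (y - x)) xi + 0)) (en0 n).
    move=> ->.
      by rewrite Rint_expn1_cos cos0 mul1r gtr0_norm// /Psi; ring.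
    apply: (intgM (@intg_expn1 R d) (B := 1)) => [|xi]; last exact: norm_cos_le1.
    apply: measurableT_comp; first exact: measurable_cos.
    by apply: measurable_funD => //; apply: measurable_funM => //; exact: measurable_edotl.
  rewrite RintZ// -[X in X ^- d](gtr0_norm (e0 n)) -(@Rint_affine R d (e n) x)//.
  by apply: eq_Rint => z; rewrite /Psi addrK scalerA mulVf// scale1r.
have u2 : u n @[n --> \oo] --> h x.
  rewrite (funext uE : u = _).
  rewrite (_ : h x = \int[mu]_z (h x * poisson_rV z)); last first.
    rewrite RintZ; last exact: intg_poisson_rV.
    rewrite (_ : \int[mu]_z poisson_rV z = 1) ?mulr1//.
    by apply: EFin_inj; rewrite EFin_Rint ?integral_poisson_rV//; exact: intg_poisson_rV.
  apply: (proj2 (@Rint_cvg _ _ R mu (fun n z => h (e n *: z + x) * poisson_rV z)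
     (fun z => h x * poisson_rV z) (fun z => B * poisson_rV z) _ _ _ _)).
  - move=> n; apply: measurable_funM; first exact: measurable_comp_affine.
    exact: measurable_poisson_rV.
  - move=> z; apply: cvgM; last exact: cvg_cst.
    have H : (e n *: z + x) @[n --> \oo] --> x.
      rewrite -[X in _ --> X]add0r; apply: cvgD; last exact: cvg_cst.
      by rewrite -[X in _ --> X](scale0r z); exact: cvgZr_tmp.
    exact: (cvg_comp _ _ H hx).
  - by apply: intgZ; exact: intg_poisson_rV.
  - by move=> n z; rewrite absM (ger0_norm (poisson_rV_ge0 _)) ler_wpM2r ?poisson_rV_ge0.
exact: (cvg_unique _ u1 u2).
Qed.

End inversion.

(** * Multipliers acting on Schwartz functions *)

Lemma wtV_mono (R : realType) d (x y : 'rV[R]_d) (c : R) N : 0 < c ->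
  wt y <= c * wt x -> wt x ^- N <= c ^+ N * wt y ^- N.
Proof.
move=> c0 yx; rewrite ler_pdivlMr ?exprn_gt0 ?wt_gt0// -exprVn -exprMn.
apply: lerXn2r.
- by rewrite nnegrE mulr_ge0 ?invr_ge0 ?(ltW (wt_gt0 _)).
- by rewrite nnegrE ltW.
- by rewrite ler_pdivrMl ?wt_gt0// mulrC.
Qed.

Section smooth_class.
Variables (R : realType) (d : nat).
Local Notation V := 'rV[R]_d.
Local Notation mu := (lebesgue_rV R d).
Local Notation delta i := (delta_mx ord0 i : V).

Definition rapid (E : Type) (s : E -> V -> R) :=
  forall N, exists K, 0 <= K /\ forall e x, `|s e x| <= K * wt x ^- N.

Definition is_partial (E : Type) i (s s' : E -> V -> R) :=
  forall e x t, is_derive (t : R) 1 (fun h : R => s e (x + h *: delta i))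
    (s' e (x + t *: delta i)).

(** Families indexed by E, so that the decay constants are uniform in the index, later the dyadic
    scale. Closure of the class under partial derivatives replaces bookkeeping with
    multi-indices. *)
Definition smooth_class (E : Type) (X : (E -> V -> R) -> Prop) :=
  forall s, X s -> [/\ forall e, measurable_fun setT (s e), rapid s &
    forall i, exists2 s', X s' & is_partial i s s'].

Lemma rapid_intg (E : Type) (s : E -> V -> R) e :
  measurable_fun setT (s e) -> rapid s -> intg mu (s e).
Proof. by move=> ms /(_ 2%N)[K [_ sK]]; exact: (wt_decay_intg ms (sK e)). Qed.

(** No boundary terms occur: the integral of s(y + h e_i) cos(...) is differentiated at h = 0 in two
    ways, under the integral sign and after a translation that moves h into the phase. *)
Lemma Tr_partial (E : Type) (s s' : E -> V -> R) i e th xi :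
  measurable_fun setT (s e) -> measurable_fun setT (s' e) ->
  rapid s -> rapid s' -> is_partial i s s' ->
  Tr (s' e) th xi = - (2 * pi * xi ord0 i) * Tr (s e) (th + pi / 2) xi.
Proof.
move=> ms ms' rs rs' ss'.
have is_ := rapid_intg ms rs; have is' := rapid_intg ms' rs'.
pose c (y : V) := cos (2 * pi * edot y xi + th).
have mc : measurable_fun setT c.
  apply: measurableT_comp; first exact: measurable_cos.
  by apply: measurable_funD => //; apply: measurable_funM => //; exact: measurable_edotr.
pose f (h : R) (y : V) := s e (y + h *: delta i) * c y.
have intf h : intg mu (f h).
  apply: (intgM (B := 1)) mc _ => [|y]; last exact: norm_cos_le1.
  exact: intg_shift.
pose F h := \int[mu]_y f h y.
pose b := 2 * pi * xi ord0 i.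
have FE h : F h = cos (- (b * h)) * Tr (s e) th xi + sin (- (b * h)) * Tr (s e) (th + pi / 2) xi.
  rewrite -TrD// /F /Tr -[LHS](Rint_shift (- (h *: delta i)) (intf h)).
  apply: eq_Rint => y; rewrite /f subrK; congr (_ * cos _).
  by rewrite edotDl edotNl edotZl edot_delta /b; ring.
have dF : is_derive (0 : R) 1 F (- b * Tr (s e) (th + pi / 2) xi).
  rewrite (funext FE).
  have h1 : is_derive (0:R) 1 (fun h => - (b * h)) (- b).
    have h := is_deriveN (is_deriveZ b (is_derive_id (0:R) (1 : R))).
    by apply: is_derive_eq h _; rewrite /GRing.scale/= mulr1.
  have h2 : is_derive (0:R) 1 (fun h => cos (- (b * h))) (- sin (- (b * 0)) * - b).
    by apply: (is_derive1_comp (f := cos)).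
  have h3 : is_derive (0:R) 1 (fun h => sin (- (b * h))) (cos (- (b * 0)) * - b).
    by apply: (is_derive1_comp (f := sin)).
  have h4 := is_deriveD (is_deriveM h2 (is_derive_cst (Tr (s e) th xi) (0:R) 1))
     (is_deriveM h3 (is_derive_cst (Tr (s e) (th + pi / 2) xi) (0:R) 1)).
  apply: is_derive_eq h4 _; rewrite !fctE/= /GRing.scale/=.
  by rewrite !mulr0 oppr0 sin0 cos0; ring.
have [K [K0 sK]] := rs' 2%N.
have df (h : R) (y : V) : is_derive h 1 (f ^~ y) (s' e (y + h *: delta i) * c y).
  have h4 := is_deriveM (ss' e y h) (is_derive_cst (c y) h 1).
  by apply: is_derive_eq h4 _; rewrite /GRing.scale/= mulr0 add0r mulrC.
have H := @differentiation_under_integral R _ _ mu f setT measurableT 0 (- 1) 1 _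
  (fun h _ => intf h) _ (fun y => 4 * K * wt y ^- 2) _ _ _.
have {H} : derive1 F 0 = \int[mu]_y partial1of2 f 0 y.
  apply: H.
  - by rewrite /= in_itv/= ltrN10 ltr01.
  - by move=> h y _ _; have [] := df h y.
  - by move=> y; rewrite !mulr_ge0 ?wtV_ge0.
  - by apply: intgZ; exact: intg_wt2.
  (* For |h| < 1 a shift along one axis changes [wt] by a factor of at most 2, hence [wt^-2] by at
     most 4, the constant in the dominating function. *)
  - move=> h y /=; rewrite in_itv/= => /andP[h1 h2] _.
    rewrite partial1of2E; have [_ ->] := df h y.
    rewrite absM -[leRHS]mulr1 ler_pM ?norm_cos_le1//.
    rewrite (le_trans (sK _ _))// [4 * K]mulrC -mulrA ler_wpM2l//.
    have := wtB (y + h *: delta i) (h *: delta i); rewrite addrK => H.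
    have W2 : wt (h *: delta i) <= 2.
      rewrite /wt (bigD1 i)//= big1 ?mulr1; last first.
        by move=> j ji; rewrite !mxE (negbTE ji) mulr0 normr0 addr0.
      by rewrite !mxE !eqxx mulr1 -lerBrDl; apply/ltW; rewrite ltr_norml; apply/andP; split; lra.
    have -> : 4 = (2 : R) ^+ 2 by ring.
    by apply: wtV_mono => //; rewrite (le_trans H)// mulrC ler_wpM2r// ltW// wt_gt0.
rewrite derive1E; have [_ ->] := dF => EF.
rewrite -/b EF; apply: eq_Rint => y; rewrite partial1of2E.
have [_ ->] := df 0 y.
by rewrite scale0r addr0.
Qed.

Lemma rapid_bound (E : Type) (s : E -> V -> R) :
  (forall e, measurable_fun setT (s e)) -> rapid s ->
  exists K : R, forall e th (xi : V), `|Tr (s e) th xi| <= K.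
Proof.
move=> ms rs; have [K [K0 sK]] := rs 2%N.
exists (K * \int[mu]_x wt x ^- 2) => e th xi.
rewrite -RintZ; last exact: intg_wt2.
apply: le_norm_Rint.
- by apply: intg_Tr; exact: rapid_intg.
- by apply: intgZ; exact: intg_wt2.
- move=> y; apply: le_trans (sK e y); rewrite absM ler_piMr//.
  exact: norm_cos_le1.
Qed.

Lemma smooth_class_decay_seq (E : Type) (X : (E -> V -> R) -> Prop) s
    (l : seq 'I_d) : smooth_class X -> X s ->
  exists K : R, forall e th (xi : V),
    \prod_(i <- l) (1 + `|xi ord0 i|) * `|Tr (s e) th xi| <= K.
Proof.
move=> cX; elim: l s => [|i l ih] s Xs; have [ms rs ps] := cX _ Xs.
  have [K sK] := rapid_bound ms rs; exists K => e th xi.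
  by rewrite big_nil mul1r.
have [s' Xs' ss'] := ps i; have [ms' rs' _] := cX _ Xs'.
have [K1 H1] := ih _ Xs; have [K2 H2] := ih _ Xs'.
exists (K1 + K2) => e th xi; rewrite big_cons.
set P := \prod_(_ <- _) _ in H1 H2 *; rewrite -mulrA mulrDl mul1r.
have P0 : 0 <= P by apply: prodr_ge0 => j _; rewrite addr_ge0.
apply: lerD; first exact: H1.
apply: (le_trans _ (H2 e (th - pi / 2) xi)); rewrite mulrCA ler_wpM2l//.
rewrite (Tr_partial _ _ (ms e) (ms' e) rs rs' ss') subrK absM ler_wpM2r//.
rewrite normrN !absM ler_peMl// (ger0_norm (pi_ge0 R)) ger0_norm//.
by have := @pi_ge2 R; lra.
Qed.

Lemma smooth_class_decay (E : Type) (X : (E -> V -> R) -> Prop) s :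
  smooth_class X -> X s -> forall N, exists K : R, 0 <= K /\
  forall e th (xi : V), `|Tr (s e) th xi| <= K * wt xi ^- N.
Proof.
move=> cX Xs N.
have [K sK] := @smooth_class_decay_seq E X s (flatten (nseq N (enum 'I_d))) cX Xs.
exists `|K|; split => // e th xi.
have wtE : \prod_(i <- flatten (nseq N (enum 'I_d))) (1 + `|xi ord0 i|) = wt xi ^+ N.
  elim: (N) => [|n ih]; first by rewrite big_nil.
  by rewrite /= big_cat/= ih exprS /wt big_enum.
rewrite ler_pdivlMr ?exprn_gt0 ?wt_gt0// mulrC -wtE.
by rewrite (le_trans (sK e th xi))// ler_norm.
Qed.

Inductive span_class (E : Type) (X : (E -> V -> R) -> Prop) :
    (E -> V -> R) -> Prop :=
| SpanBase s : X s -> span_class X s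
| SpanD s1 s2 : span_class X s1 -> span_class X s2 ->
    span_class X (fun e x => s1 e x + s2 e x)
| SpanZ (c : E -> R) (B : R) s : (forall e, `|c e| <= B) -> span_class X s ->
    span_class X (fun e x => c e * s e x).

Lemma Tr_Dsum (E : Type) (s1 s2 : E -> V -> R) e th xi :
  intg mu (s1 e) -> intg mu (s2 e) ->
  Tr (fun x => s1 e x + s2 e x) th xi = Tr (s1 e) th xi + Tr (s2 e) th xi.
Proof.
move=> i1 i2; rewrite /Tr -RintD; [|exact: intg_Tr|exact: intg_Tr].
by apply: eq_Rint => y; rewrite mulrDl.
Qed.

Lemma TrZ (f : V -> R) c th xi : intg mu f ->
  Tr (fun x => c * f x) th xi = c * Tr f th xi.
Proof.
move=> i1; rewrite /Tr -RintZ; last exact: intg_Tr.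
by apply: eq_Rint => y; rewrite mulrA.
Qed.

End smooth_class.

Section schwartz_class.
Variables (R : realType) (d : nat).
Local Notation V := 'rV[R]_d.
Local Notation mu := (lebesgue_rV R d).
Local Notation delta i := (delta_mx ord0 i : V).

Lemma is_derive_line (g : V -> R) (x v : V) (t : R) :
  differentiable g (x + t *: v) ->
  is_derive t 1 (fun h : R => g (x + h *: v)) ('D_v g (x + t *: v)).
Proof.
move=> dg; have E : (fun h : R => h^-1 *: (g (x + (h *: 1 + t) *: v) - g (x + t *: v))) =
    (fun h : R => h^-1 *: ((g \o shift (x + t *: v)) (h *: v) - g (x + t *: v))).
  apply/funext => h /=; congr (_ *: (g _ - _)).
  by rewrite scaler1 scalerDl addrCA.
have dv : derivable g (x + t *: v) v by exact: diff_derivable.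
apply: DeriveDef; first by rewrite /derivable /= E.
by rewrite /derive /= E.
Qed.

Definition schwartz_fam (f : V -> R) : (unit -> V -> R) -> Prop :=
  fun s => exists l, s = (fun _ => partials l f).

(** Links [wt] to the monomials of the Schwartz seminorms: 1 + |x_i| is at most 2 |x_i| on the
    coordinates with |x_i| >= 1 and at most 2 on the others. The set S depends on x, but there are
    finitely many candidates. *)
Lemma wt_exp_le (x : V) N : exists S : {set 'I_d},
  wt x ^+ N <= 2 ^+ (d * N) * \prod_(i < d) `|x ord0 i| ^+ (if i \in S then N else 0%N).
Proof.
exists (finset (fun i => 1 <= `|x ord0 i|)).
have -> : 2 ^+ (d * N) = \prod_(i < d) (2 ^+ N : R).
  by rewrite prodr_const card_ord -exprM mulnC.
rewrite /wt -prodrXl -big_split/=; apply: ler_prod => i _.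
rewrite exprn_ge0 ?addr_ge0//= inE; case: ifPn => h.
  rewrite -exprMn; apply: lerXn2r; rewrite ?nnegrE ?addr_ge0 ?mulr_ge0//; lra.
rewrite expr0 mulr1; apply: lerXn2r; rewrite ?nnegrE ?addr_ge0//.
by move: h; rewrite -ltNge => /ltW; lra.
Qed.

Lemma schwartz_fam_smooth (f : V -> R) : schwartz f -> smooth_class (schwartz_fam f).
Proof.
move=> [df bf] s [l ->]; split.
- move=> _; apply: continuous_measurable_rV => x.
  exact/differentiable_continuous/df.
- move=> N.
  pose a (S : {set 'I_d}) i := if i \in S then N else 0%N.
  have /choice[M MP] : forall S : {set 'I_d}, exists M : R, forall x : V,
    `|(\prod_(i < d) x ord0 i ^+ a S i) * partials l f x| <= M by move=> S; exact: bf.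
  exists (2 ^+ (d * N) * \sum_S `|M S|); split.
    by rewrite mulr_ge0 ?exprn_ge0 ?sumr_ge0.
  move=> _ x; rewrite ler_pdivlMr ?exprn_gt0 ?wt_gt0//.
  have [S HS] := wt_exp_le x N.
  apply: (le_trans (ler_wpM2l (normr_ge0 _) HS)).
  rewrite mulrCA ler_wpM2l ?exprn_ge0//.
  have := MP S x; rewrite absM normr_prod.
  rewrite (eq_bigr (fun i => `|x ord0 i| ^+ a S i)); last by move=> i _; rewrite normrX.
  rewrite mulrC => H; apply: (le_trans H).
  rewrite (bigD1 S)//= (le_trans (ler_norm _))// lerDl sumr_ge0//.
- move=> i; exists (fun _ => partials (i :: l) f); first by exists (i :: l).
  by move=> _ x t /=; apply: is_derive_line; exact: df.
Qed.

Lemma schwartz_continuous (f : V -> R) : schwartz f -> continuous f.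
Proof.
by move=> [df _] x; apply: differentiable_continuous; exact: (df [::]).
Qed.

End schwartz_class.

Lemma wt_neq0 (R : realType) d (x : 'rV[R]_d) : wt x != 0.
Proof. by rewrite gt_eqF// wt_gt0. Qed.

Lemma wtX_neq0 (R : realType) d (x : 'rV[R]_d) n : wt x ^+ n != 0.
Proof. by rewrite expf_neq0// wt_neq0. Qed.

Section multipliers.
Variables (R : realType) (d : nat).
Local Notation V := 'rV[R]_d.
Local Notation mu := (lebesgue_rV R d).
Implicit Types (f g h k m s a b : V -> R) (x y xi : V) (th : R).

Definition mult m f x : R := \int[mu]_xi (m xi * Cf f x xi).

Definition conv k h x : R := \int[mu]_y (k y * h (x - y)).

Lemma multiplierE m f x : intg mu f -> multiplier m f x = mult m f x.
Proof.
move=> fi; rewrite /multiplier /inv_fourier /cintegral/=; apply: eq_Rint => xi.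
rewrite /fourier /cintegral /expi /=.
have E1 : \int[mu]_y (f y * cos (- (2 * pi * edot y xi)) - 0 * sin (- (2 * pi * edot y xi))) = Tr f 0 xi.
  by apply: eq_Rint => y; rewrite mul0r subr0 cosN addr0.
have E2 : \int[mu]_y (f y * sin (- (2 * pi * edot y xi)) + 0 * cos (- (2 * pi * edot y xi))) = Tr f (0 + pi / 2) xi.
  by apply: eq_Rint => y; rewrite mul0r addr0 sinN add0r cosDpihalf.
rewrite E1 E2 /Cf -(add0r (- (2 * pi * edot x xi))) (TrD 0 (- (2 * pi * edot x xi)) xi fi) cosN sinN.
by ring.
Qed.

(** The working class: it contains the Schwartz functions, is stable under products, linear
    combinations and dilations, and has just what inversion and multipliers of polynomial growth
    require. Derivatives need not be tracked any more. *)
Definition nice f := [/\ continuous f, exists K, 0 <= K /\ forall x, `|f x| <= K * wt x ^- 2 &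
  forall n : nat, exists K, 0 <= K /\ forall th xi, `|Tr f th xi| <= K * wt xi ^- n].

Lemma nice_measurable f : nice f -> measurable_fun setT f.
Proof. by case=> cf _ _; exact: continuous_measurable_rV. Qed.

Lemma nice_intg f : nice f -> intg mu f.
Proof.
by move=> nf; have [_ [K [_ fK]] _] := nf; exact: (wt_decay_intg (nice_measurable nf) fK).
Qed.

Lemma nice_bounded f : nice f -> exists B, 0 <= B /\ forall x, `|f x| <= B.
Proof.
case=> _ [K [K0 fK]] _; exists K; split => // x.
by rewrite (le_trans (fK x))// ler_piMr// wtV_le1.
Qed.

Lemma nice_Cf f N : nice f -> exists K, 0 <= K /\ forall x xi, `|Cf f x xi| <= K * wt xi ^- N.
Proof. by case=> _ _ /(_ N)[K [K0 fK]]; exists K; split => // x xi; exact: fK. Qed.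

Definition polyg m := measurable_fun setT m /\
  exists (K : R) (N : nat), 0 <= K /\ forall xi, `|m xi| <= K * wt xi ^+ N.

Lemma polyg_bounded m B : measurable_fun setT m -> (forall xi, `|m xi| <= B) -> polyg m.
Proof.
move=> mm mB; split => //; exists `|B|, 0%N; split => // xi.
by rewrite expr0 mulr1 (le_trans (mB xi))// ler_norm.
Qed.

Lemma polyg_nice m f : polyg m -> nice f ->
  exists K, 0 <= K /\ forall x xi, `|m xi * Cf f x xi| <= K * wt xi ^- 2.
Proof.
move=> [mm [K [N [K0 mK]]]] nf; have [K' [K'0 fK]] := nice_Cf (N + 2)%N nf.
exists (K * K'); split; first exact: mulr_ge0.
move=> x xi; rewrite absM (le_trans (ler_pM _ _ (mK xi) (fK x xi)))//.
rewrite mulrACA ler_wpM2l ?mulr_ge0// exprD invfM mulrA divff ?mul1r//.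
by rewrite gt_eqF// exprn_gt0// wt_gt0.
Qed.

Lemma intg_mult m f x : polyg m -> nice f -> intg mu (fun xi => m xi * Cf f x xi).
Proof.
move=> pm nf; have [K [K0 H]] := polyg_nice pm nf.
apply: wt_decay_intg (H x); apply: measurable_funM; first by case: pm.
by apply: measurable_Cf; exact: nice_intg.
Qed.

Lemma mult_bounded m f : polyg m -> nice f -> exists B, 0 <= B /\ forall x, `|mult m f x| <= B.
Proof.
move=> pm nf; have [K [K0 H]] := polyg_nice pm nf.
exists (K * \int[mu]_x wt x ^- 2); split.
  by rewrite mulr_ge0// ge0_Rint// => x; exact: wtV_ge0.
move=> x; rewrite -RintZ; last exact: intg_wt2.
apply: le_norm_Rint => //; first exact: intg_mult.
by apply: intgZ; exact: intg_wt2.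
Qed.

Lemma measurable_mult m f : polyg m -> nice f -> measurable_fun setT (mult m f).
Proof.
move=> pm nf.
apply: (@measurable_Rint _ _ _ _ R mu (fun z : V * V => m z.2 * Cf f z.1 z.2)).
  apply: measurable_funM; last by apply: measurable_Cf2; exact: nice_intg.
  by case: pm => mm _; apply: (measurableT_comp mm); exact: measurable_snd.
by move=> x; exact: (intg_mult x pm nf).
Qed.

Lemma nice_inversion f x : nice f -> mult (cst 1) f x = f x.
Proof.
move=> nf; have [B [_ fB]] := nice_bounded nf.
rewrite -(@inversion R d f x B)//.
- by apply: eq_Rint => xi; rewrite mul1r.
- exact: nice_intg.
- by case: nf => + _ _; exact.
- apply: eq_intg (intg_mult x (@polyg_bounded (cst 1) 1 _ _) nf) => [xi|//|xi].
    by rewrite /= mul1r.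
  by rewrite normr1.
Qed.

Lemma CfD f g x xi : intg mu f -> intg mu g ->
  Cf (fun y => f y + g y) x xi = Cf f x xi + Cf g x xi.
Proof. by move=> fi gi; rewrite /Cf (@Tr_Dsum _ _ unit (fun _ => f) (fun _ => g) tt). Qed.

Lemma niceZ c f : nice f -> nice (fun x => c * f x).
Proof.
move=> nf; have [cf [K [K0 fK]] tf] := nf; split.
- by move=> x; apply: (@continuousM _ _ (cst c) f); [exact: cst_continuous|exact: cf].
- exists (`|c| * K); split; first exact: mulr_ge0.
  by move=> x; rewrite absM -mulrA ler_wpM2l.
- move=> N; have [K' [K'0 H]] := tf N; exists (`|c| * K'); split; first exact: mulr_ge0.
  by move=> th xi; rewrite TrZ ?absM -?mulrA ?ler_wpM2l//; exact: nice_intg.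
Qed.

Lemma niceD f g : nice f -> nice g -> nice (fun x => f x + g x).
Proof.
move=> nf ng; have [cf [K [K0 fK]] tf] := nf; have [cg [K1 [K10 gK]] tg] := ng; split.
- by move=> x; apply: (@continuousD _ _ _ f g); [exact: cf|exact: cg].
- exists (K + K1); split; first exact: addr_ge0.
  by move=> x; rewrite mulrDl; apply normD_le.
- move=> N; have [K' [K'0 H]] := tf N; have [K'' [K''0 H'']] := tg N.
  exists (K' + K''); split; first exact: addr_ge0.
  move=> th xi.
  rewrite (@Tr_Dsum _ _ unit (fun _ => f) (fun _ => g) tt) ?mulrDl; [|exact: nice_intg..].
  by apply normD_le.
Qed.

Lemma nice0 : nice (fun _ => 0).
Proof.
split; first by move=> x; exact: cst_continuous.
  by exists 0; split => // x; rewrite normr0 mul0r.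
move=> N; exists 0; split => // th xi; rewrite mul0r /Tr.
rewrite (_ : \int[mu]_y _ = \int[mu]_y (0 * (wt y ^- 2))).
  by rewrite RintZ ?mul0r ?normr0//; exact: intg_wt2.
by apply: eq_Rint => y; rewrite !mul0r.
Qed.

Lemma nice_lin n (c : 'I_n -> R) (F : 'I_n -> V -> R) :
  (forall i, nice (F i)) -> nice (fun x => \sum_(i < n) c i * F i x).
Proof.
move=> nF; elim: (index_enum 'I_n) => [|i s ih].
  by under eq_fun do rewrite big_nil; exact: nice0.
by under eq_fun do rewrite big_cons; apply: niceD => //; exact: niceZ.
Qed.

Lemma nice_sum n (F : 'I_n -> V -> R) :
  (forall i, nice (F i)) -> nice (fun x => \sum_(i < n) F i x).
Proof.
move=> nF; have := @nice_lin n (fun _ => 1) F nF.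
by under eq_fun do under eq_bigr do rewrite mul1r.
Qed.

Lemma multD m f g x : polyg m -> nice f -> nice g ->
  mult m (fun y => f y + g y) x = mult m f x + mult m g x.
Proof.
move=> pm nf ng; rewrite /mult -RintD; [|exact: intg_mult..].
by apply: eq_Rint => xi; rewrite CfD ?mulrDr//; exact: nice_intg.
Qed.

Lemma multZ m c f x : polyg m -> nice f -> mult m (fun y => c * f y) x = c * mult m f x.
Proof.
move=> pm nf; rewrite /mult -RintZ; last exact: intg_mult.
by apply: eq_Rint => xi; rewrite /Cf TrZ; [rewrite mulrCA|exact: nice_intg].
Qed.

Lemma mult0 m x : polyg m -> mult m (fun _ => 0) x = 0.
Proof.
move=> pm.
have -> : (fun _ : V => 0 : R) = (fun y : V => (0 : R) * (fun _ => 0) y).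
  by apply/funext => y; rewrite mul0r.
by rewrite (multZ 0 x pm nice0) mul0r.
Qed.

Lemma mult_lin m n (c : 'I_n -> R) (F : 'I_n -> V -> R) x : polyg m ->
  (forall i, nice (F i)) ->
  mult m (fun x => \sum_(i < n) c i * F i x) x = \sum_(i < n) c i * mult m (F i) x.
Proof.
move=> pm nF.
suff [] : nice (fun x => \sum_(i < n) c i * F i x) /\
  mult m (fun x => \sum_(i < n) c i * F i x) x = \sum_(i < n) c i * mult m (F i) x by [].
elim: (index_enum 'I_n) => [|i s [ih1 ih2]].
  split; first by under eq_fun do rewrite big_nil; exact: nice0.
  under eq_fun do rewrite big_nil; rewrite big_nil; exact: mult0.
split.
  by under eq_fun do rewrite big_cons; apply: niceD => //; exact: niceZ.
under eq_fun do rewrite big_cons.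
rewrite (multD x pm (niceZ (c i) (nF i)) ih1) multZ// ih2 big_cons//.
Qed.

Lemma mult_sum m n (F : 'I_n -> V -> R) x : polyg m -> (forall i, nice (F i)) ->
  mult m (fun x => \sum_(i < n) F i x) x = \sum_(i < n) mult m (F i) x.
Proof.
move=> pm nF; have := @mult_lin m n (fun _ => 1) F x pm nF.
under eq_fun do under eq_bigr do rewrite mul1r.
by under eq_bigr do rewrite mul1r.
Qed.

Lemma schwartz_nice f : schwartz f -> nice f.
Proof.
move=> sf; have cX := schwartz_fam_smooth sf.
have Xf : schwartz_fam f (fun _ => f) by exists [::].
split; first exact: schwartz_continuous.
  have [_ /(_ 2%N)[K [K0 H]] _] := cX _ Xf.
  by exists K; split => // x; exact: (H tt).
move=> N; have [K [K0 H]] := smooth_class_decay cX Xf N.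
by exists K; split => // th xi; exact: (H tt).
Qed.

Lemma Cf_shift f x y xi : intg mu f ->
  Cf f (x - y) xi = cos (2 * pi * edot y xi) * Cf f x xi +
    sin (2 * pi * edot y xi) * Tr f (- (2 * pi * edot x xi) + pi / 2) xi.
Proof.
move=> fi; rewrite -TrD//; congr Tr.
by rewrite edotBl; ring.
Qed.

(** The transform of a product is a convolution: f is replaced by its inversion formula and the
    integrals are exchanged. The decay in xi is shared by means of wt xi <= wt eta * wt (xi +-
    eta). *)
Lemma nice_mul f g : nice f -> nice g -> nice (fun x => f x * g x).
Proof.
move=> nf ng; have [cf [Kf [Kf0 fK]] tf] := nf; have [cg _ tg] := ng.
have [Bg [Bg0 gB]] := nice_bounded ng.
have fi := nice_intg nf; have gi := nice_intg ng.
split.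
- by move=> x; apply: (@continuousM _ _ f g); [exact: cf|exact: cg].
- exists (Kf * Bg); split; first exact: mulr_ge0.
  by move=> x; rewrite absM mulrAC ler_pM.
move=> N; have [K1 [K10 H1]] := tf (N + 2)%N; have [K2 [K20 H2]] := tg N.
exists (2 * (K1 * K2) * \int[mu]_x wt x ^- 2); split.
  by rewrite !mulr_ge0// ge0_Rint// => x; exact: wtV_ge0.
move=> th xi.
have -> : Tr (fun x => f x * g x) th xi =
    \int[mu]_eta \int[mu]_y (g y * cos (2 * pi * edot y xi + th) * Cf f y eta).
  rewrite -(@RFubini_dom _ _ _ _ R mu mu (fun z : V * V => g z.1 * cos (2 * pi * edot z.1 xi + th) * Cf f z.1 z.2)
    (fun y => `|g y|) (fun eta => K1 * wt eta ^- 2)).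
  - apply: eq_Rint => y; rewrite -(nice_inversion y nf) /mult mulrC mulrA mulrC mulrA -RintZ.
      by apply: eq_Rint => eta; rewrite mul1r; ring.
    by apply: intg_mult => //; apply: (@polyg_bounded _ 1) => //= z; rewrite normr1.
  - apply: measurable_funM; last exact: measurable_Cf2.
    apply: (measurableT_comp (f := fun y => g y * cos (2 * pi * edot y xi + th))); last exact: measurable_fst.
    by apply: intg_measurable; exact: intg_Tr.
  - exact: intg_norm.
  - by apply: intgZ; exact: intg_wt2.
  - move=> y eta /=; rewrite !absM -mulrA ler_wpM2l// -[leRHS]mul1r ler_pM ?norm_cos_le1//.
    apply: (le_trans (H1 _ _)); rewrite ler_wpM2l//; exact: wtV_le (leq_addl _ _).
have inner eta : `|\int[mu]_y (g y * cos (2 * pi * edot y xi + th) * Cf f y eta)| <=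
    2 * (K1 * K2) * wt xi ^- N * wt eta ^- 2.
  set A := Tr f 0 eta; set B := Tr f (0 + pi / 2) eta.
  have CfE' y : Cf f y eta = cos (2 * pi * edot y eta) * A - sin (2 * pi * edot y eta) * B.
    by rewrite /Cf -(add0r (- (2 * pi * edot y eta))) (TrD 0 (- (2 * pi * edot y eta)) eta fi) cosN sinN mulNr.
  have -> : \int[mu]_y (g y * cos (2 * pi * edot y xi + th) * Cf f y eta) =
    \int[mu]_y (2^-1 * A * (g y * cos (2 * pi * edot y (xi + eta) + th)) +
                2^-1 * A * (g y * cos (2 * pi * edot y (xi - eta) + th)) +
               (2^-1 * B * (g y * cos (2 * pi * edot y (xi + eta) + (th + pi / 2))) -
                2^-1 * B * (g y * cos (2 * pi * edot y (xi - eta) + (th + pi / 2))))).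
    apply: eq_Rint => y; rewrite CfE' !addrA !cosDpihalf.
    rewrite (edotC y (xi + eta)) (edotC y (xi - eta)) edotDl edotBl !(edotC _ y).
    set u := edot y xi; set v := edot y eta.
    have -> : 2 * pi * (u + v) + th = (2 * pi * u + th) + 2 * pi * v by ring.
    have -> : 2 * pi * (u - v) + th = (2 * pi * u + th) - 2 * pi * v by ring.
    by rewrite !(cosD, sinD, cosN, sinN); field.
  have it t z : intg mu (fun y => g y * cos (2 * pi * edot y z + t)) by exact: intg_Tr.
  rewrite RintD; [|apply: intgD; exact: intgZ|apply: intgB; exact: intgZ].
  rewrite RintD; [|exact: intgZ..]; rewrite RintB; [|exact: intgZ..].
  rewrite !RintZ//.
  have W z : wt xi <= wt eta * wt z -> forall t, `|Tr g t z| <= K2 * (wt eta ^+ N * wt xi ^- N).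
    move=> h t; apply: (le_trans (H2 t z)); rewrite ler_wpM2l//.
    by apply: wtV_mono; rewrite ?wt_gt0.
  have W1 : wt xi <= wt eta * wt (xi + eta).
    by have := wtB (xi + eta) eta; rewrite addrK mulrC.
  have W2 : wt xi <= wt eta * wt (xi - eta).
    by have := wtD (xi - eta) eta; rewrite subrK mulrC.
  have hA : `|A| <= K1 * wt eta ^- (N + 2) by exact: H1.
  have hB : `|B| <= K1 * wt eta ^- (N + 2) by exact: H1.
  have P u z t : `|u| <= K1 * wt eta ^- (N + 2) -> wt xi <= wt eta * wt z ->
      `|2^-1 * u * Tr g t z| <= 2^-1 * (K1 * K2 * wt xi ^- N * wt eta ^- 2).
    move=> hu hz; rewrite -mulrA absM ger0_norm ?invr_ge0// ler_wpM2l ?invr_ge0//.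
    rewrite absM (le_trans (ler_pM _ _ hu (W _ hz t)))//.
    rewrite le_eqVlt; apply/orP; left; apply/eqP.
    rewrite exprD invfM; field.
    by rewrite wt_neq0 !wtX_neq0.
  rewrite (_ : 2 * _ * _ * _ = (2^-1 * (K1 * K2 * wt xi ^- N * wt eta ^- 2) + 2^-1 * (K1 * K2 * wt xi ^- N * wt eta ^- 2)) +
    (2^-1 * (K1 * K2 * wt xi ^- N * wt eta ^- 2) + 2^-1 * (K1 * K2 * wt xi ^- N * wt eta ^- 2))); last by field; rewrite ?wt_neq0 ?wtX_neq0.
  apply normD_le; first by apply normD_le; exact: P.
  by apply normB_le; exact: P.
rewrite mulrAC -[X in _ <= X]RintZ; last exact: intg_wt2.
apply: le_norm_Rint => //; last by apply: intgZ; exact: intg_wt2.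
apply: (dom_intg _ inner); last by apply: intgZ; exact: intg_wt2.
apply: (@measurable_Rint _ _ _ _ R mu (fun z : V * V => g z.2 * cos (2 * pi * edot z.2 xi + th) * Cf f z.2 z.1)).
  apply: measurable_funM.
    apply: (measurableT_comp (f := fun y => g y * cos (2 * pi * edot y xi + th))); last exact: measurable_snd.
    by apply: intg_measurable; exact: intg_Tr.
  apply: (measurableT_comp (measurable_Cf2 fi) (g := fun z : V * V => (z.2, z.1))).
  by apply/measurable_fun_pair => /=; [exact: measurable_snd|exact: measurable_fst].
move=> eta /=; apply: (intgM (B := K1)) => //; first exact: intg_Tr.
  apply: (measurableT_comp (measurable_Cf2 fi) (g := fun y : V => (y, eta))).
  exact: measurable_pair2.
move=> y; apply: (le_trans (H1 _ _)); rewrite ler_piMr//; exact: wtV_le1.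
Qed.

End multipliers.

(** * Kernels with smooth symbols *)

Section kernels.
Variables (R : realType) (d : nat).
Local Notation V := 'rV[R]_d.
Local Notation mu := (lebesgue_rV R d).
Implicit Types (f g h k m s a b : V -> R) (x y xi eta : V) (th la : R).

Definition ker s x : R := Tr s 0 x.

(* k is the (real, even) inverse Fourier transform of s *)
Definition is_sym k s := forall th xi, Tr k th xi = cos th * s xi.

Lemma Tr_even s th x : intg mu s -> (forall xi, s (- xi) = s xi) ->
  Tr s th x = cos th * ker s x.
Proof.
move=> si se.
have o : Tr s (0 + pi / 2) x = 0.
  have E : Tr s (0 + pi / 2) x = - Tr s (0 + pi / 2) x.
    have h := Rint_reflect 0 (intg_Tr (0 + pi / 2) x si).
    transitivity (\int[mu]_y (-1 * (s y * cos (2 * pi * edot y x + (0 + pi / 2))))); last first.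
      by rewrite (RintZ _ (intg_Tr (0 + pi / 2) x si)) mulN1r.
    rewrite /Tr; apply: (eq_trans (esym h)).
    apply: eq_Rint => y; rewrite sub0r se edotNl mulrN !add0r !cosDpihalf sinN; ring.
  by move: E; lra.
by rewrite -{1}(add0r th) TrD// o mulr0 addr0.
Qed.

Lemma ker_even s x : ker s (- x) = ker s x.
Proof.
by apply: eq_Rint => y; rewrite (edotC y (- x)) edotNl edotC mulrN !addr0 cosN.
Qed.

(** For even functions the transform and its inverse coincide, so Fourier inversion applied to s,
    read at the frequency xi, returns the symbol. *)
Lemma ker_sym s B : (forall xi, s (- xi) = s xi) -> intg mu s ->
  (forall xi, `|s xi| <= B) -> continuous s -> intg mu (ker s) ->
  is_sym (ker s) s.
Proof.
move=> se si sB cs ki th xi; rewrite Tr_even//; last exact: ker_even.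
congr (_ * _); rewrite -[RHS](inversion si sB (cs xi)); last first.
  apply: eq_intg (intg_Tr 0 xi ki) => y /=.
  by rewrite /Cf Tr_even// cosN addr0 mulrC edotC.
by apply: eq_Rint => y; rewrite /Cf Tr_even// cosN addr0 mulrC edotC.
Qed.

Lemma conv_Cf k s h x xi : intg mu k -> is_sym k s -> intg mu h ->
  \int[mu]_y (k y * Cf h (x - y) xi) = s xi * Cf h x xi.
Proof.
move=> ki ks hi.
set B := Tr h (- (2 * pi * edot x xi) + pi / 2) xi.
have E y : k y * Cf h (x - y) xi = Cf h x xi * (k y * cos (2 * pi * edot y xi + 0)) -
    B * (k y * cos (2 * pi * edot y xi + pi / 2)).
  by rewrite Cf_shift// -/B cosDpihalf addr0; ring.
rewrite (eq_Rint _ E) RintB; [|exact/intgZ/intg_Tr..].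
rewrite !RintZ; [|exact: intg_Tr..].
have -> : \int[mu]_y (k y * cos (2 * pi * edot y xi + 0)) = Tr k 0 xi by [].
have -> : \int[mu]_y (k y * cos (2 * pi * edot y xi + pi / 2)) = Tr k (pi / 2) xi by [].
by rewrite !ks cos0 cos_pihalf; ring.
Qed.

Lemma intgM_Cf k h x xi : intg mu k -> intg mu h ->
  intg mu (fun y => k y * Cf h (x - y) xi).
Proof.
move=> ki hi; apply: (intgM ki); last by move=> y; exact: (Cf_le (x - y) xi hi).
apply: (measurable_comp_sub (f := fun y => Cf h y xi)).
exact: (measurableT_comp (measurable_Cf2 hi) (measurable_pair2 xi)).
Qed.

Lemma conv_mult k s m f x : intg mu k -> is_sym k s -> polyg m -> nice f ->
  conv k (mult m f) x = mult (fun xi => s xi * m xi) f x.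
Proof.
move=> ki ks pm nf; have fi := nice_intg nf.
have [K [K0 H]] := polyg_nice pm nf; have [mm _] := pm.
transitivity (\int[mu]_y \int[mu]_xi (k y * (m xi * Cf f (x - y) xi))).
  by apply: eq_Rint => y; rewrite RintZ//; exact: intg_mult.
rewrite (@RFubini_dom _ _ _ _ R mu mu (fun z : V * V => k z.1 * (m z.2 * Cf f (x - z.1) z.2))
  (fun y => `|k y|) (fun xi => K * wt xi ^- 2)); first last.
- by move=> y xi /=; rewrite absM ler_wpM2l.
- by apply: intgZ; exact: intg_wt2.
- exact: intg_norm.
- apply: measurable_funM; first exact: (measurableT_comp (intg_measurable ki) measurable_fst).
  apply: measurable_funM; first exact: (measurableT_comp mm measurable_snd).
  apply: (measurableT_comp (measurable_Cf2 fi) (g := fun z : V * V => (x - z.1, z.2))).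
  apply/measurable_fun_pair => /=; last exact: measurable_snd.
  apply: (measurableT_comp (f := fun y : V => x - y)); last exact: measurable_fst.
  exact: measurable_rV_sub.
apply: eq_Rint => xi /=; rewrite -mulrA [RHS]mulrCA -(conv_Cf x xi ki ks fi) -RintZ; last exact: intgM_Cf.
by apply: eq_Rint => y; rewrite mulrCA.
Qed.

Lemma conv_nice k s f x : intg mu k -> is_sym k s -> nice f -> conv k f x = mult s f x.
Proof.
move=> ki ks nf.
have p1 : polyg (cst 1 : V -> R).
  by apply: (@polyg_bounded R d (cst 1) 1) => // z; rewrite normr1.
have E : f = mult (cst 1) f by apply/funext => y; rewrite nice_inversion.
rewrite {1}E (conv_mult x ki ks p1 nf).
by congr mult; apply/funext => xi; rewrite mulr1.
Qed.

Lemma intg_mult1 a f x : intg mu a -> intg mu f -> intg mu (fun xi => a xi * Cf f x xi).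
Proof.
move=> ai fi; apply: (intgM ai); first exact: measurable_Cf.
by move=> xi; exact: (Cf_le x xi fi).
Qed.

Lemma mult1_bounded a f x : intg mu a -> intg mu f ->
  `|mult a f x| <= \int[mu]_xi `|a xi| * \int[mu]_y `|f y|.
Proof.
move=> ai fi; rewrite -RintZr; last exact: intg_norm.
apply: le_norm_Rint; first exact: intg_mult1.
  apply: eq_intg (intgZ (\int[mu]_y `|f y|) (intg_norm ai)) => xi /=; by rewrite mulrC.
by move=> xi; rewrite absM ler_wpM2l// Cf_le.
Qed.

Lemma measurable_mult1 a f : intg mu a -> intg mu f -> measurable_fun setT (mult a f).
Proof.
move=> ai fi.
apply: (@measurable_Rint _ _ _ _ R mu (fun z : V * V => a z.2 * Cf f z.1 z.2)).
  apply: measurable_funM; last exact: measurable_Cf2.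
  by apply: (measurableT_comp (intg_measurable ai)); exact: measurable_snd.
by move=> x; exact: (intg_mult1 x ai fi).
Qed.

Lemma conv_mult1 k a f (G : V -> R) B x : intg mu k -> intg mu a -> intg mu f ->
  measurable_fun setT G -> (forall y, `|G y| <= B) ->
  \int[mu]_y (k y * (mult a f (x - y) * G y)) =
  \int[mu]_xi (a xi * \int[mu]_y (k y * (Cf f (x - y) xi * G y))).
Proof.
move=> ki ai fi mG GB.
transitivity (\int[mu]_y \int[mu]_xi (a xi * (k y * (Cf f (x - y) xi * G y)))).
  apply: eq_Rint => y; rewrite [in LHS]mulrC -mulrA -RintZr; last exact: intg_mult1.
  by apply: eq_Rint => xi; ring.
have mC : measurable_fun setT (fun z : V * V => Cf f (x - z.1) z.2).
  apply: (measurableT_comp (measurable_Cf2 fi) (g := fun z : V * V => (x - z.1, z.2))).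
  apply/measurable_fun_pair => /=; last exact: measurable_snd.
  apply: (measurableT_comp (f := fun y : V => x - y)); last exact: measurable_fst.
  exact: measurable_rV_sub.
have kGB y xi : `|k y * (Cf f (x - y) xi * G y)| <= `|k y| * (\int[mu]_y `|f y| * B).
  rewrite !absM ler_wpM2l// ler_pM//; exact: Cf_le.
have B0 : 0 <= \int[mu]_y `|f y| * B.
  by rewrite mulr_ge0 ?ge0_Rint// (le_trans _ (GB 0)).
rewrite (@RFubini_dom _ _ _ _ R mu mu (fun z : V * V => a z.2 * (k z.1 * (Cf f (x - z.1) z.2 * G z.1)))
  (fun y => (\int[mu]_y `|f y| * B) * `|k y|) (fun xi => `|a xi|)); first last.
- by move=> y xi /=; rewrite absM [leRHS]mulrC ler_wpM2l// [leRHS]mulrC; exact: kGB.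
- exact: intg_norm.
- by apply: intgZ; exact: intg_norm.
- apply: measurable_funM; first exact: (measurableT_comp (intg_measurable ai) measurable_snd).
  apply: measurable_funM; first exact: (measurableT_comp (intg_measurable ki) measurable_fst).
  by apply: measurable_funM; [exact: mC|exact: (measurableT_comp mG measurable_fst)].
apply: eq_Rint => xi /=; rewrite RintZ//.
apply: (dom_intg _ (fun y => kGB y xi)).
  apply: measurable_funM; first exact: (intg_measurable ki).
  apply: measurable_funM => //.
  exact: (measurableT_comp mC (measurable_pair2 xi)).
by apply: eq_intg (intgZ (\int[mu]_y `|f y| * B) (intg_norm ki)) => y /=; rewrite mulrC.
Qed.

(** The principle that frequencies add, without distributions: both factors are expanded in cosines
    and integrated against k. A product of cosines splits into the frequencies xi + eta and xi -
    eta, which is why the hypothesis concerns both signs. *)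
Lemma conv_prod_vanish k s a b f g x : intg mu k -> is_sym k s ->
  intg mu a -> intg mu b -> intg mu f -> intg mu g ->
  (forall xi eta, a xi != 0 -> b eta != 0 -> s (xi + eta) = 0 /\ s (xi - eta) = 0) ->
  conv k (fun y => mult a f y * mult b g y) x = 0.
Proof.
move=> ki ks ai bi fi gi ab.
have C0 (h : V -> R) : \int[mu]_xi (0 * h xi) = 0.
  rewrite (_ : \int[mu]_xi _ = \int[mu]_xi (0 * (wt xi ^- 2))).
    by rewrite RintZ ?mul0r//; exact: intg_wt2.
  by apply: eq_Rint => y; rewrite !mul0r.
rewrite /conv.
rewrite (conv_mult1 (G := fun y => mult b g (x - y))
  (B := \int[mu]_xi `|b xi| * \int[mu]_y `|g y|) x ki ai fi); first last.
- by move=> y; exact: (mult1_bounded (x - y) bi gi).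
- by apply: measurable_comp_sub; exact: measurable_mult1.
apply: etrans (C0 (fun=> 1)); apply: eq_Rint => xi; rewrite mul0r.
have [->|a0] := eqVneq (a xi) 0; first by rewrite mul0r.
apply/eqP; rewrite mulf_eq0 (negbTE a0)/=; apply/eqP.
transitivity (\int[mu]_y (k y * (mult b g (x - y) * Cf f (x - y) xi))).
  by apply: eq_Rint => y; rewrite [X in _ * X]mulrC.
rewrite (conv_mult1 (G := fun y => Cf f (x - y) xi)
  (B := \int[mu]_y `|f y|) x ki bi gi); first last.
- by move=> y; exact: (Cf_le (x - y) xi fi).
- apply: (measurable_comp_sub (f := fun y => Cf f y xi)).
  exact: (measurableT_comp (measurable_Cf2 fi) (measurable_pair2 xi)).
apply: etrans (C0 (fun=> 1)); apply: eq_Rint => eta; rewrite mul0r.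
have [->|b0] := eqVneq (b eta) 0; first by rewrite mul0r.
have [s1 s2] := ab _ _ a0 b0.
apply/eqP; rewrite mulf_eq0 (negbTE b0)/=; apply/eqP.
set A := Cf f x xi; set A' := Tr f (- (2 * pi * edot x xi) + pi / 2) xi.
set D := Cf g x eta; set D' := Tr g (- (2 * pi * edot x eta) + pi / 2) eta.
have E y : k y * (Cf g (x - y) eta * Cf f (x - y) xi) =
   2^-1 * (A * D - A' * D') * (k y * cos (2 * pi * edot y (xi + eta) + 0)) +
   2^-1 * (A * D + A' * D') * (k y * cos (2 * pi * edot y (xi - eta) + 0)) -
   (2^-1 * (A * D' + A' * D) * (k y * cos (2 * pi * edot y (xi + eta) + pi / 2)) +
    2^-1 * (A' * D - A * D') * (k y * cos (2 * pi * edot y (xi - eta) + pi / 2))).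
  rewrite !Cf_shift// -/A -/A' -/D -/D' !cosDpihalf !addr0.
  rewrite (edotC y (xi + eta)) (edotC y (xi - eta)) edotDl edotBl !(edotC _ y).
  set u := edot y xi; set v := edot y eta.
  have -> : 2 * pi * (u + v) = 2 * pi * u + 2 * pi * v by ring.
  have -> : 2 * pi * (u - v) = 2 * pi * u - 2 * pi * v by ring.
  by rewrite !(cosD, sinD, cosN, sinN); field.
have it t z : intg mu (fun y => k y * cos (2 * pi * edot y z + t)) by exact: intg_Tr.
have Ek t z : \int[mu]_y (k y * cos (2 * pi * edot y z + t)) = Tr k t z by [].
rewrite (eq_Rint _ E) RintB; [|by apply: intgD; exact: intgZ|by apply: intgD; exact: intgZ].
rewrite !RintD; [|exact: intgZ..].
rewrite !RintZ// !Ek !ks s1 s2 !mulr0; ring.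
Qed.

Definition dil la k x : R := la ^+ d * k (la *: x).

Lemma intg_dilk la k : 0 < la -> intg mu k -> intg mu (dil la k).
Proof. by move=> la0 ki; apply: intgZ; apply: intg_dil => //; rewrite gt_eqF. Qed.

Lemma dil_sym la k s : 0 < la -> intg mu k -> is_sym k s ->
  is_sym (dil la k) (fun xi => s (la^-1 *: xi)).
Proof.
move=> la0 ki ks th xi; have la0' : la != 0 by rewrite gt_eqF.
rewrite -ks /Tr.
have := @Rint_dil R d la (fun y => k y * cos (2 * pi * edot y (la^-1 *: xi) + th)) la0' (intg_Tr th (la^-1 *: xi) ki).
rewrite gtr0_norm// => /(congr1 (fun z => la ^+ d * z)).
rewrite mulrA divff ?expf_neq0// mul1r => <-.
rewrite -RintZ; last exact: (intg_dil la0' (intg_Tr th (la^-1 *: xi) ki)).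
apply: eq_Rint => y; rewrite /dil -mulrA; congr (_ * (_ * cos _)).
by rewrite edotZl edotZr mulVKf.
Qed.

End kernels.

Section kernel_lipschitz.
Variables (R : realType) (d : nat).
Local Notation V := 'rV[R]_d.
Local Notation mu := (lebesgue_rV R d).
Implicit Types (s : V -> R) (x y xi : V) (t : R).

Definition coordM (i : 'I_d) s : V -> R := fun xi => xi ord0 i * s xi.

Lemma ker_is_derive s x y t : intg mu s -> (forall i, intg mu (coordM i s)) ->
  is_derive t 1 (fun h : R => ker s (x + h *: y))
    (\sum_i (2 * pi * y ord0 i) * Tr (coordM i s) (pi / 2) (x + t *: y)).
Proof.
move=> si ci.
pose f (h : R) (xi : V) := s xi * cos (2 * pi * edot xi (x + h *: y) + 0).
pose g (h : R) (xi : V) := \sum_i (2 * pi * y ord0 i) *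
   (coordM i s xi * cos (2 * pi * edot xi (x + h *: y) + pi / 2)).
have df (h : R) xi : is_derive h 1 (f ^~ xi) (g h xi).
  have h1 : is_derive h 1 (fun h => 2 * pi * edot xi (x + h *: y) + 0) (2 * pi * edot xi y).
    have E : (fun h => 2 * pi * edot xi (x + h *: y) + 0) =
        (fun h => (2 * pi * edot xi y) * h + 2 * pi * edot xi x).
      apply/funext => k; rewrite edotC edotDl edotZl !(edotC _ xi); ring.
    rewrite E.
    have := is_deriveD (is_deriveZ (2 * pi * edot xi y) (is_derive_id h (1 : R)))
      (is_derive_cst (2 * pi * edot xi x) h 1).
    by move=> H; apply: is_derive_eq H _; rewrite /GRing.scale/= mulr1 addr0.
  have h2 : is_derive h 1 (fun h => cos (2 * pi * edot xi (x + h *: y) + 0))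
      (- sin (2 * pi * edot xi (x + h *: y) + 0) * (2 * pi * edot xi y)).
    by apply: (is_derive1_comp (f := cos)).
  have h3 := is_deriveZ (s xi) h2.
  apply: is_derive_eq h3 _; rewrite /g /GRing.scale/= cosDpihalf addr0.
  set S := sin _; rewrite /edot mulr_sumr mulr_sumr mulr_sumr; apply: eq_bigr => i _.
  by rewrite /coordM; ring.
have H := @differentiation_under_integral R _ _ mu f setT measurableT t (t - 1) (t + 1) _
  (fun h _ => intg_Tr 0 (x + h *: y) si) _
  (fun xi => \sum_i `|2 * pi * y ord0 i| * `|coordM i s xi|) _ _ _.
have H' := @derivable_under_integral R _ _ mu f setT measurableT t (t - 1) (t + 1) _
  (fun h _ => intg_Tr 0 (x + h *: y) si) _
  (fun xi => \sum_i `|2 * pi * y ord0 i| * `|coordM i s xi|) _ _ _.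
have a1 : [set` `]t - 1, t + 1[] t by rewrite /= in_itv/= ltrBlDr ltrDl ltr01.
have a2 (h : R) (xi : V) : [set` `]t - 1, t + 1[] h -> setT xi -> derivable (f ^~ xi) h 1.
  by move=> _ _; have [] := df h xi.
have a3 (xi : V) : 0 <= \sum_i `|2 * pi * y ord0 i| * `|coordM i s xi|.
  by apply: sumr_ge0 => i _; rewrite mulr_ge0.
have a4 : intg mu (fun xi => \sum_i `|2 * pi * y ord0 i| * `|coordM i s xi|).
  by apply: intg_sum => i; apply: intgZ; exact: intg_norm.
have a5 (h : R) (xi : V) : [set` `]t - 1, t + 1[] h -> setT xi ->
    `|partial1of2 f h xi| <= \sum_i `|2 * pi * y ord0 i| * `|coordM i s xi|.
  move=> _ _; rewrite partial1of2E; have [_ ->] := df h xi.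
  apply: (le_trans (ler_norm_sum _ _ _)); apply: ler_sum => i _.
  by rewrite [leLHS]absM ler_wpM2l// [leLHS]absM ler_piMr// norm_cos_le1.
apply: DeriveDef; first exact: (H' a1 a2 a3 a4 a5).
have {}H := H a1 a2 a3 a4 a5.
rewrite -derive1E; apply: (eq_trans H).
transitivity (\int[mu]_xi g t xi).
  by apply: eq_Rint => xi; rewrite partial1of2E; have [_ ->] := df t xi.
rewrite /g Rint_sum; last by move=> i; apply: intgZ; exact: intg_Tr.
by apply: eq_bigr => i _; rewrite RintZ//; exact: intg_Tr.
Qed.

Definition l1n y : R := \sum_i `|y ord0 i|.

Lemma l1n_ge0 y : 0 <= l1n y. Proof. by apply: sumr_ge0. Qed.

Lemma l1nZ (a : R) y : l1n (a *: y) = `|a| * l1n y.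
Proof. by rewrite /l1n mulr_sumr; apply: eq_bigr => i _; rewrite mxE absM. Qed.

Lemma l1n_le_wt y : l1n y <= wt y.
Proof.
suff [] : 0 <= l1n y /\ 1 + l1n y <= wt y by lra.
rewrite /l1n /wt; elim/big_rec2: _ => [|i a b _ [b0 ab]]; first by rewrite addr0.
have := normr_ge0 (y ord0 i) => h; split; [lra|nra].
Qed.

Lemma norm_coord_l1n y i : `|y ord0 i| <= l1n y.
Proof. by rewrite /l1n (bigD1 i)//= lerDl sumr_ge0. Qed.

(** Mean value theorem on the segment from x to x + y. The gradient of the kernel is the transform
    of the symbol multiplied by coordinates, and evaluating it at an intermediate point instead of x
    costs [wt y ^+ N]. *)
Lemma ker_lip (E : Type) (X : (E -> V -> R) -> Prop) (s : E -> V -> R) N :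
  smooth_class X -> X s -> (forall i, X (fun e => coordM i (s e))) ->
  exists K : R, 0 <= K /\ forall e x y,
    `|ker (s e) (x + y) - ker (s e) x| <= K * l1n y * wt y ^+ N * wt x ^- N.
Proof.
move=> cX Xs Xi.
have si e : intg mu (s e) by have [m r _] := cX _ Xs; exact: (rapid_intg (m e) r).
have ci e i : intg mu (coordM i (s e)).
  by have [m r _] := cX _ (Xi i); exact: (@rapid_intg _ _ E (fun e => coordM i (s e)) e).
have /choice[M MP] : forall i, exists K : R, 0 <= K /\ forall e th (xi : V),
  `|Tr (coordM i (s e)) th xi| <= K * wt xi ^- N.
  by move=> i; exact: (smooth_class_decay cX (Xi i) N).
exists (2 * pi * \sum_i M i); split.
  by rewrite !mulr_ge0 ?pi_ge0// sumr_ge0// => i _; have [] := MP i.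
move=> e x y.
pose F (h : R) := ker (s e) (x + h *: y).
pose F' (t : R) := \sum_i (2 * pi * y ord0 i) * Tr (coordM i (s e)) (pi / 2) (x + t *: y).
have dF t : is_derive t 1 F (F' t) by exact: ker_is_derive.
have [c c01 E01] : exists2 c, c \in `[0, 1]%R & F 1 - F 0 = F' c * (1 - 0).
  apply: MVT_segment => //.
  apply: derivable_within_continuous => t _; by have [] := dF t.
move: E01; rewrite subr0 mulr1 /F scale1r scale0r addr0 => ->.
apply: (le_trans (ler_norm_sum _ _ _)).
rewrite -!mulrA mulr_suml mulr_sumr mulr_sumr.
have W : wt (x + c *: y) ^- N <= wt y ^+ N * wt x ^- N.
  apply: wtV_mono; first exact: wt_gt0.
  have := wtB (x + c *: y) (c *: y); rewrite addrK => /le_trans; apply.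
  rewrite mulrC ler_wpM2r ?(ltW (wt_gt0 _))//.
  by move: c01; rewrite in_itv/= => /andP[? ?]; exact: wt_dil_le1.
apply: ler_sum => i _; have [M0 MM] := MP i.
rewrite !absM -!mulrA !(ger0_norm (pi_ge0 R)) (ger0_norm (ler0n R 2)) !ler_wpM2l ?pi_ge0//.
rewrite [leRHS]mulrCA; apply: ler_pM => //; first exact: norm_coord_l1n.
by apply: (le_trans (MM _ _ _)); rewrite ler_wpM2l.
Qed.

End kernel_lipschitz.

(** * A smooth cutoff with explicit derivatives *)

Section bump.
Variable R : realType.
Implicit Types (x u h : R) (n m : nat).

(** The flat function exp(-1/x) with negative powers of x attached: up to linear combinations the
    family is closed under differentiation, so smoothness becomes algebra. *)
Definition en n x : R := if 0 < x then x ^- n * expR (- x^-1) else 0.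

Lemma en_ge0 n x : 0 <= en n x.
Proof.
by rewrite /en; case: ifPn => // x0; rewrite mulr_ge0 ?expR_ge0// invr_ge0 exprn_ge0// ltW.
Qed.

Lemma en_gt0 n x : 0 < x -> 0 < en n x.
Proof. by move=> x0; rewrite /en x0 mulr_gt0 ?expR_gt0// invr_gt0 exprn_gt0. Qed.

Lemma en0 n x : x <= 0 -> en n x = 0.
Proof. by move=> x0; rewrite /en ltNge x0. Qed.

Lemma exprn_expRN (z : R) n : 0 <= z -> z ^+ n * expR (- z) <= n%:R ^+ n.
Proof.
case: n => [|n] z0; first by rewrite !expr0 mul1r -[leRHS]expR0 ler_expR oppr_le0.
have n0 : 0 < n.+1%:R :> R by rewrite ltr0n.
have -> : expR (- z) = (expR (z / n.+1%:R) ^+ n.+1)^-1.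
  by rewrite -expRM_natl mulrC divfK ?gt_eqF// expRN.
rewrite ler_pdivrMr ?exprn_gt0 ?expR_gt0// -exprMn.
apply: lerXn2r; rewrite ?nnegrE ?mulr_ge0 ?expR_ge0//.
rewrite mulrC -ler_pdivrMr//; by apply: le_trans (expR_ge1Dx _); rewrite lerDr.
Qed.

Lemma en_le n x : en n x <= n%:R ^+ n.
Proof.
rewrite /en; case: ifPn => x0; last by rewrite exprn_ge0.
by rewrite -exprVn exprn_expRN// invr_ge0 ltW.
Qed.

Lemma en_sq n x : en n x <= n.+2%:R ^+ n.+2 * x ^+ 2.
Proof.
rewrite /en; case: ifPn => x0; last by apply: mulr_ge0; [exact: exprn_ge0|exact: sqr_ge0].
have := @exprn_expRN x^-1 n.+2; rewrite invr_ge0 => /(_ (ltW x0)).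
rewrite -(ler_pM2r (_ : 0 < x ^+ 2)) ?exprn_gt0//; apply: le_trans.
rewrite -(addn2 n) exprD !exprVn le_eqVlt; apply/orP; left; apply/eqP; field.
by rewrite expf_neq0 gt_eqF.
Qed.

Lemma is_derive_quadratic (f : R -> R) x C :
  (forall h, `|f (h + x) - f x| <= C * h ^+ 2) -> is_derive x 1 f 0.
Proof.
move=> H.
have C0 : 0 <= C by have := H 1; rewrite expr1n mulr1; apply: le_trans.
have cv : h^-1 *: (f (h *: 1 + x) - f x) @[h --> 0^'] --> (0 : R).
  apply/cvgr0Pnorm_le => e e0; near=> h.
  have h0 : h != 0 by near: h; exact: nbhs_dnbhs_neq.
  rewrite /GRing.scale/= mulr1 absM normfV mulrC ler_pdivrMr ?normr_gt0//.
  apply: (le_trans (H h)); rewrite -real_normK ?num_real// expr2 mulrA ler_wpM2r//.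
  have : `|h| <= e / (C + 1).
    near: h; apply: dnbhs0_le; rewrite divr_gt0//; lra.
  rewrite ler_pdivlMr; last lra.
  have := normr_ge0 h; nra.
apply: DeriveDef; first by apply/cvg_ex; exists 0.
exact/cvg_lim.
Unshelve. all: by end_near.
Qed.

Lemma near_is_derive (f g : R -> R) x D : (\forall y \near x, f y = g y) ->
  is_derive x 1 f D -> is_derive x 1 g D.
Proof. by move=> fg; exact: near_eq_is_derive. Qed.

(** For x <= 0 the derivative is 0 because [en n] is bounded by a multiple of x^2 ([en_sq]); for x >
    0 it is the product rule. *)
Lemma is_derive_en n x : is_derive x 1 (en n) (- n%:R * en n.+1 x + en n.+2 x).
Proof.
have [x0|x0] := ltP 0 x; last first.
  rewrite !(en0 _ x0) mulr0 addr0.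
  apply: (is_derive_quadratic (C := n.+2%:R ^+ n.+2)) => h.
  rewrite (en0 _ x0) subr0 ger0_norm ?en_ge0//.
  have [h0|h0] := ltP 0 (h + x); last first.
    by rewrite en0//; apply: mulr_ge0; [exact: exprn_ge0|exact: sqr_ge0].
  apply: (le_trans (en_sq _ _)); rewrite ler_wpM2l ?exprn_ge0//.
  by apply: lerXn2r; rewrite ?nnegrE; lra.
have xn0 : x != 0 by rewrite gt_eqF.
apply: (near_is_derive (f := fun y => (y ^-1) ^+ n * expR (- y^-1))).
  near=> y; rewrite /en (_ : 0 < y) ?exprVn//.
  by near: y; exact: lt_nbhsr.
have h1 : is_derive x 1 (fun y : R => y^-1) (- x ^- 2).
  by have := is_deriveV xn0 (is_derive_id x (1:R)) => h; apply: is_derive_eq h _; rewrite /GRing.scale/= mulr1.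
have h2 : is_derive x 1 (fun y : R => y^-1 ^+ n) (n%:R * x^-1 ^+ n.-1 * - x ^- 2).
  have -> : (fun y : R => y^-1 ^+ n) = (fun y : R => y^-1) ^+ n.
    by apply/funext => y; rewrite exprfctE.
  by apply: is_derive_eq (is_deriveX n h1) _; rewrite /GRing.scale/=.
have h3 : is_derive x 1 (fun y : R => expR (- y^-1)) (expR (- x^-1) * - (- x ^- 2)).
  apply: (is_derive1_comp (f := expR)); exact: is_deriveN.
have h4 := is_deriveM h2 h3.
apply: is_derive_eq h4 _; rewrite /en x0 /GRing.scale/=.
case: n {h2} => [|n] /=.
  by field.
by rewrite !exprVn !exprS; field; rewrite xn0 expf_neq0.
Unshelve. all: by end_near.
Qed.

Definition Bf n m u : R := en n (u - 1) * en m (4 - u).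

Lemma is_derive_Bf n m u : is_derive u 1 (Bf n m)
  (- n%:R * Bf n.+1 m u + Bf n.+2 m u + (m%:R * Bf n m.+1 u + - 1 * Bf n m.+2 u)).
Proof.
have h1 : is_derive u 1 (fun u : R => u - 1) 1.
  have := is_deriveB (is_derive_id u (1 : R)) (is_derive_cst (1 : R) u 1).
  by move=> h; apply: is_derive_eq h _; rewrite subr0.
have h2 : is_derive u 1 (fun u : R => 4 - u) (-1).
  have := is_deriveB (is_derive_cst (4 : R) u 1) (is_derive_id u (1 : R)).
  by move=> h; apply: is_derive_eq h _; rewrite sub0r.
have h3 := @is_derive1_comp R (en n) (fun u => u - 1) u _ _ (is_derive_en n (u - 1)) h1.
have h4 := @is_derive1_comp R (en m) (fun u => 4 - u) u _ _ (is_derive_en m (4 - u)) h2.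
apply: is_derive_eq (is_deriveM h3 h4) _.
by rewrite /Bf /GRing.scale/=; ring.
Qed.

Lemma Bf_ge0 n m u : 0 <= Bf n m u.
Proof. by rewrite mulr_ge0 ?en_ge0. Qed.

Lemma Bf_le1 n m u : u <= 1 -> Bf n m u = 0.
Proof. by move=> u1; rewrite /Bf en0 ?mul0r//; lra. Qed.

Lemma Bf_ge4 n m u : 4 <= u -> Bf n m u = 0.
Proof. by move=> u1; rewrite /Bf (en0 m) ?mulr0//; lra. Qed.

Lemma Bf_le n m u : `|Bf n m u| <= n%:R ^+ n * m%:R ^+ m.
Proof. by rewrite ger0_norm ?Bf_ge0// ler_pM ?en_ge0 ?en_le. Qed.

Lemma is_derive_continuous (f : R -> R) x D : is_derive x 1 f D -> {for x, continuous f}.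
Proof. by move=> [df _]; apply/differentiable_continuous; exact/derivable1_diffP. Qed.

Lemma Bf_antiderivative : exists F : R -> R, forall u, is_derive u 1 F (Bf 0 0 u).
Proof.
have cB : continuous (Bf 0 0) by move=> u; exact: is_derive_continuous (is_derive_Bf 0 0 u).
exists (fun u => \int[@lebesgue_measure R]_(t in `[0, u]) Bf 0 0 t) => u.
have [u0|u0] := ltP 0 u.
  have uu : u < u + 1 by rewrite ltrDl.
  have iB : (@lebesgue_measure R).-integrable [set` Interval (BLeft 0) (BRight (u + 1))] (EFin \o Bf 0 0).
    apply: continuous_compact_integrable; first exact: segment_compact.
    by apply: continuous_subspaceT.
  apply: DeriveDef; last rewrite -derive1E.
    by refine (proj1 (continuous_FTC1 uu iB _ (cB u))); first [done|exact: (ltW u0)|rewrite lteBSide/= ltW].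
  by refine (proj2 (continuous_FTC1 uu iB _ (cB u))); first [done|exact: (ltW u0)|rewrite lteBSide/= ltW].
rewrite Bf_le1; last lra.
apply: (near_is_derive (f := fun _ => 0)).
near=> v; transitivity (\int[@lebesgue_measure R]_(t in `[0, v]) (0 : R)).
  by rewrite /Rintegral (@integral0 _ _ R).
apply: eq_Rintegral => t; rewrite inE/= in_itv/= => /andP[_ tv]; rewrite Bf_le1//.
apply: (le_trans tv); apply: ltW; near: v; apply: lt_nbhsl; lra.
Unshelve. all: by end_near.
Qed.

Lemma derive0_cst (f : R -> R) a b : a <= b ->
  (forall x, x \in `]a, b[%R -> is_derive x 1 f 0) -> (forall x, {for x, continuous f}) ->
  f b = f a.
Proof.
move=> ab df cf; have [|c _] := @MVT_segment R f (fun _ => 0) a b ab df.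
  by apply: continuous_subspaceT => x; exact: cf.
by rewrite mul0r => /eqP; rewrite subr_eq0 => /eqP.
Qed.

(** A normalised primitive of the bump [Bf 0 0], which lives on [1, 4]. The variable u stands for
    |xi|^2, so the cutoff is 1 for |xi| <= 1 and 0 for |xi| >= 2. *)
Lemma cutoff_exists : exists (phi : R -> R) (c : R),
  [/\ forall u, is_derive u 1 phi (c * Bf 0 0 u), forall u, u <= 1 -> phi u = 1
    & forall u, 4 <= u -> phi u = 0].
Proof.
have [F dF] := Bf_antiderivative.
have cF u : {for u, continuous F} by exact: is_derive_continuous (dF u).
have F1 u : u <= 1 -> F u = F 1.
  move=> u1; symmetry; apply: (@derive0_cst F u 1 u1 _ cF) => x; rewrite in_itv/= => /andP[_ x1].
  by rewrite -(Bf_le1 0 0 (ltW x1)); exact: dF.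
have F4 u : 4 <= u -> F u = F 4.
  move=> u1; apply: (@derive0_cst F 4 u u1 _ cF) => x; rewrite in_itv/= => /andP[x1 _].
  by rewrite -(Bf_ge4 0 0 (ltW x1)); exact: dF.
have [x x14 Fx] : exists2 c, c \in `]1, 4[%R & F 4 - F 1 = Bf 0 0 c * (4 - 1).
  have h14 : 1 < 4 :> R by lra.
  by apply: (@MVT R F (Bf 0 0) 1 4 h14 (fun x _ => dF x)); exact: continuous_subspaceT.
have F41 : 0 < F 4 - F 1.
  move: x14; rewrite in_itv/= => /andP[x1 x4]; rewrite Fx; apply: mulr_gt0; last lra.
  by rewrite /Bf; apply: mulr_gt0; apply: en_gt0; lra.
exists (fun u => - (F 4 - F 1)^-1 * F u + (1 + (F 4 - F 1)^-1 * F 1)), (- (F 4 - F 1)^-1); split.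
- move=> u; have := is_deriveD (is_deriveZ (- (F 4 - F 1)^-1) (dF u)) (is_derive_cst (1 + (F 4 - F 1)^-1 * F 1) u 1).
  by move=> h; apply: is_derive_eq h _; rewrite addr0.
- by move=> u /F1 ->; ring.
- by move=> u /F4 ->; field; lra.
Qed.

Definition cutoff : R -> R := projT1 (cid cutoff_exists).

Lemma is_derive_cutoff : exists c, forall u, is_derive u 1 cutoff (c * Bf 0 0 u).
Proof. by rewrite /cutoff; case: cid => phi /= [c [H _ _]]; exists c. Qed.

Lemma cutoff1 u : u <= 1 -> cutoff u = 1.
Proof. by rewrite /cutoff; case: cid => phi /= [c [_ H _]]; exact: H. Qed.

Lemma cutoff0 u : 4 <= u -> cutoff u = 0.
Proof. by rewrite /cutoff; case: cid => phi /= [c [_ _ H]]; exact: H. Qed.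

Lemma cutoff_bounded : exists K, 0 <= K /\ forall u, `|cutoff u| <= K.
Proof.
have [c dc] := is_derive_cutoff.
exists (1 + `|c| * 3); split; first by rewrite addr_ge0 ?mulr_ge0.
move=> u; have [u1|u1] := leP u 1; first by rewrite cutoff1// normr1 lerDl mulr_ge0.
have [u4|u4] := leP 4 u; first by rewrite cutoff0// normr0 addr_ge0 ?mulr_ge0.
have [x x1 E] : exists2 x, x \in `[1, u]%R & cutoff u - cutoff 1 = c * Bf 0 0 x * (u - 1).
  apply: (@MVT_segment R cutoff (fun x => c * Bf 0 0 x) 1 u (ltW u1) (fun x _ => dc x)).
  by apply: continuous_subspaceT => x; exact: is_derive_continuous (dc x).
have -> : cutoff u = 1 + c * Bf 0 0 x * (u - 1).
  by move: E; rewrite (cutoff1 (lexx 1)) => <-; ring.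
have u10 : 0 <= u - 1 by lra.
apply normD_le; first by rewrite normr1.
rewrite !absM -mulrA ler_wpM2l// (ger0_norm u10) -[leRHS]mul1r ler_pM//; last lra.
by have := Bf_le 0 0 x; rewrite !expr0 mulr1 -absM.
Qed.

End bump.

(** * Classes of symbols closed under differentiation *)

Section symbols1.
Variable R : realType.
Implicit Types (u : R) (z : nat -> R -> R).

(** The generators are chosen so that the derivative in u stays in the class. The bounded
    coefficients c j let the lowest frequency block j = 0 differ from the others with uniform
    constants. *)
Inductive radial : (nat -> R -> R) -> Prop :=
| radial_cutoff (a : R) : 0 < a -> radial (fun _ u => cutoff (a * u))
| radial_Bf n m (a : R) : 0 < a -> radial (fun _ u => Bf n m (a * u))
| radialD z1 z2 : radial z1 -> radial z2 -> radial (fun j u => z1 j u + z2 j u)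
| radialZ (c : nat -> R) (K : R) z : (forall j, `|c j| <= K) -> radial z ->
    radial (fun j u => c j * z j u)
| radialM z : radial z -> radial (fun j u => u * z j u).

Lemma is_derive_dil (f : R -> R) a u D : is_derive (a * u) 1 f D ->
  is_derive u 1 (fun u => f (a * u)) (a * D).
Proof.
move=> df; have h1 : is_derive u 1 (fun u : R => a * u) a.
  have := is_deriveZ a (is_derive_id u (1 : R)).
  by move=> h; apply: is_derive_eq h _; rewrite /GRing.scale/= mulr1.
by have h := @is_derive1_comp R f (fun u => a * u) u _ _ df h1; apply: is_derive_eq h _; rewrite mulrC.
Qed.

Lemma radial_derive z : radial z ->
  exists2 z', radial z' & forall j u, is_derive u 1 (z j) (z' j u).
Proof.
have cst_bound (c : R) : forall _ : nat, `|c| <= `|c| by [].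
elim=> {z} [a a0|n m a a0|z1 z2 _ [z1' X1 d1] _ [z2' X2 d2]|c K z cK _ [z' X' d']|z Xz [z' X' d']].
- have [c dc] := is_derive_cutoff R.
  exists (fun _ u => a * (c * Bf 0 0 (a * u))).
    by do 2!(apply: (radialZ (c := fun _ => _)); first exact: cst_bound); exact: radial_Bf.
  by move=> _ u; exact: is_derive_dil.
- exists (fun _ u => a * (- n%:R * Bf n.+1 m (a * u) + Bf n.+2 m (a * u) +
     (m%:R * Bf n m.+1 (a * u) + - 1 * Bf n m.+2 (a * u)))).
    apply: (radialZ (c := fun _ => _)); first exact: cst_bound.
    apply: radialD; apply: radialD; try (apply: (radialZ (c := fun _ => _)); first exact: cst_bound);
      exact: radial_Bf.
  by move=> _ u; apply: is_derive_dil; exact: is_derive_Bf.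
- exists (fun j u => z1' j u + z2' j u); first exact: radialD.
  by move=> j u; exact: is_deriveD.
- exists (fun j u => c j * z' j u); first exact: radialZ cK _.
  by move=> j u; exact: (is_deriveZ (c j) (d' j u)).
- exists (fun j u => z j u + u * z' j u); first by apply: radialD => //; exact: radialM.
  move=> j u; have := is_deriveM (is_derive_id u (1 : R)) (d' j u).
  by move=> h; apply: is_derive_eq h _; rewrite /GRing.scale/= mulr1 addrC.
Qed.

Lemma radial_support z : radial z -> exists U, 0 <= U /\ forall j u, U <= u -> z j u = 0.
Proof.
elim=> {z} [a a0|n m a a0|z1 z2 _ [U1 [U10 H1]] _ [U2 [U20 H2]]|c K z cK _ [U [U0 H]]|z _ [U [U0 H]]].
- exists (4 / a); split; first by rewrite divr_ge0// ltW.
  by move=> _ u; rewrite ler_pdivrMr// mulrC; exact: cutoff0.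
- exists (4 / a); split; first by rewrite divr_ge0// ltW.
  by move=> _ u; rewrite ler_pdivrMr// mulrC; exact: Bf_ge4.
- exists (U1 + U2); split; first exact: addr_ge0.
  by move=> j u Uu; rewrite H1 ?H2 ?addr0//; lra.
- by exists U; split => // j u Uu; rewrite H// mulr0.
- by exists U; split => // j u Uu; rewrite H// mulr0.
Qed.

Lemma radial_bounded z : radial z -> exists K, 0 <= K /\ forall j u, 0 <= u -> `|z j u| <= K.
Proof.
elim=> {z} [a a0|n m a a0|z1 z2 _ [U1 [U10 H1]] _ [U2 [U20 H2]]|c K z cK _ [U [U0 H]]|z Xz [K [K0 H]]].
- by have [K [K0 H]] := cutoff_bounded R; exists K; split.
- exists (n%:R ^+ n * m%:R ^+ m); split; first by rewrite mulr_ge0 ?exprn_ge0.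
  by move=> *; exact: Bf_le.
- exists (U1 + U2); split; first exact: addr_ge0.
  by move=> j u u0; apply normD_le; [exact: H1|exact: H2].
- have K0 : 0 <= K by rewrite (le_trans _ (cK 0%N)).
  exists (K * U); split; first exact: mulr_ge0.
  by move=> j u u0; rewrite absM ler_pM// H.
- have [U [U0 HU]] := radial_support Xz; exists (U * K); split; first exact: mulr_ge0.
  move=> j u u0; have [Uu|uU] := leP U u; first by rewrite HU// mulr0 normr0 mulr_ge0.
  by rewrite absM ler_pM ?H// ger0_norm// ltW.
Qed.

End symbols1.

Section symbols.
Variables (R : realType) (d : nat).
Local Notation V := 'rV[R]_d.
Local Notation mu := (lebesgue_rV R d).
Variable ep : nat -> R.
Hypothesis ep01 : forall j, 0 <= ep j <= 1.
Implicit Types (u t dl : R) (z : nat -> R -> R) (x xi : V).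

Definition bsym j u : R := ep j + 4 * pi ^+ 2 * u.

(** Keeps the base of the fractional power away from 0 on the support of z, uniformly in j. Only u
    >= 0 matters in the end; the margin u > -dl provides a neighbourhood of u = 0 for taking
    derivatives. *)
Definition away dl z := forall j u, - dl < u -> z j u != 0 -> dl <= bsym j u.

Definition bpow t z : nat -> R -> R := fun j u => z j u * bsym j u `^ t.

Lemma is_derive_unique (f : R -> R) u D D' :
  is_derive u 1 f D -> is_derive u 1 f D' -> D = D'.
Proof. by move=> [_ <-] [_ <-]. Qed.

Lemma away_near dl z j u : away dl z -> - dl < u -> bsym j u < dl ->
  \forall v \near u, z j v = 0.
Proof.
have pp : 0 < 4 * pi ^+ 2 :> R by rewrite mulr_gt0// exprn_gt0// pi_gt0.
move=> az udl bu; near=> v; apply/eqP; apply: contraT => /az.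
have v1 : - dl < v by near: v; exact: lt_nbhsr.
move=> /(_ v1); rewrite leNgt => /negP[].
have : v < (dl - ep j) / (4 * pi ^+ 2).
  near: v; apply: lt_nbhsl; rewrite ltr_pdivlMr//.
  by move: bu; rewrite /bsym mulrC; lra.
by rewrite ltr_pdivlMr// /bsym mulrC; lra.
Unshelve. all: by end_near.
Qed.

(** Either the base is positive and the product rule applies, or it is at most 0 < dl, and then z
    vanishes near u and both sides are 0. *)
Lemma is_derive_bpow t z z' dl j u : 0 < dl -> away dl z -> - dl < u ->
  (forall j u, is_derive u 1 (z j) (z' j u)) ->
  is_derive u 1 (bpow t z j) (bpow t z' j u + t * (4 * pi ^+ 2) * bpow (t - 1) z j u).
Proof.
move=> dl0 az udl dz; have [b0|b0] := ltP 0 (bsym j u); last first.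
  have nz := away_near az udl (le_lt_trans b0 dl0).
  have z0 : z j u = 0 by exact: nbhs_singleton nz.
  have z'0 : z' j u = 0.
    apply: (is_derive_unique (dz j u)).
    apply: (near_is_derive (f := fun _ => 0)).
    by near=> v; symmetry; near: v.
  rewrite /bpow z'0 z0 !mul0r mulr0 addr0.
  apply: (near_is_derive (f := fun _ => 0)).
  near=> v; have -> : z j v = 0 by near: v.
  by rewrite mul0r.
have h1 : is_derive u 1 (bsym j) (4 * pi ^+ 2).
  have := is_deriveD (is_derive_cst (ep j) u (1:R)) (is_deriveZ (4 * pi ^+ 2) (is_derive_id u (1 : R))).
  by move=> h; apply: is_derive_eq h _; rewrite add0r /GRing.scale/= mulr1.
have h2 := @is_derive1_comp R (@powR R ^~ t) (bsym j) u _ _ (is_derive1_powR t b0) h1.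
apply: is_derive_eq (is_deriveM (dz j u) h2) _.
by rewrite /bpow /GRing.scale/=; ring.
Unshelve. all: by end_near.
Qed.

Lemma away_derive z z' dl : 0 < dl -> away dl z ->
  (forall j u, is_derive u 1 (z j) (z' j u)) -> away dl z'.
Proof.
move=> dl0 az dz j u udl; apply: contraNT; rewrite -ltNge => /(away_near az udl) nz.
apply/eqP/(is_derive_unique (dz j u)).
apply: (near_is_derive (f := fun _ => 0)).
by near=> v; symmetry; near: v.
Unshelve. all: by end_near.
Qed.

Lemma bpow_bounded t z dl : 0 < dl -> away dl z -> radial z ->
  exists K, 0 <= K /\ forall j u, 0 <= u -> `|bpow t z j u| <= K.
Proof.
move=> dl0 az rz; have [U [U0 HU]] := radial_support rz; have [K [K0 HK]] := radial_bounded rz.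
set M := 1 + 4 * pi ^+ 2 * U.
have pp : 0 < 4 * pi ^+ 2 :> R by rewrite mulr_gt0// exprn_gt0// pi_gt0.
exists (K * (dl `^ t + M `^ t)); split; first by rewrite mulr_ge0// addr_ge0// powR_ge0.
move=> j u u0; rewrite /bpow; have [->|zu] := eqVneq (z j u) 0.
  by rewrite mul0r normr0 mulr_ge0// addr_ge0// powR_ge0.
have bdl : dl <= bsym j u by apply: az => //; lra.
have bM : bsym j u <= M.
  rewrite /bsym /M lerD//; first by case/andP: (ep01 j).
  rewrite ler_pM2l// leNgt; apply/negP => Uu; move: zu.
  by rewrite HU ?eqxx// ltW.
rewrite absM ler_pM ?HK// (ger0_norm (powR_ge0 _ _)).
have [t0|t0] := leP 0 t.
  have : bsym j u `^ t <= M `^ t by rewrite ge0_ler_powR// nnegrE; lra.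
  by have := powR_ge0 dl t; lra.
have : bsym j u `^ t <= dl `^ t.
  rewrite -(opprK t) !(powRN _ (- t)) lef_pV2 ?posrE ?powR_gt0//; last lra.
  by rewrite ge0_ler_powR// ?nnegrE; lra.
by have := powR_ge0 M t; lra.
Qed.

(* The [ep j] enter only through powers of [bsym j], which plays the part of
   the symbol of (ep j - \triangle) in the variable u = |xi|^2. *)
Inductive ysym : (nat -> R -> R) -> Prop :=
| ysym_radial z : radial z -> ysym z
| ysym_pow t z dl : 0 < dl -> away dl z -> radial z -> ysym (bpow t z)
| ysymD y1 y2 : ysym y1 -> ysym y2 -> ysym (fun j u => y1 j u + y2 j u)
| ysymZ (c : R) y : ysym y -> ysym (fun j u => c * y j u).

Lemma ysym_derive y : ysym y -> exists2 y', ysym y' &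
  forall j u, 0 <= u -> is_derive u 1 (y j) (y' j u).
Proof.
elim=> {y} [z rz|t z dl dl0 az rz|y1 y2 _ [y1' Y1 d1] _ [y2' Y2 d2]|c y _ [y' Y dy]].
- have [z' rz' dz] := radial_derive rz; exists z'; first exact: ysym_radial.
  by move=> j u _; exact: dz.
- have [z' rz' dz] := radial_derive rz; have az' := away_derive dl0 az dz.
  exists (fun j u => bpow t z' j u + t * (4 * pi ^+ 2) * bpow (t - 1) z j u).
    apply: ysymD; first exact: ysym_pow dl0 az' rz'.
    by apply: ysymZ; exact: ysym_pow dl0 az rz.
  by move=> j u u0; apply: (is_derive_bpow t j dl0 az _ dz); lra.
- exists (fun j u => y1' j u + y2' j u); first exact: ysymD.
  by move=> j u u0; apply: is_deriveD; [exact: d1|exact: d2].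
- exists (fun j u => c * y' j u); first exact: ysymZ.
  by move=> j u u0; exact: (is_deriveZ c (dy j u u0)).
Qed.

Lemma ysym_support y : ysym y -> exists U, 0 <= U /\ forall j u, U <= u -> y j u = 0.
Proof.
elim=> {y} [z rz|t z dl dl0 az rz|y1 y2 _ [U1 [U10 H1]] _ [U2 [U20 H2]]|c y _ [U [U0 H]]].
- exact: radial_support.
- have [U [U0 H]] := radial_support rz; exists U; split => // j u Uu.
  by rewrite /bpow H// mul0r.
- exists (U1 + U2); split; first exact: addr_ge0.
  by move=> j u Uu; rewrite H1 ?H2 ?addr0//; lra.
- by exists U; split => // j u Uu; rewrite H// mulr0.
Qed.

Lemma ysym_bounded y : ysym y ->
  exists K, 0 <= K /\ forall j u, 0 <= u -> `|y j u| <= K.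
Proof.
elim=> {y} [z rz|t z dl dl0 az rz|y1 y2 _ [U1 [U10 H1]] _ [U2 [U20 H2]]|c y _ [U [U0 H]]].
- exact: radial_bounded.
- exact: (bpow_bounded t dl0 az rz).
- exists (U1 + U2); split; first exact: addr_ge0.
  by move=> j u u0; apply normD_le; [exact: H1|exact: H2].
- exists (`|c| * U); split; first exact: mulr_ge0.
  by move=> j u u0; rewrite absM ler_wpM2l// H.
Qed.

Definition sq xi : R := edot xi xi.

(** Functions of |xi|^2 multiplied by coordinates. By the chain rule a partial derivative of
    y(|xi|^2) is 2 xi_i y'(|xi|^2), so the class is stable and [smooth_class] applies to it. *)
Inductive symb : (nat -> V -> R) -> Prop :=
| symb_base y : ysym y -> symb (fun j xi => y j (sq xi))
| symb_coord i s : symb s -> symb (fun j => coordM i (s j))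
| symbD s1 s2 : symb s1 -> symb s2 -> symb (fun j xi => s1 j xi + s2 j xi)
| symbZ (c : R) s : symb s -> symb (fun j xi => c * s j xi).

Lemma sq_ge0 xi : 0 <= sq xi.
Proof. by apply: sumr_ge0 => i _; rewrite -expr2 sqr_ge0. Qed.

Lemma is_derive_sq i xi (t : R) :
  is_derive t 1 (fun h : R => sq (xi + h *: (delta_mx ord0 i : V))) (2 * (xi + t *: delta_mx ord0 i) ord0 i).
Proof.
set e : V := delta_mx ord0 i.
have E : (fun h : R => sq (xi + h *: e)) = (fun h => sq xi + ((2 * xi ord0 i) * h + h * h)).
  apply/funext => h; rewrite /sq edotDl edotZl (edotC xi) (edotC e) !edotDl !edotZl (edotC xi e) !edot_delta.
  rewrite mxE !eqxx/=; ring.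
rewrite E.
have h1 := is_derive_id t (1 : R).
have := is_deriveD (is_derive_cst (sq xi) t (1:R)) (is_deriveD (is_deriveZ (2 * xi ord0 i) h1) (is_deriveM h1 h1)).
by move=> h; apply: is_derive_eq h _; rewrite /GRing.scale/= !mxE !eqxx/=; ring.
Qed.

Lemma continuous_sq : continuous sq.
Proof.
rewrite /sq /edot; elim: (index_enum 'I_d) => [|i l ih].
  by under eq_fun do rewrite big_nil; move=> x; exact: cst_continuous.
under eq_fun do rewrite big_cons.
by move=> x; apply: (@continuousD _ _ _ (fun x : V => x ord0 i * x ord0 i)); [apply: (@continuousM _ _ (fun x : V => x ord0 i)); exact: coord_continuous|exact: ih].
Qed.

Lemma symb_continuous s j : symb s -> continuous (s j).
Proof.
elim=> {s} [y Yy|i s _ ih|s1 s2 _ ih1 _ ih2|c s _ ih] x.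
- have [y' _ dy] := ysym_derive Yy.
  apply: (@continuous_comp _ _ _ sq (y j)); first exact: continuous_sq.
  exact: (is_derive_continuous (dy j _ (sq_ge0 x))).
- apply: (@continuousM _ _ (fun x : V => x ord0 i) (s j)); [exact: coord_continuous|exact: ih].
- by apply: (@continuousD _ _ _ (s1 j) (s2 j)); [exact: ih1|exact: ih2].
- by apply: (@continuousM _ _ (cst c) (s j)); [exact: cst_continuous|exact: ih].
Qed.

Lemma symb_rapid s : symb s -> rapid s.
Proof.
elim=> {s} [y Yy|i s _ ih|s1 s2 _ ih1 _ ih2|c s _ ih] N.
- have [U [U0 HU]] := ysym_support Yy; have [K [K0 HK]] := ysym_bounded Yy.
  exists (K * (2 + U) ^+ (d * N)); split; first by rewrite mulr_ge0// exprn_ge0//; lra.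
  move=> j xi; rewrite ler_pdivlMr ?exprn_gt0 ?wt_gt0//.
  have [Us|sU] := leP U (sq xi).
    by rewrite HU// normr0 mul0r mulr_ge0// exprn_ge0//; lra.
  apply: ler_pM => //; [by rewrite exprn_ge0// ltW// wt_gt0|by apply: HK; exact: sq_ge0|].
  rewrite exprM; apply: lerXn2r; rewrite ?nnegrE ?exprn_ge0 ?(ltW (wt_gt0 _))//; first lra.
  have -> : (2 + U) ^+ d = \prod_(i < d) (2 + U) by rewrite prodr_const card_ord.
  rewrite /wt; apply: ler_prod => i _; rewrite addr_ge0//=.
  have : `|xi ord0 i| ^+ 2 <= sq xi.
    rewrite real_normK ?num_real// /sq /edot (bigD1 i)//= expr2 lerDl.
    by apply: sumr_ge0 => k _; rewrite -expr2 sqr_ge0.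
  have := normr_ge0 (xi ord0 i); nra.
- have [K [K0 H]] := ih N.+1; exists K; split => // j xi.
  rewrite /coordM absM; apply: (le_trans (ler_pM _ _ (norm_coord_wt xi i) (H j xi))) => //.
  by rewrite mulrCA ler_wpM2l// exprS invfM mulrA divff ?mul1r// wt_neq0.
- have [K1 [K10 H1]] := ih1 N; have [K2 [K20 H2]] := ih2 N.
  exists (K1 + K2); split; first exact: addr_ge0.
  by move=> j xi; rewrite mulrDl; apply normD_le.
- have [K [K0 H]] := ih N; exists (`|c| * K); split; first exact: mulr_ge0.
  by move=> j xi; rewrite absM -mulrA ler_wpM2l.
Qed.

Lemma symb_partial s i : symb s -> exists2 s', symb s' & is_partial i s s'.
Proof.
move=> Xs; elim: Xs i => {s} [y Yy|k s Xs ih|s1 s2 _ ih1 _ ih2|c s _ ih] i.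
- have [y' Yy' dy] := ysym_derive Yy.
  exists (fun j => coordM i (fun xi => 2 * y' j (sq xi))).
    apply: (@symb_coord i (fun j xi => 2 * y' j (sq xi))).
    by apply: (@symbZ 2 (fun j xi => y' j (sq xi))); exact: symb_base.
  move=> j x h.
  have := @is_derive1_comp R (y j) (fun h : R => sq (x + h *: delta_mx ord0 i)) h _ _
    (dy j _ (sq_ge0 _)) (is_derive_sq i x h).
  by move=> H; apply: is_derive_eq H _; rewrite /coordM; ring.
- have [s' Xs' ds] := ih i.
  exists (fun j xi => (k == i)%:R * s j xi + coordM k (s' j) xi).
    apply: (@symbD (fun j xi => (k == i)%:R * s j xi) (fun j => coordM k (s' j))).
      exact: symbZ.
    exact: symb_coord.
  move=> j x h.
  have h1 : is_derive h 1 (fun h : R => (x + h *: delta_mx ord0 i) ord0 k) (k == i)%:R.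
    have E : (fun h : R => (x + h *: delta_mx ord0 i) ord0 k) = (fun h => x ord0 k + (k == i)%:R * h).
      by apply/funext => l; rewrite !mxE eqxx/= mulrC.
    rewrite E.
    have := is_deriveD (is_derive_cst (x ord0 k) h (1:R)) (is_deriveZ ((k == i)%:R : R) (is_derive_id h (1 : R))).
    by move=> H; apply: is_derive_eq H _; rewrite add0r /GRing.scale/= mulr1.
  have := is_deriveM h1 (ds j x h).
  by move=> H; apply: is_derive_eq H _; rewrite /coordM /GRing.scale/=; ring.
- have [s1' X1' d1] := ih1 i; have [s2' X2' d2] := ih2 i.
  exists (fun e x => s1' e x + s2' e x); first exact: symbD.
  by move=> e x t; exact: is_deriveD.
- have [s' Xs' ds] := ih i.
  exists (fun e x => c * s' e x); first exact: symbZ.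
  by move=> e x t; exact: (is_deriveZ c (ds e x t)).
Qed.

Lemma symb_smooth : smooth_class symb.
Proof.
move=> s Xs; split; last by move=> i; exact: symb_partial.
- by move=> j; apply: continuous_measurable_rV; exact: symb_continuous.
- exact: symb_rapid.
Qed.

End symbols.

(** * Kernels at dyadic scales *)

Section kernel_packages.
Variables (R : realType) (d : nat).
Local Notation V := 'rV[R]_d.
Local Notation mu := (lebesgue_rV R d).
Implicit Types (x y xi : V) (la : R).

(** The weight at length scale 1/la, scaled to keep its integral. Kernels are taken with N = 8 and
    averages with N = 2; the surplus absorbs the powers of [wt] lost when centres are moved. *)
Definition wk N la x : R := la ^+ d * wt (la *: x) ^- N.

Lemma exp2_gt0 j : 0 < 2 ^+ j :> R. Proof. exact: exprn_gt0. Qed.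
Lemma exp2_neq0 j : 2 ^+ j != 0 :> R. Proof. by rewrite gt_eqF// exp2_gt0. Qed.
Hint Resolve exp2_gt0 exp2_neq0 : core.

(* Estimates for the kernels [k j] at scale [2 ^ -j], with symbols [sy j]. *)
Definition kpack N (K : R) (k sy : nat -> V -> R) :=
  [/\ forall j, intg mu (k j), forall j, is_sym (k j) (sy j),
     forall j x, `|k j x| <= K * wk N (2 ^+ j) x &
     forall j x y, `|k j (x + y) - k j x| <=
       K * l1n (2 ^+ j *: y) * wt (2 ^+ j *: y) ^+ 2 * wk 2 (2 ^+ j) x].

Lemma wk_ge0 N la x : 0 <= la -> 0 <= wk N la x.
Proof. by move=> la0; rewrite mulr_ge0 ?exprn_ge0 ?wtV_ge0. Qed.

Lemma kpack_le N K K' k sy : K <= K' -> kpack N K k sy -> kpack N K' k sy.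
Proof.
move=> KK [ki ks kb kl]; split => //.
- move=> j x; apply: (le_trans (kb j x)); rewrite ler_wpM2r//.
  by apply: wk_ge0; exact: ltW.
- move=> j x y; apply: (le_trans (kl j x y)).
  apply: ler_wpM2r; first by apply: wk_ge0; exact: ltW.
  apply: ler_wpM2r; first exact/exprn_ge0/ltW/wt_gt0.
  by apply: ler_wpM2r => //; exact: l1n_ge0.
Qed.

Variable ep : nat -> R.
Hypothesis ep01 : forall j, 0 <= ep j <= 1.

Lemma kpack_symb N s : symb ep s -> (forall j xi, s j (- xi) = s j xi) ->
  exists K, 0 <= K /\
  kpack N K (fun j => dil (2 ^+ j) (ker (s j))) (fun j xi => s j ((2 ^+ j)^-1 *: xi)).
Proof.
move=> Xs se; have cX := @symb_smooth R d ep ep01.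
have [ms rs _] := cX _ Xs.
have is_ j : intg mu (s j) by exact: (rapid_intg (ms j) rs).
have [K1 [K10 H1]] := smooth_class_decay cX Xs N.
have [K2 [K20 H2]] := smooth_class_decay cX Xs 2%N.
have [K3 [K30 H3]] := ker_lip 2 cX Xs (fun i => symb_coord i Xs).
have [K4 [_ H4]] := rs 0%N.
have mk j : measurable_fun setT (ker (s j)).
  by apply: measurable_Tr => //; exact: measurable_cst.
have ki j : intg mu (ker (s j)).
  by apply: (wt_decay_intg (mk j)) => x; exact: (H2 j 0 x).
have ks j : is_sym (ker (s j)) (s j).
  apply: (@ker_sym _ _ (s j) K4) => //.
    by move=> xi; have := H4 j xi; rewrite expr0 invr1 mulr1.
  by move=> x; apply: symb_continuous; exact: Xs.
exists (K1 + K3); split; first exact: addr_ge0.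
split.
- by move=> j; exact: intg_dilk.
- by move=> j; exact: dil_sym.
- move=> j x; rewrite /dil absM (ger0_norm (ltW (exprn_gt0 d (exp2_gt0 j)))).
  rewrite /wk mulrCA ler_wpM2l ?exprn_ge0//.
  apply: (le_trans (H1 j 0 _)); rewrite ler_wpM2r ?wtV_ge0//; lra.
- move=> j x y; rewrite /dil -mulrBr absM (ger0_norm (ltW (exprn_gt0 d (exp2_gt0 j)))).
  rewrite /wk mulrCA ler_wpM2l ?exprn_ge0// scalerDr.
  apply: (le_trans (H3 j _ _)).
  apply: ler_wpM2r; first exact: wtV_ge0.
  apply: ler_wpM2r; first exact/exprn_ge0/ltW/wt_gt0.
  by apply: ler_wpM2r; [exact: l1n_ge0|lra].
Qed.

End kernel_packages.

(** * Littlewood-Paley symbols of the Bessel operator *)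

Section lp_symbols.
Variables (R : realType) (d : nat).
Local Notation V := 'rV[R]_d.
Implicit Types (xi : V) (u s : R) (j n : nat).

(** With u = 4^-j |xi|^2 one has 1 + 4 pi^2 |xi|^2 = 4^j (4^-j + 4 pi^2 u), so after rescaling the
    block j sees the constant 4^-j instead of 1. *)
Definition ep4 j : R := (2 ^+ j) ^- 2.

Lemma ep4_01 j : 0 <= ep4 j <= 1.
Proof.
rewrite /ep4 invr_ge0 exprn_ge0 ?exprn_ge0//= invf_le1 ?exprn_gt0//.
by rewrite exprn_ege1// exprn_ege1// ler1n.
Qed.

(** The Littlewood-Paley profile in u = 4^-j |xi|^2: the annulus 1/4 <= u <= 4 for j > 0 and the
    ball u <= 4 for j = 0. The blocks telescope to [Phi]. *)
Definition beta j u : R := cutoff u + (- (0 < j)%:R) * cutoff (4 * u).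
(** A wider annulus, equal to 1 for 1/16 <= u <= 16 when j > 0. It covers the output frequencies of
    a block j multiplied by a block at least four octaves lower, a situation in which j > 0. *)
Definition chi j u : R := (0 < j)%:R * (cutoff (16^-1 * u) + (-1) * cutoff (64 * u)).

Lemma radial_cutoff1 : radial (fun _ : nat => @cutoff R).
Proof.
have -> : (fun _ : nat => @cutoff R) = (fun _ u => cutoff (1 * u)).
  by apply/funext => j; apply/funext => u; rewrite mul1r.
by apply: radial_cutoff; lra.
Qed.

Lemma radial_beta : radial beta.
Proof.
apply: radialD; first exact: radial_cutoff1.
apply: (radialZ (c := fun j => - (0 < j)%:R) (K := 1)).
  by move=> j; rewrite normrN; case: (0 < j)%N; rewrite ?normr1// normr0.
by apply: radial_cutoff; lra.
Qed.

Lemma radial_chi : radial chi.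
Proof.
apply: (radialZ (c := fun j => (0 < j)%:R) (K := 1)).
  by move=> j; case: (0 < j)%N; rewrite ?normr1// normr0.
apply: radialD; first by apply: radial_cutoff; lra.
apply: (radialZ (c := fun j => -1) (K := 1)); first by move=> _; rewrite normrN normr1.
by apply: radial_cutoff; lra.
Qed.

Lemma pi2_bound : 4 <= 4 * pi ^+ 2 :> R /\ 4 * pi ^+ 2 <= 64 :> R.
Proof.
have := @pi_ge2 R; have := @pihalf_lt2 R; set p := pi => a b.
have {}a : p < 4 by move: a; rewrite ltr_pdivrMr//; lra.
by split; nra.
Qed.

(** For j = 0 and u > -1/65 the base exceeds 1 - 64/65 = 1/65 because 4 pi^2 <= 64. For j > 0 one
    has u > 1/64 on the support, and 4 pi^2 >= 4 suffices. *)
Lemma away_low z : (forall j u, (0 < j)%N -> u <= 1 / 64 -> z j u = 0) ->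
  away ep4 (1 / 65) z.
Proof.
move=> z0 j u u1 zn; rewrite /bsym; have [p1 p2] := pi2_bound.
have [e0 e1] := andP (ep4_01 j).
case: j => [|j] in zn e0 e1 *.
  rewrite /ep4 expr0 expr1n invr1.
  have [u0|u0] := leP 0 u; nra.
have u2 : 1 / 64 < u.
  by rewrite ltNge; apply/negP => ul; move: zn; rewrite z0// eqxx.
nra.
Qed.

Lemma away_beta : away ep4 (1 / 65) beta.
Proof.
apply: away_low => // j u j0 u1; rewrite /beta j0 !cutoff1; [by rewrite mulr1; exact: subrr|lra|lra].
Qed.

Lemma away_chi : away ep4 (1 / 65) chi.
Proof.
apply: away_low => // j u j0 u1; rewrite /chi j0.
rewrite !cutoff1; [by rewrite mulN1r subrr mulr0|lra|lra].
Qed.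

Definition Phi n xi : R := cutoff (ep4 n * sq xi).
Definition bl j xi : R := beta j (ep4 j * sq xi).
(** The symbol of the Bessel operator. *)
Definition mB s xi : R := (1 + 4 * pi ^+ 2 * sq xi) `^ (s / 2).

Lemma sum_bl n xi : \sum_(j < n.+1) bl j xi = Phi n xi.
Proof.
elim: n => [|n ih]; first by rewrite big_ord_recl big_ord0 addr0 /bl /beta /Phi/= oppr0 mul0r addr0.
rewrite big_ord_recr/= ih /bl /beta /Phi /= mulN1r.
have -> : 4 * (ep4 n.+1 * sq xi) = ep4 n * sq xi.
  have n0 : (2 : R) ^+ n != 0 by exact: expf_neq0.
  by rewrite /ep4 (exprS (2 : R)); field.
by rewrite addrC subrK.
Qed.

Lemma sq_dil (la : R) xi : sq (la^-1 *: xi) = la ^- 2 * sq xi.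
Proof. by rewrite /sq edotZl edotZr mulrA -expr2 exprVn. Qed.

Lemma base_gt0 xi : 0 < 1 + 4 * pi ^+ 2 * sq xi.
Proof.
have := sq_ge0 xi; have [p1 p2] := pi2_bound; nra.
Qed.

Lemma mB_gt0 s xi : 0 < mB s xi.
Proof. by rewrite powR_gt0// base_gt0. Qed.

Lemma ep4_powR s j : ep4 j `^ (s / 2) = (2 `^ s) ^- j /\ ep4 j `^ (- (s / 2)) = (2 `^ s) ^+ j.
Proof.
have E : ep4 j = 2 `^ (- (j * 2)%N%:R) by rewrite powRN powR_mulrn// /ep4 -exprM.
have H : ep4 j `^ (s / 2) = (2 `^ s) ^- j.
  rewrite E -powRrM -powR_mulrn ?powR_ge0// -powRrM -powRN; congr (_ `^ _).
  by rewrite natrM; field.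
by split=> //; rewrite powRN H invrK.
Qed.

Lemma bpow_scale t (z : nat -> R -> R) j xi :
  bpow ep4 t z j (ep4 j * sq xi) =
  ep4 j `^ t * (z j (ep4 j * sq xi) * (1 + 4 * pi ^+ 2 * sq xi) `^ t).
Proof.
rewrite /bpow /bsym.
have -> : ep4 j + 4 * pi ^+ 2 * (ep4 j * sq xi) = ep4 j * (1 + 4 * pi ^+ 2 * sq xi) by ring.
rewrite powRM; first by ring.
  by have [] := andP (ep4_01 j).
exact/ltW/base_gt0.
Qed.

Lemma kpack_eq N K (k sy sy' : nat -> V -> R) : (forall j xi, sy j xi = sy' j xi) ->
  kpack N K k sy -> kpack N K k sy'.
Proof. by move=> E [a b c e]; split => // j th xi; rewrite b E. Qed.

Lemma kpack_ysym N (y : nat -> R -> R) (sy : nat -> V -> R) : ysym ep4 y ->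
  (forall j xi, y j (ep4 j * sq xi) = sy j xi) ->
  exists K, 0 <= K /\ exists k, kpack N K k sy.
Proof.
move=> Yy E.
have [] := @kpack_symb R d ep4 ep4_01 N (fun j xi => y j (sq xi)).
- exact: symb_base.
- by move=> j xi; rewrite /sq edotNl edotC edotNl opprK.
move=> K [K0 Kk]; exists K; split => //; eexists; apply: kpack_eq Kk => j xi.
by rewrite sq_dil -E.
Qed.

Lemma intg_bl j : intg (lebesgue_rV R d) (bl j).
Proof.
have Xb := symb_base d (ysym_radial ep4 radial_beta).
have [ms rs _] := @symb_smooth R d ep4 ep4_01 _ Xb.
have h := @intg_dil R d (2 ^+ j)^-1 (fun xi => beta j (sq xi)) _ (rapid_intg (ms j) rs).
by apply: eq_intg (h _) => [xi|]; [rewrite sq_dil|rewrite invr_eq0 exp2_neq0].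
Qed.

Lemma sq_le_wt xi : sq xi <= wt xi ^+ 2.
Proof.
apply: (@le_trans _ _ (l1n xi ^+ 2)); last first.
  by apply: lerXn2r; rewrite ?nnegrE ?l1n_ge0 ?(ltW (wt_gt0 _)) ?l1n_le_wt.
rewrite /sq /edot expr2 {2}/l1n mulr_sumr; apply: ler_sum => i _.
apply: (le_trans (ler_norm _)).
by rewrite absM ler_wpM2r// norm_coord_l1n.
Qed.

Lemma measurable_sq : measurable_fun setT (@sq R d).
Proof. by apply: continuous_measurable_rV; exact: continuous_sq. Qed.

Lemma polyg_mB s : 0 <= s -> polyg (mB s).
Proof.
move=> s0; split.
  apply: (measurableT_comp (f := @powR R ^~ (s / 2))); first exact: measurable_powR.
  apply: measurable_funD => //; apply: measurable_funM => //; exact: measurable_sq.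
pose N := (Num.truncn (s / 2)).+1.
exists (65 ^+ N), (2 * N)%N; split; first exact: exprn_ge0.
move=> xi; have b0 := base_gt0 xi; have sw := sq_le_wt xi; have sq0 := sq_ge0 xi.
have [p1 p2] := pi2_bound; have w1 : 1 <= wt xi ^+ 2 by rewrite exprn_ege1// wt_ge1.
rewrite ger0_norm ?powR_ge0// exprM -exprMn.
apply: (@le_trans _ _ ((1 + 4 * pi ^+ 2 * sq xi) `^ N%:R)).
  apply: ler_powR; first nra.
  by apply: ltW; rewrite truncnS_gt.
rewrite powR_mulrn ?(ltW b0)//.
by apply: lerXn2r; rewrite ?nnegrE; nra.
Qed.

Lemma measurable_bl j : measurable_fun setT (bl j).
Proof. exact: intg_measurable (intg_bl j). Qed.

Lemma polyg_bl j : polyg (bl j).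
Proof.
have [K [K0 HK]] := radial_bounded radial_beta.
apply: (@polyg_bounded R d _ K); first exact: measurable_bl.
move=> xi; apply: HK; rewrite mulr_ge0 ?sq_ge0//.
by have [] := andP (ep4_01 j).
Qed.

Lemma ep4_gt0 j : 0 < ep4 j. Proof. by rewrite invr_gt0 !exprn_gt0. Qed.

Lemma bl_supp j xi : bl j xi != 0 -> ep4 j * sq xi < 4 /\ ((0 < j)%N -> 1 / 4 < ep4 j * sq xi).
Proof.
rewrite /bl /beta; set u := _ * _ => h; split.
  rewrite ltNge; apply/negP => u4; move: h.
  have u16 : 4 <= 4 * u by lra.
  by rewrite (cutoff0 u4) (cutoff0 u16) mulr0 addr0 eqxx.
move=> j0; rewrite ltNge; apply/negP => u4; move: h; rewrite j0.
have u1 : u <= 1 by lra.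
have u2 : 4 * u <= 1 by lra.
by rewrite (cutoff1 u1) (cutoff1 u2) mulr1 subrr eqxx.
Qed.

Lemma ep4D j n : ep4 (j + n) = ep4 j * ep4 n.
Proof. by rewrite /ep4 exprD exprMn invfM. Qed.

Lemma sq_sub_le a b : sq (a - b : V) <= 2 * sq a + 2 * sq b.
Proof.
have E1 : edot (a + b) (a + b) = edot a a + 2 * edot a b + edot b b.
  by rewrite edotDl !(edotC _ (a + b)) !edotDl (edotC b a); ring.
have E2 : edot (a - b) (a - b) = edot a a - 2 * edot a b + edot b b.
  by rewrite edotBl !(edotC _ (a - b)) !edotBl (edotC b a); ring.
have := sq_ge0 (a + b); rewrite /sq E1 E2; lra.
Qed.

Lemma sqN a : sq (- a : V) = sq a.
Proof. by rewrite /sq edotNl edotC edotNl opprK. Qed.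

Lemma sq_add_le a b : sq (a + b : V) <= 2 * sq a + 2 * sq b.
Proof. by have := sq_sub_le a (- b); rewrite opprK sqN. Qed.

Lemma lp_kernels s N : exists K, 0 <= K /\ exists kpsi klam kkap kE,
  [/\ kpack N K kpsi bl,
      kpack N K klam (fun j xi => (2 `^ s) ^+ j * (bl j xi / mB s xi)),
      kpack N K kkap (fun j xi => (2 `^ s) ^- j * (mB s xi * bl j xi)) &
      kpack N K kE (fun j xi => (2 `^ s) ^- j * (mB s xi * chi j (ep4 j * sq xi)))].
Proof.
have dl0 : 0 < 1 / 65 :> R by lra.
have [K1 [K10 [k1 H1]]] := @kpack_ysym N beta bl (ysym_radial ep4 radial_beta) (fun j xi => erefl).
have [||K2 [K20 [k2 H2]]] := @kpack_ysym N (bpow ep4 (- (s / 2)) beta) (fun j xi => (2 `^ s) ^+ j * (bl j xi / mB s xi)).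
- exact: (ysym_pow _ dl0 away_beta radial_beta).
- by move=> j xi; rewrite bpow_scale (ep4_powR s j).2 powRN.
have [||K3 [K30 [k3 H3]]] := @kpack_ysym N (bpow ep4 (s / 2) beta) (fun j xi => (2 `^ s) ^- j * (mB s xi * bl j xi)).
- exact: (ysym_pow _ dl0 away_beta radial_beta).
- by move=> j xi; rewrite bpow_scale (ep4_powR s j).1 [bl j xi * _]mulrC.
have [||K4 [K40 [k4 H4]]] := @kpack_ysym N (bpow ep4 (s / 2) chi)
   (fun j xi => (2 `^ s) ^- j * (mB s xi * chi j (ep4 j * sq xi))).
- exact: (ysym_pow _ dl0 away_chi radial_chi).
- by move=> j xi; rewrite bpow_scale (ep4_powR s j).1 [chi _ _ * _]mulrC.
exists (K1 + K2 + K3 + K4); split; first by rewrite !addr_ge0.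
exists k1, k2, k3, k4; split.
- by apply: kpack_le H1; lra.
- by apply: kpack_le H2; lra.
- by apply: kpack_le H3; lra.
- by apply: kpack_le H4; lra.
Qed.

(** For s = 2M the power is a polynomial in u, so it is smooth through the origin and may be cut off
    by a ball instead of an annulus. One kernel then handles all output frequencies below 2^j, with
    no decomposition of the output. *)
Lemma lp_kernel_even M N : let s := (2 * M)%:R in
  exists K, 0 <= K /\ exists k,
  kpack N K k (fun j xi => (2 `^ s) ^- j * (mB s xi * cutoff ((2 ^+ 5) ^- 2 * (ep4 j * sq xi)))).
Proof.
move=> s.
pose c0 : R := (2 ^+ 5) ^- 2.
have c00 : 0 < c0 by rewrite /c0; lra.
have Y : forall m, radial (fun j u => bsym ep4 j u ^+ m * cutoff (c0 * u)).
  elim=> [|m ih].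
    rewrite (_ : (fun _ => _) = fun _ u => cutoff (c0 * u)); first exact: radial_cutoff.
    by apply/funext => j; apply/funext => u; rewrite expr0 mul1r.
  rewrite (_ : (fun _ => _) = fun j u => ep4 j * (bsym ep4 j u ^+ m * cutoff (c0 * u)) +
     4 * pi ^+ 2 * (u * (bsym ep4 j u ^+ m * cutoff (c0 * u)))); last first.
    by apply/funext => j; apply/funext => u; rewrite exprS {1}/bsym; ring.
  apply: radialD.
    apply: (radialZ (c := ep4) (K := 1)) => // j.
    by have /andP[h1 h2] := ep4_01 j; rewrite ger0_norm.
  by apply: (radialZ (c := fun=> 4 * pi ^+ 2) (K := `|4 * pi ^+ 2|)) => //; exact: radialM.
apply: kpack_ysym (ysym_radial ep4 (Y M)) _ => j xi.
have b0 := base_gt0 xi.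
have -> : bsym ep4 j (ep4 j * sq xi) = ep4 j * (1 + 4 * pi ^+ 2 * sq xi) by rewrite /bsym; ring.
have sM : s / 2 = M%:R by rewrite /s natrM mulrC mulKf.
have [e0 _] := andP (ep4_01 j).
rewrite exprMn -(ep4_powR s j).1 /mB sM !powR_mulrn ?(ltW b0)//.
by rewrite /c0 -[LHS]mulrA; congr (_ * (_ * cutoff _)).
Qed.

End lp_symbols.

(** * The pointwise Leibniz estimate *)

Section conv_estimates.
Variables (R : realType) (d : nat).
Local Notation V := 'rV[R]_d.
Local Notation mu := (lebesgue_rV R d).
Implicit Types (f g h k : V -> R) (x y z : V) (la : R).

Definition BM h := measurable_fun setT h /\ exists B, forall x, `|h x| <= B.

Lemma BM_bound h : BM h -> exists B, 0 <= B /\ forall x, `|h x| <= B.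
Proof. by move=> [_ [B hB]]; exists B; split => //; exact: le_trans (hB 0). Qed.

Lemma BM_norm h : BM h -> BM (fun x => `|h x|).
Proof.
move=> [mh [B hB]]; split; first exact: measurableT_comp.
by exists B => x; rewrite normr_id.
Qed.

Lemma BM_M h g : BM h -> BM g -> BM (fun x => h x * g x).
Proof.
move=> bh bg; split; first by apply: measurable_funM; [case: bh|case: bg].
have [B [B0 hB]] := BM_bound bh; have [B' [B0' hB']] := BM_bound bg.
by exists (B * B') => x; rewrite absM ler_pM.
Qed.

Lemma BM_sub h x : BM h -> BM (fun y => h (x - y)).
Proof. by move=> [mh [B hB]]; split; [exact: measurable_comp_sub|exists B]. Qed.

Lemma BM_nice f : nice f -> BM f.
Proof.
move=> nf; split; first exact: nice_measurable.
by have [B [_ H]] := nice_bounded nf; exists B.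
Qed.

Lemma BM_mult m f : polyg m -> nice f -> BM (mult m f).
Proof.
move=> pm nf; split; first exact: measurable_mult.
by have [B [_ H]] := mult_bounded pm nf; exists B.
Qed.

Lemma intgM_BM k h : intg mu k -> BM h -> intg mu (fun y => k y * h y).
Proof. by move=> ki [mh [B hB]]; exact: (intgM ki mh hB). Qed.

Lemma intg_conv k h x : intg mu k -> BM h -> intg mu (fun y => k y * h (x - y)).
Proof. by move=> ki bh; apply: intgM_BM ki _; exact: BM_sub. Qed.

Lemma conv_bound k h B x : intg mu k -> BM h -> (forall y, `|h y| <= B) ->
  `|conv k h x| <= \int[mu]_y `|k y| * B.
Proof.
move=> ki bh hB; rewrite /conv -RintZr; last exact: intg_norm.
apply: le_norm_Rint; first exact: intg_conv.
  apply: (eq_intg _ (intgZ B (intg_norm ki))) => y; exact: mulrC.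
by move=> y; rewrite absM ler_wpM2l.
Qed.

Lemma BM_conv k h : intg mu k -> BM h -> BM (conv k h).
Proof.
move=> ki bh; have [mh [B hB]] := bh; split; last first.
  by exists (\int[mu]_y `|k y| * B) => x; exact: conv_bound.
apply: (@measurable_Rint _ _ _ _ R mu (fun z : V * V => k z.2 * h (z.1 - z.2))).
  apply: measurable_funM; last exact: measurable_comp_sub2.
  by apply: (measurableT_comp (intg_measurable ki)); exact: measurable_snd.
by move=> x; exact: intg_conv.
Qed.

Lemma conv_shift k h x y : intg mu k -> BM h ->
  conv k h (x - y) = \int[mu]_z (k (z - y) * h (x - z)).
Proof.
move=> ki bh; rewrite /conv.
rewrite -(Rint_shift (- y) (intg_conv (x - y) ki bh)).
by apply: eq_Rint => z; congr (_ * h _); rewrite opprB addrA subrK.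
Qed.

Lemma wk_leN N M la z : 0 < la -> (M <= N)%N -> wk N la z <= wk M la z.
Proof. by move=> la0 MN; rewrite ler_wpM2l ?wtV_le// exprn_ge0// ltW. Qed.

Lemma intg_wk N la : 0 < la -> (2 <= N)%N -> intg mu (wk N la).
Proof.
move=> la0 N2; apply: intgZ; apply: (intg_dil (f := fun x => wt x ^- N)).
  by rewrite gt_eqF.
exact: intg_wt.
Qed.

Definition I2 : R := \int[mu]_z wt z ^- 2.

Lemma I2_ge0 : 0 <= I2. Proof. by apply: ge0_Rint => z; exact: wtV_ge0. Qed.

Lemma Rint_wk N la : 0 < la -> (2 <= N)%N -> \int[mu]_z wk N la z <= I2.
Proof.
move=> la0 N2; have la0' : la != 0 by rewrite gt_eqF.
apply: (@le_trans _ _ (\int[mu]_z wk 2 la z)).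
  by apply: le_Rint; [exact: intg_wk|exact: intg_wk|move=> z; exact: wk_leN].
rewrite /wk RintZ; last exact: (intg_dil (f := fun x => wt x ^- 2) la0' (intg_wt2 R d)).
rewrite (Rint_dil la0' (intg_wt2 R d)) gtr0_norm// mulrA divff ?mul1r//.
by rewrite expf_neq0.
Qed.

Lemma wk_sub N la z y : 0 < la -> wk N la (z - y) <= wt (la *: y) ^+ N * wk N la z.
Proof.
move=> la0; rewrite /wk mulrCA ler_wpM2l ?exprn_ge0 ?(ltW la0)//.
apply: wtV_mono; first exact: wt_gt0.
by have := wtD (la *: (z - y)) (la *: y); rewrite -scalerDr subrK mulrC.
Qed.

(** A Peetre-type bound: since [wt] is submultiplicative, moving the centre from x to x - y costs
    only [wt (la *: y) ^+ N]. *)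
Lemma conv_peetre k h K N la x y : 0 < la -> (2 <= N)%N -> 0 <= K -> intg mu k ->
  (forall z, `|k z| <= K * wk N la z) -> BM h ->
  `|conv k h (x - y)| <= K * wt (la *: y) ^+ N * conv (wk N la) (fun z => `|h z|) x.
Proof.
move=> la0 N2 K0 ki kK bh; have iW : intg mu (fun z => wk N la z * `|h (x - z)|) := intg_conv x (intg_wk la0 N2) (BM_norm bh).
rewrite (conv_shift x y ki bh) -(RintZ _ iW).
apply: le_norm_Rint.
- apply: intgM_BM; last exact: BM_sub.
  exact: (intg_shift (- y) ki).
- exact: intgZ.
- move=> z; rewrite absM mulrA ler_wpM2r//.
  by apply: (le_trans (kK _)); rewrite -mulrA ler_wpM2l// wk_sub.
Qed.

Lemma conv_lip k h K N la x y : 0 < la -> (2 <= N)%N -> 0 <= K -> intg mu k ->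
  (forall z u, `|k (z + u) - k z| <= K * l1n (la *: u) * wt (la *: u) ^+ N * wk N la z) ->
  BM h ->
  `|conv k h (x - y) - conv k h x| <=
    K * l1n (la *: y) * wt (la *: y) ^+ N * conv (wk N la) (fun z => `|h z|) x.
Proof.
move=> la0 N2 K0 ki kK bh; have iW : intg mu (fun z => wk N la z * `|h (x - z)|) := intg_conv x (intg_wk la0 N2) (BM_norm bh).
rewrite (conv_shift x y ki bh) /conv -RintB; last 2 first.
- apply: intgM_BM; last exact: BM_sub.
  exact: (intg_shift (- y) ki).
- exact: intg_conv.
rewrite -(RintZ _ iW).
apply: le_norm_Rint.
- apply: intgB; last exact: intg_conv.
  apply: intgM_BM; last exact: BM_sub.
  exact: (intg_shift (- y) ki).
- exact: intgZ.
- move=> z; rewrite -mulrBl absM mulrA ler_wpM2r//.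
  by have := kK z (- y); rewrite scalerN wtN /l1n; under eq_bigr do rewrite mxE normrN.
Qed.

Lemma convB k h1 h2 x : intg mu k -> BM h1 -> BM h2 ->
  conv k (fun y => h1 y - h2 y) x = conv k h1 x - conv k h2 x.
Proof.
move=> ki b1 b2; rewrite /conv -RintB; [|exact: intg_conv..].
by apply: eq_Rint => y; rewrite mulrBr.
Qed.

Lemma BM0 : BM (fun _ => 0).
Proof. by split => //; exists 0 => x; rewrite normr0. Qed.

Lemma BMD h g : BM h -> BM g -> BM (fun x => h x + g x).
Proof.
move=> [m1 [B1 H1]] [m2 [B2 H2]]; split; first exact: measurable_funD.
by exists (B1 + B2) => x; apply normD_le.
Qed.

Lemma BM_sum (I : Type) (s : seq I) (F : I -> V -> R) : (forall i, BM (F i)) ->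
  BM (fun x => \sum_(i <- s) F i x).
Proof.
move=> bF; elim: s => [|i s ih].
  by under eq_fun do rewrite big_nil; exact: BM0.
by under eq_fun do rewrite big_cons; exact: BMD.
Qed.

Lemma conv_sumr (I : Type) (s : seq I) k (F : I -> V -> R) x : intg mu k ->
  (forall i, BM (F i)) ->
  conv k (fun y => \sum_(i <- s) F i y) x = \sum_(i <- s) conv k (F i) x.
Proof.
move=> ki bF; rewrite /conv -Rint_sum; last by move=> i; exact: intg_conv.
by apply: eq_Rint => y; rewrite mulr_sumr.
Qed.

Lemma conv_suml (I : Type) (s : seq I) (k : I -> V -> R) h x :
  (forall i, intg mu (k i)) -> BM h ->
  conv (fun y => \sum_(i <- s) k i y) h x = \sum_(i <- s) conv (k i) h x.
Proof.
move=> ki bh; rewrite /conv -Rint_sum; last by move=> i; exact: intg_conv.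
by apply: eq_Rint => y; rewrite mulr_suml.
Qed.

Lemma convZl c k h x : intg mu k -> BM h -> conv (fun y => c * k y) h x = c * conv k h x.
Proof.
move=> ki bh; rewrite /conv -RintZ; last exact: intg_conv.
by apply: eq_Rint => y; rewrite mulrA.
Qed.

Lemma conv_conv k l h x : intg mu k -> intg mu l -> BM h ->
  conv k (conv l h) x = \int[mu]_z (l z * conv k h (x - z)).
Proof.
move=> ki li bh; have [mh [B hB]] := bh.
transitivity (\int[mu]_y \int[mu]_z (k y * (l z * h (x - y - z)))).
  by apply: eq_Rint => y; rewrite RintZ//; exact: intg_conv.
rewrite (@RFubini_dom _ _ _ _ R mu mu (fun p : V * V => k p.1 * (l p.2 * h (x - p.1 - p.2)))
  (fun y => B * `|k y|) (fun z => `|l z|)); first last.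
- by move=> y z /=; rewrite !absM (mulrC B) -[leRHS]mulrA [B * _]mulrC ler_wpM2l// ler_wpM2l.
- exact: intg_norm.
- by apply: intgZ; exact: intg_norm.
- apply: measurable_funM; first exact: (measurableT_comp (intg_measurable ki) measurable_fst).
  apply: measurable_funM; first exact: (measurableT_comp (intg_measurable li) measurable_snd).
  apply: (measurableT_comp (f := fun p : V * V => h (p.1 - p.2)) _ (g := fun p : V * V => (x - p.1, p.2))).
    exact: measurable_comp_sub2.
  apply/measurable_fun_pair => /=; last exact: measurable_snd.
  apply: (measurableT_comp (f := fun y : V => x - y)); last exact: measurable_fst.
  exact: measurable_rV_sub.
apply: eq_Rint => z /=; rewrite -RintZ; last exact: intg_conv.
by apply: eq_Rint => y; rewrite mulrCA addrAC.
Qed.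

End conv_estimates.

Section sym_linear.
Variables (R : realType) (d : nat).
Local Notation V := 'rV[R]_d.
Local Notation mu := (lebesgue_rV R d).
Implicit Types (k l s t : V -> R).

Lemma is_symZ c k s : intg mu k -> is_sym k s -> is_sym (fun y => c * k y) (fun xi => c * s xi).
Proof. by move=> ki ks th xi; rewrite TrZ// ks mulrCA. Qed.

Lemma is_symD k l s t : intg mu k -> intg mu l -> is_sym k s -> is_sym l t ->
  is_sym (fun y => k y + l y) (fun xi => s xi + t xi).
Proof.
move=> ki li ks lt th xi; rewrite (@Tr_Dsum _ _ unit (fun _ => k) (fun _ => l) tt)//.
by rewrite ks lt mulrDr.
Qed.

Lemma is_sym0 : @is_sym R d (fun _ => 0) (fun _ => 0).
Proof.
move=> th xi; rewrite mulr0; have E := @TrZ R d (fun x => wt x ^- 2) 0 th xi (intg_wt2 R d).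
rewrite mul0r in E; apply: etrans E; apply: eq_Rint => y; by rewrite !mul0r.
Qed.

Lemma is_sym_sum (I : Type) (r : seq I) (k s : I -> V -> R) :
  (forall i, intg mu (k i)) -> (forall i, is_sym (k i) (s i)) ->
  is_sym (fun y => \sum_(i <- r) k i y) (fun xi => \sum_(i <- r) s i xi).
Proof.
move=> ki ks; elim: r => [|i r ih].
  have -> : (fun y => \sum_(i <- [::]) k i y) = fun=> 0 by apply/funext => y; rewrite big_nil.
  have -> : (fun y => \sum_(i <- [::]) s i y) = fun=> 0 by apply/funext => y; rewrite big_nil.
  exact: is_sym0.
have -> : (fun y => \sum_(j <- i :: r) k j y) = fun y => k i y + \sum_(j <- r) k j y.
  by apply/funext => y; rewrite big_cons.
have -> : (fun y => \sum_(j <- i :: r) s j y) = fun y => s i y + \sum_(j <- r) s j y.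
  by apply/funext => y; rewrite big_cons.
by apply: is_symD => //; exact: intg_sum.
Qed.

Lemma multZl c m (f : V -> R) x : polyg m -> nice f ->
  mult (fun xi => c * m xi) f x = c * mult m f x.
Proof.
move=> pm nf; rewrite /mult -RintZ; last exact: intg_mult.
by apply: eq_Rint => xi; rewrite mulrA.
Qed.

Lemma eq_mult m m' (f : V -> R) x : m =1 m' -> mult m f x = mult m' f x.
Proof. by move=> mm; apply: eq_Rint => xi; rewrite mm. Qed.

Lemma polygM m m' : polyg m -> polyg m' -> @polyg R d (fun xi => m xi * m' xi).
Proof.
move=> [mm [K [N [K0 H]]]] [mm' [K' [N' [K0' H']]]]; split; first exact: measurable_funM.
exists (K * K'), (N + N')%N; split; first exact: mulr_ge0.
by move=> xi; rewrite absM exprD mulrACA ler_pM.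
Qed.

Lemma is_sym_eq k s t : s =1 t -> is_sym k s -> is_sym k t.
Proof. by move=> st ks th xi; rewrite ks st. Qed.

Lemma BM_mult1 (a f : V -> R) : intg mu a -> intg mu f -> BM (mult a f).
Proof.
move=> ai fi; split; first exact: measurable_mult1.
by eexists => x; exact: mult1_bounded.
Qed.

(** [conv_prod_vanish] for k - l: a kernel may be exchanged for another whose symbol agrees on the
    frequencies that the product can contain. *)
Lemma conv_sym_eq k l s t (a b f g : V -> R) x : intg mu k -> intg mu l ->
  is_sym k s -> is_sym l t ->
  intg mu a -> intg mu b -> intg mu f -> intg mu g ->
  (forall xi eta, a xi != 0 -> b eta != 0 ->
     s (xi + eta) = t (xi + eta) /\ s (xi - eta) = t (xi - eta)) ->
  conv k (fun y => mult a f y * mult b g y) x = conv l (fun y => mult a f y * mult b g y) x.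
Proof.
move=> ki li ks lt ai bi fi gi st.
have il : intg mu (fun y => -1 * l y) by exact: intgZ.
have bh : BM (fun y => mult a f y * mult b g y) by apply: BM_M; exact: BM_mult1.
have := @conv_prod_vanish R d _ _ a b f g x (intgD ki il)
  (is_symD ki il ks (is_symZ (-1) li lt)) ai bi fi gi.
rewrite /conv => H.
have {}H : \int[mu]_y ((k y + -1 * l y) * (mult a f (x - y) * mult b g (x - y))) = 0.
  apply: H => xi eta a0 b0; have [-> ->] := st xi eta a0 b0.
  by split; rewrite mulN1r subrr.
apply/eqP; rewrite -subr_eq0; apply/eqP; rewrite -[RHS]H -RintB.
- by apply: eq_Rint => y; rewrite mulrDl mulN1r mulNr.
- exact: (intg_conv x ki bh).
- exact: (intg_conv x li bh).
Qed.

End sym_linear.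

(** * Blocks of f and g, and products of distant frequencies *)

Section pieces.
Variables (R : realType) (d : nat) (s : R).
Hypothesis s0 : 0 < s.
Local Notation V := 'rV[R]_d.
Local Notation mu := (lebesgue_rV R d).
Local Notation Q := (2 `^ s).
Local Notation D := (mult (@mB R d s)).
Implicit Types (f g h : V -> R) (x y xi eta : V) (j k n i : nat).
Variables (K : R) (kpsi klam kkap kE : nat -> V -> R).
Hypothesis K0 : 0 <= K.
Hypothesis Hpsi : kpack 8 K kpsi (@bl R d).
Hypothesis Hlam : kpack 8 K klam (fun j xi => Q ^+ j * (bl j xi / mB s xi)).
Hypothesis Hkap : kpack 8 K kkap (fun j xi => Q ^- j * (mB s xi * bl j xi)).
Hypothesis HE : kpack 8 K kE (fun j xi => Q ^- j * (mB s xi * chi j (ep4 R j * sq xi))).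

Local Notation la j := ((2 : R) ^+ j).
Let la0 j : 0 < la j. Proof. exact: exprn_gt0. Qed.
Let Q0 : 0 < Q. Proof. exact: powR_gt0. Qed.
Let Qj0 j : 0 < Q ^+ j. Proof. exact: exprn_gt0. Qed.
Let Qjn j : Q ^+ j != 0. Proof. by rewrite gt_eqF. Qed.
Let pm : polyg (@mB R d s). Proof. by apply: polyg_mB; exact: ltW. Qed.
Let ipsi j : intg mu (kpsi j). Proof. by case: Hpsi. Qed.
Let ilam j : intg mu (klam j). Proof. by case: Hlam. Qed.
Let ikap j : intg mu (kkap j). Proof. by case: Hkap. Qed.
Let iE j : intg mu (kE j). Proof. by case: HE. Qed.

Lemma psi_mult f j x : nice f -> conv (kpsi j) f x = mult (bl j) f x.
Proof. by move=> nf; apply: conv_nice => //; case: Hpsi. Qed.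

Lemma psi_lam f j x : nice f -> conv (kpsi j) f x = Q ^- j * conv (klam j) (D f) x.
Proof.
move=> nf; have [_ sl _ _] := Hlam.
rewrite psi_mult// (conv_mult x (ilam j) (sl j) pm nf).
transitivity (Q ^- j * mult (fun xi => Q ^+ j * bl j xi) f x).
  by rewrite (multZl _ _ (@polyg_bl R d j) nf) mulKf.
congr (_ * _); apply: eq_mult => xi.
by rewrite -mulrA divfK// gt_eqF// mB_gt0.
Qed.

Lemma kap_psi f j x : nice f -> conv (kkap j) f x = Q ^- j * conv (kpsi j) (D f) x.
Proof.
move=> nf; have [_ sk _ _] := Hkap; have [_ sp _ _] := Hpsi.
rewrite (conv_nice x (ikap j) (sk j) nf) (conv_mult x (ipsi j) (sp j) pm nf).
rewrite (@multZl _ _ _ (fun xi => mB s xi * bl j xi)); last exact: nf.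
  by congr (_ * _); apply: eq_mult => xi; rewrite mulrC.
exact: polygM pm (@polyg_bl R d j).
Qed.

(** A bound c for the maximal function of h at the single point x. With numbers in place of maximal
    functions, the pointwise estimate needs neither their measurability nor their finiteness. *)
Definition wsup h x c := forall j, conv (wk 2 (la j)) (fun z => `|h z|) x <= c.

(** The size of the block j of f: at most c by averaging f, and at most Q^-j a by writing it as a
    kernel applied to D f. *)
Definition Fm (c a : R) j := Num.min c (Q ^- j * a).

Lemma wsup_ge0 h x c : BM h -> wsup h x c -> 0 <= c.
Proof.
move=> bh /(_ 0%N); apply: le_trans; apply: ge0_Rint => y.
by rewrite mulr_ge0// wk_ge0// ltW.
Qed.

Lemma kpack_wk2 (k : nat -> V -> R) sy j z : kpack 8 K k sy -> `|k j z| <= K * wk 2 (la j) z.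
Proof.
move=> [_ _ H _]; apply: (le_trans (H j z)); rewrite ler_wpM2l//.
exact: wk_leN.
Qed.

Lemma kpack_peetre (k : nat -> V -> R) sy h x c j y : kpack 8 K k sy -> BM h -> wsup h x c ->
  `|conv (k j) h (x - y)| <= K * wt (la j *: y) ^+ 2 * c.
Proof.
move=> Hk bh hc; have [ki _ _ _] := Hk.
apply: (le_trans (conv_peetre x y (la0 j) (leqnn 2) K0 (ki j) (fun z => kpack_wk2 j z Hk) bh)).
by apply: ler_wpM2l (hc j); apply: mulr_ge0 => //; exact/exprn_ge0/ltW/wt_gt0.
Qed.

Lemma kpack_lip (k : nat -> V -> R) sy h x c j y : kpack 8 K k sy -> BM h -> wsup h x c ->
  `|conv (k j) h (x - y) - conv (k j) h x| <=
     K * l1n (la j *: y) * wt (la j *: y) ^+ 2 * c.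
Proof.
move=> Hk bh hc; have [ki _ _ kl] := Hk.
apply: (le_trans (conv_lip x y (la0 j) (leqnn 2) K0 (ki j) (kl j) bh)).
apply: ler_wpM2l (hc j); apply: mulr_ge0; last exact/exprn_ge0/ltW/wt_gt0.
by apply: mulr_ge0 => //; exact: l1n_ge0.
Qed.

Let minE (A c a : R) j X : 0 <= A -> X <= A * c -> X <= Q ^- j * (A * a) -> X <= A * Fm c a j.
Proof.
move=> A0 h1 h2; rewrite /Fm; case: (leP c (Q ^- j * a)) => _ //.
by rewrite mulrCA.
Qed.

Section at_point.
Variables (f g : V -> R) (x : V) (c a b e : R).
Hypothesis nf : nice f.
Hypothesis ng : nice g.
Hypothesis hfc : wsup f x c.
Hypothesis hfa : wsup (D f) x a.
Hypothesis hgb : wsup g x b.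
Hypothesis hge : wsup (D g) x e.

Let bf := BM_nice nf.
Let bDf := BM_mult pm nf.

Lemma piece_peetre j y :
  `|conv (kpsi j) f (x - y)| <= K * wt (la j *: y) ^+ 2 * Fm c a j.
Proof.
apply: minE.
- by apply: mulr_ge0 => //; exact/exprn_ge0/ltW/wt_gt0.
- exact: kpack_peetre Hpsi bf hfc.
- rewrite psi_lam// absM ger0_norm// ler_wpM2l//.
  exact: kpack_peetre Hlam bDf hfa.
Qed.

Lemma piece_lip j y :
  `|conv (kpsi j) f (x - y) - conv (kpsi j) f x| <=
    K * l1n (la j *: y) * wt (la j *: y) ^+ 2 * Fm c a j.
Proof.
apply: minE.
- apply: mulr_ge0; last exact/exprn_ge0/ltW/wt_gt0.
  by apply: mulr_ge0 => //; exact: l1n_ge0.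
- exact: kpack_lip Hpsi bf hfc.
- rewrite !psi_lam// -mulrBr absM ger0_norm// ler_wpM2l//.
  exact: kpack_lip Hlam bDf hfa.
Qed.

Lemma piece0 j : `|conv (kpsi j) f x| <= K * Fm c a j.
Proof. by have := piece_peetre j 0; rewrite subr0 scaler0 wt0 expr1n mulr1. Qed.

Lemma piece_kap j : `|conv (kkap j) f x| <= K * Fm c a j.
Proof.
apply: minE => //.
- by have := kpack_peetre j 0 Hkap bf hfc; rewrite subr0 scaler0 wt0 expr1n mulr1.
- rewrite kap_psi// absM ger0_norm// ler_wpM2l//.
  by have := kpack_peetre j 0 Hpsi bDf hfa; rewrite subr0 scaler0 wt0 expr1n mulr1.
Qed.

Lemma Fm_ge0 j : 0 <= Fm c a j.
Proof.
have c0 := wsup_ge0 bf hfc; have a0 := wsup_ge0 bDf hfa.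
by rewrite le_min c0 mulr_ge0.
Qed.

End at_point.
(** An integrable kernel for D restricted to frequencies up to about 2^n. It stands in for D, which
    has no integrable kernel. *)
Definition tau n y : R := \sum_(i < n.+1) Q ^+ i * kkap i y.

Lemma intg_tau n : intg mu (tau n).
Proof. by apply: intg_sum => i; exact: intgZ. Qed.

Lemma sym_tau n : is_sym (tau n) (fun xi => mB s xi * Phi n xi).
Proof.
have [_ sk _ _] := Hkap.
have H := @is_sym_sum R d _ (index_enum 'I_n.+1) (fun (i : 'I_n.+1) y => Q ^+ i * kkap i y)
   (fun (i : 'I_n.+1) xi => Q ^+ i * (Q ^- i * (mB s xi * bl i xi)))
   (fun i : 'I_n.+1 => intgZ _ (ikap i)) (fun i : 'I_n.+1 => is_symZ _ (ikap i) (sk i)).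
apply: is_sym_eq H => xi.
rewrite -sum_bl mulr_sumr; apply: eq_bigr => i _.
by rewrite mulrA divff ?mul1r.
Qed.

Lemma tau_conv n h x : BM h -> conv (tau n) h x = \sum_(i < n.+1) Q ^+ i * conv (kkap i) h x.
Proof.
move=> bh; rewrite /tau (conv_suml _ _ (fun i : 'I_n.+1 => intgZ _ (ikap i)) bh).
by apply: eq_bigr => i _; rewrite convZl.
Qed.

Let psi_multE f j : nice f -> conv (kpsi j) f = mult (bl j) f.
Proof. by move=> nf; apply/funext => y; exact: psi_mult. Qed.

Lemma Phi1 n xi : ep4 R n * sq xi <= 1 -> Phi n xi = 1.
Proof. exact: cutoff1. Qed.

Let ep4_le i j : (i <= j)%N -> ep4 R j <= ep4 R i.
Proof.
move=> /subnKC <-; rewrite ep4D ler_piMr ?(ltW (ep4_gt0 _ _))//.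
by have [] := andP (@ep4_01 R (j - i)).
Qed.

Let ep4_2 : ep4 R 2 = 1 / 16. Proof. by rewrite /ep4 -exprM -natrX div1r. Qed.
Let ep4_4 : ep4 R 4 = 1 / 256. Proof. by rewrite /ep4 -exprM -natrX div1r. Qed.

Let chi1 j u : (0 < j)%N -> 1 / 16 <= u -> u <= 16 -> chi j u = 1 :> R.
Proof.
move=> j0 u1 u2; rewrite /chi j0 cutoff1; last lra.
by rewrite cutoff0; [rewrite mulr0 addr0 mulr1|lra].
Qed.

Lemma E_piece j f x : nice f -> (0 < j)%N ->
  conv (kE j) (conv (kpsi j) f) x = conv (kkap j) f x.
Proof.
move=> nf j0; have [_ sk _ _] := Hkap; have [_ sE _ _] := HE.
rewrite psi_multE// (conv_mult x (iE j) (sE j) (@polyg_bl R d j) nf).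
rewrite (conv_nice x (ikap j) (sk j) nf); apply: eq_mult => xi.
have [->|/bl_supp[b1 /(_ j0) b2]] := eqVneq (bl j xi) 0; first by rewrite !mulr0.
rewrite chi1//; [by rewrite mulr1 mulrA|lra|lra].
Qed.

(** For frequencies xi in the block j and eta at least four octaves lower, xi +- eta satisfies 1/16
    <= 4^-j |xi +- eta|^2 <= 16, where [chi j] is 1; two more octaves make [Phi n] equal to 1
    there. *)
Lemma tau_kE n j k f g x : nice f -> nice g -> (k + 4 <= j)%N -> (j + 2 <= n)%N ->
  conv (tau n) (fun y => conv (kpsi j) f y * conv (kpsi k) g y) x =
  Q ^+ j * conv (kE j) (fun y => conv (kpsi j) f y * conv (kpsi k) g y) x.
Proof.
move=> nf ng kj jn; have [_ sE _ _] := HE.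
have j0 : (0 < j)%N by apply: leq_trans kj; rewrite addn4.
rewrite !psi_multE// -convZl//; last first.
  by apply: BM_M; apply: BM_mult => //; exact: polyg_bl.
apply: (conv_sym_eq x (intg_tau n) (intgZ _ (iE j)) (@sym_tau n) (is_symZ _ (iE j) (sE j)));
  rewrite ?(nice_intg nf) ?(nice_intg ng)//; try exact: intg_bl; try exact: nice_intg.
move=> xi eta /bl_supp[x1 /(_ j0) x2] /bl_supp[y1 _].
have ejk : ep4 R j * sq eta < 1 / 64.
  have := ep4_le kj; rewrite ep4D ep4_4; have := sq_ge0 eta; nra.
have ejn : ep4 R n <= ep4 R j / 16.
  by have := ep4_le jn; rewrite ep4D ep4_2; lra.
have ej0 := ep4_gt0 R j.
have H (z : V) : ep4 R j * sq z <= 16 -> 1 / 16 <= ep4 R j * sq z ->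
   mB s z * Phi n z = Q ^+ j * (Q ^- j * (mB s z * chi j (ep4 R j * sq z))).
  move=> z1 z2; have -> : Phi n z = 1 by apply: Phi1; have := sq_ge0 z; nra.
  by rewrite chi1// !mulr1 mulrA divff ?mul1r.
have U (z : V) : sq z <= 2 * sq xi + 2 * sq eta -> sq xi <= 2 * sq z + 2 * sq eta ->
    mB s z * Phi n z = Q ^+ j * (Q ^- j * (mB s z * chi j (ep4 R j * sq z))).
  by move=> z1 z2; apply: H; nra.
split; apply: U.
- exact: sq_add_le.
- by rewrite -{1}(addrK eta xi); exact: sq_sub_le.
- exact: sq_sub_le.
- by rewrite -{1}(subrK eta xi); exact: sq_add_le.
Qed.

Lemma wt_dil_mono (u v : R) y : 0 <= u -> u <= v -> wt (u *: y) <= wt (v *: y).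
Proof.
move=> u0 uv; apply: ler_prod => i _; rewrite addr_ge0//= lerD2l !mxE !absM ler_wpM2r//.
by rewrite !ger0_norm// (le_trans u0).
Qed.

Lemma la_le i j : (i <= j)%N -> la i <= la j.
Proof. by move=> ij; rewrite ler_eXn2l// ltr1n. Qed.

Section offdiagonal.
Variables (f g : V -> R) (x : V) (c a b e : R).
Hypothesis nf : nice f.
Hypothesis ng : nice g.
Hypothesis hfc : wsup f x c.
Hypothesis hfa : wsup (D f) x a.
Hypothesis hgb : wsup g x b.
Hypothesis hge : wsup (D g) x e.
Local Notation fj j := (conv (kpsi j) f).
Local Notation gk k := (conv (kpsi k) g).
Local Notation F j := (Fm c a j).
Local Notation G k := (Fm b e k).

Let bfj j : BM (fj j). Proof. by apply: BM_conv => //; exact: BM_nice. Qed.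
Let bgk k : BM (gk k). Proof. by apply: BM_conv => //; exact: BM_nice. Qed.
Let F0 j : 0 <= F j. Proof. exact: (Fm_ge0 nf hfc hfa). Qed.
Let G0 j : 0 <= G j. Proof. exact: (Fm_ge0 ng hgb hge). Qed.

(** The difference is an integral of kE(y) f_j(x - y) (g_k(x - y) - g_k(x)). The kernel lives at
    length 2^-j, where g_k varies by a fraction 2^(k-j) of its size. *)
Lemma commutator_bound j k : (k <= j)%N ->
  `|conv (kE j) (fun y => fj j y * gk k y) x - gk k x * conv (kE j) (fj j) x| <=
  K ^+ 3 * I2 R d * (la k / la j) * (F j * G k).
Proof.
move=> kj; have r0 : 0 <= la k / la j by rewrite divr_ge0 ?ltW.
have i1 := intg_conv x (iE j) (BM_M (bfj j) (bgk k)).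
have i2 := intgZ (gk k x) (intg_conv x (iE j) (bfj j)).
rewrite /conv -[X in _ - X]RintZ; last exact: (intg_conv x (iE j) (bfj j)).
rewrite -RintB//.
apply: (@le_trans _ _ (\int[mu]_y (K ^+ 3 * (la k / la j) * (F j * G k) * wk 2 (la j) y))).
  apply: le_norm_Rint; first exact: intgB.
    by apply: intgZ; exact: intg_wk.
  move=> y; have [_ _ kE8 _] := HE.
  have h1 := kE8 j y; have h2 := piece_peetre nf hfc hfa j y.
  have h3 := piece_lip ng hgb hge k y.
  have wl : wt (la k *: y) <= wt (la j *: y) by apply: wt_dil_mono; [exact: ltW|exact: la_le].
  have ll : l1n (la k *: y) <= la k / la j * wt (la j *: y).
    have -> : la k *: y = (la k / la j) *: (la j *: y).
      by rewrite scalerA divfK// gt_eqF.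
    by rewrite l1nZ (ger0_norm r0) ler_wpM2l// l1n_le_wt.
  rewrite (_ : _ - _ = kE j y * (fj j (x - y) * (gk k (x - y) - gk k x))); last by rewrite /conv; ring.
  set W := wt (la j *: y) in h2 wl ll *; have W1 : 1 <= W by exact: wt_ge1.
  have h3' : `|gk k (x - y) - gk k x| <= K * (la k / la j) * W ^+ 3 * G k.
    apply: (le_trans h3); apply: ler_wpM2r => //.
    rewrite (_ : K * (la k / la j) * W ^+ 3 = K * (la k / la j * W) * W ^+ 2); last by ring.
    apply: ler_pM; [|exact/exprn_ge0/ltW/wt_gt0|by apply: ler_wpM2l|].
      by apply: mulr_ge0 => //; exact: l1n_ge0.
    by apply: lerXn2r => //; rewrite nnegrE ltW// wt_gt0.
  rewrite !absM; apply: (le_trans (ler_pM _ _ h1 (ler_pM _ _ h2 h3'))) => //.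
  rewrite /wk -/W; set P := la j ^+ d; set r := la k / la j; set z := (W ^+ 8)^-1.
  have P0 : 0 <= P by rewrite exprn_ge0// ltW.
  rewrite [leLHS](_ : _ = K ^+ 3 * r * (F j * G k) * (P * (W ^+ 5 * z))); last by ring.
  apply: ler_wpM2l; first by rewrite !mulr_ge0// exprn_ge0.
  (* The factors W^2 from f_j and W^3 from the increment of g_k are taken from the decay 8 of [kE];
     what remains is 3, more than the 2 needed for integrability. *)
  apply: ler_wpM2l => //; rewrite /z (_ : (8 = 5 + 3)%N)// exprD invfM mulrA divff; last exact: wtX_neq0.
  by rewrite mul1r; exact: wtV_le.
rewrite RintZ; last exact: intg_wk.
rewrite [leRHS](_ : _ = K ^+ 3 * (la k / la j) * (F j * G k) * I2 R d); last by ring.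
apply: ler_wpM2l; last exact: Rint_wk.
by rewrite !mulr_ge0// exprn_ge0.
Qed.

(** The share of the pair f_j, g_k in D(fg) - f Dg - g Df, with the truncated D on the product. Off
    the diagonal one of the subtracted terms cancels the main part of the product, and the other is
    small. *)
Definition Bil n j k : R := conv (tau n) (fun y => fj j y * gk k y) x
  - fj j x * (Q ^+ k * conv (kkap k) g x) - gk k x * (Q ^+ j * conv (kkap j) f x).

Lemma offdiag_bound n j k : (k + 4 <= j)%N -> (j + 2 <= n)%N ->
  `|Bil n j k| <= (K ^+ 3 * I2 R d + K ^+ 2) *
     ((Q ^+ j * (la k / la j) + Q ^+ k) * (F j * G k)).
Proof.
move=> kj jn; have kj' : (k <= j)%N by apply: leq_trans kj; exact: leq_addr.
have j0 : (0 < j)%N by apply: leq_trans kj; rewrite addn4.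
have h1 := commutator_bound kj'.
have h2 := piece0 nf hfc hfa j; have h3 := piece_kap ng hgb hge k.
rewrite (E_piece _ nf j0) in h1.
rewrite /Bil tau_kE//.
have -> : forall u v w z : R, Q ^+ j * u - v * (Q ^+ k * w) - z * (Q ^+ j * conv (kkap j) f x) =
   Q ^+ j * (u - z * conv (kkap j) f x) - Q ^+ k * (v * w) by move=> *; ring.
have I20 := I2_ge0 R d; have r0 : 0 <= la k / la j by rewrite divr_ge0 ?ltW.
have FG := mulr_ge0 (F0 j) (G0 k).
have qj := ltW (Qj0 j); have qk := ltW (Qj0 k).
have K2 : 0 <= K ^+ 2 by exact: exprn_ge0.
have K3 : 0 <= K ^+ 3 * I2 R d by rewrite mulr_ge0// exprn_ge0.
apply: (@le_trans _ _ (Q ^+ j * (K ^+ 3 * I2 R d * (la k / la j) * (F j * G k)) + Q ^+ k * (K ^+ 2 * (F j * G k)))).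
  apply normB_le; rewrite absM (ger0_norm (ltW (Qj0 _))) ler_wpM2l//.
  rewrite absM (_ : K ^+ 2 * _ = K * F j * (K * G k)); last by ring.
  exact: ler_pM.
set X := K ^+ 3 * _ in K3 *; set Y := K ^+ 2 in K2 *; set Z := F j * G k in FG *.
set r := la k / la j in r0 *; set p := Q ^+ j in qj *; set q := Q ^+ k in qk *.
have := mulr_ge0 (mulr_ge0 (mulr_ge0 qj r0) FG) K2; have := mulr_ge0 (mulr_ge0 qk FG) K3.
lra.
Qed.

End offdiagonal.
End pieces.

(** * A trilinear estimate of Young type *)

Section trilinear.
Variables (R : realType) (d : nat).
Local Notation V := 'rV[R]_d.
Local Notation mu := (lebesgue_rV R d).
Implicit Types (h g : V -> R) (x y z : V) (i j k t : nat).
Local Notation la j := ((2 : R) ^+ j).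

Let la0 j : 0 < la j. Proof. exact: exprn_gt0. Qed.
Let wk0 N j z : 0 <= wk N (la j) z. Proof. exact/wk_ge0/ltW. Qed.

(* With X = h^u g^v / L, Y = h^u and Z = g^v one has
   h g = L^lam X^lam Y^(1 - 1/v) Z^(1 - 1/u), and the exponents add up to 1. *)
Lemma weighted_amgm (h g L lam u v : R) : 0 <= h -> 0 <= g -> 0 < L ->
  1 <= u -> 1 <= v -> 0 <= lam -> u^-1 + v^-1 = 1 + lam ->
  h * g <= L `^ lam * (h `^ u * g `^ v / L + h `^ u + g `^ v).
Proof.
move=> h0 g0 L0 u1 v1 lam0 uv.
have u0 : 0 < u by lra.
have v0 : 0 < v by lra.
have e1 : lam + (1 - v^-1 + (1 - u^-1)) = 1 by lra.
have pos : 0 <= L `^ lam * (h `^ u * g `^ v / L + h `^ u + g `^ v).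
  by rewrite mulr_ge0 ?powR_ge0// !addr_ge0 ?divr_ge0 ?mulr_ge0 ?powR_ge0// ltW.
move: h0; rewrite le_eqVlt => /predU1P[h0|h0]; first by move: pos; rewrite -h0 mul0r.
move: g0; rewrite le_eqVlt => /predU1P[g0|g0]; first by move: pos; rewrite -g0 mulr0.
set X := h `^ u * g `^ v / L; set Y := h `^ u; set Z := g `^ v.
have Y0 : 0 < Y by rewrite powR_gt0.
have Z0 : 0 < Z by rewrite powR_gt0.
have X0 : 0 < X by rewrite divr_gt0// mulr_gt0.
set S := X + Y + Z; have S0 : 0 < S by rewrite !addr_gt0.
have uV : u^-1 <= 1 by rewrite invf_le1.
have vV : v^-1 <= 1 by rewrite invf_le1.
have E : h * g = L `^ lam * (X `^ lam * (Y `^ (1 - v^-1) * Z `^ (1 - u^-1))).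
  have -> : 1 - v^-1 = u^-1 - lam by lra.
  have -> : 1 - u^-1 = v^-1 - lam by lra.
  have pn (w e : R) : 0 < w -> w `^ e != 0 by move=> w0; rewrite gt_eqF// powR_gt0.
  rewrite !powRB ?(gt_eqF Y0) ?(gt_eqF Z0) ?implybT//.
  have -> : Y `^ u^-1 = h by rewrite /Y -powRrM mulfV ?gt_eqF// powRr1 ?ltW.
  have -> : Z `^ v^-1 = g by rewrite /Z -powRrM mulfV ?gt_eqF// powRr1 ?ltW.
  have -> : X `^ lam = Y `^ lam * Z `^ lam / L `^ lam.
    rewrite /X powRM ?mulr_ge0 ?ltW ?invr_gt0// powRM ?ltW//; congr (_ * _).
    by rewrite -powR_inv1 ?ltW// -powRrM mulN1r powRN.
  have F (l y z : R) : l != 0 -> y != 0 -> z != 0 ->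
      h * g = l * (y * z / l * ((h / y) * (g / z))).
    by move=> *; field; apply/and3P.
  by apply: F; exact: pn.
rewrite E ler_wpM2l ?powR_ge0//.
have ES : S = S `^ lam * (S `^ (1 - v^-1) * S `^ (1 - u^-1)).
  rewrite -!powRD ?(gt_eqF S0) ?implybT//.
  by rewrite e1 powRr1// ltW.
have XS : X <= S by rewrite /S -addrA lerDl ltW// addr_gt0.
have YS : Y <= S by rewrite /S [X + Y]addrC -addrA lerDl ltW// addr_gt0.
have ZS : Z <= S by rewrite /S lerDr ltW// addr_gt0.
have le_pow (w e : R) : 0 <= e -> 0 < w -> w <= S -> w `^ e <= S `^ e.
  by move=> e0 w0 wS; apply: ge0_ler_powR => //; rewrite nnegrE ltW.
have dv : 0 <= 1 - v^-1 by rewrite subr_ge0.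
have du : 0 <= 1 - u^-1 by rewrite subr_ge0.
rewrite [leRHS]ES; apply: ler_pM; rewrite ?mulr_ge0 ?powR_ge0//.
  exact: le_pow.
by apply: ler_pM; rewrite ?powR_ge0//; exact: le_pow.
Qed.

Lemma wt_scale i j t y : (i <= j + t)%N -> wt (la i *: y) <= (la t) ^+ d * wt (la j *: y).
Proof.
move=> ij; apply: (@le_trans _ _ (wt (la t *: (la j *: y)))).
  rewrite scalerA -exprD; apply: wt_dil_mono; first exact: ltW.
  by apply: la_le; rewrite addnC.
by apply: wt_dil_ge1; rewrite exprn_ege1// ler1n.
Qed.

Lemma wtX_scale i j t y N : (i <= j + t)%N ->
  wt (la i *: y) ^+ N <= ((la t) ^+ d) ^+ N * wt (la j *: y) ^+ N.
Proof.
move=> ij; rewrite -exprMn; apply: lerXn2r.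
- by rewrite nnegrE ltW// wt_gt0.
- by rewrite nnegrE mulr_ge0 ?exprn_ge0// ltW// wt_gt0.
- exact: wt_scale.
Qed.

Local Notation c8 := ((la 8 ^+ d) ^+ 2).

Lemma conv_wk_ge0 N j h x : (forall y, 0 <= h y) -> 0 <= conv (wk N (la j)) h x.
Proof. by move=> h0; apply: ge0_Rint => y; rewrite mulr_ge0// wk_ge0// ltW. Qed.

(** Averaging an average is harmless when the outer kernel is not much narrower than the inner one.
    After exchanging the two, the Peetre loss wt(2^i z)^2 is at most c8 wt(2^j z)^2, and the inner
    weight of order 8 absorbs it. *)
Lemma conv_wk_wk N i j h x : (2 <= N)%N -> (i <= j + 8)%N -> BM h -> (forall y, 0 <= h y) ->
  (forall j, conv (wk 2 (la j)) h x <= 1) ->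
  conv (wk N (la i)) (conv (wk 8 (la j)) h) x <= c8 * I2 R d.
Proof.
move=> N2 ij bh h0 h1.
have i8 : intg mu (wk 8 (la j)) by exact: intg_wk.
rewrite (conv_conv x (intg_wk d (la0 i) N2) i8 bh).
have nh : (fun z => `|h z|) = h by apply/funext => z; rewrite ger0_norm.
have H z : conv (wk N (la i)) h (x - z) <= wt (la i *: z) ^+ 2.
  apply: (le_trans (ler_norm _)).
  have := @conv_peetre R d (wk N (la i)) h 1 2 (la i) x z (la0 i) (leqnn 2) ler01 (intg_wk d (la0 i) N2) _ bh.
  rewrite mul1r nh => /(_ _)/le_trans; apply.
    by move=> y; rewrite mul1r ger0_norm ?wk0// wk_leN.
  by rewrite ler_piMr// exprn_ge0// ltW// wt_gt0.
apply: (@le_trans _ _ (\int[mu]_z (c8 * wk 2 (la j) z))).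
  apply: le_Rint.
  - by apply: intgM_BM i8 _; apply: BM_sub; apply: BM_conv => //; exact: intg_wk.
  - by apply: intgZ; exact: intg_wk.
  move=> z; apply: (@le_trans _ _ (wk 8 (la j) z * (c8 * wt (la j *: z) ^+ 2))).
    rewrite ler_wpM2l ?wk0//; apply: (le_trans (H z)).
    exact: wtX_scale.
  rewrite mulrCA ler_wpM2l ?exprn_ge0// /wk -mulrA ler_wpM2l ?exprn_ge0//.
  rewrite (_ : (8 = 6 + 2)%N)// exprD invfM -mulrA mulVf ?wtX_neq0// mulr1.
  exact: wtV_le.
rewrite RintZ; last exact: intg_wk.
by rewrite ler_wpM2l ?exprn_ge0//; exact: Rint_wk.
Qed.

(** [weighted_amgm] applied to h(p - z) and g(p - z') and integrated against both kernels in the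
    independent variables z and z'. *)
Lemma conv_pair_le j k h g (L lam u v : R) p : BM h -> BM g ->
  BM (fun z => h z `^ u) -> BM (fun z => g z `^ v) ->
  (forall y, 0 <= h y) -> (forall y, 0 <= g y) -> 0 < L ->
  1 <= u -> 1 <= v -> 0 <= lam -> u^-1 + v^-1 = 1 + lam ->
  conv (wk 8 (la j)) h p * conv (wk 8 (la k)) g p <=
  L `^ lam * (conv (wk 8 (la j)) (fun z => h z `^ u) p * conv (wk 8 (la k)) (fun z => g z `^ v) p / L +
     I2 R d * conv (wk 8 (la j)) (fun z => h z `^ u) p + I2 R d * conv (wk 8 (la k)) (fun z => g z `^ v) p).
Proof.
move=> bh bg bu bv h0 g0 L0 u1 v1 l0 uv.
have ij : intg mu (wk 8 (la j)) by exact: intg_wk.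
have ik : intg mu (wk 8 (la k)) by exact: intg_wk.
set P := conv _ (fun z => h z `^ u) p; set S := conv _ (fun z => g z `^ v) p.
have P0 : 0 <= P by apply: conv_wk_ge0 => y; exact: powR_ge0.
have S0 : 0 <= S by apply: conv_wk_ge0 => y; exact: powR_ge0.
have Ll := powR_ge0 L lam.
have LV : 0 <= L^-1 by rewrite invr_ge0 ltW.
have W1 i : \int[mu]_z wk 8 (la i) z <= I2 R d by exact: Rint_wk.
have step z' : g (p - z') * conv (wk 8 (la j)) h p <=
    L `^ lam * (g (p - z') `^ v * (P / L + I2 R d) + P).
  rewrite /conv -RintZ; last exact: (intg_conv p ij bh).
  set G := g (p - z') `^ v; have G0 : 0 <= G by exact: powR_ge0.
  have iP : intg mu (fun z => wk 8 (la j) z * h (p - z) `^ u) := intg_conv p ij bu.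
  apply: (@le_trans _ _ (\int[mu]_z (L `^ lam * (G / L + 1) * (wk 8 (la j) z * h (p - z) `^ u) +
      L `^ lam * G * wk 8 (la j) z))).
    apply: le_Rint.
    - by apply: intgZ; exact: (intg_conv p ij bh).
    - by apply: intgD; exact: intgZ.
    move=> z; have w0 := wk_ge0 8 z (ltW (la0 j)).
    have := ler_wpM2l w0 (weighted_amgm (h0 (p - z)) (g0 (p - z')) L0 u1 v1 l0 uv).
    rewrite -/G => H; rewrite mulrCA [g _ * _]mulrC; apply: (le_trans H).
    by rewrite le_eqVlt; apply/orP; left; apply/eqP; ring.
  rewrite RintD; [|exact: intgZ..]; rewrite (RintZ _ iP) (RintZ _ ij).
  have -> : \int[mu]_x (wk 8 (la j) x * h (p - x) `^ u) = P by [].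
  rewrite [leRHS](_ : _ = L `^ lam * (G / L + 1) * P + L `^ lam * G * I2 R d); last by ring.
  by rewrite lerD2l; exact: (ler_wpM2l (mulr_ge0 Ll G0) (W1 j)).
rewrite [leLHS]mulrC {1}/conv -RintZr; last exact: (intg_conv p ik bg).
have iS : intg mu (fun z => wk 8 (la k) z * g (p - z) `^ v) := intg_conv p ik bv.
apply: (@le_trans _ _ (\int[mu]_z (L `^ lam * (P / L + I2 R d) * (wk 8 (la k) z * g (p - z) `^ v) +
      L `^ lam * P * wk 8 (la k) z))).
  apply: le_Rint.
  - have := intgZ (conv (wk 8 (la j)) h p) (intg_conv p ik bg).
    by apply: eq_intg => z; rewrite mulrC.
  - by apply: intgD; exact: intgZ.
  move=> z; have w0 := wk_ge0 8 z (ltW (la0 k)).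
  rewrite -mulrA; apply: (le_trans (ler_wpM2l w0 (step z))).
  by rewrite le_eqVlt; apply/orP; left; apply/eqP; ring.
rewrite RintD; [|exact: intgZ..]; rewrite (RintZ _ iS) (RintZ _ ik).
have -> : \int[mu]_x (wk 8 (la k) x * g (p - x) `^ v) = S by [].
rewrite [leRHS](_ : _ = L `^ lam * (P / L + I2 R d) * S + L `^ lam * P * I2 R d); last by ring.
by rewrite lerD2l; exact: (ler_wpM2l (mulr_ge0 Ll P0) (W1 k)).
Qed.

Definition Cpure : R := c8 * (c8 * I2 R d) + 2 * (I2 R d * (c8 * I2 R d)).

(** L = 2^(td) compares the kernel at scale k <= i + t with the one at scale i. It bounds S
    pointwise by L, so the term P S / L is as good as P alone, and the only loss left is the
    prefactor L^lam. *)
Lemma pure_bound i j k t h g (lam u v : R) x : BM h -> BM g ->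
  BM (fun z => h z `^ u) -> BM (fun z => g z `^ v) ->
  (forall y, 0 <= h y) -> (forall y, 0 <= g y) ->
  (forall j, conv (wk 2 (la j)) (fun z => h z `^ u) x <= 1) ->
  (forall j, conv (wk 2 (la j)) (fun z => g z `^ v) x <= 1) ->
  1 <= u -> 1 <= v -> 0 <= lam -> u^-1 + v^-1 = 1 + lam ->
  (i <= j + 8)%N -> (i <= k + 8)%N -> (k <= i + t)%N ->
  conv (wk 8 (la i)) (fun y => conv (wk 8 (la j)) h y * conv (wk 8 (la k)) g y) x <=
  Cpure * (la t ^+ d) `^ lam.
Proof.
move=> bh bg bu bv h0 g0 hu gv u1 v1 l0 uv ij ik ki.
set L := la t ^+ d; have L0 : 0 < L by exact: exprn_gt0.
set P := conv (wk 8 (la j)) (fun z => h z `^ u); set S := conv (wk 8 (la k)) (fun z => g z `^ v).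
have wi m : intg mu (wk 8 (la m)) by exact: intg_wk.
have bP : BM P by exact: BM_conv.
have bS : BM S by exact: BM_conv.
have P0 y : 0 <= P y by apply: conv_wk_ge0 => z; exact: powR_ge0.
have S0 y : 0 <= S y by apply: conv_wk_ge0 => z; exact: powR_ge0.
have Ll := powR_ge0 L lam.
have SL y : S (x - y) <= L * c8 * wt (la i *: y) ^+ 2.
  apply: (le_trans (ler_norm _)).
  have K0 : 0 <= L * c8 by rewrite mulr_ge0 ?exprn_ge0// ltW.
  have := @conv_peetre R d (wk 8 (la k)) _ (L * c8) 2 (la i) x y (la0 i) (leqnn 2) K0 (wi k) _ bv.
  have -> : (fun z => `|g z `^ v|) = (fun z => g z `^ v).
    by apply/funext => z; rewrite ger0_norm// powR_ge0.
  move=> /(_ _)/le_trans; apply; last first.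
    rewrite ler_piMr//; apply: mulr_ge0 => //; exact/exprn_ge0/ltW/wt_gt0.
  move=> z; rewrite ger0_norm ?wk0//.
  apply: (le_trans (wk_leN z (la0 k) (isT : (2 <= 8)%N))).
  rewrite /wk mulrACA.
  apply: ler_pM; rewrite ?exprn_ge0 ?wtV_ge0//.
    by rewrite /L -exprMn -exprD; apply: lerXn2r; rewrite ?nnegrE ?exprn_ge0//; apply: la_le; rewrite addnC.
  have := @wt_scale i k 8 z ik; exact: wtV_mono (exprn_gt0 _ (la0 8)).
have cP : conv (wk 6 (la i)) P x <= c8 * I2 R d.
  by apply: conv_wk_wk => // y; exact: powR_ge0.
have cP8 : conv (wk 8 (la i)) P x <= c8 * I2 R d.
  by apply: conv_wk_wk => // y; exact: powR_ge0.
have cS8 : conv (wk 8 (la i)) S x <= c8 * I2 R d.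
  by apply: conv_wk_wk => // y; exact: powR_ge0.
have pw y : conv (wk 8 (la j)) h (x - y) * conv (wk 8 (la k)) g (x - y) <=
    L `^ lam * (P (x - y) * S (x - y) / L + I2 R d * P (x - y) + I2 R d * S (x - y)).
  exact: (conv_pair_le j k (x - y) bh bg bu bv h0 g0 L0 u1 v1 l0 uv).
have bhg : BM (fun y => conv (wk 8 (la j)) h y * conv (wk 8 (la k)) g y).
  by apply: BM_M; exact: BM_conv.
clearbody P S.
have cPS : conv (wk 8 (la i)) (fun y => P y * S y) x <= L * c8 * conv (wk 6 (la i)) P x.
  rewrite {2}/conv -RintZ; last by apply: (intg_conv x _ bP); exact: intg_wk.
  apply: le_Rint.
  - exact: (intg_conv x (wi i) (BM_M bP bS)).
  - by apply: intgZ; apply: (intg_conv x _ bP); exact: intg_wk.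
  move=> y; apply: (@le_trans _ _ (wk 8 (la i) y * (P (x - y) * (L * c8 * wt (la i *: y) ^+ 2)))).
    by rewrite ler_wpM2l ?wk0// ler_wpM2l.
  rewrite /wk (_ : (8 = 6 + 2)%N)// exprD invfM.
  rewrite le_eqVlt; apply/orP; left; apply/eqP; field.
  by rewrite ?wt_neq0 ?wtX_neq0.
apply: (@le_trans _ _ (L `^ lam * (L^-1 * conv (wk 8 (la i)) (fun y => P y * S y) x +
    I2 R d * conv (wk 8 (la i)) P x + I2 R d * conv (wk 8 (la i)) S x))).
  have j1 : intg mu (fun y => wk 8 (la i) y * (P (x - y) * S (x - y))) :=
    intg_conv x (wi i) (BM_M bP bS).
  have j2 : intg mu (fun y => wk 8 (la i) y * P (x - y)) := intg_conv x (wi i) bP.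
  have j3 : intg mu (fun y => wk 8 (la i) y * S (x - y)) := intg_conv x (wi i) bS.
  have i12 := intgD (intgZ L^-1 j1) (intgZ (I2 R d) j2).
  have i123 := intgD i12 (intgZ (I2 R d) j3).
  have -> : L `^ lam * (L^-1 * conv (wk 8 (la i)) (fun y => P y * S y) x +
      I2 R d * conv (wk 8 (la i)) P x + I2 R d * conv (wk 8 (la i)) S x) =
    \int[mu]_y (L `^ lam * (L^-1 * (wk 8 (la i) y * (P (x - y) * S (x - y))) +
      I2 R d * (wk 8 (la i) y * P (x - y)) + I2 R d * (wk 8 (la i) y * S (x - y)))).
    rewrite (RintZ _ i123) (RintD i12 (intgZ (I2 R d) j3)).
    by rewrite (RintD (intgZ L^-1 j1) (intgZ (I2 R d) j2)) (RintZ _ j1) (RintZ _ j2) (RintZ _ j3).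
  apply: le_Rint.
  - exact: (intg_conv x (wi i) bhg).
  - exact: intgZ.
  move=> y; apply: (le_trans (ler_wpM2l (wk0 8 i y) (pw y))).
  by rewrite le_eqVlt; apply/orP; left; apply/eqP; ring.
rewrite [leRHS]mulrC ler_wpM2l// /Cpure.
have I0 := I2_ge0 R d.
have h1 : L^-1 * conv (wk 8 (la i)) (fun y => P y * S y) x <= c8 * (c8 * I2 R d).
  apply: (@le_trans _ _ (L^-1 * (L * c8 * (c8 * I2 R d)))).
    apply: ler_wpM2l; first by rewrite invr_ge0 ltW.
    apply: (le_trans cPS).
    by rewrite ler_wpM2l// mulr_ge0 ?exprn_ge0// ltW.
  by rewrite -mulrA mulKf// gt_eqF.
have := ler_wpM2l I0 cP8; have := ler_wpM2l I0 cS8; lra.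
Qed.

End trilinear.

Lemma powR_conv (R : realType) (w dl : R) : 0 <= w -> w `^ dl * w `^ (1 - dl) = w.
Proof.
move=> w0; have e : dl + (1 - dl) = 1 by rewrite addrC subrK.
by rewrite -powRD e ?powRr1// oner_eq0.
Qed.

Lemma powR_dyadic (R : realType) (kap : R) t d :
  ((2 : R) ^+ t ^+ d) `^ kap = (2 `^ (d%:R * kap)) ^+ t.
Proof.
rewrite -exprM -(@powR_mulrn R 2)// -(powR_mulrn _ (powR_ge0 _ _)) -2!powRrM natrM.
by congr (_ `^ _); ring.
Qed.

Lemma le_interp (R : realType) (z x y dl : R) : 0 <= z -> z <= x -> z <= y ->
  0 <= dl -> dl <= 1 -> z <= x `^ dl * y `^ (1 - dl).
Proof.
move=> z0 zx zy d0 d1; have d1' : 0 <= 1 - dl by rewrite subr_ge0.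
move: z0; rewrite le_eqVlt => /predU1P[<-|z0]; first by rewrite mulr_ge0 ?powR_ge0.
have -> : z = z `^ dl * z `^ (1 - dl).
  by rewrite powR_conv// ltW.
apply: ler_pM; rewrite ?powR_ge0//; apply: ge0_ler_powR => //; rewrite nnegrE ltW//;
  exact: lt_le_trans zx || exact: lt_le_trans zy.
Qed.

Lemma geometric_le (R : realType) (rho : R) n : 0 <= rho -> rho < 1 ->
  \sum_(0 <= i < n) rho ^+ i <= (1 - rho)^-1.
Proof.
move=> r0 r1; have r1' : 0 < 1 - rho by lra.
suff -> : \sum_(0 <= i < n) rho ^+ i = (1 - rho ^+ n) / (1 - rho).
  by rewrite ler_pdivrMr// mulVf ?gt_eqF// gerBl exprn_ge0.
elim: n => [|n ih]; first by rewrite big_geq// expr0 subrr mul0r.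
rewrite big_nat_recr//= ih exprS; field; lra.
Qed.

(** * Products of comparable frequencies *)

Section high_high.
Variables (R : realType) (d : nat) (s : R).
Hypothesis s0 : 0 < s.
Local Notation V := 'rV[R]_d.
Local Notation mu := (lebesgue_rV R d).
Local Notation Q := (2 `^ s).
Local Notation D := (mult (@mB R d s)).
Implicit Types (f g h : V -> R) (x y xi eta : V) (j k n i t : nat).
Variables (K : R) (kpsi klam kkap : nat -> V -> R).
Hypothesis K0 : 0 <= K.
Hypothesis Hpsi : kpack 8 K kpsi (@bl R d).
Hypothesis Hlam : kpack 8 K klam (fun j xi => Q ^+ j * (bl j xi / mB s xi)).
Hypothesis Hkap : kpack 8 K kkap (fun j xi => Q ^- j * (mB s xi * bl j xi)).

Local Notation la j := ((2 : R) ^+ j).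
Let la0 j : 0 < la j. Proof. exact: exprn_gt0. Qed.
Let Q0 : 0 < Q. Proof. exact: powR_gt0. Qed.
Let Qj0 j : 0 < Q ^+ j. Proof. exact: exprn_gt0. Qed.
Let Qjn j : Q ^+ j != 0. Proof. by rewrite gt_eqF. Qed.
Let pm : polyg (@mB R d s). Proof. by apply: polyg_mB; exact: ltW. Qed.
Let ipsi j : intg mu (kpsi j). Proof. by case: Hpsi. Qed.
Let ilam j : intg mu (klam j). Proof. by case: Hlam. Qed.
Let ikap j : intg mu (kkap j). Proof. by case: Hkap. Qed.
Let wk0 N j (z : V) : 0 <= wk N (la j) z. Proof. exact/wk_ge0/ltW. Qed.
Let psiE f j : nice f -> conv (kpsi j) f = mult (bl j) f.
Proof. by move=> nf; apply/funext => y; exact: (psi_mult Hpsi j y nf). Qed.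
Let Wk (i : nat) : intg mu (wk 8 (la i)). Proof. exact: intg_wk. Qed.

(** Keeps the minima in [Fm], which will make the sum over j converge, at the price of a large loss
    2^(4td): the Peetre weights of both blocks are compared with that of the wider kernel at scale
    i. *)
Lemma lossy (kk : nat -> V -> R) sy f g x c a b e i j k t : kpack 8 K kk sy ->
  nice f -> nice g -> wsup f x c -> wsup (D f) x a -> wsup g x b -> wsup (D g) x e ->
  (j <= i + t)%N -> (k <= i + t)%N ->
  `|conv (kk i) (fun y => conv (kpsi j) f y * conv (kpsi k) g y) x| <=
  K ^+ 3 * I2 R d * (la t ^+ d) ^+ 4 * (Fm s c a j * Fm s b e k).
Proof.
move=> Hk nf ng hc ha hb he ji ki; have [ik _ kb _] := Hk.
have F0 := Fm_ge0 s0 nf hc ha j.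
have G0 := Fm_ge0 s0 ng hb he k.
have pf := piece_peetre s0 K0 Hpsi Hlam nf hc ha j.
have pg := piece_peetre s0 K0 Hpsi Hlam ng hb he k.
set F := Fm s c a j in F0 pf *; set G := Fm s b e k in G0 pg *.
have bfg : BM (fun y => conv (kpsi j) f y * conv (kpsi k) g y).
  by apply: BM_M; apply: BM_conv => //; exact: BM_nice.
set T := la t ^+ d; have T0 : 0 <= T by exact: exprn_ge0.
apply: (@le_trans _ _ (\int[mu]_y (K ^+ 3 * T ^+ 4 * (F * G) * wk 2 (la i) y))).
  apply: le_norm_Rint; first exact: (intg_conv x (ik i) bfg).
    by apply: intgZ; exact: intg_wk.
  move=> y; rewrite !absM.
  have h1 : `|conv (kpsi j) f (x - y)| <= K * (T ^+ 2 * wt (la i *: y) ^+ 2) * F.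
    by apply: (le_trans (pf y)); rewrite ler_wpM2r// ler_wpM2l// wtX_scale.
  have h2 : `|conv (kpsi k) g (x - y)| <= K * (T ^+ 2 * wt (la i *: y) ^+ 2) * G.
    by apply: (le_trans (pg y)); rewrite ler_wpM2r// ler_wpM2l// wtX_scale.
  apply: (le_trans (ler_pM _ _ (kb i y) (ler_pM _ _ h1 h2))); rewrite ?mulr_ge0//.
  rewrite /wk; set P := la i ^+ d; set W := wt (la i *: y); set z := (W ^+ 8)^-1.
  have P0 : 0 <= P by rewrite exprn_ge0// ltW.
  rewrite [leLHS](_ : _ = K ^+ 3 * T ^+ 4 * (F * G) * (P * (W ^+ 4 * z))); last by ring.
  apply: ler_wpM2l; first by rewrite !mulr_ge0// exprn_ge0.
  apply: ler_wpM2l => //; rewrite /z (_ : (8 = 4 + 4)%N)// exprD invfM mulrA divff; last exact: wtX_neq0.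
  by rewrite mul1r; exact: wtV_le.
rewrite RintZ; last exact: intg_wk.
rewrite [leRHS](_ : _ = K ^+ 3 * T ^+ 4 * (F * G) * I2 R d); last by ring.
apply: ler_wpM2l; last exact: Rint_wk.
by rewrite !mulr_ge0// exprn_ge0.
Qed.

(** The complement of [lossy]: it loses only 2^(t d lam), but it uses D f and g alone, so it carries
    no decay that would allow a sum over j. *)
Lemma pure f g x A B u v lam i j k t : nice f -> nice g -> 0 < A -> 0 < B ->
  (forall j, conv (wk 2 (la j)) (fun z => (`|D f z| / A) `^ u) x <= 1) ->
  (forall j, conv (wk 2 (la j)) (fun z => (`|g z| / B) `^ v) x <= 1) ->
  1 <= u -> 1 <= v -> 0 <= lam -> u^-1 + v^-1 = 1 + lam ->
  (i <= j + 8)%N -> (i <= k + 8)%N -> (k <= i + t)%N ->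
  `|conv (kkap i) (fun y => conv (kpsi j) f y * conv (kpsi k) g y) x| <=
  K ^+ 3 * Cpure R d * Q ^- j * (la t ^+ d) `^ lam * (A * B).
Proof.
move=> nf ng A0 B0 hu hv u1 v1 l0 uv ij ik ki; have [_ _ kb _] := Hkap.
pose h z := `|D f z| / A; pose g' z := `|g z| / B.
have BMdiv w C : 0 < C -> BM w -> BM (fun z : V => `|w z| / C).
  move=> C0 [mw [M wM]]; split.
    by apply: measurable_funM => //; exact: measurableT_comp.
  exists (M / C) => z; rewrite ger0_norm ?divr_ge0 ?(ltW C0)//.
  by rewrite ler_wpM2r ?invr_ge0 ?(ltW C0).
have BMpow w p : 0 <= p -> BM w -> (forall z, 0 <= w z) -> BM (fun z : V => w z `^ p).
  move=> p0 [mw [M wM]] w0; split.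
    by apply: (measurableT_comp (f := @powR R ^~ p)) => //; exact: measurable_powR.
  exists (M `^ p) => z; rewrite ger0_norm ?powR_ge0//.
  have wz : w z <= M by apply: le_trans (wM z); exact: ler_norm.
  by apply: ge0_ler_powR; rewrite ?nnegrE// (le_trans (w0 z)).
have bh : BM h by apply: BMdiv => //; exact: BM_mult.
have bg : BM g' by apply: BMdiv => //; exact: BM_nice.
have h0 z : 0 <= h z by rewrite divr_ge0// ltW.
have g0 z : 0 <= g' z by rewrite divr_ge0// ltW.
have u0 : 0 <= u by exact: le_trans u1.
have v0 : 0 <= v by exact: le_trans v1.
have PB := pure_bound bh bg (BMpow _ _ u0 bh h0) (BMpow _ _ v0 bg g0) h0 g0 hu hv u1 v1 l0 uv ij ik ki.
have kle (kk : nat -> V -> R) sy w C m y : kpack 8 K kk sy -> 0 < C -> BM w ->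
   `|conv (kk m) w y| <= K * C * conv (wk 8 (la m)) (fun z => `|w z| / C) y.
  move=> [kki _ kkb _] C0 bw.
  have iw := intg_conv y (Wk m) (BMdiv w C C0 bw).
  rewrite {2}/conv -(RintZ _ iw); apply: le_norm_Rint.
  - exact: (intg_conv y (kki m) bw).
  - exact: intgZ.
  - move=> z; rewrite absM (_ : K * C * _ = K * wk 8 (la m) z * `|w (y - z)|).
      exact: ler_wpM2r.
    by field; rewrite gt_eqF.
have bfg : BM (fun y => conv (kpsi j) f y * conv (kpsi k) g y).
  by apply: BM_M; apply: BM_conv => //; exact: BM_nice.
have bhg : BM (fun y => conv (wk 8 (la j)) h y * conv (wk 8 (la k)) g' y).
  by apply: BM_M; exact: BM_conv.
have Qv : 0 <= Q ^- j by rewrite invr_ge0 ltW.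
have pf y : `|conv (kpsi j) f y| <= Q ^- j * (K * A * conv (wk 8 (la j)) h y).
  have -> : conv (kpsi j) f y = Q ^- j * conv (klam j) (D f) y by exact: (psi_lam s0 Hpsi Hlam j y nf).
  rewrite absM ger0_norm// ler_wpM2l//.
  by apply: kle Hlam A0 _; exact: BM_mult.
have pg y : `|conv (kpsi k) g y| <= K * B * conv (wk 8 (la k)) g' y.
  by apply: kle Hpsi B0 _; exact: BM_nice.
have iW : intg mu (fun y => wk 8 (la i) y * (conv (wk 8 (la j)) h (x - y) * conv (wk 8 (la k)) g' (x - y))) :=
  intg_conv x (Wk i) bhg.
set C := K ^+ 3 * Q ^- j * (A * B).
have C0 : 0 <= C by rewrite !mulr_ge0 ?exprn_ge0// ltW.
apply: (@le_trans _ _ (C * conv (wk 8 (la i)) (fun y => conv (wk 8 (la j)) h y * conv (wk 8 (la k)) g' y) x)).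
  rewrite {2}/conv -(RintZ _ iW); apply: le_norm_Rint.
  - exact: (intg_conv x (ikap i) bfg).
  - exact: intgZ.
  - move=> y; rewrite !absM.
    apply: (le_trans (ler_pM _ _ (kb i y) (ler_pM _ _ (pf (x - y)) (pg (x - y))))); rewrite ?mulr_ge0//.
    by rewrite le_eqVlt; apply/orP; left; apply/eqP; rewrite /C; ring.
apply: (le_trans (ler_wpM2l C0 PB)).
by rewrite le_eqVlt; apply/orP; left; apply/eqP; rewrite /C; ring.
Qed.

Let ep4_le i j : (i <= j)%N -> ep4 R j <= ep4 R i.
Proof.
move=> /subnKC <-; rewrite ep4D ler_piMr ?(ltW (ep4_gt0 _ _))//.
by have [] := andP (@ep4_01 R (j - i)).
Qed.
Let ep4_3 : ep4 R 3 = 1 / 64. Proof. by rewrite /ep4 -exprM -natrX div1r. Qed.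
Let ep4_5 : ep4 R 5 = 1 / 1024. Proof. by rewrite /ep4 -exprM -natrX div1r. Qed.

(** 520 = 2 * 4 + 2 * 256: in units of 4^j the squares of the two frequencies are at most 4 and 4 *
    4^3. *)
Let freq j k (xi eta z : V) : (k <= j + 3)%N -> bl j xi != 0 -> bl k eta != 0 ->
  sq z <= 2 * sq xi + 2 * sq eta -> ep4 R j * sq z <= 520.
Proof.
move=> kj /bl_supp[x1 _] /bl_supp[y1 _] zz.
have := ep4_le kj; rewrite ep4D ep4_3 => h.
have := sq_ge0 eta; have := ep4_gt0 R j; nra.
Qed.

Lemma hh_vanish f g x i j k : nice f -> nice g -> (j + 6 <= i)%N -> (k <= j + 3)%N ->
  conv (kkap i) (fun y => conv (kpsi j) f y * conv (kpsi k) g y) x = 0.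
Proof.
move=> nf ng ji kj; have [_ sk _ _] := Hkap.
rewrite (psiE j nf) (psiE k ng).
apply: (conv_prod_vanish x (ikap i) (sk i)); try exact: intg_bl; try exact: nice_intg.
move=> xi eta x1 y1.
have H (z : V) : sq z <= 2 * sq xi + 2 * sq eta -> Q ^- i * (mB s z * bl i z) = 0.
  move=> zz; have := freq kj x1 y1 zz => hz.
  have [->|/bl_supp[_ b2]] := eqVneq (bl i z) 0; first by rewrite !mulr0.
  have i0 : (0 < i)%N by apply: leq_trans ji; rewrite addnS.
  have := ep4_le ji; rewrite (_ : (j + 6 = j + 3 + 3)%N) ?ep4D ?ep4_3; last by rewrite -addnA.
  by move=> h; have := b2 i0; have := sq_ge0 z; nra.
by split; apply: H; [exact: sq_add_le|exact: sq_sub_le].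
Qed.

(** The cutoff by a ball equals 1 up to u = 2^10 = 1024, beyond the bound 520 of [freq], so [kV]
    agrees with [tau n] on the frequencies of the product. *)
Lemma tau_kV (kV : nat -> V -> R) n j k f g x :
  kpack 8 K kV (fun j xi => Q ^- j * (mB s xi * cutoff ((2 ^+ 5) ^- 2 * (ep4 R j * sq xi)))) ->
  nice f -> nice g -> (k <= j + 3)%N -> (j + 5 <= n)%N ->
  conv (tau s kkap n) (fun y => conv (kpsi j) f y * conv (kpsi k) g y) x =
  Q ^+ j * conv (kV j) (fun y => conv (kpsi j) f y * conv (kpsi k) g y) x.
Proof.
move=> HV nf ng kj jn; have [iV sV _ _] := HV.
rewrite (psiE j nf) (psiE k ng) -convZl//; last first.
  by apply: BM_M; apply: BM_mult => //; exact: polyg_bl.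
have it : intg mu (tau s kkap n) by exact: (intg_tau Hkap n).
have st : is_sym (tau s kkap n) (fun xi => mB s xi * Phi n xi) by exact: (sym_tau Hkap n).
apply: (conv_sym_eq x it (intgZ _ (iV j)) st (is_symZ _ (iV j) (sV j)));
  try exact: intg_bl; try exact: nice_intg.
move=> xi eta x1 y1.
have H (z : V) : sq z <= 2 * sq xi + 2 * sq eta -> mB s z * Phi n z =
   Q ^+ j * (Q ^- j * (mB s z * cutoff ((2 ^+ 5) ^- 2 * (ep4 R j * sq z)))).
  move=> zz; have := freq kj x1 y1 zz => hz; have z0 := sq_ge0 z.
  have -> : Phi n z = 1.
    by apply: Phi1; have := ep4_le jn; rewrite ep4D ep4_5; nra.
  have e5 : (2 ^+ 5 : R) ^- 2 = 1 / 1024 by exact: ep4_5.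
  by rewrite e5 cutoff1; [rewrite !mulr1 mulrA divff ?mul1r|lra].
by split; apply: H; [exact: sq_add_le|exact: sq_sub_le].
Qed.

Lemma hh_even (kV : nat -> V -> R) f g x c a b e j k n :
  kpack 8 K kV (fun j xi => Q ^- j * (mB s xi * cutoff ((2 ^+ 5) ^- 2 * (ep4 R j * sq xi)))) ->
  nice f -> nice g -> wsup f x c -> wsup (D f) x a -> wsup g x b -> wsup (D g) x e ->
  (k <= j + 3)%N -> (j + 5 <= n)%N ->
  `|conv (tau s kkap n) (fun y => conv (kpsi j) f y * conv (kpsi k) g y) x| <=
  K ^+ 3 * I2 R d * (la 5 ^+ d) ^+ 4 * (Q ^+ j * (Fm s c a j * Fm s b e k)).
Proof.
move=> HV nf ng hc ha hb he kj jn; rewrite (tau_kV x HV nf ng kj jn).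
rewrite absM (ger0_norm (ltW (Qj0 j))) mulrCA ler_wpM2l ?(ltW (Qj0 j))//.
apply: (lossy HV nf ng hc ha hb he); first exact: leq_addr.
by apply: leq_trans kj _; rewrite leq_add2l.
Qed.

(** The output is decomposed into blocks i, and on each the geometric mean of [lossy] and [pure] is
    taken. A small share dl of [lossy] retains summability in j, while the loss stays close to that
    of [pure]. The hypothesis on d, dl and lam says that the gain 2^-s per octave still wins. *)
Lemma hh_bound lam u v dl : 1 <= u -> 1 <= v -> 0 <= lam -> u^-1 + v^-1 = 1 + lam ->
  0 < dl -> dl <= 1 -> d%:R * (4 * dl + lam * (1 - dl)) < s ->
  exists2 CH, 0 <= CH & forall f g x c a b e A B j k n,
  nice f -> nice g -> wsup f x c -> wsup (D f) x a -> wsup g x b -> wsup (D g) x e ->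
  0 < A -> 0 < B ->
  (forall j, conv (wk 2 (la j)) (fun z => (`|D f z| / A) `^ u) x <= 1) ->
  (forall j, conv (wk 2 (la j)) (fun z => (`|g z| / B) `^ v) x <= 1) ->
  (k <= j + 3)%N -> (j <= k + 3)%N -> (j + 5 <= n)%N ->
  `|conv (tau s kkap n) (fun y => conv (kpsi j) f y * conv (kpsi k) g y) x| <=
  CH * ((Q ^+ j * (Fm s c a j * Fm s b e k)) `^ dl * (A * B) `^ (1 - dl)).
Proof.
move=> u1 v1 l0 uv d0 d1 ds.
set kap := 4 * dl + lam * (1 - dl) in ds.
pose rho := 2 `^ (d%:R * kap) / Q.
have rho0 : 0 < rho by rewrite divr_gt0// powR_gt0.
have rho1 : rho < 1.
  rewrite ltr_pdivrMr// mul1r /powR.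
  by rewrite (gt_eqF (ltr0Sn R 1)) ltr_expR ltr_pM2r// ln_gt0// ltr1n.
pose M := Q ^+ 5 * (K ^+ 3 * (I2 R d + Cpure R d)).
have I0 := I2_ge0 R d.
have Cp0 : 0 <= Cpure R d.
  by rewrite /Cpure addr_ge0// !mulr_ge0// !exprn_ge0.
have M0 : 0 <= M.
  apply: mulr_ge0; first exact/ltW/Qj0.
  by apply: mulr_ge0; [exact: exprn_ge0|exact: addr_ge0].
exists (M / (1 - rho)); first by rewrite divr_ge0// subr_ge0 ltW.
move=> f g x c a b e A B j k n nf ng hc ha hb he A0 B0 hu hv kj jk jn.
have F0 := Fm_ge0 s0 nf hc ha j.
have G0 := Fm_ge0 s0 ng hb he k.
set X := Q ^+ j * _; have X0 : 0 <= X by apply: mulr_ge0; [exact/ltW/Qj0|exact: mulr_ge0].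
set Y := A * B; have Y0 : 0 <= Y by exact/ltW/mulr_gt0.
set Z := X `^ dl * Y `^ (1 - dl); have Z0 : 0 <= Z by rewrite mulr_ge0 ?powR_ge0.
have bfg : BM (fun y => conv (kpsi j) f y * conv (kpsi k) g y).
  by apply: BM_M; apply: BM_conv => //; exact: BM_nice.
have -> : conv (tau s kkap n) (fun y => conv (kpsi j) f y * conv (kpsi k) g y) x =
    \sum_(i < n.+1) Q ^+ i * conv (kkap i) (fun y => conv (kpsi j) f y * conv (kpsi k) g y) x.
  exact: (tau_conv Hkap n x bfg).
rewrite -(big_mkord xpredT (fun i => Q ^+ i * conv (kkap i) (fun y => conv (kpsi j) f y * conv (kpsi k) g y) x)).
have jn6 : (j + 6 <= n.+1)%N by rewrite addnS ltnS.
rewrite (big_cat_nat (leq0n _) jn6)/=.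
rewrite [X in _ + X]big_nat_cond [X in _ + X]big1 ?addr0; last first.
  by move=> i /andP[/andP[ji _] _]; rewrite hh_vanish ?mulr0.
(* The sum is re-indexed by t = j + 5 - i, the number of octaves by which the output block lies
   below 2^(j+5). *)
rewrite big_nat_rev/= add0n.
apply: (le_trans (ler_norm_sum _ _ _)).
apply: (@le_trans _ _ (\sum_(0 <= t < j + 6) M * Z * rho ^+ t)); last first.
  rewrite -mulr_sumr mulrAC ler_wpM2r//; last exact: (ler_wpM2l M0 (geometric_le _ (ltW rho0) rho1)).
rewrite big_nat_cond [leRHS]big_nat_cond; apply: ler_sum => t /andP[/andP[_ tj] _].
rewrite (_ : (j + 6 - t.+1 = j + 5 - t)%N); last by rewrite addnS subSS.
have tj' : (t <= j + 5)%N by move: tj; rewrite addnS ltnS.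
set i := (j + 5 - t)%N.
have it : (i + t = j + 5)%N by rewrite subnK.
have Qi : Q ^+ i = Q ^+ j * Q ^+ 5 / Q ^+ t by rewrite -exprD -it exprD mulfK.
have ij : (i <= j + 8)%N by apply: (@leq_trans (j + 5)); [exact: leq_subr|rewrite leq_add2l].
have ik : (i <= k + 8)%N.
  apply: (@leq_trans (j + 5)); first exact: leq_subr.
  by rewrite (_ : (k + 8 = k + 3 + 5)%N) ?leq_add2r// -addnA.
have kt : (k <= i + t)%N by rewrite it; apply: leq_trans kj _; rewrite leq_add2l.
have jt : (j <= i + t)%N by rewrite it leq_addr.
have h1 := lossy Hkap nf ng hc ha hb he jt kt.
have h2 := pure nf ng A0 B0 hu hv u1 v1 l0 uv ij ik kt.
set T := la t ^+ d in h1 h2; have T0 : 0 < T by exact: exprn_gt0.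
rewrite absM (ger0_norm (ltW (Qj0 _))).
set c0 := `|conv _ _ _| in h1 h2 *.
have K3 : 0 <= K ^+ 3 by exact: exprn_ge0.
have QQ : 0 <= Q ^+ 5 / Q ^+ t by rewrite divr_ge0// ltW.
have e1 : Q ^+ i * c0 <= M / Q ^+ t * (T ^+ 4 * X).
  apply: (le_trans (ler_wpM2l (ltW (Qj0 i)) h1)); rewrite Qi.
  rewrite [leLHS](_ : _ = Q ^+ 5 / Q ^+ t * (K ^+ 3 * I2 R d) * (T ^+ 4 * X)); last by rewrite /X; ring.
  rewrite [M / _](_ : _ = Q ^+ 5 / Q ^+ t * (K ^+ 3 * (I2 R d + Cpure R d))); last by rewrite /M; ring.
  apply: ler_wpM2r; first by rewrite mulr_ge0// exprn_ge0// ltW.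
  by rewrite ler_wpM2l// ler_wpM2l// lerDl.
have e2 : Q ^+ i * c0 <= M / Q ^+ t * (T `^ lam * Y).
  apply: (le_trans (ler_wpM2l (ltW (Qj0 i)) h2)); rewrite Qi.
  rewrite [leLHS](_ : _ = Q ^+ 5 / Q ^+ t * (K ^+ 3 * Cpure R d) * (T `^ lam * Y)); last first.
    by rewrite /Y; field; rewrite !Qjn.
  rewrite [M / _](_ : _ = Q ^+ 5 / Q ^+ t * (K ^+ 3 * (I2 R d + Cpure R d))); last by rewrite /M; ring.
  apply: ler_wpM2r; first by rewrite mulr_ge0 ?powR_ge0.
  by rewrite ler_wpM2l// ler_wpM2l// lerDr.
have m0 : 0 <= M / Q ^+ t := divr_ge0 M0 (ltW (Qj0 t)).
have q0 : 0 <= Q ^+ i * c0 := mulr_ge0 (ltW (Qj0 i)) (normr_ge0 _).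
(* The losses T^4 and T^lam combine to T^kap = 2^(t d kap); against the factor Q^-t this leaves
   rho^t with rho < 1. *)
apply: (le_trans (le_interp q0 e1 e2 (ltW d0) d1)).
have T4 : 0 <= T ^+ 4 by rewrite exprn_ge0// ltW.
have -> : (M / Q ^+ t * (T ^+ 4 * X)) `^ dl = (M / Q ^+ t) `^ dl * (T `^ (4 * dl) * X `^ dl).
  rewrite (powRM dl m0 (mulr_ge0 T4 X0)) (powRM dl T4 X0); congr (_ * (_ * _)).
  by rewrite powRrM powR_mulrn// ltW.
have -> : (M / Q ^+ t * (T `^ lam * Y)) `^ (1 - dl) =
    (M / Q ^+ t) `^ (1 - dl) * (T `^ (lam * (1 - dl)) * Y `^ (1 - dl)).
  rewrite (powRM _ m0 (mulr_ge0 (powR_ge0 T lam) Y0)) (powRM _ (powR_ge0 T lam) Y0).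
  by rewrite -powRrM.
have Tk : T `^ (4 * dl) * T `^ (lam * (1 - dl)) = (2 `^ (d%:R * kap)) ^+ t.
  rewrite -powR_dyadic -/T -powRD//.
  by apply/implyP => _; exact: lt0r_neq0.
have Mk := powR_conv dl m0.
rewrite [leLHS](_ : _ = ((M / Q ^+ t) `^ dl * (M / Q ^+ t) `^ (1 - dl)) *
   (T `^ (4 * dl) * T `^ (lam * (1 - dl))) * Z); last by rewrite /Z; ring.
rewrite Mk Tk /rho expr_div_n le_eqVlt; apply/orP; left; apply/eqP; ring.
Qed.

End high_high.

(** * Summation over the blocks *)

Section sums.
Variables (R : realType).
Implicit Types (q x t : R) (n j : nat).

Lemma powR_expR (x p : R) : expR x `^ p = expR (p * x).
Proof. by rewrite /powR gt_eqF ?expR_gt0// expRK. Qed.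

(* The potential x / (1 + x) increases by at least a multiple of min(x, 1/x)
   when x is multiplied by q. *)
Lemma geo_two_sided q x n : 1 < q -> 0 < x ->
  \sum_(j < n) Num.min (q ^+ j * x) (q ^+ j * x)^-1 <= 4 * q / (q - 1).
Proof.
move=> q1 x0; pose phi y : R := y / (1 + y).
have step y : 0 < y -> Num.min y y^-1 <= 4 * q / (q - 1) * (phi (q * y) - phi y).
  move=> y0; have q0 : 0 < q by lra.
  have -> : phi (q * y) - phi y = (q - 1) * y / ((1 + q * y) * (1 + y)).
    by rewrite /phi; field; apply/andP; split; rewrite gt_eqF//; nra.
  have -> : 4 * q / (q - 1) * ((q - 1) * y / ((1 + q * y) * (1 + y))) =
      4 * q * y / ((1 + q * y) * (1 + y)).
    by field; apply/and3P; split; rewrite gt_eqF//; nra.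
  have p0 : 0 < (1 + q * y) * (1 + y) by nra.
  have [y1|y1] := leP y 1.
    apply: (@le_trans _ _ y); first by rewrite ge_min lexx.
    rewrite ler_pdivlMr//.
    have a1 : 1 + q * y <= 2 * q by nra.
    have a2 : 1 + y <= 2 by lra.
    have a3 : (1 + q * y) * (1 + y) <= 2 * q * 2 by apply: ler_pM => //; nra.
    by rewrite [leRHS](_ : _ = y * (2 * q * 2)); [rewrite ler_wpM2l// ltW|ring].
  apply: (@le_trans _ _ y^-1); first by rewrite ge_min lexx orbT.
  rewrite ler_pdivlMr// mulrC ler_pdivrMr//.
  have h1 : 1 + q * y <= 2 * (q * y) by nra.
  have h2 : 1 + y <= 2 * y by nra.
  apply: (@le_trans _ _ (2 * (q * y) * (2 * y))); first by apply: ler_pM => //; nra.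
  by rewrite le_eqVlt; apply/orP; left; apply/eqP; ring.
have c0 : 0 <= 4 * q / (q - 1) by rewrite divr_ge0//; lra.
have pos j : 0 < q ^+ j * x by rewrite mulr_gt0// exprn_gt0//; lra.
have phi01 y : 0 < y -> 0 <= phi y <= 1.
  by move=> y0; rewrite /phi divr_ge0 ?ler_pdivrMr /=; lra.
suff H : \sum_(j < n) Num.min (q ^+ j * x) (q ^+ j * x)^-1 <=
    4 * q / (q - 1) * (phi (q ^+ n * x) - phi x).
  apply: (le_trans H); rewrite -[leRHS]mulr1 ler_wpM2l//.
  have /andP[a1 a2] := phi01 _ (pos n); have /andP[b1 b2] := phi01 _ x0; lra.
elim: n => [|n ih]; first by rewrite big_ord0 expr0 mul1r subrr mulr0.
rewrite big_ord_recr/=.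
have := step _ (pos n); rewrite mulrA -exprS => h.
apply: (le_trans (lerD ih h)); rewrite -mulrDr ler_wpM2l//; lra.
Qed.

Lemma young_sum (x y th : R) : 0 < x -> 0 < y -> 0 <= th <= 1 -> x `^ (1 - th) * y `^ th <= x + y.
Proof.
move=> x0 y0 /andP[t0 t1]; have xy : 0 < x + y by lra.
apply: (@le_trans _ _ ((x + y) `^ (1 - th) * (x + y) `^ th)); last first.
  by rewrite mulrC powR_conv// ltW.
apply: ler_pM; rewrite ?powR_ge0//; apply: ge0_ler_powR; rewrite ?nnegrE; lra.
Qed.

Variable s : R.
Hypothesis s0 : 0 < s.
Local Notation Q := (2 `^ s).
Local Notation l2 := (ln (2 : R)).
Let l20 : 0 < l2. Proof. by rewrite ln_gt0// ltr1n. Qed.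

Lemma Q_exp j : Q ^+ j = expR (j%:R * (s * l2)).
Proof.
rewrite expRM_natl; congr (_ ^+ _).
by rewrite /powR (gt_eqF (ltr0Sn R 1)).
Qed.

Lemma two_exp j : (2 : R) ^+ j = expR (j%:R * l2).
Proof. by rewrite expRM_natl lnK// posrE. Qed.

(** The two entries of the minimum balance where Q^j = a/c. There the term has the size of the right
    side, and it decays geometrically in both directions because 0 < th < 1. In logarithmic form
    this is [geo_two_sided]. *)
Lemma sum_Fm (th dl : R) : 0 < th -> th < 1 -> 0 < dl -> exists2 C, 0 < C &
  forall c a n, 0 < c -> 0 < a ->
  \sum_(j < n) ((Q ^+ j) `^ (1 - th) * Fm s c a j) `^ dl <= C * (a `^ (1 - th) * c `^ th) `^ dl.
Proof.
move=> t0 t1 d0; pose rho := dl * Num.min th (1 - th).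
have m0 : 0 < Num.min th (1 - th) by rewrite lt_min t0 subr_gt0.
have r0 : 0 < rho by rewrite mulr_gt0.
have r1 : rho <= dl * th by rewrite ler_pM2l// ge_min lexx.
have r2 : rho <= dl * (1 - th) by rewrite ler_pM2l// ge_min lexx orbT.
pose q := expR (rho * (s * l2)).
have q1 : 1 < q by rewrite -expR0 ltr_expR !mulr_gt0.
exists (4 * q / (q - 1)); first by rewrite divr_gt0 ?mulr_gt0 ?expR_gt0// subr_gt0.
move=> c a n c0 a0.
have cE : c = expR (ln c) by rewrite lnK.
have aE : a = expR (ln a) by rewrite lnK.
set E := (a `^ (1 - th) * c `^ th) `^ dl.
have EE : E = expR (dl * ((1 - th) * ln a + th * ln c)).
  by rewrite /E {1}aE {1}cE !powR_expR -expRD powR_expR.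
have E0 : 0 < E by rewrite EE expR_gt0.
pose x := expR (rho * (ln c - ln a)).
apply: (@le_trans _ _ (\sum_(j < n) E * Num.min (q ^+ j * x) (q ^+ j * x)^-1)); last first.
  by rewrite -mulr_sumr mulrC ler_wpM2r ?(ltW E0)// geo_two_sided// expR_gt0.
apply: ler_sum => j _.
set t := j%:R * (s * l2) + ln c - ln a.
have zE : q ^+ j * x = expR (rho * t).
  by rewrite /q -expRM_natl -expRD; congr expR; rewrite /t; ring.
rewrite zE -expRN.
have T : ((Q ^+ j) `^ (1 - th) * Fm s c a j) `^ dl <=
    expR (dl * ((1 - th) * ln a + th * ln c + (1 - th) * t)) /\
    ((Q ^+ j) `^ (1 - th) * Fm s c a j) `^ dl <=
    expR (dl * ((1 - th) * ln a + th * ln c - th * t)).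
  have F0 : 0 <= Fm s c a j.
    by rewrite le_min (ltW c0) mulr_ge0 ?(ltW a0)// invr_ge0 exprn_ge0 ?powR_ge0.
  have P0 := powR_ge0 (Q ^+ j) (1 - th).
  split.
  - apply: (@le_trans _ _ (((Q ^+ j) `^ (1 - th) * c) `^ dl)).
      apply: ge0_ler_powR; rewrite ?nnegrE ?mulr_ge0 ?(ltW c0) ?(ltW d0)//.
      by rewrite ler_wpM2l// ge_min lexx.
    rewrite Q_exp powR_expR {1}cE -expRD powR_expR ler_expR le_eqVlt; apply/orP; left.
    by apply/eqP; rewrite /t; ring.
  - apply: (@le_trans _ _ (((Q ^+ j) `^ (1 - th) * (Q ^- j * a)) `^ dl)).
      apply: ge0_ler_powR; rewrite ?nnegrE ?mulr_ge0 ?(ltW d0) ?invr_ge0 ?exprn_ge0 ?powR_ge0 ?(ltW a0)//.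
      by rewrite ler_wpM2l// ge_min lexx orbT.
    rewrite Q_exp powR_expR {1}aE -expRN -2!expRD powR_expR ler_expR le_eqVlt; apply/orP; left.
    by apply/eqP; rewrite /t; ring.
have [T1 T2] := T; rewrite EE.
suff [h1 h2] : ((Q ^+ j) `^ (1 - th) * Fm s c a j) `^ dl <=
    expR (dl * ((1 - th) * ln a + th * ln c)) * expR (rho * t) /\
    ((Q ^+ j) `^ (1 - th) * Fm s c a j) `^ dl <=
    expR (dl * ((1 - th) * ln a + th * ln c)) * expR (- (rho * t)).
  by case: (leP (expR (rho * t)) (expR (- (rho * t)))).
rewrite -!expRD; have [h|h] := leP t 0.
  by split; apply: (le_trans T1); rewrite ler_expR mulrDr lerD2l; nra.
by split; apply: (le_trans T2); rewrite ler_expR mulrBr lerD2l; nra.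
Qed.

Lemma sum_Fm1 (th : R) : 0 < th -> th < 1 -> exists2 C, 0 < C &
  forall c a n, 0 < c -> 0 < a ->
  \sum_(j < n) (Q ^+ j) `^ (1 - th) * Fm s c a j <= C * (a `^ (1 - th) * c `^ th).
Proof.
move=> t0 t1; have [C C0 H] := sum_Fm t0 t1 ltr01; exists C => // c a n c0 a0.
have P : 0 <= a `^ (1 - th) * c `^ th := mulr_ge0 (powR_ge0 _ _) (powR_ge0 _ _).
have := H c a n c0 a0; rewrite (powRr1 P); apply: le_trans; apply: ler_sum => j _.
have F0 : 0 <= Fm s c a j.
  by rewrite le_min (ltW c0) mulr_ge0 ?(ltW a0)// invr_ge0 exprn_ge0 ?powR_ge0.
by rewrite (powRr1 (mulr_ge0 (powR_ge0 (Q ^+ j) (1 - th)) F0)).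
Qed.

End sums.

(** * The sum over all pairs of blocks *)

Section core.
Variables (R : realType) (d : nat) (s : R).
Hypothesis s0 : 0 < s.
Local Notation V := 'rV[R]_d.
Local Notation mu := (lebesgue_rV R d).
Local Notation Q := (2 `^ s).
Local Notation D := (mult (@mB R d s)).
Implicit Types (f g h : V -> R) (x y xi eta : V) (j k n i t : nat).
Variables (K : R) (kpsi klam kkap kE : nat -> V -> R).
Hypothesis K0 : 0 <= K.
Hypothesis Hpsi : kpack 8 K kpsi (@bl R d).
Hypothesis Hlam : kpack 8 K klam (fun j xi => Q ^+ j * (bl j xi / mB s xi)).
Hypothesis Hkap : kpack 8 K kkap (fun j xi => Q ^- j * (mB s xi * bl j xi)).
Hypothesis HE : kpack 8 K kE (fun j xi => Q ^- j * (mB s xi * chi j (ep4 R j * sq xi))).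

Local Notation la j := ((2 : R) ^+ j).
Local Notation l2 := (ln (2 : R)).
Let la0 j : 0 < la j. Proof. exact: exprn_gt0. Qed.
Let Q0 : 0 < Q. Proof. exact: powR_gt0. Qed.
Let Qj0 j : 0 < Q ^+ j. Proof. exact: exprn_gt0. Qed.
Let l20 : 0 < l2. Proof. by rewrite ln_gt0// ltr1n. Qed.

(** Any th in ]0, 1[ with th s <= 1 would do: [freq_split] must absorb both Q^j 2^(k-j) and Q^k into
    Q^(j(1-th)) Q^(k th), so that the double sum factors into two sums of the form [sum_Fm]. *)
Let th : R := (1 + s)^-1.
Let th0 : 0 < th. Proof. by rewrite invr_gt0 addr_gt0. Qed.
Let th1 : th < 1. Proof. by rewrite invf_lt1 ?addr_gt0// ltrDl. Qed.

Let freq_split j k : (k <= j)%N ->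
  Q ^+ j * (la k / la j) <= (Q ^+ j) `^ (1 - th) * (Q ^+ k) `^ th /\
  Q ^+ k <= (Q ^+ j) `^ (1 - th) * (Q ^+ k) `^ th.
Proof.
move=> kj; have kj' : (k%:R : R) <= j%:R by rewrite ler_nat.
have ths : th * s <= 1 by rewrite /th mulrC ler_pdivrMr ?addr_gt0// mul1r lerDr.
have sl : 0 <= s * l2 by rewrite mulr_ge0// ltW.
rewrite !Q_exp !powR_expR !two_exp -expRN -!expRD !ler_expR; split.
- have : 0 <= (j%:R - k%:R) * l2 * (1 - th * s).
    by rewrite !mulr_ge0// ?subr_ge0// ltW.
  lra.
- have : 0 <= (j%:R - k%:R) * (s * l2) * (1 - th).
    by rewrite !mulr_ge0 ?subr_ge0// ltW.
  lra.
Qed.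

(** Near the diagonal the two powers are comparable and are split evenly. The exponent is written
    [1 - 2^-1] to match the form [1 - th] of [sum_Fm]. *)
Let half_split j k : (j <= k + 3)%N -> Q ^+ j <= Q ^+ 3 * ((Q ^+ j) `^ (1 - 2^-1) * (Q ^+ k) `^ (1 - 2^-1)).
Proof.
move=> jk; have jk' : (j%:R : R) <= k%:R + 3%:R by rewrite -natrD ler_nat.
rewrite !Q_exp !powR_expR -!expRD ler_expR.
have : 0 <= (k%:R + 3%:R - j%:R) * (s * l2) by rewrite mulr_ge0 ?subr_ge0// mulr_ge0// ltW.
have : 0 <= s * l2 by rewrite mulr_ge0// ltW.
lra.
Qed.

Lemma Bil_sym f g x n j k : Bil s kpsi kkap f g x n j k = Bil s kpsi kkap g f x n k j.
Proof.
have E : (fun y => conv (kpsi j) f y * conv (kpsi k) g y) =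
    (fun y => conv (kpsi k) g y * conv (kpsi j) f y) by apply/funext => y; exact: mulrC.
by rewrite /Bil E addrAC.
Qed.

Section fixed.
Variables (CH dl : R).
Hypothesis CH0 : 0 <= CH.
Hypothesis dl0 : 0 < dl.
Hypothesis dl1 : dl <= 1.

Let C1 : R := 2 * (K ^+ 3 * I2 R d + K ^+ 2).
Let C2 : R := CH * (Q ^+ 3) `^ dl.
Let C3 : R := 2 * (K ^+ 2 * Q ^+ 3).

Let C10 : 0 <= C1. Proof. by rewrite mulr_ge0// addr_ge0 ?mulr_ge0 ?exprn_ge0 ?I2_ge0. Qed.
Let C20 : 0 <= C2. Proof. by rewrite mulr_ge0// powR_ge0. Qed.
Let C30 : 0 <= C3. Proof. by rewrite !mulr_ge0 ?exprn_ge0// powR_ge0. Qed.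

(** The right side adds the bounds of all regimes, so that one formula holds for every pair: the
    first two summands serve k + 4 <= j and j + 4 <= k. On the diagonal strip the third bounds the
    two subtracted products and the fourth the high-high term. *)
Lemma Bil_bound f g x c a b e Y j k n :
  nice f -> nice g -> wsup f x c -> wsup (D f) x a -> wsup g x b -> wsup (D g) x e ->
  0 <= Y ->
  ((k <= j + 3)%N -> (j <= k + 3)%N ->
    `|conv (tau s kkap n) (fun y => conv (kpsi j) f y * conv (kpsi k) g y) x| <=
     CH * ((Q ^+ j * (Fm s c a j * Fm s b e k)) `^ dl * Y `^ (1 - dl))) ->
  (j + 2 <= n)%N -> (k + 2 <= n)%N ->
  `|Bil s kpsi kkap f g x n j k| <=
    C1 * (((Q ^+ j) `^ (1 - th) * Fm s c a j) * ((Q ^+ k) `^ th * Fm s b e k)) +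
    C1 * (((Q ^+ j) `^ th * Fm s c a j) * ((Q ^+ k) `^ (1 - th) * Fm s b e k)) +
    C3 * (((Q ^+ j) `^ (1 - 2^-1) * Fm s c a j) * ((Q ^+ k) `^ (1 - 2^-1) * Fm s b e k)) +
    C2 * Y `^ (1 - dl) * (((Q ^+ j) `^ (1 - 2^-1) * Fm s c a j) `^ dl * ((Q ^+ k) `^ (1 - 2^-1) * Fm s b e k) `^ dl).
Proof.
move=> nf ng hc ha hb he Y0 HH jn kn.
have F0 := Fm_ge0 s0 nf hc ha j; have G0 := Fm_ge0 s0 ng hb he k.
have pow (u v : R) : 0 <= u `^ v by exact: powR_ge0.
have off (f' g' : V -> R) c' a' b' e' j' k' : nice f' -> nice g' -> wsup f' x c' -> wsup (D f') x a' ->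
    wsup g' x b' -> wsup (D g') x e' -> (k' + 4 <= j')%N -> (j' + 2 <= n)%N ->
    `|Bil s kpsi kkap f' g' x n j' k'| <=
    C1 * (((Q ^+ j') `^ (1 - th) * Fm s c' a' j') * ((Q ^+ k') `^ th * Fm s b' e' k')).
  move=> nf' ng' hc' ha' hb' he' kj' jn'.
  have F0' := Fm_ge0 s0 nf' hc' ha' j'; have G0' := Fm_ge0 s0 ng' hb' he' k'.
  apply: (le_trans (offdiag_bound s0 K0 Hpsi Hlam Hkap HE nf' ng' hc' ha' hb' he' kj' jn')).
  have [h1 h2] := freq_split (leq_trans (leq_addr 4 k') kj').
  rewrite /C1 [leRHS](_ : _ = (K ^+ 3 * I2 R d + K ^+ 2) *
     ((2 * ((Q ^+ j') `^ (1 - th) * (Q ^+ k') `^ th)) * (Fm s c' a' j' * Fm s b' e' k'))); last by ring.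
  apply: ler_wpM2l; first by rewrite addr_ge0 ?mulr_ge0 ?exprn_ge0 ?I2_ge0.
  apply: ler_wpM2r; first exact: mulr_ge0.
  by rewrite mulr_natl mulr2n; exact: lerD.
set t1 := C1 * _; set t2 := C1 * _; set t3 := C3 * _; set t4 := C2 * _ * _.
have t10 : 0 <= t1 by rewrite mulr_ge0// mulr_ge0// mulr_ge0.
have t20 : 0 <= t2 by rewrite mulr_ge0// mulr_ge0// mulr_ge0.
have t30 : 0 <= t3 by rewrite mulr_ge0// mulr_ge0// mulr_ge0.
have t40 : 0 <= t4 by rewrite mulr_ge0// mulr_ge0.
have [kj|kj] := leqP (k + 4) j.
  by have := off _ _ _ _ _ _ _ _ nf ng hc ha hb he kj jn; rewrite -/t1; lra.
have [jk|jk] := leqP (j + 4) k.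
  have := off _ _ _ _ _ _ _ _ ng nf hb he hc ha jk kn; rewrite -Bil_sym.
  by rewrite [X in C1 * X]mulrC -/t2; lra.
have kj3 : (k <= j + 3)%N by rewrite -ltnS -addnS.
have jk3 : (j <= k + 3)%N by rewrite -ltnS -addnS.
have h0 := HH kj3 jk3.
have hj := half_split jk3; have hk := half_split kj3; rewrite [X in Q ^+ 3 * X]mulrC in hk.
set hf := (Q ^+ j) `^ (1 - 2^-1) in hj hk t3 t4 t30 t40 *; set hg := (Q ^+ k) `^ (1 - 2^-1) in hj hk t3 t4 t30 t40 *.
have hf0 : 0 <= hf by exact: powR_ge0. have hg0 : 0 <= hg by exact: powR_ge0.
have FG0 := mulr_ge0 F0 G0.
have b4 : CH * ((Q ^+ j * (Fm s c a j * Fm s b e k)) `^ dl * Y `^ (1 - dl)) <= t4.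
  rewrite /t4 /C2 [leRHS](_ : _ = CH * (((Q ^+ 3) `^ dl * ((hf * Fm s c a j) `^ dl * (hg * Fm s b e k) `^ dl)) * Y `^ (1 - dl))); last by ring.
  apply: ler_wpM2l => //; apply: ler_wpM2r => //.
  rewrite -(powRM dl (mulr_ge0 hf0 F0) (mulr_ge0 hg0 G0)).
  rewrite -(powRM dl (ltW (Qj0 3)) (mulr_ge0 (mulr_ge0 hf0 F0) (mulr_ge0 hg0 G0))).
  apply: ge0_ler_powR; [exact: ltW| | |].
  - by rewrite nnegrE mulr_ge0// ltW.
  - by rewrite nnegrE; apply: mulr_ge0; [exact: ltW|apply: mulr_ge0; exact: mulr_ge0].
  rewrite [leRHS](_ : _ = Q ^+ 3 * (hf * hg) * (Fm s c a j * Fm s b e k)); last by ring.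
  exact: ler_wpM2r.
have p1 := piece0 s0 K0 Hpsi Hlam nf hc ha j.
have p2 := piece_kap s0 K0 Hpsi Hkap nf hc ha j.
have p3 := piece0 s0 K0 Hpsi Hlam ng hb he k.
have p4 := piece_kap s0 K0 Hpsi Hkap ng hb he k.
have loc (q z w P G F : R) : `|z| <= K * F -> `|w| <= K * G -> 0 <= q -> q <= P -> 0 <= F * G ->
    `|z * (q * w)| <= K ^+ 2 * P * (F * G).
  move=> hz hw q0 qP FG; rewrite !absM (ger0_norm q0) mulrCA.
  rewrite (_ : K ^+ 2 * P * (F * G) = P * ((K * F) * (K * G))); last by ring.
  by apply: ler_pM => //; exact: ler_pM.
have b5 : `|conv (kpsi j) f x * (Q ^+ k * conv (kkap k) g x)| <= K ^+ 2 * (Q ^+ 3 * (hf * hg)) * (Fm s c a j * Fm s b e k).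
  exact: (loc _ _ _ _ _ _ p1 p4 (ltW (Qj0 k)) hk FG0).
have b6 : `|conv (kpsi k) g x * (Q ^+ j * conv (kkap j) f x)| <= K ^+ 2 * (Q ^+ 3 * (hf * hg)) * (Fm s b e k * Fm s c a j).
  by apply: (loc _ _ _ _ _ _ p3 p2 (ltW (Qj0 j)) hj); rewrite mulrC.
have b3 : K ^+ 2 * (Q ^+ 3 * (hf * hg)) * (Fm s c a j * Fm s b e k) +
   K ^+ 2 * (Q ^+ 3 * (hf * hg)) * (Fm s b e k * Fm s c a j) = t3.
  by rewrite /t3 /C3; ring.
rewrite /Bil; apply: (@le_trans _ _ (t4 + t3)); last by lra.
rewrite -b3 addrA; apply normB_le => //; apply normB_le => //.
exact: le_trans h0 b4.
Qed.

(** Each summand of [Bil_bound] is a product of a function of j and a function of k. The factors sum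
    to powers of a, c and of b, e whose product is a weighted geometric mean of a b and c e, hence
    at most their sum. *)
Lemma Bil_sum : exists2 C, 0 <= C & forall f g x c a b e Y N n,
  nice f -> nice g -> wsup f x c -> wsup (D f) x a -> wsup g x b -> wsup (D g) x e ->
  0 < c -> 0 < a -> 0 < b -> 0 < e -> 0 <= Y -> Y <= a * b ->
  (forall j k, (k <= j + 3)%N -> (j <= k + 3)%N -> (j + 5 <= n)%N ->
    `|conv (tau s kkap n) (fun y => conv (kpsi j) f y * conv (kpsi k) g y) x| <=
     CH * ((Q ^+ j * (Fm s c a j * Fm s b e k)) `^ dl * Y `^ (1 - dl))) ->
  (N + 5 <= n)%N ->
  \sum_(j < N) \sum_(k < N) `|Bil s kpsi kkap f g x n j k| <= C * (a * b + c * e).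
Proof.
have hf : 0 < 2^-1 :> R by rewrite invr_gt0.
have hf1 : 2^-1 < 1 :> R by rewrite invf_lt1// ltr1n.
have [S1 S10 H1] := sum_Fm1 s0 th0 th1.
have th0' : 0 < 1 - th by rewrite subr_gt0.
have th1' : 1 - th < 1 by rewrite gtrBl.
have [S2 S20 H2] := sum_Fm1 s0 th0' th1'.
have [S3 S30 H3] := sum_Fm1 s0 hf hf1.
have [S4 S40 H4] := sum_Fm s0 hf hf1 dl0.
exists (C1 * (S1 * S2) + C1 * (S2 * S1) + C3 * (S3 * S3) + C2 * (S4 * S4)).
  by apply: addr_ge0; first (apply: addr_ge0; first apply: addr_ge0);
    (apply: mulr_ge0 => //; apply: mulr_ge0; exact: ltW).
move=> f g x c a b e Y N n nf ng hc ha hb he c0 a0 b0 e0 Y0 Yab HH Nn.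
have F0 j : 0 <= Fm s c a j := Fm_ge0 s0 nf hc ha j.
have G0 j : 0 <= Fm s b e j := Fm_ge0 s0 ng hb he j.
set Z := a * b + c * e.
have ab0 : 0 < a * b by exact: mulr_gt0. have ce0 : 0 < c * e by exact: mulr_gt0.
have Z0 : 0 < Z by exact: addr_gt0.
have mixE (t : R) : a `^ (1 - t) * c `^ t * (b `^ (1 - t) * e `^ t) = (a * b) `^ (1 - t) * (c * e) `^ t.
  by rewrite (powRM _ (ltW a0) (ltW b0)) (powRM _ (ltW c0) (ltW e0)); ring.
have mix (t : R) : 0 <= t <= 1 -> a `^ (1 - t) * c `^ t * (b `^ (1 - t) * e `^ t) <= Z.
  by move=> t01; rewrite mixE; exact: young_sum.
have halfE : 1 - 2^-1 = 2^-1 :> R by rewrite {1}[1]splitr div1r addrK.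
have sub1 (t : R) : 1 - (1 - t) = t by rewrite opprB addrC subrK.
apply: (@le_trans _ _ (\sum_(j < N) \sum_(k < N) (
    C1 * (((Q ^+ j) `^ (1 - th) * Fm s c a j) * ((Q ^+ k) `^ th * Fm s b e k)) +
    C1 * (((Q ^+ j) `^ th * Fm s c a j) * ((Q ^+ k) `^ (1 - th) * Fm s b e k)) +
    C3 * (((Q ^+ j) `^ (1 - 2^-1) * Fm s c a j) * ((Q ^+ k) `^ (1 - 2^-1) * Fm s b e k)) +
    C2 * Y `^ (1 - dl) * (((Q ^+ j) `^ (1 - 2^-1) * Fm s c a j) `^ dl * ((Q ^+ k) `^ (1 - 2^-1) * Fm s b e k) `^ dl)))).
  apply: ler_sum => j _; apply: ler_sum => k _.
  have lN (i : 'I_N) m : (m <= 5)%N -> (i + m <= n)%N.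
    by move=> m5; apply: leq_trans Nn; apply: leq_add m5; exact: ltnW.
  apply: (Bil_bound nf ng hc ha hb he Y0); last 2 first.
  - exact: lN.
  - exact: lN.
  by move=> kj jk; apply: HH => //; exact: lN.
rewrite (eq_bigr (fun j : 'I_N =>
   (C1 * \sum_(k < N) ((Q ^+ j) `^ (1 - th) * Fm s c a j) * ((Q ^+ k) `^ th * Fm s b e k)) +
   (C1 * \sum_(k < N) ((Q ^+ j) `^ th * Fm s c a j) * ((Q ^+ k) `^ (1 - th) * Fm s b e k)) +
   (C3 * \sum_(k < N) ((Q ^+ j) `^ (1 - 2^-1) * Fm s c a j) * ((Q ^+ k) `^ (1 - 2^-1) * Fm s b e k)) +
   (C2 * Y `^ (1 - dl) * \sum_(k < N) ((Q ^+ j) `^ (1 - 2^-1) * Fm s c a j) `^ dl * ((Q ^+ k) `^ (1 - 2^-1) * Fm s b e k) `^ dl))); last first.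
  by move=> j _; rewrite !big_split/= -!mulr_sumr.
rewrite !big_split/= -!mulr_sumr -!big_distrlr/=.
have pw (F : 'I_N -> R) : (forall i : 'I_N, 0 <= F i) -> 0 <= \sum_(i < N) F i.
  by move=> F_; apply: sumr_ge0.
have P (u v : R) : 0 <= u `^ v by exact: powR_ge0.
have A1 := H1 c a N c0 a0; have B1 := H1 b e N b0 e0.
have A2 := H2 c a N c0 a0; have B2 := H2 b e N b0 e0.
have A3 := H3 c a N c0 a0; have B3 := H3 b e N b0 e0.
have A4 := H4 c a N c0 a0; have B4 := H4 b e N b0 e0.
rewrite sub1 in A2; rewrite sub1 in B2.
rewrite [leRHS](_ : _ = C1 * (S1 * S2 * Z) + C1 * (S2 * S1 * Z) + C3 * (S3 * S3 * Z) + C2 * (S4 * S4) * Z); last by ring.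
have prod (x1 x2 y1 y2 T1 T2 : R) : 0 <= x1 -> 0 <= x2 -> 0 <= T1 -> 0 <= T2 ->
    x1 <= T1 * y1 -> x2 <= T2 * y2 -> y1 * y2 <= Z -> x1 * x2 <= T1 * T2 * Z.
  move=> x10 x20 T10 T20 h1 h2 yZ; apply: (le_trans (ler_pM x10 x20 h1 h2)).
  by rewrite mulrACA ler_wpM2l// mulr_ge0.
have s1 := ltW S10; have s2 := ltW S20; have s3 := ltW S30; have s4 := ltW S40.
have th01 : 0 <= th <= 1 by rewrite !ltW.
have half01 : 0 <= (2^-1 : R) <= 1 by rewrite !ltW.
apply: lerD; first apply: lerD; first apply: lerD.
- apply: ler_wpM2l => //; apply: (prod _ _ _ _ _ _ _ _ s1 s2 A1 B2);
    try (by apply: pw => i; rewrite mulr_ge0).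
  by rewrite [e `^ _ * _]mulrC; exact: mix.
- apply: ler_wpM2l => //; apply: (prod _ _ _ _ _ _ _ _ s2 s1 A2 B1);
    try (by apply: pw => i; rewrite mulr_ge0).
  by rewrite [a `^ _ * _]mulrC [e `^ _ * _]mulrC; rewrite mulrACA [c `^ _ * _]mulrC mulrACA [X in _ * X]mulrC;
     have := mix (1 - th); rewrite sub1 => H; apply: le_trans (H _);
     [rewrite le_eqVlt; apply/orP; left; apply/eqP; ring|rewrite subr_ge0 gerBl !ltW].
- apply: ler_wpM2l => //; apply: (prod _ _ _ _ _ _ _ _ s3 s3 A3 B3);
    try (by apply: pw => i; rewrite mulr_ge0).
  have := mix 2^-1 half01.
  rewrite halfE.
  by move=> H; apply: le_trans H; rewrite le_eqVlt; apply/orP; left; apply/eqP; ring.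
- rewrite -[leLHS]mulrA -[leRHS]mulrA; apply: ler_wpM2l => //.
  set W := a `^ (1 - 2^-1) * c `^ 2^-1 * (e `^ (1 - 2^-1) * b `^ 2^-1).
  have W0 : 0 <= W by rewrite !mulr_ge0.
  have WZ : W <= Z.
    have := mix 2^-1 half01; rewrite /W.
    rewrite halfE.
    by move=> H; apply: le_trans H; rewrite le_eqVlt; apply/orP; left; apply/eqP; ring.
  apply: (@le_trans _ _ (Y `^ (1 - dl) * (S4 * S4 * W `^ dl))).
    apply: ler_wpM2l; first exact: P.
    apply: (le_trans (ler_pM _ _ A4 B4)); try (by apply: pw => i).
    by rewrite mulrACA /W [in leRHS](powRM _ (mulr_ge0 (P _ _) (P _ _)) (mulr_ge0 (P _ _) (P _ _))).
  rewrite mulrCA; apply: ler_wpM2l; first exact: mulr_ge0.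
  have d1 : 0 <= 1 - dl by rewrite subr_ge0.
  apply: (@le_trans _ _ (Z `^ (1 - dl) * Z `^ dl)); last first.
    by rewrite mulrC powR_conv// ltW.
  apply: ler_pM => //; apply: ge0_ler_powR => //; rewrite ?nnegrE ?(ltW Z0) ?(ltW dl0)//.
  by apply: (le_trans Yab); rewrite lerDl ltW.
Qed.

End fixed.
End core.

(** * Removing the frequency truncation *)

Section limits.
Variables (R : realType) (d : nat) (s : R).
Hypothesis s0 : 0 < s.
Local Notation V := 'rV[R]_d.
Local Notation mu := (lebesgue_rV R d).
Local Notation Q := (2 `^ s).
Local Notation D := (mult (@mB R d s)).
Implicit Types (f g h : V -> R) (x y xi eta : V) (j k n i t M N : nat).

Local Notation la j := ((2 : R) ^+ j).
Let la0 j : 0 < la j. Proof. exact: exprn_gt0. Qed.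
Let Q0 : 0 < Q. Proof. exact: powR_gt0. Qed.
Let Qj0 j : 0 < Q ^+ j. Proof. exact: exprn_gt0. Qed.
Let pm : polyg (@mB R d s). Proof. by apply: polyg_mB; exact: ltW. Qed.

Lemma polyg_Phi M : polyg (@Phi R d M).
Proof.
have [K [K0 HK]] := cutoff_bounded R; apply: (@polyg_bounded R d _ K).
  apply: (measurableT_comp (f := @cutoff R)).
    apply: continuous_measurable_fun => u; have [c dc] := is_derive_cutoff R.
    exact: is_derive_continuous (dc u).
  by apply: measurable_funM => //; exact: measurable_sq.
by move=> xi; exact: HK.
Qed.

(** On the frequencies removed, [wt xi] is at least 2^M, and the transform of a nice function decays
    faster than any power; an arbitrary power of 2^-M can be extracted uniformly in x. *)
Lemma tail_bound m F N : polyg m -> nice F -> exists2 C, 0 <= C & forall M x,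
  `|mult m F x - mult (fun xi => m xi * Phi M xi) F x| <= C * (la M)^-1 ^+ N.
Proof.
move=> pm' nF; have [K [K0 HK]] := cutoff_bounded R.
have [mm [K1 [N1 [K10 H1]]]] := pm'.
have [K2 [K20 H2]] := nice_Cf (N1 + (2 + N))%N nF.
exists (K1 * (1 + K) * K2 * I2 R d).
  by rewrite !mulr_ge0 ?I2_ge0// addr_ge0.
move=> M x; have pP := polygM pm' (polyg_Phi M).
rewrite /mult -RintB; [|exact: intg_mult..].
have r0 : 0 <= (la M)^-1 ^+ N by rewrite exprn_ge0// invr_ge0 ltW.
set r := (la M)^-1 ^+ N in r0 *.
rewrite [leRHS](_ : _ = K1 * (1 + K) * K2 * r * I2 R d); last by ring.
rewrite /I2 -(RintZ _ (intg_wt2 R d)).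
apply: le_norm_Rint; first by apply: intgB; exact: intg_mult.
  by apply: intgZ; exact: intg_wt2.
move=> xi; rewrite -mulrBl -{1}(mulr1 (m xi)) -mulrBr !absM.
have [s1|s1] := leP (ep4 R M * sq xi) 1.
  rewrite Phi1// subrr normr0 mulr0 mul0r mulr_ge0 ?wtV_ge0//.
  by rewrite !mulr_ge0// addr_ge0.
have wM : la M <= wt xi.
  rewrite leNgt; apply/negP => wl; move: s1; rewrite ltNge => /negP[].
  rewrite mulrC ler_pdivrMr ?exprn_gt0// mul1r; apply: (le_trans (sq_le_wt xi)).
  by apply: lerXn2r; rewrite ?nnegrE ?exprn_ge0 ?(ltW wl) ?(ltW (wt_gt0 _)).
have wN : wt xi ^- N <= r.
  by rewrite /r -exprVn; apply: lerXn2r; rewrite ?nnegrE ?invr_ge0 ?(ltW (wt_gt0 _)) ?exprn_ge0// lef_pV2// posrE ?wt_gt0.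
have h3 : `|1 - Phi M xi| <= 1 + K by apply normB_le; rewrite ?normr1//; exact: HK.
apply: (le_trans (ler_pM _ _ (ler_pM _ _ (H1 xi) h3) (H2 x xi))); rewrite ?mulr_ge0//.
have -> : wt xi ^- (N1 + (2 + N)) = wt xi ^- N1 * (wt xi ^- 2 * wt xi ^- N).
  by rewrite exprD invfM exprD invfM.
rewrite [leLHS](_ : _ = K1 * (1 + K) * K2 * (wt xi ^- 2 * wt xi ^- N)); last first.
  by field; rewrite ?wt_neq0 ?wtX_neq0.
rewrite [leRHS](_ : _ = K1 * (1 + K) * K2 * (wt xi ^- 2 * r)); last by ring.
apply: ler_wpM2l; first by rewrite !mulr_ge0// addr_ge0.
by apply: ler_wpM2l => //; exact: wtV_ge0.
Qed.

Lemma le_limit (X B C : R) : 0 <= C -> (forall M, X <= B + C * (la M)^-1) -> X <= B.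
Proof.
move=> C0 H; apply/ler_addgt0Pr => e e0.
pose M := (Num.truncn (C / e)).+1.
apply: (le_trans (H M)); rewrite lerD2l ler_pdivrMr// mulrC -ler_pdivrMr//.
apply: ltW; apply: (lt_le_trans (truncnS_gt _)).
by rewrite -natrX ler_nat -/M ltnW// ltn_expl.
Qed.

Variables (K : R) (kpsi kkap : nat -> V -> R).
Hypothesis K0 : 0 <= K.
Hypothesis Hpsi : kpack 8 K kpsi (@bl R d).
Hypothesis Hkap : kpack 8 K kkap (fun j xi => Q ^- j * (mB s xi * bl j xi)).
Let ikap j : intg mu (kkap j). Proof. by case: Hkap. Qed.
Let ipsi j : intg mu (kpsi j). Proof. by case: Hpsi. Qed.

Lemma sum_mult_bl m f M x : polyg m -> nice f ->
  \sum_(j < M.+1) mult (fun xi => m xi * bl j xi) f x = mult (fun xi => m xi * Phi M xi) f x.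
Proof.
move=> pm' nf; rewrite /mult -Rint_sum; last first.
  by move=> j; apply: intg_mult => //; apply: polygM => //; exact: polyg_bl.
by apply: eq_Rint => xi; rewrite -sum_bl mulr_sumr mulr_suml.
Qed.

Lemma partial_sum f M x : nice f ->
  \sum_(j < M.+1) conv (kpsi j) f x = mult (fun xi => cst 1 xi * Phi M xi) f x.
Proof.
move=> nf; have p1 : polyg (cst 1 : V -> R) by apply: (@polyg_bounded R d (cst 1) 1) => // z; rewrite normr1.
rewrite -(sum_mult_bl _ _ p1 nf); apply: eq_bigr => j _.
rewrite (psi_mult Hpsi _ _ nf); apply: eq_mult => xi; by rewrite mul1r.
Qed.

Lemma partial_kap f M x : nice f ->
  \sum_(j < M.+1) Q ^+ j * conv (kkap j) f x = mult (fun xi => mB s xi * Phi M xi) f x.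
Proof.
move=> nf; have [_ sk _ _] := Hkap.
rewrite -(sum_mult_bl _ _ pm nf); apply: eq_bigr => j _.
rewrite (conv_nice x (ikap j) (sk j) nf).
have pb : polyg (fun xi : V => mB s xi * bl j xi) by apply: polygM => //; exact: polyg_bl.
by rewrite (multZl _ _ pb nf) mulrA divff ?mul1r// gt_eqF.
Qed.

(** A crude exponential bound is enough, since the truncation errors fed into [tau] can be made
    smaller than any given exponential. *)
Lemma tau_L1 : exists2 a, True & forall n, \int[mu]_y `|tau s kkap n y| <= K * I2 R d * (la a.+1) ^+ n.+1.
Proof.
pose a := (Num.truncn s).+1; exists a => // n.
have Qa : Q <= la a.
  by rewrite -(@powR_mulrn R 2)// ler_powR// ?ler1n// ltW// truncnS_gt.
have [_ _ kb _] := Hkap.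
have it := intg_norm (intg_tau Hkap n).
have iw (i : 'I_n.+1) : intg mu (fun y => Q ^+ i * K * wk 8 (la i) y) by apply: intgZ; exact: intg_wk.
apply: (@le_trans _ _ (\int[mu]_y \sum_(i < n.+1) Q ^+ i * K * wk 8 (la i) y)).
  apply: le_Rint => //; first exact: intg_sum.
  move=> y; apply: (le_trans (ler_norm_sum _ _ _)); apply: ler_sum => i _.
  by rewrite absM (ger0_norm (ltW (Qj0 i))) -mulrA ler_wpM2l// ltW.
rewrite Rint_sum//.
apply: (@le_trans _ _ (\sum_(i < n.+1) K * I2 R d * la a ^+ i)).
  apply: ler_sum => i _; rewrite RintZ; last exact: intg_wk.
  rewrite [leLHS](_ : _ = Q ^+ i * (K * \int[mu]_x wk 8 (la i) x)); last by ring.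
  rewrite [leRHS]mulrC; apply: ler_pM.
  - exact: (ltW (Qj0 i)).
  - by apply: mulr_ge0 => //; apply: ge0_Rint => y; exact/wk_ge0/ltW.
  - by apply: lerXn2r => //; rewrite nnegrE ?(ltW Q0) ?(ltW (la0 _)).
  - by rewrite ler_wpM2l//; exact: Rint_wk.
rewrite -mulr_sumr ler_wpM2l ?mulr_ge0 ?I2_ge0//.
elim: n {it iw} => [|n ih].
  by rewrite big_ord_recl big_ord0 addr0 expr0 expr1 exprn_ege1// ler1n.
rewrite big_ord_recr/= (exprS (la a.+1) n.+1).
have h : la a ^+ n.+1 <= la a.+1 ^+ n.+1.
  by apply: lerXn2r; rewrite ?nnegrE ?(ltW (la0 _))//; exact: la_le.
have p : 0 <= la a.+1 ^+ n.+1 by rewrite exprn_ge0// ltW.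
have l2 : 2 <= la a.+1 by rewrite exprS ler_peMr// exprn_ege1// ler1n.
apply: (le_trans (lerD ih h)); have := ler_wpM2r p l2; set w := la a.+1 ^+ n.+1; lra.
Qed.

Section fixed_functions.
Variables (f g : V -> R) (x : V).
Hypothesis nf : nice f.
Hypothesis ng : nice g.
Let nfg : nice (fun y => f y * g y). Proof. exact: nice_mul. Qed.
Let fM M y := \sum_(j < M.+1) conv (kpsi j) f y.
Let gM M y := \sum_(j < M.+1) conv (kpsi j) g y.
Let TM (h : V -> R) M := \sum_(j < M.+1) Q ^+ j * conv (kkap j) h x.

Let bpf (h : V -> R) j : nice h -> BM (conv (kpsi j) h).
Proof. by move=> nh; apply: BM_conv => //; exact: BM_nice. Qed.

Lemma Bil_expand n M :
  conv (tau s kkap n) (fun y => fM M y * gM M y) x - fM M x * TM g M - gM M x * TM f M =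
  \sum_(j < M.+1) \sum_(k < M.+1) Bil s kpsi kkap f g x n j k.
Proof.
have it := intg_tau Hkap n.
have -> : conv (tau s kkap n) (fun y => fM M y * gM M y) x =
    \sum_(j < M.+1) \sum_(k < M.+1) conv (tau s kkap n) (fun y => conv (kpsi j) f y * conv (kpsi k) g y) x.
  have -> : (fun y => fM M y * gM M y) =
     (fun y => \sum_(j < M.+1) \sum_(k < M.+1) conv (kpsi j) f y * conv (kpsi k) g y).
    by apply/funext => y; rewrite /fM /gM big_distrlr.
  have b1 (j k : 'I_M.+1) : BM (fun y => conv (kpsi j) f y * conv (kpsi k) g y).
    by apply: BM_M; exact: bpf.
  rewrite conv_sumr//; last by move=> j; apply: BM_sum => k; exact: b1.
  by apply: eq_bigr => j _; rewrite conv_sumr.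
have -> : fM M x * TM g M =
    \sum_(j < M.+1) \sum_(k < M.+1) conv (kpsi j) f x * (Q ^+ k * conv (kkap k) g x).
  by rewrite /fM /TM big_distrlr.
have -> : gM M x * TM f M =
    \sum_(j < M.+1) \sum_(k < M.+1) conv (kpsi k) g x * (Q ^+ j * conv (kkap j) f x).
  by rewrite /gM /TM big_distrlr exchange_big.
rewrite -!sumrB; apply: eq_bigr => j _; rewrite -!sumrB; apply: eq_bigr => k _.
by [].
Qed.

(** f and g are replaced by sums of their first M + 1 blocks and D on the product by [tau (M + 6)];
    the five errors are multiples of 2^-M. The offset 6 puts all these blocks at least five octaves
    below the truncation of [tau]. *)
Lemma core_limit B : (forall M, \sum_(j < M.+1) \sum_(k < M.+1) `|Bil s kpsi kkap f g x (M + 6) j k| <= B) ->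
  `|D (fun y => f y * g y) x - f x * D g x - g x * D f x| <= B.
Proof.
move=> HB; have [a _ Ha] := tau_L1.
have p1 : polyg (cst 1 : V -> R) by apply: (@polyg_bounded R d (cst 1) 1) => // z; rewrite normr1.
have [C1 C10 H1] := tail_bound 1%N pm nfg.
(* These errors are convolved with [tau (M + 6)], whose L^1 norm is of order 2^((a+1)M); the power a
   + 2 leaves one factor 2^-M. *)
have [Cf Cf0 Hf] := tail_bound a.+2 p1 nf.
have [Cg Cg0 Hg] := tail_bound a.+2 p1 ng.
have [Df Df0 HDf] := tail_bound 1%N pm nf.
have [Dg Dg0 HDg] := tail_bound 1%N pm ng.
have [Bf [Bf0 HBf]] := nice_bounded nf.
have [Bg [Bg0 HBg]] := nice_bounded ng.
have [Ef [Ef0 HEf]] := mult_bounded pm nf.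
have [Eg [Eg0 HEg]] := mult_bounded pm ng.
pose C2 := K * I2 R d * la a.+1 ^+ 7 * (Cf * (Bg + Cg) + Bf * Cg).
pose C3 := Bf * Dg + Cf * (Eg + Dg); pose C4 := Bg * Df + Cg * (Ef + Df).
have I0 := I2_ge0 R d.
have L7 : 0 <= la a.+1 ^+ 7 by rewrite exprn_ge0// ltW.
have C20 : 0 <= C2 by rewrite !mulr_ge0// !addr_ge0// !mulr_ge0// addr_ge0.
have C30 : 0 <= C3 by rewrite addr_ge0// mulr_ge0// addr_ge0.
have C40 : 0 <= C4 by rewrite addr_ge0// mulr_ge0// addr_ge0.
apply: (le_limit (addr_ge0 (addr_ge0 (addr_ge0 C10 C20) C30) C40)) => M; set r := (la M)^-1.
have r0 : 0 < r by rewrite invr_gt0.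
have r1 : r <= 1 by rewrite invf_le1// exprn_ege1// ler1n.
have rN N : r ^+ N.+1 <= r by rewrite exprS ger_pMr// exprn_ile1// ltW.
have fMf y : `|f y - fM M y| <= Cf * r ^+ a.+2.
  by have := Hf M y; rewrite nice_inversion// -(partial_sum M y nf).
have gMg y : `|g y - gM M y| <= Cg * r ^+ a.+2.
  by have := Hg M y; rewrite nice_inversion// -(partial_sum M y ng).
have TfM : `|D f x - TM f M| <= Df * r.
  by have := HDf M x; rewrite expr1 -(partial_kap M x nf).
have TgM : `|D g x - TM g M| <= Dg * r.
  by have := HDg M x; rewrite expr1 -(partial_kap M x ng).
have gMb y : `|gM M y| <= Bg + Cg.
  have -> : gM M y = g y - (g y - gM M y) by ring.
  apply normB_le => //; apply: (le_trans (gMg y)).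
  by rewrite ler_piMr//; apply: le_trans (rN a.+1) r1.
have e1 : `|D (fun y => f y * g y) x - conv (tau s kkap (M + 6)) (fun y => f y * g y) x| <= C1 * r.
  rewrite (conv_nice x (intg_tau Hkap _) (sym_tau Hkap (M + 6)) nfg).
  apply: (le_trans (H1 (M + 6)%N x)); rewrite expr1 ler_wpM2l// lef_pV2 ?posrE//.
  by apply: la_le; exact: leq_addr.
have BfM (h : V -> R) N : nice h -> BM (fun y => \sum_(j < N.+1) conv (kpsi j) h y).
  by move=> nh; apply: BM_sum => j; exact: bpf.
have bfg : BM (fun y => f y * g y) by apply: BM_M; exact: BM_nice.
have bMM : BM (fun y => fM M y * gM M y) by apply: BM_M; exact: BfM.
have bdiff : BM (fun y => f y * g y - fM M y * gM M y).
  have [m1 [B1 HB1]] := bfg; have [m2 [B2 HB2]] := bMM.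
  split; first exact: measurable_funB.
  by exists (B1 + B2) => y; apply normB_le.
have e2 : `|conv (tau s kkap (M + 6)) (fun y => f y * g y) x -
    conv (tau s kkap (M + 6)) (fun y => fM M y * gM M y) x| <= C2 * r.
  have it := intg_tau Hkap (M + 6).
  rewrite -(convB x it bfg bMM).
  apply: (le_trans (conv_bound (B := (Cf * (Bg + Cg) + Bf * Cg) * r ^+ a.+2) x it bdiff _)).
    move=> y; have -> : f y * g y - fM M y * gM M y = (f y - fM M y) * gM M y + f y * (g y - gM M y) by ring.
    rewrite [leRHS]mulrDl; apply normD_le; rewrite absM.
      rewrite mulrAC; apply: ler_pM => //; exact: fMf.
    by rewrite -mulrA; apply: ler_pM.
  apply: (le_trans (ler_wpM2r _ (Ha (M + 6)%N))).
    by rewrite mulr_ge0 ?exprn_ge0 ?(ltW r0)// addr_ge0 ?mulr_ge0 ?addr_ge0.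
  rewrite le_eqVlt; apply/orP; left; apply/eqP.
  have -> : la a.+1 ^+ (M + 6).+1 = la a.+1 ^+ 7 * (la M) ^+ a.+1.
    by rewrite -addnS exprD mulrC -!exprM (mulnC a.+1 M).
  have rE : (la M) ^+ a.+1 * r ^+ a.+2 = r.
    by rewrite (exprSr r) mulrA -exprMn divff ?expr1n ?mul1r// gt_eqF.
  transitivity (C2 * ((la M) ^+ a.+1 * r ^+ a.+2)); last by rewrite rE.
  by rewrite /C2; set u := la M ^+ a.+1; set w := r ^+ a.+2; set l := la a.+1 ^+ 7; ring.
have e3 : `|f x * D g x - fM M x * TM g M| <= C3 * r.
  have -> : f x * D g x - fM M x * TM g M = f x * (D g x - TM g M) + (f x - fM M x) * TM g M by ring.
  rewrite [leRHS]mulrDl; apply normD_le; rewrite absM.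
    by rewrite -mulrA; apply: ler_pM.
  rewrite mulrAC; apply: ler_pM => //.
    by apply: (le_trans (fMf x)); rewrite ler_wpM2l.
  have -> : TM g M = D g x - (D g x - TM g M) by ring.
  by apply normB_le => //; apply: (le_trans TgM); rewrite ler_piMr.
have e4 : `|g x * D f x - gM M x * TM f M| <= C4 * r.
  have -> : g x * D f x - gM M x * TM f M = g x * (D f x - TM f M) + (g x - gM M x) * TM f M by ring.
  rewrite [leRHS]mulrDl; apply normD_le; rewrite absM.
    by rewrite -mulrA; apply: ler_pM.
  rewrite mulrAC; apply: ler_pM => //.
    by apply: (le_trans (gMg x)); rewrite ler_wpM2l.
  have -> : TM f M = D f x - (D f x - TM f M) by ring.
  by apply normB_le => //; apply: (le_trans TfM); rewrite ler_piMr.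
have e5 : `|conv (tau s kkap (M + 6)) (fun y => fM M y * gM M y) x - fM M x * TM g M - gM M x * TM f M| <= B.
  rewrite Bil_expand; apply: le_trans (HB M).
  apply: (le_trans (ler_norm_sum _ _ _)); apply: ler_sum => j _; exact: ler_norm_sum.
set p1' := D (fun y => f y * g y) x in e1 *.
set p2 := conv _ (fun y => f y * g y) x in e1 e2.
set p3 := conv _ (fun y => fM M y * gM M y) x in e2 e5.
set q1 := f x * D g x in e3 *; set q2 := fM M x * _ in e3 e5.
set q3 := g x * D f x in e4 *; set q4 := gM M x * _ in e4 e5.
have -> : p1' - q1 - q3 = (p3 - q2 - q4) + ((p1' - p2) + (p2 - p3) - (q1 - q2) - (q3 - q4)) by ring.
apply normD_le => //; rewrite [leRHS]mulrDl (mulrDl (C1 + C2)) (mulrDl C1).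
by apply normB_le => //; apply normB_le => //; apply normD_le.
Qed.

End fixed_functions.
End limits.

(** * The pointwise estimate for the Bessel operator *)

Section core_theorem.
Variables (R : realType) (d : nat) (s : R).
Hypothesis s0 : 0 < s.
Local Notation V := 'rV[R]_d.
Local Notation D := (mult (@mB R d s)).
Local Notation la j := ((2 : R) ^+ j).
Implicit Types (f g h : V -> R) (x y : V).

Definition pointwise_leibniz (u v : R) := exists2 C, 0 <= C & forall f g x A B c e,
  nice f -> nice g -> 0 < A -> 0 < B -> 0 < c -> 0 < e ->
  (forall j, conv (wk 2 (la j)) (fun z => (`|D f z| / A) `^ u) x <= 1) ->
  (forall j, conv (wk 2 (la j)) (fun z => (`|g z| / B) `^ v) x <= 1) ->
  wsup f x c -> wsup (D g) x e ->
  `|D (fun y => f y * g y) x - f x * D g x - g x * D f x| <= C * (A * B + c * e).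

(** An elementary substitute for Jensen: z <= 1 + z^u for z = |h| / A, and the kernels have mass at
    most [I2]. *)
Lemma wsup_pow h A u x : BM h -> 0 < A -> 1 <= u ->
  (forall j, conv (wk 2 (la j)) (fun z => (`|h z| / A) `^ u) x <= 1) ->
  wsup h x ((I2 R d + 1) * A).
Proof.
move=> bh A0 u1 H j; have la0 : 0 < la j by exact: exprn_gt0.
have [mh [B HB]] := bh; have u0 : 0 <= u by lra.
have bp : BM (fun z => (`|h z| / A) `^ u).
  split.
    apply: (measurableT_comp (f := @powR R ^~ u)); first exact: measurable_powR.
    by apply: measurable_funM => //; exact: measurableT_comp.
  exists ((B / A) `^ u) => z; rewrite ger0_norm ?powR_ge0//.
  have B0 : 0 <= B by apply: le_trans (HB z).
  by apply: ge0_ler_powR; rewrite ?nnegrE ?divr_ge0 ?(ltW A0)// ler_wpM2r ?invr_ge0 ?(ltW A0).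
have iw := intg_wk d la0 (leqnn 2).
have i1 : intg (lebesgue_rV R d) (fun y => wk 2 (la j) y * (`|h (x - y)| / A) `^ u) := intg_conv x iw bp.
apply: (@le_trans _ _ (\int[lebesgue_rV R d]_y (A * wk 2 (la j) y + A * (wk 2 (la j) y * (`|h (x - y)| / A) `^ u)))).
  apply: le_Rint; first exact: (intg_conv x iw (BM_norm bh)).
    by apply: intgD; exact: intgZ.
  move=> y; set z := `|h (x - y)| / A; have z0 : 0 <= z by rewrite divr_ge0// ltW.
  have -> : `|h (x - y)| = A * z by rewrite mulrC divfK// gt_eqF.
  have zu : z <= 1 + z `^ u.
    have [z1|z1] := leP z 1; first by have := powR_ge0 z u; lra.
    have := ler_powR (ltW z1) u1; rewrite powRr1//; lra.
  rewrite -mulrDr mulrCA ler_wpM2l ?(ltW A0)// -{2}[wk 2 (la j) y]mulr1 -mulrDr ler_wpM2l//.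
  exact/wk_ge0/ltW.
rewrite RintD; [|exact: intgZ..]; rewrite (RintZ _ iw) (RintZ _ i1) [leRHS]mulrC mulrDr.
apply: lerD; apply: ler_wpM2l; rewrite ?(ltW A0)//; first exact: Rint_wk.
exact: H.
Qed.

(** Only the high-high bound depends on the arithmetic of s and on u, v. It is taken as a hypothesis
    here, so that fractional and even s share the rest. *)
Lemma leibniz_scale u v CH dl (K : R) (kpsi klam kkap kE : nat -> V -> R) :
  1 <= u -> 1 <= v -> 0 <= K ->
  kpack 8 K kpsi (@bl R d) ->
  kpack 8 K klam (fun j xi => (2 `^ s) ^+ j * (bl j xi / mB s xi)) ->
  kpack 8 K kkap (fun j xi => (2 `^ s) ^- j * (mB s xi * bl j xi)) ->
  kpack 8 K kE (fun j xi => (2 `^ s) ^- j * (mB s xi * chi j (ep4 R j * sq xi))) ->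
  0 <= CH -> 0 < dl -> dl <= 1 ->
  (forall f g x c a b e A B j k n,
  nice f -> nice g -> wsup f x c -> wsup (D f) x a -> wsup g x b -> wsup (D g) x e ->
  0 < A -> 0 < B ->
  (forall j, conv (wk 2 (la j)) (fun z => (`|D f z| / A) `^ u) x <= 1) ->
  (forall j, conv (wk 2 (la j)) (fun z => (`|g z| / B) `^ v) x <= 1) ->
  (k <= j + 3)%N -> (j <= k + 3)%N -> (j + 5 <= n)%N ->
  `|conv (tau s kkap n) (fun y => conv (kpsi j) f y * conv (kpsi k) g y) x| <=
  CH * (((2 `^ s) ^+ j * (Fm s c a j * Fm s b e k)) `^ dl * (A * B) `^ (1 - dl))) ->
  pointwise_leibniz u v.
Proof.
move=> u1 v1 K0 Hpsi Hlam Hkap HE CH0 d0 d1 HH.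
have [C C0 H] := Bil_sum s0 K0 Hpsi Hlam Hkap HE CH0 d0 d1.
have I0 := I2_ge0 R d; set I := I2 R d + 1.
have I1 : 1 <= I by rewrite /I; lra.
exists (C * (I * I)); first by rewrite !mulr_ge0//; lra.
move=> f g x A B c e nf ng A0 B0 c0 e0 hu hv hc he.
have pmB : polyg (@mB R d s) by apply: polyg_mB; exact: ltW.
have ha : wsup (D f) x (I * A) := wsup_pow (BM_mult pmB nf) A0 u1 hu.
have hb : wsup g x (I * B) := wsup_pow (BM_nice ng) B0 v1 hv.
clearbody I.
have AB0 := mulr_gt0 A0 B0; have ce0 := mulr_gt0 c0 e0.
have II : 1 <= I * I by nra.
apply: (@le_trans _ _ (C * ((I * A) * (I * B) + c * e))); last first.
  by rewrite -[leRHS]mulrA; apply: ler_wpM2l => //; rewrite mulrACA mulrDr lerD2l ler_peMl// ltW.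
apply: (core_limit s0 K0 Hpsi Hkap nf ng) => M.
have I00 : 0 < I by lra.
apply: (H f g x c (I * A) (I * B) e (A * B) M.+1 (M + 6)%N nf ng hc ha hb he c0 (mulr_gt0 I00 A0) (mulr_gt0 I00 B0) e0 (ltW AB0)).
- by rewrite mulrACA ler_peMl// ltW.
- by move=> j k kj jk jn; apply: (HH f g x c (I * A) (I * B) e A B j k (M + 6)%N).
- by rewrite addSn -addnS.
Qed.

Lemma leibniz_fractional lam u v : 1 <= u -> 1 <= v -> 0 <= lam ->
  u^-1 + v^-1 = 1 + lam -> d%:R * lam < s -> pointwise_leibniz u v.
Proof.
move=> u1 v1 l0 uv ls.
have [K [K0 [kpsi [klam [kkap [kE [Hpsi Hlam Hkap HE]]]]]]] := @lp_kernels R d s 8.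
pose gap := s - d%:R * lam; have g0 : 0 < gap by rewrite subr_gt0.
have D0 : 0 <= d%:R :> R by exact: ler0n.
have den : 0 < 8 * d%:R + gap + 1 by lra.
(* Small enough that dl <= 1 and 4 d dl < gap, which turns d lam < s into the strict condition of
   [hh_bound]. *)
pose dl := Num.min 1 gap / (8 * d%:R + gap + 1).
have mn : 0 < Num.min 1 gap by rewrite lt_min ltr01.
have dl0 : 0 < dl by rewrite divr_gt0.
have mg : Num.min 1 gap <= gap by rewrite ge_min lexx orbT.
have m1 : Num.min 1 gap <= 1 by rewrite ge_min lexx.
have dl1 : dl <= 1 by rewrite ler_pdivrMr// mul1r; lra.
have dlg : dl * (8 * d%:R + gap + 1) <= gap by rewrite divfK ?gt_eqF.
have cond : d%:R * (4 * dl + lam * (1 - dl)) < s.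
  have a1 : 0 <= d%:R * (lam * dl) := mulr_ge0 D0 (mulr_ge0 l0 (ltW dl0)).
  have gap1 : 0 < gap + 1 by lra.
  have a2 := mulr_gt0 dl0 gap1.
  have a3 := mulr_ge0 (ltW dl0) D0.
  have -> : d%:R * (4 * dl + lam * (1 - dl)) = 4 * (dl * d%:R) + d%:R * lam - d%:R * (lam * dl) by ring.
  by move: dlg a2; rewrite /gap; lra.
have [CH CH0 HH] := hh_bound s0 K0 Hpsi Hlam Hkap u1 v1 l0 uv dl0 dl1 cond.
exact: (leibniz_scale u1 v1 K0 Hpsi Hlam Hkap HE CH0 dl0 dl1 HH).
Qed.

(** With dl = 1 the high-high hypothesis is the bound [hh_even] by a single kernel. No sum over
    output scales occurs, so s is not compared with d and lam. *)
Lemma leibniz_even u v M : 1 <= u -> 1 <= v -> s = (2 * M)%:R -> pointwise_leibniz u v.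
Proof.
move=> u1 v1 sM.
have [K1 [K10 [kpsi [klam [kkap [kE [Hpsi Hlam Hkap HE]]]]]]] := @lp_kernels R d s 8.
have [K2 [K20 [kV HV]]] := @lp_kernel_even R d M 8; rewrite -sM in HV.
have k1 : K1 <= K1 + K2 by rewrite lerDl. have k2 : K2 <= K1 + K2 by rewrite lerDr.
have K0 : 0 <= K1 + K2 by exact: addr_ge0.
have Hpsi' := kpack_le k1 Hpsi; have Hlam' := kpack_le k1 Hlam.
have Hkap' := kpack_le k1 Hkap; have HE' := kpack_le k1 HE; have HV' := kpack_le k2 HV.
set K := K1 + K2 in K0 Hpsi' Hlam' Hkap' HE' HV'.
have CH0 : 0 <= K ^+ 3 * I2 R d * (la 5 ^+ d) ^+ 4.
  by rewrite !mulr_ge0 ?I2_ge0 ?exprn_ge0.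
apply: (leibniz_scale u1 v1 K0 Hpsi' Hlam' Hkap' HE' CH0 ltr01 (lexx 1)).
move=> f g x c a b e A B j k n nf ng hc ha hb he A0 B0 _ _ kj jk jn.
have := hh_even s0 K0 Hpsi' Hlam' Hkap' HV' nf ng hc ha hb he kj jn.
have X0 : 0 <= (2 `^ s) ^+ j * (Fm s c a j * Fm s b e k).
  apply: mulr_ge0; first by rewrite exprn_ge0// powR_ge0.
  by apply: mulr_ge0; [exact: (Fm_ge0 s0 nf hc ha)|exact: (Fm_ge0 s0 ng hb he)].
by rewrite powRr1// subrr powRr0 mulr1.
Qed.

End core_theorem.

(** * L^p quasi-norms *)

Section Lnorm_quasi.
Context d (T : measurableType d) (R : realType) (mu : {measure set T -> \bar R}).
Implicit Types (p q r : \bar R) (F G : T -> R).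
Local Open Scope ereal_scope.

(* No measurability is needed: the integral of a nonnegative function is defined
   as a supremum over the simple functions below it. *)
Lemma ge0_le_integralT (f g : T -> \bar R) :
  (forall x, 0 <= f x) -> (forall x, f x <= g x) ->
  \int[mu]_x f x <= \int[mu]_x g x.
Proof.
move=> f0 fg; have g0 x : 0 <= g x by exact: le_trans (fg x).
rewrite !ge0_integralTE//; apply: ub_ereal_sup => _ [h hf <-].
by apply: ereal_sup_ubound; exists h => // x; exact: le_trans (fg x).
Qed.

Lemma le_poweR (a b : \bar R) t : (0 <= t)%R -> 0 <= a -> a <= b -> a `^ t <= b `^ t.
Proof.
move=> t0 a0 ab; apply: gt0_ler_poweR => //; rewrite in_itv/= leey andbT//.
exact: le_trans ab.
Qed.

Lemma Lnorm_fin p (f : T -> \bar R) (r : R) : p = r%:E ->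
  Lnorm mu p f = (\int[mu]_x `|f x| `^ r) `^ r^-1.
Proof. by move=> ->; rewrite unlock. Qed.

Lemma le_Lnorm p (f g : T -> \bar R) : 0 < p ->
  (forall x, `|f x| <= `|g x|) -> Lnorm mu p f <= Lnorm mu p g.
Proof.
move=> p0 fg; rewrite unlock /Lnorm; case: p p0 => [r||]//.
- rewrite lte_fin => r0; apply: le_poweR; first by rewrite invr_ge0 ltW.
    by apply: integral_ge0 => x _; exact: poweR_ge0.
  apply: ge0_le_integralT => x; first exact: poweR_ge0.
  by apply: le_poweR => //; exact: ltW.
- by move=> _; case: ifPn => // _; apply: le_ess_sup; exact: nearW.
Qed.

Lemma LnormZ_real p (c : R) F : 0 < p -> (0 <= c)%R -> measurable_fun setT F ->
  Lnorm mu p (fun x => (c * F x)%:E) = c%:E * Lnorm mu p (EFin \o F).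
Proof.
move=> p0 c0 mF; rewrite unlock /Lnorm; case: p p0 => [r||]//.
- rewrite lte_fin => r0.
  under eq_integral => x _ do rewrite /= normrM (ger0_norm c0) powRM// EFinM.
  rewrite ge0_integralZl ?lee_fin ?powR_ge0//; last first.
    apply/measurable_EFinP; apply: (measurableT_comp (f := @powR R ^~ r)).
      exact: measurable_powR.
    exact: measurableT_comp.
  rewrite poweRM ?lee_fin ?powR_ge0//; last first.
    by apply: integral_ge0 => x _; rewrite lee_fin powR_ge0.
  by rewrite /= -powRrM divff ?gt_eqF// powRr1.
- move=> _; case: ifPn => [m0|]; last by rewrite mule0.
  rewrite -ess_supZl//; apply: eq_ess_sup; apply: nearW => x /=.
  by rewrite normrM ger0_norm.
Qed.

Definition quasi_const p : R := if p is r%:E then (2 * 2 `^ r^-1)%R else 1%R.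

Lemma quasi_const_ge1 p : 0 < p -> (1 <= quasi_const p)%R.
Proof.
case: p => [r||]//=; rewrite lte_fin => r0.
have : (2 `^ 0 <= 2 `^ r^-1 :> R)%R by rewrite ler_powR ?invr_ge0 ?ltW//; lra.
by rewrite powRr0; lra.
Qed.

(** Valid for all p > 0, without convexity: |F + G|^r <= 2^r (|F|^r + |G|^r), and then the sum of
    the two integrals is at most twice the larger one. This gives the constant 2 * 2^(1/r). *)
Lemma LnormD_quasi p F G : 0 < p ->
  measurable_fun setT F -> measurable_fun setT G ->
  Lnorm mu p (fun x => (F x + G x)%:E) <=
  (quasi_const p)%:E * (Lnorm mu p (EFin \o F) + Lnorm mu p (EFin \o G)).
Proof.
move=> p0 mF mG; case: p p0 => [r||]//; last first.
  move=> _; rewrite mul1e unlock /Lnorm.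
  case: ifPn => [m0|]; last by rewrite adde0.
  apply: le_trans (ess_supD _ _ _); apply: le_ess_sup; apply: nearW => x /=.
  by rewrite lee_fin ler_normD.
rewrite lte_fin => r0; rewrite /quasi_const; set z := (2 `^ r^-1)%R.
have z1 : (1 <= z)%R.
  by rewrite -(powRr0 2) ler_powR ?invr_ge0 ?ltW//; lra.
have mr (H : T -> R) : measurable_fun setT H -> measurable_fun setT (fun x => (`|H x| `^ r)%R).
  move=> mH; apply: (measurableT_comp (f := @powR R ^~ r)); first exact: measurable_powR.
  exact: measurableT_comp.
rewrite !(Lnorm_fin _ (erefl r%:E)).
set a := \int[mu]_x `|(EFin \o F) x| `^ r; set b := \int[mu]_x `|(EFin \o G) x| `^ r.
have a0 : 0 <= a by apply: integral_ge0 => x _; exact: poweR_ge0.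
have b0 : 0 <= b by apply: integral_ge0 => x _; exact: poweR_ge0.
have H : \int[mu]_x `|(F x + G x)%:E| `^ r <= (2 `^ r)%:E * (a + b).
  apply: (@le_trans _ _ (\int[mu]_x ((2 `^ r)%:E * ((`|F x| `^ r + `|G x| `^ r)%R)%:E))); last first.
    have mS : measurable_fun setT (fun x => ((`|F x| `^ r + `|G x| `^ r)%R)%:E).
      by apply/measurable_EFinP; apply: measurable_funD; exact: mr.
    have S0 x : [set: T] x -> 0 <= ((`|F x| `^ r + `|G x| `^ r)%R)%:E.
      by rewrite lee_fin addr_ge0 ?powR_ge0.
    have c0 : 0 <= (2 `^ r)%:E :> \bar R by rewrite lee_fin powR_ge0.
    rewrite (ge0_integralZl mu measurableT mS S0 c0).
    under eq_integral => x _ do rewrite EFinD.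
    by rewrite ge0_integralD//; apply/measurable_EFinP; exact: mr.
  apply: ge0_le_integralT => x; first exact: poweR_ge0.
  rewrite /= -EFinM lee_fin.
  have [FG|GF] := leP `|F x|%R `|G x|%R.
    apply: (@le_trans _ _ ((2 * `|G x|) `^ r)%R).
      apply: ge0_ler_powR; rewrite ?nnegrE ?mulr_ge0 ?(ltW r0)//.
      by apply: le_trans (ler_normD _ _) _; lra.
    by rewrite powRM// ler_wpM2l ?powR_ge0// lerDr powR_ge0.
  apply: (@le_trans _ _ ((2 * `|F x|) `^ r)%R).
    apply: ge0_ler_powR; rewrite ?nnegrE ?mulr_ge0 ?(ltW r0)//.
    by apply: le_trans (ler_normD _ _) _; lra.
  by rewrite powRM// ler_wpM2l ?powR_ge0// lerDl powR_ge0.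
have L0 : 0 <= \int[mu]_x `|(F x + G x)%:E| `^ r.
  by apply: integral_ge0 => x _; exact: poweR_ge0.
move: a b a0 b0 (\int[mu]_x `|(F x + G x)%:E| `^ r) H L0 => a b a0 b0 L H L0.
have ri : (0 <= r^-1)%R by rewrite invr_ge0 ltW.
have e2 c : 0 <= c -> ((2 `^ r)%:E * (2%:E * c)) `^ r^-1 = (2 * z)%:E * c `^ r^-1.
  move=> c0; rewrite poweRM ?mule_ge0 ?lee_fin ?powR_ge0// poweRM//.
  by rewrite muleA /= -powRrM divff ?gt_eqF// powRr1.
have fin c : 0 <= c -> a + b <= 2%:E * c -> c `^ r^-1 <= a `^ r^-1 + b `^ r^-1 ->
   L `^ r^-1 <= (2 * z)%:E * (a `^ r^-1 + b `^ r^-1).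
  move=> c0 abc h; apply: (@le_trans _ _ (((2 `^ r)%:E * (2%:E * c)) `^ r^-1)).
    apply: le_poweR => //.
    by apply: le_trans H _; apply: lee_wpmul2l => //; rewrite lee_fin powR_ge0.
  rewrite e2//; apply: lee_wpmul2l => //; rewrite lee_fin; nra.
have t2 c : 2%:E * c = c + c :> \bar R by rewrite -(mule2n c) mule_natl.
have [ab|ba] := leP a b.
  apply: (fin b b0); first by rewrite t2; exact: leeD.
  by rewrite leeDr// poweR_ge0.
apply: (fin a a0); first by rewrite t2; apply: leeD => //; exact: ltW.
by rewrite leeDl// poweR_ge0.
Qed.

Lemma Lnorm_ae_bound r (M : R) F G : 0 < r -> (0 <= M)%R ->
  measurable_fun setT F -> measurable_fun setT G ->
  (\forall x \ae mu, (`|F x| <= M)%R) ->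
  Lnorm mu r (fun x => (F x * G x)%:E) <= M%:E * Lnorm mu r (EFin \o G).
Proof.
move=> r0 M0 mF mG FM; rewrite -(LnormZ_real r0 M0 mG).
case: r r0 => [r||]//; last first.
  move=> _; rewrite unlock /Lnorm; case: ifPn => // _; apply: le_ess_sup.
  move: FM; apply: filterS => x FM /=; rewrite lee_fin !normrM (ger0_norm M0).
  by rewrite ler_wpM2r.
rewrite lte_fin => r0; rewrite !(Lnorm_fin _ (erefl r%:E)).
apply: le_poweR; first by rewrite invr_ge0 ltW.
  by apply: integral_ge0 => x _; exact: poweR_ge0.
have mr (H : T -> R) : measurable_fun setT H -> measurable_fun setT (fun x => (`|H x| `^ r)%R).
  move=> mH; apply: (measurableT_comp (f := @powR R ^~ r)); first exact: measurable_powR.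
  exact: measurableT_comp.
apply: ae_ge0_le_integral => //.
- by move=> x _; exact: poweR_ge0.
- by apply/measurable_EFinP; apply: mr; exact: measurable_funM.
- by move=> x _; exact: poweR_ge0.
- by apply/measurable_EFinP; apply: mr; exact: measurable_funM.
move: FM; apply: filterS => x FM _ /=; rewrite lee_fin.
apply: ge0_ler_powR; rewrite ?nnegrE ?(ltW r0)//.
by rewrite !normrM (ger0_norm M0) ler_wpM2r.
Qed.

Lemma Lnorm_eq0_mul r F G : 0 < r -> measurable_fun setT F -> measurable_fun setT G ->
  (\forall x \ae mu, F x = 0%R) -> Lnorm mu r (fun x => (F x * G x)%:E) = 0.
Proof.
move=> r0 mF mG F0.
have h : Lnorm mu r (fun x => (F x * G x)%:E) <= 0%:E * Lnorm mu r (EFin \o G).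
  by apply: Lnorm_ae_bound => //; move: F0; apply: filterS => x ->; rewrite normr0.
by apply/eqP; rewrite eq_le Lnorm_ge0 andbT; move: h; rewrite mul0e.
Qed.

Lemma Lnorm0_ae p F : 0 < p -> measurable_fun setT F -> Lnorm mu p (EFin \o F) = 0 ->
  \forall x \ae mu, F x = 0%R.
Proof.
move=> p0 mF N0; have mEF : measurable_fun setT (EFin \o F) by exact/measurable_EFinP.
have := Lnorm_eq0_eq0 mEF p0 N0; apply: filterS => x /=.
by move=> /(_ I)[].
Qed.

(** The classical inequality for |F|^r and |G|^r with the conjugate exponents p/r and q/r. *)
Lemma Lnorm_hoelder_fin (p q r : R) F G : (0 < p)%R -> (0 < q)%R -> (0 < r)%R ->
  (p^-1 + q^-1 = r^-1)%R ->
  measurable_fun setT F -> measurable_fun setT G ->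
  Lnorm mu r%:E (fun x => (F x * G x)%:E) <=
  Lnorm mu p%:E (EFin \o F) * Lnorm mu q%:E (EFin \o G).
Proof.
move=> p0 q0 r0 pqr mF mG.
have mr (H : T -> R) : measurable_fun setT H -> measurable_fun setT (fun x => (`|H x| `^ r)%R).
  move=> mH; apply: (measurableT_comp (f := @powR R ^~ r)); first exact: measurable_powR.
  exact: measurableT_comp.
have pr0 : (0 < p / r)%R by rewrite divr_gt0.
have qr0 : (0 < q / r)%R by rewrite divr_gt0.
have e1 : ((p / r)^-1 + (q / r)^-1 = 1)%R.
  rewrite !invfM !invrK -mulrDl pqr mulVf// gt_eqF//.
have E (s : R) (H : T -> R) : (0 < s)%R ->
   Lnorm mu (s / r)%:E (EFin \o (fun x => `|H x| `^ r)%R) = Lnorm mu s%:E (EFin \o H) `^ r.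
  move=> s0; rewrite !(Lnorm_fin _ (erefl _%:E)) -poweRrM invfM invrK; congr (_ `^ _).
  apply: eq_integral => x _ /=; rewrite ger0_norm ?powR_ge0// -powRrM mulrCA divff ?mulr1//.
  by rewrite gt_eqF.
have h := hoelder mu (mr F mF) (mr G mG) pr0 qr0 e1.
rewrite (E p F p0) (E q G q0) in h.
rewrite -(poweRM r (Lnorm_ge0 _ _ _) (Lnorm_ge0 _ _ _)) Lnorm1 in h.
rewrite (Lnorm_fin _ (erefl r%:E)).
have -> : \int[mu]_x `|(F x * G x)%:E| `^ r = \int[mu]_x `|(EFin \o (fun x => `|F x| `^ r * `|G x| `^ r)%R) x|.
  apply: eq_integral => x _ /=.
  by rewrite [in RHS]ger0_norm ?mulr_ge0 ?powR_ge0// normrM powRM.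
apply: le_trans (le_poweR _ _ h) _; rewrite ?invr_ge0 ?(ltW r0)//.
  by apply: integral_ge0.
by rewrite -poweRrM divff ?gt_eqF// poweRe1// mule_ge0 ?Lnorm_ge0.
Qed.

(** Two degenerate cases need care. On a null space the product vanishes almost everywhere. If the
    sup norm is infinite, the right side is infinite unless the norm of G is 0, and then again the
    product vanishes almost everywhere. *)
Lemma Lnorm_infty_mul r F G : 0 < r -> measurable_fun setT F -> measurable_fun setT G ->
  Lnorm mu r (fun x => (F x * G x)%:E) <=
  Lnorm mu +oo (EFin \o F) * Lnorm mu r (EFin \o G).
Proof.
move=> r0 mF mG.
have [m0|] := ltP 0 (mu setT); last first.
  move=> m0; have {}m0 : mu setT = 0 by apply/eqP; rewrite eq_le m0 measure_ge0.
  rewrite (@Lnorm_eq0_mul r)// ?mule_ge0 ?Lnorm_ge0//.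
  by exists setT; split.
have ae : \forall x \ae mu, `|(F x)%:E| <= Lnorm mu +oo (EFin \o F).
  by rewrite unlock /Lnorm m0; exact: ess_sup_ge.
have := Lnorm_ge0 mu +oo (EFin \o F).
case e : (Lnorm mu +oo (EFin \o F)) => [M||]//.
  rewrite lee_fin => M0; apply: Lnorm_ae_bound => //.
  by move: ae; apply: filterS => x; rewrite e lee_fin.
move=> _; have [G0|G0] := eqVneq (Lnorm mu r (EFin \o G)) 0.
  rewrite G0 mule0.
  under eq_Lnorm => x do rewrite mulrC.
  by rewrite (@Lnorm_eq0_mul r G F)//; exact: (Lnorm0_ae r0 mG G0).
by rewrite gt0_mulye ?leey// lt0e G0 Lnorm_ge0.
Qed.

Lemma inve_inj_gt0 (a b : \bar R) : 0 < a -> 0 < b -> a^-1 = b^-1 -> a = b.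
Proof.
case: a => [a||]//; case: b => [b||]//; rewrite ?lte_fin ?inver ?invey.
- by move=> a0 b0; rewrite (gt_eqF a0) (gt_eqF b0) => -[] /invr_inj ->.
- by move=> a0 _; rewrite (gt_eqF a0) => -[] /eqP; rewrite invr_eq0 (gt_eqF a0).
- by move=> _ b0; rewrite (gt_eqF b0) => -[] /esym/eqP; rewrite invr_eq0 (gt_eqF b0).
Qed.

Lemma Lnorm_hoelder p q r F G : 0 < p -> 0 < q -> 0 < r -> p^-1 + q^-1 = r^-1 ->
  measurable_fun setT F -> measurable_fun setT G ->
  Lnorm mu r (fun x => (F x * G x)%:E) <=
  Lnorm mu p (EFin \o F) * Lnorm mu q (EFin \o G).
Proof.
move=> p0 q0 r0 pqr mF mG.
have [e|e] := eqVneq p +oo.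
  have -> : q = r by apply: inve_inj_gt0 => //; rewrite -pqr e invey add0e.
  by rewrite e; exact: Lnorm_infty_mul.
have [e'|e'] := eqVneq q +oo.
  have -> : p = r by apply: inve_inj_gt0 => //; rewrite -pqr e' invey adde0.
  rewrite e' muleC; under eq_Lnorm => x do rewrite mulrC.
  exact: Lnorm_infty_mul.
case: p p0 e pqr => [p||]//; case: q q0 e' => [q||]//; rewrite !lte_fin => q0 _ p0 _.
rewrite !inver (gt_eqF p0) (gt_eqF q0).
case: r r0 => [r||]//; last by rewrite invey -EFinD => _ [] h; have := invr_gt0 p; have := invr_gt0 q; rewrite p0 q0 => ? ?; exfalso; lra.
rewrite lte_fin inver => r0; rewrite (gt_eqF r0) -EFinD => -[h].
exact: Lnorm_hoelder_fin.
Qed.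

End Lnorm_quasi.

(** * Bases adapted to a quasi-norm *)

Section adapted_basis.
Variables (R : realType) (n : nat).
Local Notation V := 'rV[R]_n.
Implicit Types (S : {set 'I_n}) (v w : V) (N : V -> \bar R).

Definition supp_in S v := forall i, i \notin S -> v ord0 i = 0.

Definition quasi_norm K N := [/\ 1 <= K, (forall v, (0 <= N v)%E),
  (forall c v, N (c *: v) = (`|c|%:E * N v)%E) &
  (forall u v, (N (u + v)%R <= K%:E * (N u + N v))%E)].

(** Required on every coordinate subspace, since the greedy choice descends through them. The factor
    2 replaces attainment of the infimum, which can fail for a discontinuous or infinite N. *)
Definition near_min N := forall S, (exists i, i \in S) -> exists e,
  [/\ supp_in S e, `|e| = 1 &
      forall w, supp_in S w -> `|w| = 1 -> (N e <= 2%:E * N w)%E].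

Definition ap (phi : 'cV[R]_n) w : R := (w *m phi) ord0 ord0.

Lemma apE phi w : ap phi w = \sum_i w ord0 i * phi i ord0.
Proof. by rewrite /ap mxE. Qed.

Lemma mul_ap phi w (e : V) : (w *m phi) *m e = ap phi w *: e.
Proof. by rewrite [w *m phi]mx11_scalar mul_scalar_mx. Qed.

Lemma norm_mxE v : `|v| = mx_norm v. Proof. by []. Qed.

Lemma le_norm_coord v i : `|v ord0 i| <= `|v|.
Proof.
rewrite norm_mxE mx_normrE.
exact: (le_bigmax _ (fun ij => `|v ij.1 ij.2|) (ord0, i)).
Qed.

(** Induction on |S|. Let e0 be a near-minimizer and t a coordinate with |e0_t| = 1; then psi(w) =
    w_t / e0_t satisfies |psi(w)| <= |w|, and near-minimality at w / |w| gives |psi(w)| N(e0) <= 2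
    N(w). The remainder w - psi(w) e0 lives on S minus t and has N at most K (1 + 2) N(w), whence a
    factor 3 K per step. *)
Lemma adapted_basis K N : quasi_norm K N -> near_min N ->
  forall m S, #|S| = m -> exists (e : 'I_n -> V) (phi : 'I_n -> 'cV[R]_n),
  [/\ forall i, i \in S -> `|e i| = 1,
      forall w, supp_in S w -> \sum_(i in S) ap (phi i) w *: e i = w &
      forall w i, supp_in S w -> i \in S ->
        `|ap (phi i) w| <= (3 * K) ^+ m * `|w| /\
        (`|ap (phi i) w|%:E * N (e i) <= ((3 * K) ^+ m)%:E * N w)%E].
Proof.
move=> [K1 N0 NZ ND] nm; elim => [|m ih] S cS.
  exists (fun=> 0), (fun=> 0); move/eqP: cS; rewrite cards_eq0 => /eqP ->.
  split => [i|w ws|w i _]; rewrite ?inE//.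
  rewrite big_set0; apply/rowP => i; rewrite mxE ws ?inE//.
have S0 : exists i, i \in S by apply/set0Pn; rewrite -card_gt0 cS.
have [e0 [se0 ne0 me0]] := nm S S0.
have [t tS te] : exists2 t, t \in S & `|e0 ord0 t| = 1.
  have [t ht] : exists t, `|e0 ord0 t| = `|e0|.
    have h : mx_norm e0 != 0 by rewrite -[mx_norm e0]/(`|e0|) ne0 oner_eq0.
    by have [[j t] /= ht] := mx_norm_neq0 h; exists t; rewrite norm_mxE ht (ord1 j).
  exists t; last by rewrite ht.
  by apply/negPn/negP => /se0 h; move: ht; rewrite h normr0 ne0 => /eqP; rewrite eq_sym oner_eq0.
have a0 : e0 ord0 t != 0 by rewrite -normr_eq0 te oner_eq0.
have cS' : #|S :\ t| = m by move: cS; rewrite (cardsD1 t) tS => -[].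
have [e [phi [he hsum hb]]] := ih _ cS'.
pose psi : 'cV[R]_n := (e0 ord0 t)^-1 *: delta_mx t ord0.
have psiE w : ap psi w = w ord0 t / e0 ord0 t.
  rewrite apE (bigD1 t)//= big1 ?addr0 => [|i it]; rewrite !mxE ?eqxx ?mulr1//.
  by rewrite (negbTE it) mulr0 mulr0.
pose red w := w - ap psi w *: e0.
exists (fun i => if i == t then e0 else e i).
exists (fun i => if i == t then psi else phi i - psi *m (e0 *m phi i)).
have apred w i : ap (phi i - psi *m (e0 *m phi i)) w = ap (phi i) (red w).
  by rewrite /ap /red mulmxBr mulmxBl !mulmxA mul_ap.
have sred w : supp_in S w -> supp_in (S :\ t) (red w).
  move=> ws i; rewrite !inE negb_and negbK => /orP[/eqP->|iS].
    by rewrite !mxE psiE divfK// subrr.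
  by rewrite !mxE ws// se0// mulr0 subr0.
have npsi w : `|ap psi w| <= `|w|.
  by rewrite psiE normrM normfV te invr1 mulr1 le_norm_coord.
have Npsi w : supp_in S w -> (`|ap psi w|%:E * N e0 <= 2%:E * N w)%E.
  move=> ws; have [->|w0] := eqVneq w 0.
    by rewrite psiE mxE mul0r normr0 mul0e mule_ge0.
  have nw0 : 0 < `|w| by rewrite normr_gt0.
  apply: (@le_trans _ _ (`|w|%:E * N e0)%E).
    by apply: lee_wpmul2r => //; rewrite lee_fin.
  have := me0 (`|w|^-1 *: w) _ _; rewrite NZ ger0_norm ?invr_ge0// => h.
  apply: le_trans (lee_wpmul2l _ (h _ _)) _ => //.
  - by move=> i iS; rewrite mxE ws// mulr0.
  - by rewrite normrZ ger0_norm ?invr_ge0// mulVf// gt_eqF.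
  - by rewrite muleCA [X in (_ * X)%E]muleA -EFinM divff ?gt_eqF// mul1e.
have nred w : supp_in S w -> `|red w| <= 2 * `|w|.
  move=> ws; apply: le_trans (ler_normB _ _) _; rewrite normrZ ne0 mulr1.
  by have := npsi w; lra.
have Nred w : supp_in S w -> (N (red w) <= (3 * K)%:E * N w)%E.
  move=> ws; apply: le_trans (ND _ _) _; rewrite -scaleNr NZ normrN.
  rewrite mulrC EFinM -muleA; apply: lee_wpmul2l; first by rewrite lee_fin; lra.
  have -> : (3%:E = 1%:E + 2%:E :> \bar R)%E by rewrite -EFinD; congr EFin; lra.
  rewrite ge0_muleDl ?lee_fin// mul1e; exact: leeD2l (Npsi w ws).
have K3 : 1 <= (3 * K) ^+ m by apply: exprn_ege1; lra.
split.
- move=> i iS; case: eqP => // /eqP it; apply: he; by rewrite !inE it.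
- move=> w ws; rewrite (big_setD1 t)//= eqxx.
  rewrite (eq_bigr (fun i => ap (phi i) (red w) *: e i)); last first.
    by move=> i; rewrite !inE => /andP[/negbTE-> _]; rewrite apred.
  by rewrite (hsum _ (sred w ws)) /red addrCA subrr addr0.
- move=> w i ws iS; have [it|it] /= := eqVneq i t.
    split.
      apply: le_trans (npsi w) _; rewrite exprS ler_peMl//; nra.
    apply: le_trans (Npsi w ws) _; apply: lee_wpmul2r => //; rewrite lee_fin exprS; nra.
  have iS' : i \in S :\ t by rewrite !inE it.
  rewrite apred; have [h1 h2] := hb _ _ (sred w ws) iS'; split.
    apply: le_trans h1 _; rewrite exprS -mulrA mulrCA ler_wpM2l//; first by rewrite exprn_ge0//; lra.
    by apply: le_trans (nred w ws) _; rewrite ler_wpM2r//; lra.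
  apply: le_trans h2 _; apply: le_trans (lee_wpmul2l _ (Nred w ws)) _.
    by rewrite lee_fin exprn_ge0//; lra.
  by rewrite muleA -EFinM exprSr.
Qed.

Lemma unit_supp S : (exists i, i \in S) -> exists w, supp_in S w /\ `|w| = 1.
Proof.
move=> [i iS]; exists (delta_mx ord0 i); split.
  move=> j jS; rewrite mxE eqxx/=; case: eqP => // ji.
  by move: jS; rewrite ji iS.
apply/eqP; rewrite eq_le; apply/andP; split.
  rewrite norm_mxE mx_normrE; apply: bigmax_le => // -[j k] _ /=.
  by rewrite mxE; case: (_ && _); rewrite ?normr1 ?normr0.
by have := le_norm_coord (delta_mx ord0 i) i; rewrite mxE !eqxx normr1.
Qed.

(** A zero of N is a minimizer. Otherwise the infimum is at least c > 0, so an element within c of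
    it is within a factor 2; if the infimum is infinite, any unit vector serves. *)
Lemma near_min_pos N : (forall v, (0 <= N v)%E) ->
  (forall S, (exists i, i \in S) ->
    (exists e, [/\ supp_in S e, `|e| = 1 & N e = 0%E]) \/
    exists2 c : R, 0 < c & forall w, supp_in S w -> `|w| = 1 -> (c%:E <= N w)%E) ->
  near_min N.
Proof.
move=> N0 H S S0; case: (H S S0) => [[e [se ne Ne]]|[c c0 hc]].
  by exists e; split => // w _ _; rewrite Ne mule_ge0.
pose A := [set N w | w in [set w | supp_in S w /\ `|w| = 1]].
have [w0 [sw0 nw0]] := unit_supp S0.
have cI : (c%:E <= ereal_inf A)%E.
  by apply: le_ereal_inf_tmp => _ [w [sw nw] <-]; exact: hc.
have [Ioo|Ifin] := eqVneq (ereal_inf A) +oo%E.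
  exists w0; split => // w sw nw.
  have -> : N w = +oo%E.
    apply/eqP; rewrite -leye_eq -Ioo; apply: ereal_inf_lbound; by exists w.
  by rewrite gt0_muley ?leey// lte_fin.
have fI : ereal_inf A \is a fin_num.
  by rewrite fin_numE Ifin andbT gt_eqF// (lt_le_trans _ cI)// ltNyr.
have [_ [e [se ne] <-] he] := lb_ereal_inf_adherent c0 fI.
exists e; split => // w sw nw; apply: (le_trans (ltW he)).
have h : (ereal_inf A <= N w)%E by apply: ereal_inf_lbound; exists w.
apply: le_trans (leeD h (le_trans cI h)) _.
by rewrite -(mule2n (N w)) mule_natl.
Qed.

Lemma quasi_norm_lipschitz K N : quasi_norm K N -> (forall i, (N (delta_mx ord0 i) < +oo)%E) ->
  exists2 L : R, 0 < L & forall v, (N v <= (L * `|v|)%:E)%E.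
Proof.
move=> [K1 N0 NZ ND] fin.
have N00 : N 0 = 0%E by have := NZ 0 0; rewrite scale0r normr0 mul0e.
have finD i : N (delta_mx ord0 i) \is a fin_num by rewrite ge0_fin_numE.
pose B := 1 + \sum_(i < n) fine (N (delta_mx ord0 i)).
have dB i : fine (N (delta_mx ord0 i)) <= B.
  rewrite /B (bigD1 i)//= addrCA lerDl addr_ge0// sumr_ge0// => j _.
  exact: fine_ge0.
have B0 : 0 < B by rewrite ltr_pwDl// sumr_ge0// => j _; exact: fine_ge0.
have main v (s : seq 'I_n) : exists2 L : R, 0 < L & forall v,
    (N (\sum_(i <- s) v ord0 i *: delta_mx ord0 i)%R <= (L * `|v|)%:E)%E.
  elim: s => [|i s [L L0 hL]].
    by exists 1 => // u; rewrite big_nil N00 lee_fin mul1r.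
  exists (K * (B + L)); first by rewrite mulr_gt0//; lra.
  move=> u; rewrite big_cons; apply: le_trans (ND _ _) _.
  rewrite -mulrA EFinM; apply: lee_wpmul2l; first by rewrite lee_fin; lra.
  rewrite mulrDl EFinD; apply: leeD => //.
  rewrite NZ -(fineK (finD i)) -EFinM lee_fin mulrC.
  by apply: ler_pM => //; [exact: fine_ge0|exact: le_norm_coord].
have [L L0 hL] := main 0 (index_enum 'I_n).
exists L => // v; apply: le_trans (hL v).
by rewrite {1}(row_sum_delta v).
Qed.

(** If N has no zero on the unit sphere of the subspace, compactness bounds it below. N need not be
    continuous, but N(w) <= K (N(v) + N(w - v)) and the Lipschitz bound keep N(v) >= N(w) / (2K)
    near w. *)
Lemma near_min_finite K N : quasi_norm K N ->
  (forall i, (N (delta_mx ord0 i) < +oo)%E) -> near_min N.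
Proof.
move=> qN fin; have [K1 N0 NZ ND] := qN.
have [L L0 hL] := quasi_norm_lipschitz qN fin.
apply: near_min_pos => // S S0.
have [[e [se ne Ne]]|no] := pselect (exists e, [/\ supp_in S e, `|e| = 1 & N e = 0%E]).
  by left; exists e.
right; pose A := [set w : V | supp_in S w /\ `|w| = 1].
have cA : compact A.
  apply: bounded_closed_compact.
    exists 1; split; first exact: num_real.
    by move=> x x1 w [_ /= ->]; exact: ltW.
  have -> : A = \bigcap_(i in [set i | i \notin S]) [set w : V | w ord0 i = 0] `&` [set w | `|w| = 1].
    by apply/seteqP; split => w [h1 h2]; split => //; move=> i iS; exact: h1.
  apply: closedI.
    apply: closed_bigI => i _.
    by apply: (@closed_comp _ _ (fun w : V => w ord0 i) [set x | x = 0]);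
      [move=> x _; exact: coord_continuous|exact: closed_eq].
  apply: (@closed_comp _ _ (fun w : V => `|w|) [set x | x = 1]); last exact: closed_eq.
  by move=> x _; exact: norm_continuous.
have /compact_near_coveringP/(_ R (0^'+) (fun dl w => (dl%:E <= N w)%E)) := cA.
move=> /(_ _); case.
  move=> w [sw nw].
  have Nw : (0 < N w)%E.
    by rewrite lt0e N0 andbT; apply/eqP => h; apply: no; exists w.
  have Nwf : N w \is a fin_num.
    by rewrite ge0_fin_numE//; apply: le_lt_trans (hL w) _; rewrite ltry.
  pose c := fine (N w); have c0 : 0 < c by rewrite fine_gt0// Nw ltey_eq Nwf.
  (* On the ball of radius r one has N(w - v) <= L r = c / (2K), which uses up half of c = N(w) in
     the quasi-triangle inequality. *)
  pose r := c / (2 * K * L); have r0 : 0 < r.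
    by rewrite divr_gt0// !mulr_gt0//; lra.
  exists (ball w r, [set dl | dl <= c / (2 * K)]); first split => /=.
  - exact: nbhsx_ballx.
  - by apply: nbhs_right_le; rewrite divr_gt0// mulr_gt0//; lra.
  move=> [v dl] /= []; rewrite -ball_normE /= => hv hdl; apply: (@le_trans _ _ (c / (2 * K))%:E).
    by rewrite lee_fin.
  have h : (N w <= K%:E * (N v + (c / (2 * K))%:E))%E.
    have -> : N w = N (v + (w - v)) by rewrite addrC subrK.
    apply: le_trans (ND _ _) _; apply: lee_wpmul2l; first by rewrite lee_fin; lra.
    apply: leeD2l; apply: le_trans (hL _) _; rewrite lee_fin.
    apply: (le_trans (ler_wpM2l (ltW L0) (ltW hv))).
    rewrite /r le_eqVlt; apply/orP; left; apply/eqP; field; lra.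
  have Nvf : N v \is a fin_num.
    by rewrite ge0_fin_numE//; apply: le_lt_trans (hL v) _; rewrite ltry.
  move: h; rewrite -(fineK Nwf) -/c -(fineK Nvf) -EFinD -EFinM !lee_fin.
  set z := fine (N v) => h; rewrite ler_pdivrMr; last lra.
  have e : K * (c / (2 * K)) = c / 2 by field; lra.
  rewrite mulrDr e in h; lra.
move=> e /= e0 he.
have e20 : 0 < e / 2 by lra.
exists (e / 2) => // w sw nw.
apply: (he (e / 2)) => //=; rewrite sub0r normrN gtr0_norm//; lra.
Qed.

End adapted_basis.

(** * The dyadic maximal function *)

Section maximal_line.
Variable R : realType.
Local Notation mu := (@lebesgue_measure R).
Implicit Types (F : R -> R) (B t : R).

Definition wk1 la tau : R := la * (1 + `|la * tau|) ^- 2.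

Lemma wk1_ge0 la tau : 0 <= la -> 0 <= wk1 la tau.
Proof. by move=> la0; rewrite /wk1 mulr_ge0// invr_ge0 exprn_ge0// addr_ge0. Qed.

Lemma measurable_wk1 la : measurable_fun setT (wk1 la).
Proof.
apply: measurable_funM => //.
rewrite [X in measurable_fun _ X](_ : _ = fun tau => (1 + `|la * tau|) `^ (- 2%:R)); last first.
  by apply/funext => tau; rewrite -powR_invn// addr_ge0.
apply: (measurableT_comp (f := @powR R ^~ (- 2%:R))); first exact: measurable_powR.
apply: measurable_funD => //; apply: measurableT_comp => //; exact: measurable_funM.
Qed.

Lemma nneseries_le_bound (u : nat -> \bar R) (a : \bar R) :
  (forall n, 0 <= u n)%E -> (forall n, \sum_(0 <= i < n) u i <= a)%E ->
  (\sum_(i <oo) u i <= a)%E.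
Proof.
move=> u0 ua; apply: lime_le; first exact: is_cvg_nneseries.
by apply: nearW => n; rewrite (le_trans _ (ua n)).
Qed.

Lemma le_nneseries_term (u : nat -> \bar R) m :
  (forall n, 0 <= u n)%E -> (u m <= \sum_(i <oo) u i)%E.
Proof.
move=> u0; rewrite (@nneseriesD1 _ u m)//; first by rewrite leeDl// nneseries_ge0.
Qed.

Lemma measurable_nneseries dT (T : measurableType dT) (u : nat -> T -> \bar R) :
  (forall n x, 0 <= u n x)%E -> (forall n, measurable_fun setT (u n)) ->
  measurable_fun setT (fun x => (\sum_(n <oo) u n x)%E).
Proof.
move=> u0 mu'; exact: (ge0_emeasurable_sum (P := xpredT) (fun k x _ _ => u0 k x) (fun k _ => mu' k)).
Qed.

Lemma geometric_half N : \sum_(0 <= i < N) 2 ^- i <= 2 :> R.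
Proof.
suff -> : \sum_(0 <= i < N) 2 ^- i = 2 - 2 * 2 ^- N :> R.
  by rewrite gerBl mulr_ge0// invr_ge0.
elim: N => [|N ih]; first by rewrite big_geq// expr0 invr1 mulr1 subrr.
rewrite big_nat_recr//= ih exprS invfM mulrA divff// mul1r; lra.
Qed.

(** The term with the least l such that |tau| < 2^l / la already dominates, because then la |tau| >=
    2^(l-1) when l > 0. *)
Lemma wk1_dyadic la tau : 0 < la ->
  ((wk1 la tau)%:E <= \sum_(l <oo) (4 * 4 ^- l * la * (`|tau| < 2 ^+ l / la)%R%:R)%:E)%E.
Proof.
move=> la0.
have ex : exists l, `|tau| < 2 ^+ l / la.
  have := truncnS_gt (`|tau| * la); set m := (Num.truncn _).+1 => hm.
  exists m; rewrite ltr_pdivlMr// (lt_trans hm)// -natrX ltr_nat.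
  exact: ltn_expl.
case: (ex_minnP ex) => l hl lmin.
apply: le_trans (@le_nneseries_term _ l _); last first.
  by move=> n; rewrite lee_fin !mulr_ge0// ?invr_ge0// ltW.
rewrite hl mulr1 lee_fin /wk1 mulrC ler_pM2r//.
case: l hl lmin => [|l] hl lmin.
  rewrite expr0 invr1 mulr1 (@le_trans _ _ 1)//; last lra.
  by rewrite invf_le1 ?exprn_gt0 ?ltr_pwDl// exprn_ege1// lerDl.
have hl' : 2 ^+ l <= 1 + `|la * tau|.
  have : ~~ (`|tau| < 2 ^+ l / la) by apply/negP => /lmin; rewrite ltnn.
  rewrite -leNgt ler_pdivrMr// normrM (gtr0_norm la0) mulrC => h.
  by apply: le_trans h _; rewrite lerDr.
have -> : (4 : R) / 4 ^+ l.+1 = 4 ^- l by rewrite exprS invfM mulrA divff ?mul1r.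
rewrite lef_pV2 ?posrE ?exprn_gt0 ?ltr_pwDl//.
have -> : (4 : R) = 2 ^+ 2 by rewrite expr2; lra.
by rewrite -exprM mulnC exprM lerXn2r// ?nnegrE// addr_ge0.
Qed.

Lemma bounded_locally_integrable F B : measurable_fun setT F ->
  (forall x, `|F x| <= B) -> locally_integrable setT F.
Proof.
move=> mF FB; split => //; first exact: openT.
move=> K _ cK.
have mK : measurable K by exact: compact_measurable.
have B0 : 0 <= B by exact: le_trans (FB 0).
apply: (@le_lt_trans _ _ (\int[mu]_(x in K) B%:E)%E).
  apply: ge0_le_integral => //.
  - apply/measurable_EFinP/measurable_funTS; exact: measurableT_comp.
  - by move=> x _; rewrite lee_fin.
rewrite integral_cst//; apply: lte_mul_pinfty => //.
by apply: compact_finite_measure.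
Qed.

Lemma iavg_le F B x r : measurable_fun setT F -> (forall x, `|F x| <= B) -> 0 < r ->
  (iavg F (ball x r) <= B%:E)%E.
Proof.
move=> mF FB r0; have B0 : 0 <= B by exact: le_trans (FB 0).
rewrite /iavg lebesgue_measure_ball ?(ltW r0)// inver mulrn_eq0/= (gt_eqF r0).
rewrite lee_pdivrMl ?pmulrn_lgt0//.
apply: (@le_trans _ _ (\int[mu]_(x in ball x r) B%:E)%E).
  apply: ge0_le_integral => //; first exact: measurable_ball.
  - apply/measurable_EFinP/measurable_funTS; exact: measurableT_comp.
  - by move=> y _; rewrite lee_fin.
rewrite integral_cst//; last exact: measurable_ball.
by rewrite -[X in (_ * X <= _)%E]/(lebesgue_measure (ball x r)) lebesgue_measure_ball ?(ltW r0)// muleC.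
Qed.

Lemma HL_maximal_le F B x : measurable_fun setT F -> (forall x, `|F x| <= B) ->
  (HL_maximal F x <= B%:E)%E.
Proof.
move=> mF FB; apply: ge_ereal_sup => _ [r /= r0 <-]; apply: iavg_le => //.
by move: r0; rewrite in_itv/= andbT.
Qed.

Lemma avg_le_HL F B x r : measurable_fun setT F -> (forall x, 0 <= F x <= B) -> 0 < r ->
  (\int[mu]_tau ((`|tau| < r)%R%:R * F (x - tau))%:E <= (r *+ 2)%:E * HL_maximal F x)%E.
Proof.
move=> mF FB r0.
pose G s := ((`|x - s| < r)%R%:R * F s)%:E.
have mG : measurable_fun setT G.
  apply/measurable_EFinP; apply: measurable_funM => //.
  rewrite [X in measurable_fun _ X](_ : _ = \1_(ball x r)); last first.
    by apply/funext => s; rewrite indicE/= mem_setE.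
  by apply: measurable_indic; exact: measurable_ball.
have G0 s : (0 <= G s)%E.
  by have /andP[F0 _] := FB s; rewrite /G lee_fin mulr_ge0.
have -> : (\int[mu]_tau ((`|tau| < r)%R%:R * F (x - tau))%:E = \int[mu]_tau G (-1 * tau + x)%R)%E.
  by apply: eq_integral => tau _; rewrite /G mulN1r (addrC (- tau)) subKr.
rewrite ge0_integral_affine ?oppr_eq0 ?oner_eq0// normrN1 invr1 mul1e.
have -> : (\int[mu]_s G s = \int[mu]_(s in ball x r) `|(F s)%:E|)%E.
  rewrite [RHS]integral_mkcond epatch_indic; apply: eq_integral => s _.
  have /andP[F0 _] := FB s.
  have -> : (EFin \o \1_(ball x r)) s = (((`|x - s| < r)%R%:R : R)%:E).
    by change ((\1_(ball x r) s)%:E = (((`|x - s| < r)%R%:R : R)%:E)); rewrite indicE mem_setE.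
  rewrite gee0_abs ?lee_fin// muleC; reflexivity.
rewrite -lee_pdivrMl ?pmulrn_lgt0//.
apply: ereal_sup_ubound; exists r; first by rewrite /= in_itv/= r0.
by rewrite /iavg lebesgue_measure_ball ?(ltW r0)// inver mulrn_eq0/= gt_eqF.
Qed.

(** The l-th term of [wk1_dyadic] has height 4 * 4^-l la and lives on an interval of length 2 * 2^l
    / la, so it contributes 8 * 2^-l times the maximal function; the sum over l is at most 16. *)
Lemma wk1_le_HL F B x la : measurable_fun setT F -> (forall x, 0 <= F x <= B) -> 0 < la ->
  (\int[mu]_tau (wk1 la tau * F (x - tau))%:E <= 16%:E * HL_maximal F x)%E.
Proof.
move=> mF FB la0.
have F0 y : 0 <= F y by have /andP[] := FB y.
have locF : locally_integrable setT F.
  by apply: (@bounded_locally_integrable _ B) => // y; rewrite ger0_norm//; have /andP[] := FB y.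
have mFx : measurable_fun setT (fun tau : R => F (x - tau)).
  by apply: measurableT_comp => //; apply: measurable_funB.
pose u l tau := (4 * 4 ^- l * la * ((`|tau| < 2 ^+ l / la)%R%:R * F (x - tau)))%:E.
have u0 l tau : (0 <= u l tau)%E.
  by rewrite lee_fin !mulr_ge0// ?invr_ge0// ltW.
have mu' l : measurable_fun setT (fun tau : R => (`|tau| < 2 ^+ l / la)%R%:R * F (x - tau)).
  apply: measurable_funM => //.
  rewrite [X in measurable_fun _ X](_ : _ = \1_(ball (0:R) (2 ^+ l / la))); last first.
    by apply/funext => s; rewrite indicE mem_setE; congr (nat_of_bool _)%:R; rewrite -[in LHS]normrN -sub0r.
  by apply: measurable_indic; exact: measurable_ball.
have mul l : measurable_fun setT (u l).
  by apply/measurable_EFinP; exact: measurable_funM.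
apply: (@le_trans _ _ (\int[mu]_tau (\sum_(l <oo) u l tau))%E).
  apply: ge0_le_integral => //.
  - by move=> tau _; rewrite lee_fin mulr_ge0// wk1_ge0// ltW.
  - by apply/measurable_EFinP; apply: measurable_funM => //; exact: measurable_wk1.
  - by apply: measurable_nneseries.
  - move=> tau _; rewrite EFinM muleC.
    apply: (@le_trans _ _ ((F (x - tau))%:E * \sum_(l <oo) (4 * 4 ^- l * la * (`|tau| < 2 ^+ l / la)%R%:R)%:E))%E.
      by apply: lee_wpmul2l; [rewrite lee_fin|exact: wk1_dyadic].
    rewrite -nneseriesZl//; last first.
      by move=> l _; rewrite lee_fin !mulr_ge0// ?invr_ge0// ltW.
    apply: lee_nneseries => l _.
      by rewrite mule_ge0// lee_fin// !mulr_ge0// ?invr_ge0// ltW.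
    by rewrite /u -EFinM lee_fin [leLHS]mulrC -[leLHS]mulrA.
rewrite integral_nneseries//.
apply: nneseries_le_bound => [l|N].
  by apply: integral_ge0.
have H0 : (0 <= HL_maximal F x)%E by exact: HL_maximalT_ge0.
apply: (@le_trans _ _ (\sum_(0 <= i < N) (8 * 2 ^- i)%:E * HL_maximal F x)%E).
  apply: lee_sum => l _.
  have r0 : 0 < 2 ^+ l / la by rewrite divr_gt0// exprn_gt0.
  under eq_integral => tau _ do rewrite /u EFinM.
  rewrite ge0_integralZl//; last 3 first.
  - by apply/measurable_EFinP; exact: mu'.
  - by move=> tau _; rewrite lee_fin mulr_ge0.
  - by rewrite lee_fin !mulr_ge0// ?invr_ge0// ltW.
  apply: le_trans (lee_wpmul2l _ (avg_le_HL x mF FB r0)) _.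
    by rewrite lee_fin !mulr_ge0// ?invr_ge0// ltW.
  rewrite muleA -EFinM; apply: lee_wpmul2r => //; rewrite lee_fin.
  have -> : (4 : R) ^- l = 2 ^- l * 2 ^- l.
    by rewrite -invfM -exprMn; congr (_ ^+ _)^-1; lra.
  have la0' : la != 0 by rewrite gt_eqF.
  have key (z w : R) : z != 0 -> w != 0 ->
      4 * (z^-1 * z^-1) * w * ((z / w) *+ 2) = 8 * z^-1.
    by move=> z0 w0; field; rewrite z0.
  by rewrite le_eqVlt; apply/orP; left; apply/eqP; apply: key => //; rewrite gt_eqF// exprn_gt0.
rewrite -ge0_sume_distrl; last by move=> i _; rewrite lee_fin mulr_ge0// invr_ge0.
apply: lee_wpmul2r => //; rewrite sumEFin lee_fin -mulr_sumr.
have := geometric_half N; lra.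
Qed.

Lemma HL_sub F (G : R -> R) B x : measurable_fun setT F -> measurable_fun setT G ->
  (forall x, `|F x| <= B) -> (forall x, `|G x| <= B) ->
  (HL_maximal (F \+ G)%R x <= HL_maximal F x + HL_maximal G x)%E.
Proof.
move=> mF mG FB GB; apply: ge_ereal_sup => _ [r /= r0 <-].
apply: le_trans (iavgD _ _ _ _) _ => //.
- exact: measurable_ball.
- rewrite lebesgue_measure_ball ?ltry//; move: r0; rewrite in_itv/= andbT => /ltW//.
- exact: measurable_funTS.
- exact: measurable_funTS.
- by apply: leeD; apply: ereal_sup_ubound; exists r.
Qed.

(** The terms below X form the tail of a geometric series that starts below X. *)
Lemma sum_below (b rho X : R) N : 0 <= b -> 0 < rho -> rho < 1 -> 0 <= X ->
  \sum_(0 <= n < N) b * rho ^+ n * (b * rho ^+ n < X)%R%:R <= X / (1 - rho).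
Proof.
move=> b0 r0 r1 X0; have r1' : 0 < 1 - rho by lra.
elim: N b b0 => [|N ih] b b0; first by rewrite big_geq// divr_ge0// ltW.
have [bX|bX] := ltP b X.
  apply: (@le_trans _ _ (\sum_(0 <= n < N.+1) b * rho ^+ n)).
    apply: ler_sum => n _; rewrite ler_piMr ?lern1 ?leq_b1//.
    by rewrite mulr_ge0// exprn_ge0// ltW.
  rewrite -mulr_sumr ler_pdivlMr// -mulrA.
  have -> : (\sum_(0 <= n < N.+1) rho ^+ n) * (1 - rho) = 1 - rho ^+ N.+1.
    elim: (N.+1) => [|k ihk]; first by rewrite big_geq// mul0r expr0 subrr.
    rewrite big_nat_recr//= mulrDl ihk exprS; ring.
  apply: le_trans (ltW bX); rewrite ler_piMr// gerBl exprn_ge0// ltW//.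
rewrite big_nat_recl//= expr0 mulr1 ltNge bX mulr0 add0r.
under eq_bigr => n _ do rewrite exprS mulrA.
by apply: ih; rewrite mulr_ge0// ltW.
Qed.

Lemma powR_split (z t : R) : 0 <= z -> 1 < t -> z `^ t = z * z `^ (t - 1).
Proof.
move=> z0 t1; rewrite -[X in X * _](powRr1 z0) -powRD; first by congr (_ `^ _); ring.
by apply/implyP => /eqP h; exfalso; lra.
Qed.

(** Marcinkiewicz interpolation between the weak (1,1) and the sup bound, carried out on the dyadic
    levels a n = B 2^-n. Where the maximal function exceeds a (n+1), that of the part of F above a
    (n+2) exceeds a (n+2), because the rest of F contributes at most a (n+2). The weak bound 3 / a
    (n+2) is the 12 / a n used below. *)
Lemma HL_strong t : 1 < t -> exists C : R, 0 <= C /\ forall F B, measurable_fun setT F ->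
  (forall x, 0 <= F x <= B) ->
  (\int[mu]_x (HL_maximal F x `^ t) <= C%:E * \int[mu]_x (F x `^ t)%:E)%E.
Proof.
move=> t1; set rho := (2 : R) `^ (1 - t).
have rho0 : 0 < rho by exact: powR_gt0.
have rho1 : rho < 1.
  have l2 : 0 < ln (2 : R) by apply: ln_gt0; lra.
  have h : 0 < (t - 1) * ln (2 : R) by apply: mulr_gt0 => //; lra.
  rewrite /rho /powR ifF ?pnatr_eq0// -[ltRHS]expR0 ltr_expR; lra.
have r1' : 0 < 1 - rho by lra.
pose C := 12 * (4 `^ (t - 1) / (1 - rho)).
have C0 : 0 <= C by rewrite mulr_ge0// divr_ge0 ?powR_ge0// ltW.
exists C; split => // F B0 mF FB0.
have F0 y : 0 <= F y by have /andP[] := FB0 y.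
(* Adding 1 keeps all levels a n positive when B0 = 0. *)
pose B := B0 + 1.
have B_gt0 : 0 < B by rewrite ltr_pwDr// (le_trans (F0 0))//; have /andP[] := FB0 0.
have FB y : `|F y| <= B.
  by rewrite ger0_norm// /B; have /andP[_ h] := FB0 y; rewrite (le_trans h)// lerDl.
pose a n := B * 2 ^- n.
have a0 n : 0 < a n by rewrite mulr_gt0// invr_gt0 exprn_gt0.
pose E n := [set x | ((a n)%:E < HL_maximal F x)%E].
have locF : locally_integrable setT F by exact: bounded_locally_integrable FB.
have mH : measurable_fun setT (HL_maximal F) by exact: measurable_HL_maximal.
have mE n : measurable (E n).
  by rewrite -[X in measurable X]setTI; exact: emeasurable_fun_o_infty.
have mI n : measurable_fun setT (fun x => (\1_(E n) x)%:E).
  by apply/measurable_EFinP; apply: measurable_indic; exact: mE.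
pose c n x := (F x * (a n < F x)%R%:R).
have mc n : measurable_fun setT (c n).
  apply: measurable_funM => //.
  rewrite [X in measurable_fun _ X](_ : _ = \1_[set x | a n < F x]); last first.
    by apply/funext => s; rewrite indicE/= mem_setE.
  apply: measurable_indic; rewrite -[X in measurable X]setTI.
  have := mF measurableT _ (measurable_itv `]a n, +oo[).
  by congr measurable; apply/seteqP; split => z [_ /=]; rewrite ?in_itv/= ?andbT.
have c0 n x : 0 <= c n x by rewrite mulr_ge0.
have cB n x : `|c n x| <= B.
  rewrite ger0_norm// /c; apply: le_trans (FB x); rewrite ger0_norm// ler_piMr ?lern1 ?leq_b1//.
have muE n : (mu (E n.+1) <= (12 / a n)%:E * \int[mu]_x (c n.+2 x)%:E)%E.
  have loc : locally_integrable setT (c n.+2) by exact: bounded_locally_integrable (cB _).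
  have := maximal_inequality loc (a0 n.+2).
  have -> : 3 / a n.+2 = 12 / a n.
    rewrite /a !exprS; field; rewrite ?expf_neq0// gt_eqF//=.
  have -> : (\int[mu]_y `|(c n.+2 y)%:E| = \int[mu]_y (c n.+2 y)%:E)%E.
    by apply: eq_integral => y _; rewrite /= ger0_norm.
  apply: le_trans; apply: le_measure; rewrite ?inE//.
    exact: mE.
  by have := emeasurable_fun_o_infty measurableT (measurable_HL_maximal loc) (a n.+2)%:E; rewrite setTI.
  move=> x; rewrite /E /= => h; rewrite ltNge; apply/negP => h'.
  move: h; apply/negP; rewrite -leNgt.
  pose G y := F y - c n.+2 y.
  have mG : measurable_fun setT G by exact: measurable_funB.
  have Ga y : `|G y| <= a n.+2.
    rewrite /G /c; case: ltP => h; first by rewrite mulr1 subrr normr0 ltW.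
    by rewrite mulr0 subr0 ger0_norm.
  have -> : F = c n.+2 \+ G by apply/funext => y; rewrite /= /G addrC subrK.
  apply: le_trans (@HL_sub _ _ B x (mc _) mG (cB _) _) _.
    move=> y; apply: le_trans (Ga y) _; rewrite /a; apply: ler_piMr; first exact: ltW.
    by rewrite invf_le1 ?exprn_gt0//; apply: exprn_ege1; rewrite ler1n.
  apply: le_trans (leeD h' (HL_maximal_le x mG Ga)) _.
  rewrite -EFinD lee_fin /a (exprS _ n.+1) invfM mulrCA -mulrDl.
  have -> : 2^-1 + 2^-1 = 1 :> R by lra.
  by rewrite mul1r.
apply: (@le_trans _ _ (\int[mu]_x \sum_(n <oo) ((a n `^ t)%:E * (\1_(E n.+1) x)%:E))%E).
  apply: ge0_le_integral => //.
  - by move=> x _; exact: poweR_ge0.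
  - exact: (measurableT_comp (measurable_poweR t) mH).
  - apply: measurable_nneseries => [n x|n]; first by rewrite mule_ge0// lee_fin ?powR_ge0.
    by apply: measurable_funeM; exact: mI.
  move=> x _.
  have := HL_maximal_le x mF FB; have := HL_maximalT_ge0 locF x.
  case e : (HL_maximal F x) => [v||]//; rewrite !lee_fin => v0 vB.
  have [->|vn0] := eqVneq v 0.
    have tn0 : t != 0 by rewrite gt_eqF//; lra.
    rewrite (poweR0r tn0).
    by apply: nneseries_ge0 => n _ _; rewrite mule_ge0// lee_fin ?powR_ge0.
  have vp : 0 < v by rewrite lt0r vn0.
  have ex : exists n, a n < v.
    exists (Num.truncn (B / v)).+1; set m := _.+1.
    have : B / v < m%:R by exact: truncnS_gt.
    rewrite ltr_pdivrMr// /a ltr_pdivrMr ?exprn_gt0// => /lt_le_trans; apply.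
    rewrite mulrC ler_pM2l// -natrX ler_nat ltnW// ltn_expl//.
  case: (ex_minnP ex) => -[|n] hn nmin.
    by move: hn; rewrite /a expr0 invr1 mulr1 ltNge vB.
  have vn : v <= a n.
    by rewrite leNgt; apply/negP => /nmin; rewrite ltnn.
  apply: le_trans (@le_nneseries_term _ n _); last first.
    by move=> k; rewrite mule_ge0// lee_fin ?powR_ge0.
  have -> : \1_(E n.+1) x = 1 :> R.
    by rewrite indicE mem_set// /E /= e lte_fin.
  by rewrite mule1 lee_fin; apply: ge0_ler_powR; rewrite ?nnegrE//; lra.
rewrite integral_nneseries//; last 2 first.
- by move=> n; apply: measurable_funeM; exact: mI.
- by move=> n x _; rewrite mule_ge0// lee_fin ?powR_ge0.
apply: (@le_trans _ _ (\sum_(n <oo) \int[mu]_x (12 * (a n `^ (t - 1)) * c n.+2 x)%:E)%E).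
  apply: lee_nneseries => n _.
    by move=> _; apply: integral_ge0 => x _; rewrite mule_ge0// lee_fin ?powR_ge0.
  rewrite ge0_integralZl//; last 2 first.
  - exact: mI.
  - by rewrite lee_fin powR_ge0.
  have iE : (\int[mu]_x (\1_(E n.+1) x)%:E = mu (E n.+1))%E.
    by rewrite integral_indic ?setIT//; exact: mE.
  rewrite iE.
  apply: le_trans (lee_wpmul2l _ (muE n)) _; first by rewrite lee_fin powR_ge0.
  under [leRHS]eq_integral => x _ do rewrite EFinM.
  have cst0 : (0 <= (12 * a n `^ (t - 1))%:E)%E by rewrite lee_fin mulr_ge0// powR_ge0.
  have mcE : measurable_fun setT (fun x => (c n.+2 x)%:E) by exact/measurable_EFinP.
  have cE0 x : [set: R] x -> (0 <= (c n.+2 x)%:E)%E by rewrite lee_fin.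
  rewrite [leRHS](ge0_integralZl mu measurableT mcE cE0 cst0).
  rewrite muleA -EFinM; apply: lee_wpmul2r; first by apply: integral_ge0 => x _; rewrite lee_fin.
  rewrite lee_fin (powR_split (ltW (a0 n))); last lra.
  rewrite le_eqVlt; apply/orP; left; apply/eqP.
  move: (a n `^ (t - 1)) => w; move: (a n) (a0 n) => z z0.
  by field; rewrite gt_eqF.
rewrite -integral_nneseries//; last 2 first.
- by move=> n; apply/measurable_EFinP; exact: (measurable_funM (measurable_cst _) (mc _)).
- by move=> n x _; rewrite lee_fin !mulr_ge0// powR_ge0.
have mFt : measurable_fun setT (fun x => (F x `^ t)%:E).
  apply/measurable_EFinP; apply: (measurableT_comp (f := @powR R ^~ t)); last exact: mF.
  exact: measurable_powR.
rewrite -ge0_integralZl//; last by move=> x _; rewrite lee_fin powR_ge0.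
apply: ge0_le_integral => //.
- by move=> x _; apply: nneseries_ge0 => n _ _; rewrite lee_fin !mulr_ge0// powR_ge0.
- apply: measurable_nneseries => [n x|n]; first by rewrite lee_fin !mulr_ge0// powR_ge0.
  by apply/measurable_EFinP; exact: (measurable_funM (measurable_cst _) (mc _)).
- exact: measurable_funeM.
move=> x _; apply: nneseries_le_bound => [n|N].
  by rewrite lee_fin !mulr_ge0// powR_ge0.
rewrite sumEFin lee_fin.
pose b := B `^ (t - 1); pose X := (4 * F x) `^ (t - 1).
have aE n : a n `^ (t - 1) = b * rho ^+ n.
  rewrite /a powRM ?invr_ge0 ?exprn_ge0 ?ltW//; congr (_ * _).
  have -> : (2 : R) ^- n = 2 `^ (- n%:R) by rewrite powR_invn.
  rewrite -powRrM /rho -(powR_mulrn n (powR_ge0 2 (1 - t))) -powRrM.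
  by congr (_ `^ _); ring.
apply: (@le_trans _ _ (12 * F x * \sum_(0 <= n < N) b * rho ^+ n * (b * rho ^+ n < X)%R%:R)).
  rewrite mulr_sumr; apply: ler_sum => n _; rewrite aE /c.
  have br0 : 0 <= b * rho ^+ n by apply: mulr_ge0; [exact: powR_ge0|exact/exprn_ge0/ltW].
  have F12 : 0 <= 12 * F x by exact: mulr_ge0.
  case: ltP => [h|_]; last first.
    by rewrite !mulr0; apply: mulr_ge0 => //; exact: mulr_ge0.
  have a4 : a n < 4 * F x.
    have : a n.+2 = a n / 4 by rewrite /a !exprS; field; rewrite expf_neq0.
    by move: h => + e; rewrite e; lra.
  have tp : 0 < t - 1 by lra.
  have hX : b * rho ^+ n < X.
    rewrite -aE; apply: (gt0_ltr_powR tp) => //; rewrite nnegrE; first exact/ltW.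
    exact: mulr_ge0.
  by rewrite hX !mulr1 mulrAC.
apply: le_trans (ler_wpM2l _ (@sum_below b rho X N _ _ _ _)) _ => //.
- by rewrite mulr_ge0.
- exact: powR_ge0.
- exact: powR_ge0.
rewrite /X powRM// (powR_split (F0 x) t1).
by rewrite /C le_eqVlt; apply/orP; left; apply/eqP; ring.
Qed.

End maximal_line.

Section maximal_rV.
Variable R : realType.
Implicit Types (lam : nat -> R).

Lemma measurable_subV d : measurable_fun setT (fun z : 'rV[R]_d * 'rV[R]_d => z.1 - z.2).
Proof.
apply: measurable_fun_rVP => i; under eq_fun do rewrite !mxE.
apply: measurable_funB.
  exact: (measurableT_comp (measurable_rV_coord i) measurable_fst).
exact: (measurableT_comp (measurable_rV_coord i) measurable_snd).
Qed.

Definition avg d la (h : 'rV[R]_d -> \bar R) (x : 'rV[R]_d) : \bar R :=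
  (\int[lebesgue_rV R d]_y ((wk 2 la y)%:E * h (x - y)%R))%E.

(** [esups] from index 0 is the supremum over the whole sequence of scales; its countability yields
    measurability. *)
Definition maxf d lam (h : 'rV[R]_d -> \bar R) (x : 'rV[R]_d) : \bar R :=
  esups (fun n => avg (lam n) h x) 0%N.

Section dim.
Variable d : nat.
Local Notation V := 'rV[R]_d.
Local Notation mu := (lebesgue_rV R d).
Implicit Types h : V -> \bar R.

Lemma avg_ge0 la h x : 0 < la -> (forall y, 0 <= h y)%E -> (0 <= avg la h x)%E.
Proof.
move=> la0 h0; apply: integral_ge0 => y _; rewrite mule_ge0// lee_fin.
exact/wk_ge0/ltW.
Qed.

Lemma avg_le_maxf lam h x n : (avg (lam n) h x <= maxf lam h x)%E.
Proof. by apply: ereal_sup_ubound; exists n. Qed.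

Lemma maxf_ge0 lam h x : (forall n, 0 < lam n) -> (forall y, 0 <= h y)%E ->
  (0 <= maxf lam h x)%E.
Proof. by move=> l0 h0; apply: le_trans (avg_le_maxf _ _ _ 0%N); exact: avg_ge0. Qed.

Lemma maxf_le lam h x b : (forall n, avg (lam n) h x <= b)%E -> (maxf lam h x <= b)%E.
Proof. by move=> hb; apply: ge_ereal_sup => _ [n _ <-]; exact: hb. Qed.

Lemma measurable_wk la : 0 < la -> measurable_fun setT (@wk R d 2 la).
Proof. by move=> la0; exact: intg_measurable (intg_wk d la0 (leqnn 2)). Qed.

Lemma measurable_avg_param dT (T : measurableType dT) la (h : T -> V -> \bar R) :
  0 < la -> measurable_fun setT (fun z : T * V => h z.1 z.2) ->
  (forall t y, 0 <= h t y)%E ->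
  measurable_fun setT (fun z : T * V => avg la (h z.1) z.2).
Proof.
move=> la0 mh h0.
pose f (w : (T * V) * V) : \bar R := ((wk 2 la w.2)%:E * h w.1.1 (w.1.2 - w.2)%R)%E.
have f0 w : (0 <= f w)%E by rewrite mule_ge0// lee_fin; exact/wk_ge0/ltW.
have mf : measurable_fun setT f.
  apply: emeasurable_funM.
    apply/measurable_EFinP; apply: measurableT_comp; first exact: measurable_wk.
    exact: measurable_snd.
  have mg : measurable_fun setT (fun w : (T * V) * V => (w.1.1, w.1.2 - w.2)).
    apply/measurable_fun_pair => /=.
      exact: (measurableT_comp measurable_fst measurable_fst).
    apply: (measurableT_comp (@measurable_subV d)
      (g := fun w : (T * V) * V => (w.1.2, w.2))).
    apply/measurable_fun_pair => /=; last exact: measurable_snd.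
    exact: (measurableT_comp measurable_snd measurable_fst).
  exact: (measurableT_comp mh mg).
exact: (measurable_fun_fubini_tonelli_F f mf f0).
Qed.

Lemma measurable_maxf_param dT (T : measurableType dT) lam (h : T -> V -> \bar R) :
  (forall n, 0 < lam n) -> measurable_fun setT (fun z : T * V => h z.1 z.2) ->
  (forall t y, 0 <= h t y)%E ->
  measurable_fun setT (fun z : T * V => maxf lam (h z.1) z.2).
Proof.
move=> l0 mh h0; apply: measurable_fun_esups => n.
exact: measurable_avg_param.
Qed.

Lemma measurable_maxf lam h : (forall n, 0 < lam n) -> measurable_fun setT h ->
  (forall y, 0 <= h y)%E -> measurable_fun setT (maxf lam h).
Proof.
move=> l0 mh h0.
have := @measurable_maxf_param _ unit lam (fun _ => h) l0 (measurableT_comp mh measurable_snd) (fun _ => h0).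
move=> H; apply: (measurableT_comp H (g := fun y : V => (tt, y))).
exact: measurable_pair1.
Qed.

Lemma maxf_bound lam h (B : R) x : (forall n, 0 < lam n) -> 0 <= B ->
  measurable_fun setT h ->
  (forall y, 0 <= h y <= B%:E)%E -> (maxf lam h x <= (I2 R d * B)%:E)%E.
Proof.
move=> l0 B0 mh hB; apply: maxf_le => n.
have iw := intg_wk d (l0 n) (leqnn 2).
apply: (@le_trans _ _ (\int[mu]_y (B%:E * (wk 2 (lam n) y)%:E))%E).
  apply: ge0_le_integralT => y; have /andP[h0 h1] := hB (x - y).
    by rewrite mule_ge0// lee_fin; exact/wk_ge0/ltW.
  rewrite muleC; apply: lee_wpmul2r => //; rewrite lee_fin; exact/wk_ge0/ltW.
rewrite ge0_integralZl//; last 2 first.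
- by apply/measurable_EFinP; exact: measurable_wk (l0 _).
- by move=> y _; rewrite lee_fin; exact/wk_ge0/ltW.
rewrite -(EFin_Rint iw) -EFinM lee_fin mulrC ler_wpM2r//.
exact: Rint_wk.
Qed.

End dim.

Lemma wk_cons d la t (y : 'rV[R]_d) :
  wk 2 la (rV_cons (t, y)) = wk1 la t * wk 2 la y.
Proof.
rewrite /wk /wk1 /wt big_ord_recl mxE rV_cons0 exprMn invfM exprS.
rewrite (eq_bigr (fun i => 1 + `|(la *: y) ord0 i|)); last first.
  by move=> i _; rewrite mxE rV_consS [in RHS]mxE.
exact: mulrACA.
Qed.

Lemma rV_consB d (t t' : R) (y y' : 'rV[R]_d) :
  rV_cons (t, y) - rV_cons (t', y') = rV_cons (t - t', y - y').
Proof.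
apply/rowP => i; rewrite mxE [X in _ + X]mxE; case: (unliftP ord0 i) => [j|] ->.
  by rewrite !rV_consS /= !mxE.
by rewrite !rV_cons0.
Qed.

(** Here the product form of the kernel pays off: for each scale the inner average is at most the
    maximal function in the other variables, and the outer one is a one-dimensional average. No
    covering argument in R^d is needed. *)
Lemma maxf_cons d lam (h : 'rV[R]_d.+1 -> \bar R) (B : R) t y :
  (forall n, 0 < lam n) -> 0 <= B -> measurable_fun setT h ->
  (forall z, 0 <= h z <= B%:E)%E ->
  (maxf lam h (rV_cons (t, y)) <=
   16%:E * HL_maximal (fun t' => fine (maxf lam (fun y' => h (rV_cons (t', y'))) y)) t)%E.
Proof.
move=> l0 B0 mh hB; pose h' t' y' := h (rV_cons (t', y')).
have h0 z : (0 <= h z)%E by have /andP[] := hB z.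
have mh' t' : measurable_fun setT (h' t') by exact: measurable_rV_cons_fst.
have mhh : measurable_fun setT (fun z : R * 'rV[R]_d => h' z.1 z.2).
  rewrite (_ : (fun z => _) = h \o (@rV_cons R d)); last by apply/funext => -[].
  by apply: measurableT_comp => //; exact: measurable_rV_cons.
have m0 t' y' : (0 <= maxf lam (h' t') y')%E by apply: maxf_ge0 => // z; exact: h0.
have mB t' y' : (maxf lam (h' t') y' <= (I2 R d * B)%:E)%E.
  by apply: maxf_bound => // z; exact: hB.
have mfin t' y' : maxf lam (h' t') y' \is a fin_num.
  by rewrite ge0_fin_numE//; apply: le_lt_trans (mB t' y') _; rewrite ltry.
pose F t' := fine (maxf lam (h' t') y).
have mF : measurable_fun setT F.
  apply/measurable_EFinP.
  rewrite (_ : EFin \o F = fun t' => maxf lam (h' t') y); last first.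
    by apply/funext => t'; rewrite /F /= fineK.
  have H := measurable_maxf_param l0 mhh (fun t' y' => h0 _).
  by apply: (measurableT_comp H (g := fun t' : R => (t', y))); exact: measurable_pair2.
have FB t' : 0 <= F t' <= I2 R d * B.
  by rewrite -!lee_fin fineK// m0 mB.
apply: maxf_le => n.
apply: le_trans (wk1_le_HL t mF FB (l0 n)).
rewrite /avg ge0_integral_rVS; last 2 first.
- apply: emeasurable_funM; first by apply/measurable_EFinP; exact: measurable_wk (l0 _).
  apply: measurableT_comp => //.
  exact: (measurableT_comp (@measurable_subV d.+1) (measurable_pair1 _)).
- by move=> z; rewrite mule_ge0// lee_fin; exact/wk_ge0/ltW.
apply: ge0_le_integralT => tau.
  by apply: integral_ge0 => z _; rewrite mule_ge0// lee_fin; exact/wk_ge0/ltW.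
under eq_integral => z _ do rewrite wk_cons rV_consB EFinM -muleA.
rewrite ge0_integralZl//; last 3 first.
- apply: emeasurable_funM; first by apply/measurable_EFinP; exact: measurable_wk (l0 _).
  apply: (measurableT_comp (mh' (t - tau))).
  exact: (measurableT_comp (@measurable_subV d) (measurable_pair1 _)).
- by move=> z _; rewrite mule_ge0// lee_fin; exact/wk_ge0/ltW.
- by rewrite lee_fin; exact/wk1_ge0/ltW.
rewrite [leRHS]EFinM; apply: lee_wpmul2l; first by rewrite lee_fin; exact/wk1_ge0/ltW.
rewrite /F fineK//; exact: avg_le_maxf.
Qed.

Lemma tonelli_swap d (f : R * 'rV[R]_d -> \bar R) : measurable_fun setT f ->
  (forall z, 0 <= f z)%E ->
  (\int[lebesgue_measure]_t \int[lebesgue_rV R d]_y f (t, y) =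
   \int[lebesgue_rV R d]_y \int[lebesgue_measure]_t f (t, y))%E.
Proof. by move=> mf f0; rewrite -fubini_tonelli1// fubini_tonelli2. Qed.

(** Induction on d: by [maxf_cons] the one-dimensional bound applies in the first variable with the
    others frozen. Tonelli then exchanges the order, and the induction hypothesis applies with the
    first variable frozen. *)
Theorem maximal_rV d (t : R) : 1 < t -> exists C : R, 0 <= C /\
  forall lam (h : 'rV[R]_d -> \bar R) (B : R), (forall n, 0 < lam n) -> 0 <= B ->
  measurable_fun setT h -> (forall z, 0 <= h z <= B%:E)%E ->
  (\int[lebesgue_rV R d]_x (maxf lam h x `^ t) <=
   C%:E * \int[lebesgue_rV R d]_x (h x `^ t))%E.
Proof.
move=> t1; have t0 : 0 <= t by lra.
have mpow dT (T : measurableType dT) (f : T -> \bar R) : measurable_fun setT f ->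
    measurable_fun setT (fun x => f x `^ t)%E.
  by move=> mf; exact: (measurableT_comp (measurable_poweR t) mf).
elim: d => [|d [C [C0 ih]]].
  exists 1; split => // lam h B l0 B0 mh hB; rewrite mul1e.
  have h0 z : (0 <= h z)%E by have /andP[] := hB z.
  apply: ge0_le_integralT => x; first exact: poweR_ge0.
  apply: le_poweR => //; first exact: maxf_ge0.
  apply: maxf_le => n; rewrite /avg ge0_integral_rV0//.
  - by rewrite /wk /wt big_ord0 expr0 expr1n invr1 mul1r mul1e subr0.
  - apply: emeasurable_funM; first by apply/measurable_EFinP; exact: measurable_wk (l0 _).
    apply: measurableT_comp => //.
    exact: (measurableT_comp (@measurable_subV 0) (measurable_pair1 _)).
  - by move=> z; rewrite mule_ge0// lee_fin; exact/wk_ge0/ltW.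
have [C1 [C10 HL]] := @HL_strong R t t1.
exists (16 `^ t * C1 * C); split; first by rewrite !mulr_ge0 ?powR_ge0.
move=> lam h B l0 B0 mh hB.
have h0 z : (0 <= h z)%E by have /andP[] := hB z.
pose h' t' y' := h (rV_cons (t', y')).
have mh' t' : measurable_fun setT (h' t') by exact: measurable_rV_cons_fst.
have mhh : measurable_fun setT (fun z : R * 'rV[R]_d => h' z.1 z.2).
  rewrite (_ : (fun z => _) = h \o (@rV_cons R d)); last by apply/funext => -[].
  by apply: measurableT_comp => //; exact: measurable_rV_cons.
pose G (z : R * 'rV[R]_d) := maxf lam (h' z.1) z.2.
have mG : measurable_fun setT G by exact: (measurable_maxf_param l0 mhh (fun t' y' => h0 _)).
have G0 z : (0 <= G z)%E by exact: (maxf_ge0 z.2 l0 (fun y => h0 _)).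
have GB z : (G z <= (I2 R d * B)%:E)%E.
  exact: (maxf_bound z.2 l0 B0 (mh' z.1) (fun y => hB _)).
have Gfin z : G z \is a fin_num.
  by rewrite ge0_fin_numE//; apply: le_lt_trans (GB z) _; rewrite ltry.
have mM := measurable_maxf l0 mh h0.
have slice y : (\int[lebesgue_measure]_t' (maxf lam h (rV_cons (t', y)) `^ t) <=
    (16 `^ t * C1)%:E * \int[lebesgue_measure]_t' (G (t', y) `^ t))%E.
  pose F t' := fine (G (t', y)).
  have mF : measurable_fun setT F.
    apply/measurable_EFinP.
    rewrite (_ : EFin \o F = fun t' => G (t', y)); last first.
      by apply/funext => t'; rewrite /F /= fineK.
    by apply: (measurableT_comp mG (g := fun t' : R => (t', y))); exact: measurable_pair2.
  have FB t' : 0 <= F t' <= I2 R d * B by rewrite -!lee_fin fineK// G0 GB.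
  have locF : locally_integrable setT F.
    by apply: (@bounded_locally_integrable _ _ (I2 R d * B)) => // z; have /andP[a b] := FB z; rewrite ger0_norm.
  apply: (@le_trans _ _ (\int[lebesgue_measure]_t' ((16 `^ t)%:E * (HL_maximal F t' `^ t)))%E).
    apply: ge0_le_integralT => t'; first exact: poweR_ge0.
    rewrite -[X in (X * _)%E]/((16%:E : \bar R) `^ t)%E -poweRM ?HL_maximalT_ge0//.
    apply: le_poweR => //; first exact: maxf_ge0.
    exact: (maxf_cons t' y l0 B0 mh hB).
  rewrite ge0_integralZl//; last 2 first.
  - exact: (mpow _ _ _ (measurable_HL_maximal locF)).
  - by move=> x _; exact: poweR_ge0.
  rewrite EFinM -muleA; apply: lee_wpmul2l; first by rewrite lee_fin powR_ge0.
  apply: le_trans (HL F _ mF FB) _.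
  rewrite le_eqVlt; apply/orP; left; apply/eqP; congr (_ * _)%E; apply: eq_integral => t' _.
  by rewrite /F -(fineK (Gfin (t', y))).
have mMc : measurable_fun setT (fun z : R * 'rV[R]_d => maxf lam h (rV_cons z) `^ t)%E.
  apply: mpow; apply: measurableT_comp => //; exact: measurable_rV_cons.
rewrite ge0_integral_rVS; last 2 first.
- exact: mpow.
- by move=> x; exact: poweR_ge0.
rewrite (tonelli_swap mMc (fun z => poweR_ge0 _ _)).
have mGt := mpow _ _ _ mG.
have Gt0 z : (0 <= G z `^ t)%E by exact: poweR_ge0.
have K0 : (0 <= (16 `^ t * C1)%:E)%E by rewrite lee_fin mulr_ge0// powR_ge0.
have mKG : measurable_fun setT (fun z => (16 `^ t * C1)%:E * G z `^ t)%E by exact: measurable_funeM.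
have KG0 z : (0 <= (16 `^ t * C1)%:E * G z `^ t)%E by exact: mule_ge0.
apply: (@le_trans _ _ (\int[lebesgue_rV R d]_y
    \int[lebesgue_measure]_t' ((16 `^ t * C1)%:E * G (t', y) `^ t))%E).
  apply: ge0_le_integralT => y.
    by apply: integral_ge0 => t' _; exact: poweR_ge0.
  have mGy : measurable_fun setT (fun t' : R => G (t', y) `^ t)%E :=
    measurableT_comp mGt (measurable_pair2 y).
  by rewrite (ge0_integralZl lebesgue_measure measurableT mGy (fun t' _ => Gt0 _) K0).
rewrite -(tonelli_swap mKG KG0).
rewrite (ge0_integral_rVS (f := fun x => h x `^ t)%E); last 2 first.
- exact: mpow.
- by move=> x; exact: poweR_ge0.
have mht := mpow _ _ _ mhh.
have ht0 (z : R * 'rV[R]_d) : (0 <= h' z.1 z.2 `^ t)%E by exact: poweR_ge0.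
have mI := measurable_fun_fubini_tonelli_F (m2 := lebesgue_rV R d)
  (fun z : R * 'rV[R]_d => h' z.1 z.2 `^ t)%E mht ht0.
have I0 t' : setT t' -> (0 <= \int[lebesgue_rV R d]_y (h' t' y `^ t))%E.
  by move=> _; apply: integral_ge0 => y _; exact: poweR_ge0.
have KC0 : (0 <= (16 `^ t * C1 * C)%:E)%E by rewrite lee_fin !mulr_ge0// powR_ge0.
rewrite -(ge0_integralZl lebesgue_measure measurableT mI I0 KC0).
apply: ge0_le_integralT => t'; first by apply: integral_ge0 => y _; exact: KG0.
have mGt' : measurable_fun setT (fun y => G (t', y) `^ t)%E :=
  measurableT_comp mGt (measurable_pair1 t').
rewrite (ge0_integralZl (lebesgue_rV R d) measurableT mGt' (fun y _ => Gt0 _) K0).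
rewrite (EFinM (_ * _)%R) -muleA; apply: lee_wpmul2l => //.
exact: (ih lam (h' t') B l0 B0 (mh' t') (fun y => hB _)).
Qed.

End maximal_rV.

(** * Dilations and the homogeneous operator *)

Section scaling.
Variables (R : realType) (d : nat) (s : R).
Hypothesis s0 : 0 < s.
Local Notation V := 'rV[R]_d.
Local Notation mu := (lebesgue_rV R d).
Local Notation la j := ((2 : R) ^+ j).
Implicit Types (f g h : V -> R) (x y xi : V) (a e : R).

(** Joins the Bessel symbol (e = 1) to the Riesz symbol (e = 0): dilating the functions by a turns e
    = 1 into e = a^-2, up to the factor a^s. *)
Definition mE e xi : R := (e + 4 * pi ^+ 2 * sq xi) `^ (s / 2).

Lemma sqZ a xi : sq (a *: xi) = a ^+ 2 * sq xi.
Proof.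
rewrite /sq /edot mulr_sumr; apply: eq_bigr => i _; rewrite !mxE; ring.
Qed.

Lemma sq_term_ge0 xi : 0 <= 4 * pi ^+ 2 * sq xi.
Proof. by apply: mulr_ge0; [apply: mulr_ge0 => //; exact: sqr_ge0|exact: sq_ge0]. Qed.

Lemma exp2_ge1 n : 1 <= la n.
Proof. by apply: exprn_ege1; rewrite ler1n. Qed.

Lemma exp2V_ge0 n : 0 <= la n ^- 2.
Proof. by rewrite invr_ge0 !exprn_ge0. Qed.

Lemma exp2V_le1 n : la n ^- 2 <= 1.
Proof.
have h : 0 < la n ^+ 2 by rewrite !exprn_gt0.
by rewrite invf_le1// exprn_ege1// exp2_ge1.
Qed.

Lemma polyg_mE e : 0 <= e -> e <= 1 -> polyg (mE e).
Proof.
move=> e0 e1; have [_ [K [N [K0 H]]]] : polyg (@mB R d s) by apply: polyg_mB; exact: ltW.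
split.
  apply: (measurableT_comp (f := @powR R ^~ (s / 2))); first exact: measurable_powR.
  by apply: measurable_funD => //; apply: measurable_funM => //; exact: measurable_sq.
exists K, N; split => // xi; apply: le_trans (H xi).
have q0 := sq_term_ge0 xi.
rewrite !ger0_norm ?powR_ge0//; apply: ge0_ler_powR; rewrite ?nnegrE ?divr_ge0 ?(ltW s0)//.
- by rewrite addr_ge0.
- exact/ltW/base_gt0.
- by rewrite lerD2r.
Qed.

Lemma mE_scale a xi : 0 < a -> @mB R d s xi = a `^ s * mE (a ^- 2) (a^-1 *: xi).
Proof.
move=> a0; rewrite /mB /mE sqZ.
have q0 := sq_term_ge0 xi.
have -> : a `^ s = (a ^+ 2) `^ (s / 2).
  by rewrite -(powR_mulrn _ (ltW a0)) -powRrM; congr (_ `^ _); field.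
have an : a != 0 by rewrite gt_eqF.
have h : 0 <= a ^- 2 + 4 * pi ^+ 2 * (a^-1 ^+ 2 * sq xi).
  apply: addr_ge0; first by rewrite invr_ge0 exprn_ge0// ltW.
  by rewrite mulrCA; apply: mulr_ge0 => //; exact: sqr_ge0.
transitivity ((a ^+ 2 * (a ^- 2 + 4 * pi ^+ 2 * (a^-1 ^+ 2 * sq xi))) `^ (s / 2)); last first.
  by rewrite powRM// exprn_ge0// ltW.
congr (_ `^ _); field; exact: an.
Qed.

Lemma Tr_dil f a th xi : 0 < a -> intg mu f ->
  Tr (fun y => f (a *: y)) th xi = a ^- d * Tr f th (a^-1 *: xi).
Proof.
move=> a0 fi; rewrite /Tr -{2}(gtr0_norm a0) -(Rint_dil (lt0r_neq0 a0) (intg_Tr th (a^-1 *: xi) fi)).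
apply: eq_Rint => y; congr (_ * cos (2 * pi * _ + _)).
rewrite /edot; apply: eq_bigr => i _; rewrite !mxE; field; exact: lt0r_neq0.
Qed.

Lemma wt_dil_le a x : 0 <= a -> wt (a *: x) <= (1 + a) ^+ d * wt x.
Proof.
move=> a0; rewrite /wt -[X in _ ^+ X]card_ord -prodr_const -big_split/=.
apply: ler_prod => i _; rewrite addr_ge0//= mxE normrM (ger0_norm a0).
have := normr_ge0 (x ord0 i); nra.
Qed.

Lemma nice_dil f a : 0 < a -> nice f -> nice (fun y => f (a *: y)).
Proof.
move=> a0 nf; have fi := nice_intg nf; have [cf [K [K0 fK]] tf] := nf.
pose c := (1 + a^-1) ^+ d; have c0 : 0 < c by rewrite exprn_gt0// addr_gt0// invr_gt0.
pose c' := (1 + a) ^+ d; have c'0 : 0 < c' by rewrite exprn_gt0// addr_gt0.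
have wc x : wt x <= c * wt (a *: x).
  have := @wt_dil_le a^-1 (a *: x); rewrite scalerA mulVf ?gt_eqF// scale1r; apply.
  by rewrite invr_ge0 ltW.
have wc' x : wt x <= c' * wt (a^-1 *: x).
  have := @wt_dil_le a (a^-1 *: x); rewrite scalerA mulfV ?gt_eqF// scale1r; apply.
  exact: ltW.
split.
- move=> x; apply: continuous_comp; last exact: cf.
  exact: scaler_continuous.
- exists (K * c ^+ 2); split; first by rewrite mulr_ge0// exprn_ge0// ltW.
  move=> x; apply: le_trans (fK _) _; rewrite -mulrA ler_wpM2l//.
  exact: wtV_mono.
- move=> n; have [K' [K'0 H]] := tf n.
  exists (a ^- d * (K' * c' ^+ n)); split.
    have h1 : 0 <= a ^- d by rewrite invr_ge0 exprn_ge0// ltW.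
    have h2 : 0 <= c' ^+ n by rewrite exprn_ge0// ltW.
    exact: mulr_ge0 h1 (mulr_ge0 K'0 h2).
  move=> th xi; rewrite (Tr_dil th xi a0 fi) normrM ger0_norm ?invr_ge0 ?exprn_ge0 ?(ltW a0)//.
  rewrite -mulrA ler_wpM2l ?invr_ge0 ?exprn_ge0 ?(ltW a0)//.
  apply: le_trans (H _ _) _; rewrite -mulrA ler_wpM2l//; exact: wtV_mono.
Qed.

Lemma mult_dil f a x : 1 <= a -> nice f ->
  mult (@mB R d s) (fun y => f (a *: y)) x = a `^ s * mult (mE (a ^- 2)) f (a *: x).
Proof.
move=> a1 nf; have a0 : 0 < a by lra.
have an : a != 0 by rewrite gt_eqF.
have ai : a^-1 != 0 by rewrite invr_eq0.
have e0 : 0 <= a ^- 2 by rewrite invr_ge0 exprn_ge0// ltW.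
have e1 : a ^- 2 <= 1 by rewrite invf_le1 ?exprn_gt0// exprn_ege1.
have ig := intg_mult (a *: x) (polyg_mE e0 e1) nf.
rewrite /mult.
transitivity (a `^ s * a ^- d * \int[mu]_xi (mE (a ^- 2) (a^-1 *: xi) * Cf f (a *: x) (a^-1 *: xi))).
  rewrite -(RintZ _ (intg_dil ai ig)); apply: eq_Rint => xi.
  rewrite (mE_scale xi a0) /Cf (Tr_dil _ _ a0 (nice_intg nf)).
  have -> : edot x xi = edot (a *: x) (a^-1 *: xi).
    by rewrite /edot; apply: eq_bigr => i _; rewrite !mxE; field.
  rewrite -!mulrA; congr (_ * _); rewrite mulrCA; reflexivity.
rewrite (Rint_dil ai ig) gtr0_norm ?invr_gt0// exprVn invrK -mulrA; congr (_ * _).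
by rewrite mulrA mulVf ?mul1r// expf_neq0.
Qed.

Lemma conv_dil h m a x : 0 < m -> 0 < a -> BM h ->
  conv (wk 2 m) (fun y => h (a *: y)) x = conv (wk 2 (m / a)) h (a *: x).
Proof.
move=> m0 a0 bh; have an : a != 0 by rewrite gt_eqF.
have ig := intg_conv (a *: x) (intg_wk d (divr_gt0 m0 a0) (leqnn 2)) bh.
rewrite /conv; transitivity (a ^+ d * \int[mu]_y (wk 2 (m / a) (a *: y) * h (a *: x - a *: y))).
  rewrite -(RintZ _ (intg_dil an ig)); apply: eq_Rint => y.
  by rewrite /wk scalerA divfK// scalerBr !mulrA -exprMn mulrCA divff// mulr1.
rewrite (Rint_dil an ig) gtr0_norm// mulrA mulfV ?mul1r// expf_neq0//.
Qed.

(* The pointwise estimate for [mult m], with averages over all dyadic scales;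
   unlike the one for a single Bessel operator it is invariant under dilations. *)
Definition pleib (m : V -> R) (u v : R) := exists2 C, 0 <= C & forall f g x A B c e,
  nice f -> nice g -> 0 < A -> 0 < B -> 0 < c -> 0 < e ->
  (forall i j, conv (wk 2 (la i / la j)) (fun z => (`|mult m f z| / A) `^ u) x <= 1) ->
  (forall i j, conv (wk 2 (la i / la j)) (fun z => (`|g z| / B) `^ v) x <= 1) ->
  (forall i j, conv (wk 2 (la i / la j)) (fun z => `|f z|) x <= c) ->
  (forall i j, conv (wk 2 (la i / la j)) (fun z => `|mult m g z|) x <= e) ->
  `|mult m (fun y => f y * g y) x - f x * mult m g x - g x * mult m f x| <= C * (A * B + c * e).

Lemma pleib_bessel u v : pointwise_leibniz d s u v -> pleib (@mB R d s) u v.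
Proof.
move=> [C C0 H]; exists C => // f g x A B c e nf ng A0 B0 c0 e0 h1 h2 h3 h4.
have E j : la j = la j / la 0 by rewrite expr0 divr1.
by apply: H => // j; rewrite ?/wsup E.
Qed.

Lemma BM_pow h A u : 0 < A -> 0 <= u -> BM h -> BM (fun z => (`|h z| / A) `^ u).
Proof.
move=> A0 u0 [mh [B HB]]; split.
  apply: (measurableT_comp (f := @powR R ^~ u)); first exact: measurable_powR.
  by apply: measurable_funM => //; exact: measurableT_comp.
exists ((B / A) `^ u) => z; rewrite ger0_norm ?powR_ge0//.
have B0 : 0 <= B by apply: le_trans (HB z).
by apply: ge0_ler_powR; rewrite ?nnegrE ?divr_ge0 ?(ltW A0)// ler_wpM2r ?invr_ge0 ?(ltW A0).
Qed.

Lemma BM_scale h c : BM h -> BM (fun z => c * h z).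
Proof.
move=> [mh [B HB]]; split; first exact: measurable_funM.
by exists (`|c| * B) => z; rewrite normrM ler_wpM2l.
Qed.

Lemma conv_scale k h c x : intg mu k -> BM h ->
  conv k (fun z => c * h z) x = c * conv k h x.
Proof.
move=> ki bh; rewrite /conv -(RintZ _ (intg_conv x ki bh)).
by apply: eq_Rint => y; rewrite mulrCA.
Qed.

Lemma pleib_scaled u v : 0 <= u -> 0 <= v -> pointwise_leibniz d s u v ->
  exists2 C, 0 <= C & forall n f g x A B c e,
  nice f -> nice g -> 0 < A -> 0 < B -> 0 < c -> 0 < e ->
  (forall i j, conv (wk 2 (la i / la j)) (fun z => (`|mult (mE (la n ^- 2)) f z| / A) `^ u) x <= 1) ->
  (forall i j, conv (wk 2 (la i / la j)) (fun z => (`|g z| / B) `^ v) x <= 1) ->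
  (forall i j, conv (wk 2 (la i / la j)) (fun z => `|f z|) x <= c) ->
  (forall i j, conv (wk 2 (la i / la j)) (fun z => `|mult (mE (la n ^- 2)) g z|) x <= e) ->
  `|mult (mE (la n ^- 2)) (fun y => f y * g y) x - f x * mult (mE (la n ^- 2)) g x
    - g x * mult (mE (la n ^- 2)) f x| <= C * (A * B + c * e).
Proof.
move=> u0 v0 [C C0 H]; exists C => // n f g x A B c e nf ng A0 B0 c0 e0 h1 h2 h3 h4.
set a := la n; have a1 : 1 <= a by exact: exp2_ge1.
have a0 : 0 < a by lra.
have an : a != 0 by rewrite gt_eqF.
have as0 : 0 < a `^ s by exact: powR_gt0.
have e0' : 0 <= a ^- 2 by rewrite invr_ge0 exprn_ge0// ltW.
have e1' : a ^- 2 <= 1 by rewrite invf_le1 ?exprn_gt0// exprn_ege1.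
have pm := polyg_mE e0' e1'.
have xa : a *: (a^-1 *: x) = x by rewrite scalerA mulfV// scale1r.
have md h z : nice h -> mult (@mB R d s) (fun y => h (a *: y)) z = a `^ s * mult (mE (a ^- 2)) h (a *: z).
  by move=> nh; exact: mult_dil.
have cd h j : BM h -> conv (wk 2 (la j)) (fun y => h (a *: y)) (a^-1 *: x) = conv (wk 2 (la j / a)) h x.
  by move=> bh; rewrite conv_dil ?exprn_gt0// xa.
have nfg := nice_mul nf ng.
have := H (fun y => f (a *: y)) (fun y => g (a *: y)) (a^-1 *: x) (a `^ s * A) B c (a `^ s * e)
  (nice_dil a0 nf) (nice_dil a0 ng) (mulr_gt0 as0 A0) B0 c0 (mulr_gt0 as0 e0).
rewrite (md _ _ nf) (md _ _ ng) (md (fun y => f y * g y) _ nfg) !xa.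
move=> /(_ _ _ _ _) h.
rewrite -(ler_pM2l as0).
have -> : a `^ s * (C * (A * B + c * e)) = C * (a `^ s * A * B + c * (a `^ s * e)).
  by move: (a `^ s) => z; ring.
rewrite -[X in X * _ <= _](ger0_norm (ltW as0)) -normrM !mulrBr (mulrCA _ (f x)) (mulrCA _ (g x)).
apply: h => j.
- have -> : (fun z => (`|mult (mB s) (fun y => f (a *: y)) z| / (a `^ s * A)) `^ u) =
      (fun z => (`|mult (mE (a ^- 2)) f (a *: z)| / A) `^ u).
    apply/funext => z; rewrite (md _ _ nf) normrM (ger0_norm (ltW as0)) -mulf_div divff ?mul1r//.
    by rewrite gt_eqF.
  by rewrite (cd (fun z => (`|mult (mE (a ^- 2)) f z| / A) `^ u)) ?h1//; exact/BM_pow/BM_mult.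
- by rewrite (cd (fun z => (`|g z| / B) `^ v)) ?h2//; exact/BM_pow/BM_nice.
- by rewrite (cd (fun z => `|f z|)) ?h3//; exact/BM_norm/BM_nice.
- have bz : BM (fun z => `|mult (mE (a ^- 2)) g z|) by exact/BM_norm/BM_mult.
  have bz' : BM (fun z => a `^ s * `|mult (mE (a ^- 2)) g z|) by exact: BM_scale.
  have -> : (fun z => `|mult (mB s) (fun y => g (a *: y)) z|) =
      (fun z => a `^ s * `|mult (mE (a ^- 2)) g (a *: z)|).
    by apply/funext => z; rewrite (md _ _ ng) normrM (ger0_norm (ltW as0)).
  rewrite (cd _ _ bz') conv_scale//; last by apply: intg_wk; rewrite // divr_gt0// exprn_gt0.
  by rewrite ler_pM2l//; exact: h4.
Qed.

Lemma cvg_powR_base (t r : R) (e_ : nat -> R) : 0 <= t -> 0 < r -> (forall n, 0 <= e_ n) ->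
  e_ n @[n --> \oo] --> 0 -> (e_ n + t) `^ r @[n --> \oo] --> t `^ r.
Proof.
move=> t0 r0 en ce.
have H eta : 0 < eta -> exists2 dl, 0 < dl & forall z, t <= z -> z < t + dl -> `|t `^ r - z `^ r| < eta.
  move=> eta0; pose b := (t `^ r + eta) `^ r^-1.
  have tr0 : 0 <= t `^ r by exact: powR_ge0.
  have bE : b `^ r = t `^ r + eta.
    by rewrite /b -powRrM mulVf ?gt_eqF// powRr1// addr_ge0// ltW.
  have tb : t < b.
    rewrite ltNge; apply/negP => bt.
    have := @ge0_ler_powR _ r (ltW r0) b t; rewrite !nnegrE powR_ge0 t0 => /(_ isT isT bt).
    rewrite bE; lra.
  exists (b - t) => [|z tz zb]; first lra.
  have zt : t `^ r <= z `^ r.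
    by apply: ge0_ler_powR; rewrite ?nnegrE ?(ltW r0)//; lra.
  rewrite distrC ger0_norm ?subr_ge0//.
  have : z `^ r < b `^ r by apply: gt0_ltr_powR; rewrite ?nnegrE//; lra.
  rewrite bE; lra.
apply/cvgrPdist_lt => eta eta0; have [dl dl0 hdl] := H eta eta0.
move/cvgrPdist_lt : ce => /(_ dl dl0); apply: filterS => n.
rewrite sub0r normrN ger0_norm// => h; apply: hdl; first by rewrite lerDr.
by rewrite addrC ltrD2l.
Qed.

(** Uniformity in x matters, since the operators are averaged over R^d. It holds because the
    transform of f has a bound independent of x, and dominated convergence is applied to the
    difference of the symbols against that bound. *)
Lemma mult_mE_unif f eta : nice f -> 0 < eta -> exists n0, forall n x, (n0 <= n)%N ->
  `|mult (mE (la n ^- 2)) f x - mult (mE 0) f x| <= eta.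
Proof.
move=> nf eta0.
have p0 : polyg (mE 0) by apply: polyg_mE.
have pB : polyg (@mB R d s) by apply: polyg_mB; exact: ltW.
have e0 := exp2V_ge0.
have e1 := exp2V_le1.
have pn n := polyg_mE (e0 n) (e1 n).
have [mB' [K1 [N [K10 HB]]]] := pB.
have [K [K0 HK]] := nice_Cf (N + 2)%N nf.
have mm n : measurable_fun setT (mE (la n ^- 2)) by case: (pn n).
have m0 : measurable_fun setT (mE 0) by case: p0.
have q0 := sq_term_ge0.
have mono n xi : mE 0 xi <= mE (la n ^- 2) xi.
  by apply: ge0_ler_powR; rewrite ?nnegrE ?addr_ge0 ?divr_ge0 ?(ltW s0)// lerD2r.
have leB n xi : mE (la n ^- 2) xi <= mB s xi.
  by apply: ge0_ler_powR; rewrite ?nnegrE ?addr_ge0 ?divr_ge0 ?(ltW s0)// lerD2r.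
pose F n xi := (mE (la n ^- 2) xi - mE 0 xi) * wt xi ^- (N + 2).
have F0 n xi : 0 <= F n xi by rewrite mulr_ge0 ?wtV_ge0// subr_ge0.
have mF n : measurable_fun setT (F n).
  by apply: measurable_funM; [exact: measurable_funB|exact: measurable_wtV].
have Fb n xi : `|F n xi| <= K1 * wt xi ^- 2.
  have -> : F n xi = (mE (la n ^- 2) xi - mE 0 xi) * wt xi ^- N * wt xi ^- 2.
    have ew : wt xi ^- (N + 2) = wt xi ^- N * wt xi ^- 2 by rewrite exprD; exact: invfM.
    by rewrite /F ew mulrA.
  rewrite ger0_norm; last by rewrite !mulr_ge0 ?wtV_ge0// subr_ge0.
  apply: ler_wpM2r; first exact: wtV_ge0.
  rewrite ler_pdivrMr ?exprn_gt0 ?wt_gt0//; apply: le_trans (HB xi).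
  rewrite ger0_norm; last exact: powR_ge0.
  by apply: le_trans (leB n xi); rewrite gerBl powR_ge0.
have cF xi : F n xi @[n --> \oo] --> 0.
  have -> : (0 : R) = (mE 0 xi - mE 0 xi) * wt xi ^- (N + 2) by rewrite subrr mul0r.
  apply: cvgM; last exact: cvg_cst.
  apply: cvgB; last exact: cvg_cst.
  rewrite {2}/mE add0r; apply: cvg_powR_base => //; first by rewrite divr_gt0.
  have -> : (fun n => la n ^- 2) = (fun n => (1 / 4 : R) ^+ n).
    by apply/funext => n; rewrite -exprM mulnC exprM div1r exprVn; congr (_ ^- _); rewrite expr2; lra.
  by apply: cvg_expr; rewrite ger0_norm; lra.
have [_ cI] := @Rint_cvg _ V R mu F (fun=> 0) _ mF cF (intgZ K1 (intg_wt2 R d)) Fb.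
have iF n : intg mu (F n) := dom_intg (mF n) (Fb n) (intgZ K1 (intg_wt2 R d)).
move: cI; have -> : \int[mu]_x (0 : R) = 0 by rewrite /Rintegral integral0.
move=> /cvgrPdist_le /(_ (eta / (K + 1))) []; first by rewrite divr_gt0//; lra.
move=> n0 _ Hn; exists n0 => n x /Hn; rewrite sub0r normrN => hn.
rewrite /mult -RintB; [|exact: intg_mult..].
have iB : intg mu (fun xi => mE (la n ^- 2) xi * Cf f x xi - mE 0 xi * Cf f x xi).
  by apply: intgB; exact: intg_mult.
apply: (@le_trans _ _ (\int[mu]_xi (K * F n xi))).
  apply: (le_norm_Rint iB); first exact: intgZ.
  move=> xi; rewrite -mulrBl normrM /F mulrCA ger0_norm ?subr_ge0// ler_wpM2l ?subr_ge0//.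
rewrite (RintZ _ (iF n)).
have hI : \int[mu]_x F n x <= eta / (K + 1) by apply: le_trans hn; exact: ler_norm.
have I0 : 0 <= \int[mu]_x F n x by apply: ge0_Rint.
move: hI; rewrite ler_pdivlMr; last lra.
clear -I0 K0; move: (\int[mu]_x F n x) I0 => z z0 h; nra.
Qed.

(** The hypotheses bound averages of the limit operator, whereas [pleib_scaled] asks for those of
    the approximations. Once the two are uniformly within A and e of each other, the averages differ
    by a constant factor, absorbed by replacing A and e by K A and K e. *)
Lemma pleib_riesz u v : 1 <= u -> 1 <= v -> pointwise_leibniz d s u v -> pleib (mE 0) u v.
Proof.
move=> u1 v1 hl; have u0 : 0 <= u by lra.
have v0 : 0 <= v by lra.
have [C C0 H] := pleib_scaled u0 v0 hl.
(* With w = |q| / A one has ((w + 1) / K)^u <= (2 / K) (1 + w^u), whose average is at most (2 / K)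
   (I2 + 1) = 1. *)
have I0 := I2_ge0 R d; set K := 2 * (1 + I2 R d).
have K2 : 2 <= K by rewrite /K; lra.
exists (C * K); first by rewrite mulr_ge0//; lra.
move=> f g x A B c e nf ng A0 B0 c0 e0 h1 h2 h3 h4.
have p0 : polyg (mE 0) by apply: polyg_mE.
have E0 := exp2V_ge0.
have E1 := exp2V_le1.
have pn n := polyg_mE (E0 n) (E1 n).
have nfg := nice_mul nf ng.
apply/ler_addgt0Pr => eta eta0.
pose z := 1 + `|f x| + `|g x|; have z0 : 0 < z by rewrite /z; have := normr_ge0 (f x); have := normr_ge0 (g x); lra.
pose th := Num.min (eta / z) (Num.min A e).
have th0 : 0 < th by rewrite !lt_min A0 e0 divr_gt0.
have [n1 H1] := mult_mE_unif nf th0; have [n2 H2] := mult_mE_unif ng th0.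
have [n3 H3] := mult_mE_unif nfg th0.
pose n := maxn n1 (maxn n2 n3).
have {}H1 y := H1 n y (leq_maxl _ _).
have {}H2 y := H2 n y (leq_trans (leq_maxl _ _) (leq_maxr _ _)).
have {}H3 y := H3 n y (leq_trans (leq_maxr _ _) (leq_maxr _ _)).
have lap i j : 0 < la i / la j by rewrite divr_gt0// exprn_gt0.
have iw i j := intg_wk d (lap i j) (leqnn 2).
have thA : th <= A by rewrite !ge_min lexx orbT.
have the : th <= e by rewrite !ge_min lexx !orbT.
have thz : th * z <= eta by rewrite -ler_pdivlMr// ge_min lexx.
have K0 : 0 < K by lra.
have k1 i j : conv (wk 2 (la i / la j)) (fun z => (`|mult (mE (la n ^- 2)) f z| / (K * A)) `^ u) x <= 1.
  have b0 := BM_pow A0 u0 (BM_mult p0 nf).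
  have bn := BM_pow (mulr_gt0 K0 A0) u0 (BM_mult (pn n) nf).
  have i0 : intg mu (fun y => wk 2 (la i / la j) y * (`|mult (mE 0) f (x - y)| / A) `^ u) := intg_conv x (iw i j) b0.
  apply: (@le_trans _ _ (\int[mu]_y (2 / K * (wk 2 (la i / la j) y + wk 2 (la i / la j) y * (`|mult (mE 0) f (x - y)| / A) `^ u)))).
    apply: le_Rint.
    - by exact: (intg_conv x (iw i j) bn).
    - by apply: intgZ; exact: intgD.
    move=> y; rewrite -[X in _ <= _ * (X + _)]mulr1 -mulrDr mulrCA ler_wpM2l ?wk_ge0 ?(ltW (lap i j))//.
    move: (H1 (x - y)); move: (mult (mE (la n ^- 2)) f (x - y)) (mult (mE 0) f (x - y)) => p q hpq.
    set w := `|q| / A; have w0 : 0 <= w := divr_ge0 (normr_ge0 _) (ltW A0).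
    have hw : `|p| / (K * A) <= (w + 1) / K.
      have wA : w * A = `|q| := divfK (lt0r_neq0 A0) _.
      rewrite ler_pdivrMr; last exact: mulr_gt0.
      have -> : (w + 1) / K * (K * A) = w * A + A by field; lra.
      rewrite wA; have := ler_normD (p - q) q; rewrite subrK; lra.
    clearbody w; apply: (@le_trans _ _ (((w + 1) / K) `^ u)).
      apply: ge0_ler_powR => //; rewrite nnegrE.
        by apply: divr_ge0 => //; apply: mulr_ge0; lra.
      by apply: divr_ge0; lra.
    have hm : ((w + 1) / K) `^ u <= ((2 / K) * Num.max w 1) `^ u.
      apply: ge0_ler_powR => //; rewrite ?nnegrE.
      + by apply: divr_ge0; lra.
      + by apply: mulr_ge0; [apply: divr_ge0; lra|rewrite le_max w0].
      + rewrite ler_pdivrMr; last lra.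
        rewrite mulrAC divfK; last by rewrite gt_eqF//; lra.
        by case: (leP w 1) => hh; lra.
    apply: le_trans hm _; rewrite powRM; [|by rewrite divr_ge0//; lra|by rewrite le_max w0].
    apply: ler_pM; rewrite ?powR_ge0//.
      rewrite -[leRHS]powRr1; last by rewrite divr_ge0//; lra.
      by apply: ger_powR => //; rewrite divr_gt0//= ler_pdivrMr// mul1r.
    by case: (leP w 1) => hh; rewrite ?powR1 ?lerDl ?powR_ge0// lerDr.
  rewrite (RintZ _ (intgD (iw i j) i0)) (RintD (iw i j) i0).
  have kw : \int[mu]_y wk 2 (la i / la j) y <= I2 R d by exact: Rint_wk.
  have k1' : \int[mu]_y (wk 2 (la i / la j) y * (`|mult (mE 0) f (x - y)| / A) `^ u) <= 1 := h1 i j.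
  move: kw k1'; move: (\int[mu]_y wk 2 (la i / la j) y) (\int[mu]_y (wk 2 (la i / la j) y * (`|mult (mE 0) f (x - y)| / A) `^ u)) => X Y hX hY.
  rewrite mulrAC ler_pdivrMr// mul1r /K; lra.
have k2 i j : conv (wk 2 (la i / la j)) (fun z => `|mult (mE (la n ^- 2)) g z|) x <= K * e.
  have b0 := BM_norm (BM_mult p0 ng).
  have i0 : intg mu (fun y => wk 2 (la i / la j) y * `|mult (mE 0) g (x - y)|) := intg_conv x (iw i j) b0.
  apply: (@le_trans _ _ (\int[mu]_y (e * wk 2 (la i / la j) y + wk 2 (la i / la j) y * `|mult (mE 0) g (x - y)|))).
    apply: le_Rint.
    - exact: (intg_conv x (iw i j) (BM_norm (BM_mult (pn n) ng))).
    - by apply: intgD => //; exact: intgZ.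
    move=> y; rewrite (mulrC e) -mulrDr ler_wpM2l ?wk_ge0 ?(ltW (lap i j))//.
    move: (H2 (x - y)); move: (mult (mE (la n ^- 2)) g (x - y)) (mult (mE 0) g (x - y)) => p q hpq.
    by have := ler_normD (p - q) q; rewrite subrK; lra.
  rewrite RintD ?(RintZ _ (iw i j))//; last exact: intgZ.
  have kw : \int[mu]_y wk 2 (la i / la j) y <= I2 R d by exact: Rint_wk.
  have k2' : \int[mu]_y (wk 2 (la i / la j) y * `|mult (mE 0) g (x - y)|) <= e := h4 i j.
  move: kw k2'; move: (\int[mu]_y wk 2 (la i / la j) y) (\int[mu]_y (wk 2 (la i / la j) y * `|mult (mE 0) g (x - y)|)) => X Y hX hY.
  rewrite /K; move: (I2 R d) I0 hX => I I0 hX; nra.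
have := H n f g x (K * A) B c (K * e) nf ng (mulr_gt0 K0 A0) B0 c0 (mulr_gt0 K0 e0) k1 h2 h3 k2.
have -> : C * (K * A * B + c * (K * e)) = C * K * (A * B + c * e) by ring.
have := H1 x; have := H2 x; have := H3 x.
move: (mult (mE (la n ^- 2)) (fun y => f y * g y) x) (mult (mE 0) (fun y => f y * g y) x)
  (mult (mE (la n ^- 2)) f x) (mult (mE 0) f x) (mult (mE (la n ^- 2)) g x) (mult (mE 0) g x)
  (C * K * (A * B + c * e)) => Xn X0 Zn Z0 Yn Y0 rhs hX hY hZ hh.
have -> : X0 - f x * Y0 - g x * Z0 =
  (Xn - f x * Yn - g x * Zn) - ((Xn - X0) - f x * (Yn - Y0) - g x * (Zn - Z0)) by ring.
apply: le_trans (ler_normB _ _) _; apply: lerD => //; apply: le_trans thz.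
have -> : th * z = th + th * `|f x| + th * `|g x| by rewrite /z; ring.
apply: le_trans (ler_normB _ _) _; rewrite (normrM (g x)); apply: lerD.
  apply: le_trans (ler_normB _ _) _; apply: lerD => //.
  by rewrite normrM mulrC ler_wpM2r.
by rewrite mulrC ler_wpM2r.
Qed.

End scaling.

(** * The vector-valued Hölder inequality *)

Section vector_hoelder.
Context dT (T : measurableType dT) (R : realType) (mu : {measure set T -> \bar R}).
Variable n : nat.
Local Open Scope ereal_scope.
Implicit Types (p q r : \bar R) (f g : 'I_n -> T -> R).

Definition vcomb (v : 'rV[R]_n) g (y : T) : R := (\sum_(i < n) v ord0 i * g i y)%R.

Lemma measurable_vcomb v g : (forall i, measurable_fun setT (g i)) ->
  measurable_fun setT (vcomb v g).
Proof. by move=> mg; apply: measurable_sum => i; exact: measurable_funM. Qed.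

Lemma sume_const_ord (m : nat) (x : \bar R) : 0 <= x ->
  \sum_(i < m) x = m%:R%:E * x.
Proof.
move=> x0; elim: m => [|m ih]; first by rewrite big_ord0 mul0e.
rewrite big_ord_recl ih -[X in X + _]mul1e -ge0_muleDl ?lee_fin//.
by rewrite -EFinD -(natrD _ 1 m) add1n.
Qed.

Lemma eq_Lnorm_norm p (F G : T -> R) : 0 < p -> (forall x, `|F x| = `|G x|)%R ->
  Lnorm mu p (EFin \o F) = Lnorm mu p (EFin \o G).
Proof.
by move=> p0 FG; apply/eqP; rewrite eq_le; apply/andP; split; apply: le_Lnorm => // x;
  rewrite lee_fin FG.
Qed.

Lemma LnormZ_norm p (c : R) (F : T -> R) : 0 < p -> measurable_fun setT F ->
  Lnorm mu p (EFin \o (fun x => c * F x)%R) = `|c|%:E * Lnorm mu p (EFin \o F).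
Proof.
move=> p0 mF; rewrite -LnormZ_real//.
by apply: (@eq_Lnorm_norm p _ (fun x => `|c| * F x)%R) => // x; rewrite !normrM normr_id.
Qed.

Lemma Lnorm_sum_quasi p (m : nat) (F : 'I_m -> T -> R) : 0 < p ->
  (forall i, measurable_fun setT (F i)) ->
  Lnorm mu p (fun x => (\sum_(i < m) F i x)%R%:E) <=
  (quasi_const p ^+ m)%:E * \sum_(i < m) Lnorm mu p (EFin \o F i).
Proof.
move=> p0; have K1 := quasi_const_ge1 p0; set K := quasi_const p in K1 *.
elim: m F => [|m ih] F mF.
  under eq_Lnorm => x do rewrite big_ord0.
  by rewrite Lnorm0 ?gt_eqF// big_ord0 mule0.
under eq_Lnorm => x do rewrite big_ord_recl.
apply: le_trans (LnormD_quasi mu p0 (mF ord0) (G := fun x => (\sum_(i < m) F (lift ord0 i) x)%R) _) _.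
  by apply: measurable_sum => i; exact: mF.
rewrite big_ord_recl exprS EFinM -muleA; apply: lee_wpmul2l; first by rewrite lee_fin; exact: le_trans ler01 K1.
rewrite ge0_muleDr ?Lnorm_ge0//; last by apply: sume_ge0 => i _; exact: Lnorm_ge0.
apply: leeD; last by apply: ih.
rewrite -[leLHS]mul1e; apply: lee_wpmul2r; first exact: Lnorm_ge0.
by rewrite lee_fin exprn_ege1.
Qed.

Lemma vcomb_quasi_norm q g : 0 < q -> (forall i, measurable_fun setT (g i)) ->
  quasi_norm (quasi_const q) (fun v => Lnorm mu q (EFin \o vcomb v g)).
Proof.
move=> q0 mg; split.
- exact: quasi_const_ge1.
- by move=> v; exact: Lnorm_ge0.
- move=> c v; rewrite -LnormZ_norm//; last exact: measurable_vcomb.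
  apply: eq_Lnorm => x /=; congr EFin; rewrite /vcomb mulr_sumr.
  by apply: eq_bigr => i _; rewrite mxE mulrA.
- move=> u v; apply: le_trans (LnormD_quasi mu q0 (measurable_vcomb u mg) (measurable_vcomb v mg)).
  rewrite le_eqVlt; apply/orP; left; apply/eqP; apply: eq_Lnorm => x /=; congr EFin.
  rewrite /vcomb -big_split/=.
  by apply: eq_bigr => i _; rewrite mxE mulrDl.
Qed.

Lemma vcomb_delta i g : vcomb (delta_mx ord0 i) g = g i.
Proof.
apply/funext => y; rewrite /vcomb (bigD1 i)//= big1 ?addr0 => [|j ji]; rewrite mxE eqxx ?eqxx/=.
  by rewrite mul1r.
by rewrite (negbTE ji) mul0r.
Qed.

Lemma vcomb_basis q g : 0 < q -> (forall i, measurable_fun setT (g i)) ->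
  (forall i, Lnorm mu q (EFin \o g i) < +oo) ->
  exists (e : 'I_n -> 'rV[R]_n) (phi : 'I_n -> 'cV[R]_n),
  [/\ forall w, (\sum_(i < n) ap (phi i) w *: e i = w)%R,
      forall i, Lnorm mu q (EFin \o vcomb (e i) g) \is a fin_num &
      forall i w, `|ap (phi i) w|%:E * Lnorm mu q (EFin \o vcomb (e i) g) <=
        ((3 * quasi_const q) ^+ n)%:E * Lnorm mu q (EFin \o vcomb w g)].
Proof.
move=> q0 mg fg; have qn := vcomb_quasi_norm q0 mg.
have fin i : Lnorm mu q (EFin \o vcomb (delta_mx ord0 i) g) < +oo by rewrite vcomb_delta.
have [e [phi [_ h1 h2]]] := adapted_basis qn (near_min_finite qn fin) (erefl #|[set: 'I_n]%SET|).
have sT (w : 'rV[R]_n) : supp_in [set: 'I_n]%SET w by move=> i; rewrite finset.inE.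
exists e, phi; split.
- move=> w; rewrite -[RHS](h1 w (sT w)); apply: eq_bigl => i; by rewrite finset.inE.
- move=> i; have [L _ hL] := quasi_norm_lipschitz qn fin.
  by rewrite ge0_fin_numE ?Lnorm_ge0//; apply: le_lt_trans (hL _) _; rewrite ltry.
- move=> i w; have iT : i \in [set: 'I_n]%SET by rewrite finset.inE.
  by have [_] := h2 w i (sT w) iT; rewrite finset.cardsT card_ord.
Qed.

Lemma dual_decomp (e : 'I_n -> 'rV[R]_n) (phi : 'I_n -> 'cV[R]_n) (w : 'rV[R]_n) g y :
  (forall w, \sum_(i < n) ap (phi i) w *: e i = w)%R ->
  (\sum_(i < n) ap (phi i) w * vcomb (e i) g y = vcomb w g y)%R.
Proof.
move=> h; rewrite -[in RHS](h w) /vcomb.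
under eq_bigr => i _ do rewrite mulr_sumr.
rewrite exchange_big/=; apply: eq_bigr => k _; rewrite summxE mulr_suml.
by apply: eq_bigr => i _; rewrite !mxE mulrA.
Qed.

Lemma measurable_ap (phi : 'cV[R]_n) f : (forall i, measurable_fun setT (f i)) ->
  measurable_fun setT (fun x => ap phi (\row_k f k x)).
Proof.
move=> mf; rewrite (_ : (fun x => _) = fun x => (\sum_k f k x * phi k ord0)%R).
  by apply: measurable_sum => k; exact: measurable_funM.
by apply/funext => x; rewrite apE; apply: eq_bigr => k _; rewrite mxE.
Qed.

Lemma vdot_row f (T2 : Type) (g : 'I_n -> T2 -> R) x y :
  vdot f g x y = (\sum_(i < n) (\row_k f k x : 'rV[R]_n) ord0 i * g i y)%R.
Proof. by apply: eq_bigr => i _; rewrite mxE. Qed.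

(* Scaling is done on the measurable side only: [H] need not be measurable. *)
Lemma Lnorm_le_scaled p (c : R) (F : T -> R) (H : T -> \bar R) : 0 < p -> (0 < c)%R ->
  measurable_fun setT F -> (forall x, `|F x|%:E <= c%:E * H x) -> (forall x, 0 <= H x) ->
  Lnorm mu p (EFin \o F) <= c%:E * Lnorm mu p H.
Proof.
move=> p0 c0 mF FH H0.
have -> : Lnorm mu p (EFin \o F) = c%:E * Lnorm mu p (EFin \o (fun x => c^-1 * F x)%R).
  rewrite LnormZ_norm// gtr0_norm ?invr_gt0// muleA -EFinM divff ?gt_eqF// mul1e//.
apply: lee_wpmul2l; first by rewrite lee_fin ltW.
apply: le_Lnorm => // x; rewrite (gee0_abs (H0 x)) /= normrM gtr0_norm ?invr_gt0//.
by rewrite EFinM lee_pdivrMl.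
Qed.

(** The norm a of e_i.g is a finite number, so after the scalar inequality it can be moved inside
    the L^p norm and used at each x: a |phi_i(f(x))| is at most C times the L^q norm of y |->
    f(x).g(y). *)
Lemma vector_hoelder p q r f g : 0 < p -> 0 < q -> 0 < r -> p^-1 + q^-1 = r^-1 ->
  (forall i, inLp mu p (f i)) -> (forall i, inLp mu q (g i)) ->
  Lnorm mu r (fun x => (vdot f g x x)%:E) <=
  (quasi_const r ^+ n * n%:R * (3 * quasi_const q) ^+ n)%:E * iter_Lnorm mu mu p q (vdot f g).
Proof.
move=> p0 q0 r0 pqr fp gq.
have mf i : measurable_fun setT (f i) by case: (fp i).
have mg i : measurable_fun setT (g i) by case: (gq i).
have fg i : Lnorm mu q (EFin \o g i) < +oo by case: (gq i).
have [e [phi [h1 h2 h3]]] := vcomb_basis q0 mg fg.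
set C := ((3 * _) ^+ n)%R in h3 *.
have C0 : (0 < C)%R by rewrite exprn_gt0//; have := quasi_const_ge1 q0; lra.
pose w x : 'rV[R]_n := (\row_k f k x)%R.
have -> : (fun x => (vdot f g x x)%:E) =
    (fun x => (\sum_(i < n) ap (phi i) (w x) * vcomb (e i) g x)%R%:E).
  by apply/funext => x; rewrite dual_decomp// vdot_row.
apply: le_trans (Lnorm_sum_quasi r0 _) _.
  by move=> i; apply: measurable_funM; [exact: measurable_ap|exact: measurable_vcomb].
rewrite !EFinM -!muleA; apply: lee_wpmul2l.
  by rewrite lee_fin exprn_ge0//; have := quasi_const_ge1 r0; lra.
apply: (@le_trans _ _ (\sum_(i < n) C%:E * iter_Lnorm mu mu p q (vdot f g))); last first.
  by rewrite sume_const_ord// mule_ge0 ?Lnorm_ge0// lee_fin ltW.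
apply: lee_sum => i _.
set a := fine (Lnorm mu q (EFin \o vcomb (e i) g)).
have a0 : (0 <= a)%R by rewrite fine_ge0// Lnorm_ge0.
have aE : Lnorm mu q (EFin \o vcomb (e i) g) = a%:E by rewrite fineK.
apply: le_trans (Lnorm_hoelder mu p0 q0 r0 pqr (measurable_ap (phi i) mf) (measurable_vcomb (e i) mg)) _.
rewrite aE muleC -(LnormZ_real mu p0 a0 (measurable_ap (phi i) mf)).
apply: Lnorm_le_scaled => //.
- by apply: measurable_funM => //; exact: measurable_ap.
- move=> x; rewrite normrM (ger0_norm a0) mulrC EFinM -aE.
  apply: le_trans (h3 i (w x)) _; rewrite le_eqVlt; apply/orP; left; apply/eqP.
  congr (_ * _); apply: eq_Lnorm => y /=; congr EFin; by rewrite vdot_row.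
- by move=> x; exact: Lnorm_ge0.
Qed.

End vector_hoelder.

(** * Scalar and vector-valued inequalities *)

Section dyadic_scales.
Variable R : realType.

(** An enumeration of the quotients 2^i / 2^j, with the value 1 at numbers that code no pair. Scales
    below 1 are included because the dilated estimate requires them. *)
Definition dyad (k : nat) : R :=
  if @unpickle (nat * nat)%type k is Some ij then 2 ^+ ij.1 / 2 ^+ ij.2 else 1.

Lemma dyad_gt0 k : 0 < dyad k.
Proof. by rewrite /dyad; case: (unpickle k) => [[i j]|]//=; rewrite divr_gt0// exprn_gt0. Qed.

Lemma dyad_pickle (i j : nat) : dyad (pickle (i, j)) = 2 ^+ i / 2 ^+ j.
Proof. by rewrite /dyad pickleK. Qed.

End dyadic_scales.

Section maximal_Lnorm.
Variables (R : realType) (d : nat).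
Local Notation V := 'rV[R]_d.
Local Notation mu := (lebesgue_rV R d).
Implicit Types (h : V -> R) (x : V) (u : R).

Definition maxpow u h x : R :=
  (fine (maxf (@dyad R) (fun z => (`|h z| `^ u)%:E) x)) `^ u^-1.

Lemma BM_powR u h : 0 <= u -> BM h -> BM (fun z => `|h z| `^ u).
Proof.
move=> u0 bh; have := BM_pow ltr01 u0 bh.
by under eq_fun do rewrite divr1.
Qed.

Lemma maxf_pow_bound u h x : 0 <= u -> BM h -> exists B : R, [/\ 0 <= B,
  forall z, (0 <= (`|h z| `^ u)%:E <= B%:E)%E &
  (0 <= maxf (@dyad R) (fun z => (`|h z| `^ u)%:E) x <= (I2 R d * B)%:E)%E].
Proof.
move=> u0 bh; have [mp [B HB]] := BM_powR u0 bh.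
have B0 : 0 <= B by apply: le_trans (HB 0).
have H z : (0 <= (`|h z| `^ u)%:E <= B%:E)%E.
  by rewrite !lee_fin powR_ge0/=; apply: le_trans (HB z); exact: ler_norm.
exists B; split => //; rewrite maxf_bound// ?andbT.
- by apply: maxf_ge0 => [n|y]; [exact: dyad_gt0|rewrite lee_fin powR_ge0].
- by move=> n; exact: dyad_gt0.
- exact/measurable_EFinP.
Qed.

Lemma maxf_pow_fin u h x : 0 <= u -> BM h ->
  maxf (@dyad R) (fun z => (`|h z| `^ u)%:E) x \is a fin_num.
Proof.
move=> u0 bh; have [B [_ _ /andP[a b]]] := maxf_pow_bound x u0 bh.
by rewrite ge0_fin_numE//; apply: le_lt_trans b _; rewrite ltry.
Qed.

Lemma maxf_pow_ge0 u h x : (0 <= maxf (@dyad R) (fun z => (`|h z| `^ u)%:E) x)%E.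
Proof. by apply: maxf_ge0 => [n|y]; [exact: dyad_gt0|rewrite lee_fin powR_ge0]. Qed.

Lemma maxpow_ge0 u h x : 0 <= maxpow u h x. Proof. exact: powR_ge0. Qed.

Lemma maxpowX u h x : 0 < u -> maxpow u h x `^ u =
  fine (maxf (@dyad R) (fun z => (`|h z| `^ u)%:E) x).
Proof.
move=> u0; rewrite /maxpow -powRrM mulVf ?gt_eqF// powRr1//.
exact/fine_ge0/maxf_pow_ge0.
Qed.

Lemma measurable_maxpow u h : 0 < u -> BM h -> measurable_fun setT (maxpow u h).
Proof.
move=> u0 bh; apply: (measurableT_comp (f := @powR R ^~ u^-1)); first exact: measurable_powR.
apply/measurable_EFinP.
rewrite (_ : EFin \o _ = maxf (@dyad R) (fun z => (`|h z| `^ u)%:E)); last first.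
  by apply/funext => x /=; rewrite fineK// maxf_pow_fin// ltW.
apply: measurable_maxf => [n||y]; first exact: dyad_gt0.
  by apply/measurable_EFinP; have [] := BM_powR (ltW u0) bh.
by rewrite lee_fin powR_ge0.
Qed.

Lemma conv_maxpow u h x (i j : nat) : 0 < u -> BM h ->
  conv (wk 2 (2 ^+ i / 2 ^+ j)) (fun z => `|h z| `^ u) x <= maxpow u h x `^ u.
Proof.
move=> u0 bh; rewrite maxpowX// -lee_fin (fineK (maxf_pow_fin x (ltW u0) bh)).
have l0 : 0 < (2 : R) ^+ i / 2 ^+ j by rewrite divr_gt0// exprn_gt0.
have ig := intg_conv x (intg_wk d l0 (leqnn 2)) (BM_powR (ltW u0) bh).
apply: le_trans (avg_le_maxf _ _ _ (pickle (i, j))).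
by rewrite dyad_pickle /conv (EFin_Rint ig).
Qed.

(** Puts the argument of H in the variable of integration, so that a bound on H holding almost
    everywhere can be used for every x. *)
Lemma avg_reflect la (H : V -> \bar R) x : 0 < la -> measurable_fun setT H ->
  (forall z, 0 <= H z)%E ->
  avg la H x = (\int[mu]_z ((wk 2 la (x - z))%:E * H z))%E.
Proof.
move=> la0 mH H0.
have msub : measurable_fun setT (fun z : V => x - z) :=
  measurableT_comp (@measurable_subV R d) (measurable_pair1 x).
have mk : measurable_fun setT (fun z : V => wk 2 la (x - z)) :=
  measurableT_comp (measurable_wk la0) msub.
have m : measurable_fun setT (fun z : V => (wk 2 la (x - z))%:E * H z)%E.
  by apply: emeasurable_funM => //; exact/measurable_EFinP.
have n1 : (-1 : R) != 0 by rewrite oppr_eq0 oner_eq0.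
have k0 z : (0 <= (wk 2 la (x - z))%:E * H z)%E.
  by rewrite mule_ge0// lee_fin; exact/wk_ge0/ltW.
have := ge0_integral_rV_affine x n1 m k0.
rewrite normrN1 expr1n invr1 mul1e => <-.
by apply: eq_integral => y _; rewrite scaleN1r (addrC (- y)) subKr.
Qed.

(** For finite p this is the maximal theorem at the exponent p/u > 1 applied to |h|^u. For p = +oo
    the averages are bounded by the mass [I2] of the kernel times the u-th power of the essential
    supremum. *)
Lemma Lnorm_maxpow (p : \bar R) u : 1 <= u -> (u%:E < p)%E ->
  exists2 C : R, 0 < C & forall h, BM h ->
  (Lnorm mu p (EFin \o maxpow u h) <= C%:E * Lnorm mu p (EFin \o h))%E.
Proof.
move=> u1; have u0 : 0 < u by lra.
case: p => [p||]//; last first.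
  move=> _; have I0 := I2_ge0 R d; exists (I2 R d + 1); first by lra.
  move=> h bh; have [mh [B HB]] := bh.
  rewrite unlock /Lnorm; case: ifPn => [m0|_]; last by rewrite mule0.
  have Mge : (0 <= ess_sup mu (abse \o (EFin \o h)))%E.
    by apply: ess_sup_gee => //; apply: nearW => x /=.
  have Mle : (ess_sup mu (abse \o (EFin \o h)) <= B%:E)%E.
    by apply/ess_supP; apply: nearW => x /=; rewrite lee_fin.
  have ae := ess_sup_ge mu (abse \o (EFin \o h)).
  move: ae Mge Mle; case: (ess_sup mu _) => [M||]//; rewrite !lee_fin => ae M0 _.
  rewrite -EFinM; apply/ess_supP; apply: nearW => x /=.
  rewrite lee_fin ger0_norm ?maxpow_ge0//.
  have bp := BM_powR (ltW u0) bh.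
  have mp : measurable_fun setT (fun z => (`|h z| `^ u)%:E) by apply/measurable_EFinP; case: bp.
  have H : (maxf (@dyad R) (fun z => (`|h z| `^ u)%:E) x <= (I2 R d * M `^ u)%:E)%E.
    have p0 z : (0 <= (`|h z| `^ u)%:E)%E by rewrite lee_fin powR_ge0.
    apply: maxf_le => n; rewrite (avg_reflect x (dyad_gt0 R n) mp p0).
    apply: (@le_trans _ _ (avg (dyad R n) (fun=> (M `^ u)%:E) x)); last first.
      apply: le_trans (avg_le_maxf (@dyad R) _ _ n) _.
      apply: (maxf_bound x (@dyad_gt0 R) (powR_ge0 M u) (measurable_cst (M `^ u)%:E)) => z.
      by rewrite lexx lee_fin powR_ge0.
    have c0 (z : V) : (0 <= (M `^ u)%:E)%E by rewrite lee_fin powR_ge0.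
    rewrite (avg_reflect x (dyad_gt0 R n) (measurable_cst (M `^ u)%:E) c0).
    have msub : measurable_fun setT (fun z : V => x - z) :=
      measurableT_comp (@measurable_subV R d) (measurable_pair1 x).
    have mk : measurable_fun setT (fun z : V => (wk 2 (dyad R n) (x - z))%:E).
      by apply/measurable_EFinP; exact: (measurableT_comp (measurable_wk (dyad_gt0 R n)) msub).
    have k0 z : (0 <= (wk 2 (dyad R n) (x - z))%:E)%E by rewrite lee_fin; exact/wk_ge0/ltW/dyad_gt0.
    apply: ae_ge0_le_integral => //.
    - by move=> z _; rewrite mule_ge0// lee_fin powR_ge0.
    - exact: emeasurable_funM.
    - by move=> z _; rewrite mule_ge0// lee_fin powR_ge0.
    - exact: emeasurable_funM.
    move: ae; apply: filterS => z hz _; apply: lee_wpmul2l => //.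
    by rewrite lee_fin; apply: ge0_ler_powR; rewrite ?nnegrE ?(ltW u0)// -lee_fin.
  have H' : maxpow u h x <= (I2 R d * M `^ u) `^ u^-1.
    apply: ge0_ler_powR; rewrite ?nnegrE ?invr_ge0 ?(ltW u0) ?mulr_ge0 ?powR_ge0//.
      exact/fine_ge0/maxf_pow_ge0.
    by rewrite -lee_fin (fineK (maxf_pow_fin x (ltW u0) bh)).
  apply: le_trans H' _; rewrite powRM ?powR_ge0// -powRrM divff ?gt_eqF// powRr1//.
  apply: ler_wpM2r => //.
  have [I1|I1] := leP (I2 R d) 1.
    apply: (@le_trans _ _ (1 `^ u^-1)); last by rewrite powR1; lra.
    by apply: ge0_ler_powR; rewrite ?nnegrE ?invr_ge0 ?(ltW u0).
  apply: (@le_trans _ _ (I2 R d `^ 1)); last by rewrite powRr1//; lra.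
  by apply: ler_powR; [exact: ltW|rewrite invf_le1].
rewrite lte_fin => up; have p0 : 0 < p by lra.
have t1 : 1 < p / u by rewrite ltr_pdivlMr// mul1r.
have [C0 [C00 HC]] := @maximal_rV R d (p / u) t1.
exists (C0 `^ p^-1 + 1); first by rewrite ltr_pwDr// powR_ge0.
move=> h bh; have [mh _] := bh.
have [B [B0 hB _]] := maxf_pow_bound 0 (ltW u0) bh.
have mp : measurable_fun setT (fun z => (`|h z| `^ u)%:E).
  by apply/measurable_EFinP; case: (BM_powR (ltW u0) bh).
have := HC (@dyad R) _ B (@dyad_gt0 R) B0 mp hB.
rewrite !(Lnorm_fin mu _ (erefl p%:E)).
have -> : (\int[mu]_x (maxf (@dyad R) (fun z => (`|h z| `^ u)%:E) x `^ (p / u)) =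
   \int[mu]_x (`|(EFin \o maxpow u h) x| `^ p))%E.
  apply: eq_integral => x _; rewrite /= ger0_norm ?maxpow_ge0//.
  rewrite -(fineK (maxf_pow_fin x (ltW u0) bh)) /= /maxpow -powRrM; congr (_ `^ _)%:E.
  by rewrite mulrC.
have -> : (\int[mu]_x ((`|h x| `^ u)%:E `^ (p / u)) = \int[mu]_x (`|(EFin \o h) x| `^ p))%E.
  by apply: eq_integral => x _; rewrite /= -powRrM mulrCA divff ?mulr1// gt_eqF.
move=> hh; apply: (@le_trans _ _ ((C0%:E * \int[mu]_x (`|(EFin \o h) x| `^ p)) `^ p^-1)%E).
  apply: le_poweR => //; first by rewrite invr_ge0 ltW.
  by apply: integral_ge0 => x _; exact: poweR_ge0.
rewrite poweRM//; last by apply: integral_ge0 => x _; exact: poweR_ge0.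
apply: lee_wpmul2r; first exact: poweR_ge0.
by rewrite lee_fin lerDl.
Qed.

(** * The scalar Kato-Ponce inequality *)

Section kato_ponce.
Variables (m : V -> R) (u v : R).
Hypotheses (pm : polyg m) (u1 : 1 <= u) (v1 : 1 <= v) (Hpl : pleib m u v).

Lemma conv_maxpow_le1 w h x (A : R) (i j : nat) : 1 <= w -> BM h -> 0 < A -> maxpow w h x <= A ->
  conv (wk 2 (2 ^+ i / 2 ^+ j)) (fun z => (`|h z| / A) `^ w) x <= 1.
Proof.
move=> w1 bh A0 hA; have w0 : 0 < w by lra.
have l0 : 0 < (2 : R) ^+ i / 2 ^+ j by rewrite divr_gt0// exprn_gt0.
have -> : (fun z => (`|h z| / A) `^ w) = (fun z => A^-1 `^ w * `|h z| `^ w).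
  by apply/funext => z; rewrite powRM ?invr_ge0 ?(ltW A0)// mulrC.
rewrite conv_scale; [|exact: (intg_wk d l0 (leqnn 2))|exact: (BM_powR (ltW w0) bh)].
apply: (@le_trans _ _ (A^-1 `^ w * A `^ w)).
  apply: ler_wpM2l; first exact: powR_ge0.
  apply: le_trans (conv_maxpow x i j w0 bh) _.
  by apply: ge0_ler_powR; rewrite ?nnegrE ?maxpow_ge0 ?(ltW w0) ?(ltW A0).
by rewrite -powRM ?invr_ge0 ?(ltW A0)// mulVf ?gt_eqF// powR1.
Qed.

Lemma conv_maxpow1 h x (A : R) (i j : nat) : BM h -> maxpow 1 h x <= A ->
  conv (wk 2 (2 ^+ i / 2 ^+ j)) (fun z => `|h z|) x <= A.
Proof.
move=> bh; apply: le_trans.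
have := conv_maxpow x i j ltr01 bh; rewrite powRr1 ?maxpow_ge0//.
by under [X in conv _ X]funext => z do rewrite powRr1//.
Qed.

(** [pleib] requires strictly positive bounds, while maximal functions may vanish; they are
    increased by dl, which then tends to 0. *)
Lemma le_limit_prod (C X a b c e : R) : 0 <= C -> 0 <= a -> 0 <= b -> 0 <= c -> 0 <= e ->
  (forall dl, 0 < dl -> X <= C * ((a + dl) * (b + dl) + (c + dl) * (e + dl))) ->
  X <= C * (a * b + c * e).
Proof.
move=> C0 a0 b0 c0 e0 H; apply/ler_addgt0Pr => eta eta0.
pose K := C * (a + b + c + e + 2) + 1.
have K0 : 0 < K by rewrite /K ltr_pwDr// mulr_ge0//; lra.
pose dl := Num.min 1 (eta / K).
have d0 : 0 < dl by rewrite lt_min ltr01 divr_gt0.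
have d1 : dl <= 1 by rewrite ge_min lexx.
have d2 : dl * K <= eta by rewrite -ler_pdivlMr// ge_min lexx orbT.
apply: le_trans (H _ d0) _.
have h : (a + dl) * (b + dl) + (c + dl) * (e + dl) <= a * b + c * e + dl * (a + b + c + e + 2) by nra.
apply: le_trans (ler_wpM2l C0 h) _; rewrite mulrDr lerD2l; apply: le_trans d2.
by rewrite mulrCA; apply: ler_wpM2l; [exact: ltW|rewrite /K lerDl].
Qed.

Lemma norm_sub2_le (z a b P Q : R) : `|z - a - b| <= P + Q -> `|z| <= `|a| + (`|b| + (P + Q)).
Proof.
move=> h; have -> : z = (z - a - b) + (a + b) by ring.
by apply: le_trans (ler_normD _ _) _; have := ler_normD a b; lra.
Qed.

Lemma pleib_maxpow : exists2 C : R, 0 <= C & forall f g x, nice f -> nice g ->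
  `|mult m (fun y => f y * g y) x - f x * mult m g x - g x * mult m f x| <=
  C * (maxpow u (mult m f) x * maxpow v g x + maxpow 1 f x * maxpow 1 (mult m g) x).
Proof.
have [C C0 H] := Hpl; exists C => // f g x nf ng.
apply: le_limit_prod; rewrite ?maxpow_ge0// => dl dl0.
have p0 w h : 0 < maxpow w h x + dl by rewrite ltr_wpDl// maxpow_ge0.
have le w h : maxpow w h x <= maxpow w h x + dl by rewrite lerDl ltW.
have bf := BM_nice nf; have bg := BM_nice ng.
have bDf := BM_mult pm nf; have bDg := BM_mult pm ng.
by apply: H => // i j; [exact: conv_maxpow_le1|exact: conv_maxpow_le1|
  exact: conv_maxpow1|exact: conv_maxpow1].
Qed.

(** The four summands of the pointwise bound are treated by the scalar Hölder inequality, with p0,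
    q0 for those containing D f and p1, q1 for those containing D g; u < p0 and v < q0 make the
    maximal functions bounded. *)
Lemma scalar_kato_ponce (p0 q0 p1 q1 r : \bar R) :
  (u%:E < p0)%E -> (v%:E < q0)%E -> (1 < p1)%E -> (1 < q1)%E -> (0 < r)%E ->
  (p0^-1 + q0^-1 = r^-1)%E -> (p1^-1 + q1^-1 = r^-1)%E ->
  exists2 C : R, 0 < C & forall f g, nice f -> nice g ->
  (Lnorm mu r (EFin \o mult m (fun y => f y * g y)%R) <=
   C%:E * (Lnorm mu p0 (EFin \o mult m f) * Lnorm mu q0 (EFin \o g) +
           Lnorm mu p1 (EFin \o f) * Lnorm mu q1 (EFin \o mult m g)))%E.
Proof.
move=> up vq p11 q11 r0 e0 e1; have [C C0 H] := pleib_maxpow.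
have gt0 (a : R) (b : \bar R) : 1 <= a -> (a%:E < b)%E -> (0 < b)%E.
  by move=> a1; apply: lt_trans; rewrite lte_fin; lra.
have p00 := gt0 _ _ u1 up; have q00 := gt0 _ _ v1 vq.
have p10 := gt0 _ _ (lexx 1) p11; have q10 := gt0 _ _ (lexx 1) q11.
have [Ca Ca0 Ha] := Lnorm_maxpow u1 up; have [Cb Cb0 Hb] := Lnorm_maxpow v1 vq.
have [Cc Cc0 Hc] := Lnorm_maxpow (lexx 1) p11; have [Ce Ce0 He] := Lnorm_maxpow (lexx 1) q11.
have K1 := quasi_const_ge1 r0; set K := quasi_const r in K1.
pose C' := K ^+ 4 * (2 + C * Ca * Cb + C * Cc * Ce).
have z1 : 0 <= C * Ca * Cb by rewrite !mulr_ge0// ltW.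
have z2 : 0 <= C * Cc * Ce by rewrite !mulr_ge0// ltW.
have K4 : 0 < K ^+ 4 by rewrite exprn_gt0//; lra.
exists C'; first by rewrite mulr_gt0//; lra.
move=> f g nf ng.
have bf := BM_nice nf; have bg := BM_nice ng.
have bDf := BM_mult pm nf; have bDg := BM_mult pm ng.
have [mf _] := bf; have [mg _] := bg; have [mDf _] := bDf; have [mDg _] := bDg.
have u0 : 0 < u by exact: lt_le_trans ltr01 u1.
have v0 : 0 < v by exact: lt_le_trans ltr01 v1.
have mA := measurable_maxpow u0 bDf; have mB := measurable_maxpow v0 bg.
have mc := measurable_maxpow ltr01 bf; have me := measurable_maxpow ltr01 bDg.
set X := (Lnorm mu p0 (EFin \o mult m f) * Lnorm mu q0 (EFin \o g))%E.
set Y := (Lnorm mu p1 (EFin \o f) * Lnorm mu q1 (EFin \o mult m g))%E.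
have X0 : (0 <= X)%E by rewrite mule_ge0 ?Lnorm_ge0.
have Y0 : (0 <= Y)%E by rewrite mule_ge0 ?Lnorm_ge0.
pose F4 (k : 'I_4) : V -> R := nth (fun=> 0)
  [:: (fun x => `|f x * mult m g x|); (fun x => `|mult m f x * g x|);
      (fun x => C * (maxpow u (mult m f) x * maxpow v g x));
      (fun x => C * (maxpow 1 f x * maxpow 1 (mult m g) x))] k.
have mF k : measurable_fun setT (F4 k).
  case: k => -[|[|[|[|//]]]] hk; rewrite /F4/=.
  - exact: (measurableT_comp (@normr_measurable R setT) (measurable_funM mf mDg)).
  - exact: (measurableT_comp (@normr_measurable R setT) (measurable_funM mDf mg)).
  - exact: (measurable_funM (measurable_cst C) (measurable_funM mA mB)).
  - exact: (measurable_funM (measurable_cst C) (measurable_funM mc me)).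
have S4 (T : nmodType) (G : 'I_4 -> T) : \sum_(k < 4) G k =
   G (@Ordinal 4 0 isT) + (G (@Ordinal 4 1 isT) + (G (@Ordinal 4 2 isT) + G (@Ordinal 4 3 isT))).
  rewrite !big_ord_recl big_ord0 addr0.
  by congr (_ + (_ + (_ + _))); congr G; exact: val_inj.
apply: (@le_trans _ _ (Lnorm mu r (fun x => (\sum_(k < 4) F4 k x)%:E))).
  apply: le_Lnorm => // x; rewrite !abse_EFin lee_fin.
  apply: le_trans (ler_norm _); rewrite S4 /F4/=.
  rewrite (mulrC (mult m f x)); apply: norm_sub2_le; rewrite -mulrDr; exact: H.
apply: le_trans (Lnorm_sum_quasi mu r0 mF) _.
have -> : C'%:E = ((K ^+ 4)%:E * (2 + C * Ca * Cb + C * Cc * Ce)%:E)%E by [].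
rewrite -muleA; apply: lee_wpmul2l; first by rewrite lee_fin ltW.
rewrite S4 /F4/=.
have n1 : (Lnorm mu r (EFin \o (fun x => `|f x * mult m g x|)%R) <= Y)%E.
  rewrite (_ : Lnorm mu r _ = Lnorm mu r (fun x => (f x * mult m g x)%:E)); last first.
    by apply: eq_Lnorm_norm => // x; rewrite normr_id.
  exact: (Lnorm_hoelder mu p10 q10 r0 e1 mf mDg).
have n2 : (Lnorm mu r (EFin \o (fun x => `|mult m f x * g x|)%R) <= X)%E.
  rewrite (_ : Lnorm mu r _ = Lnorm mu r (fun x => (mult m f x * g x)%:E)); last first.
    by apply: eq_Lnorm_norm => // x; rewrite normr_id.
  exact: (Lnorm_hoelder mu p00 q00 r0 e0 mDf mg).
have n3 : (Lnorm mu r (EFin \o (fun x => C * (maxpow u (mult m f) x * maxpow v g x))%R) <=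
    (C * Ca * Cb)%:E * X)%E.
  rewrite (LnormZ_norm mu C r0 (measurable_funM mA mB)).
  rewrite (ger0_norm C0) -mulrA EFinM -muleA; apply: lee_wpmul2l; first by rewrite lee_fin.
  apply: le_trans (Lnorm_hoelder mu p00 q00 r0 e0 mA mB) _.
  apply: le_trans (lee_pmul (Lnorm_ge0 _ _ _) (Lnorm_ge0 _ _ _) (Ha _ bDf) (Hb _ bg)) _.
  rewrite muleACA -EFinM; exact: lexx.
have n4 : (Lnorm mu r (EFin \o (fun x => C * (maxpow 1 f x * maxpow 1 (mult m g) x))%R) <=
    (C * Cc * Ce)%:E * Y)%E.
  rewrite (LnormZ_norm mu C r0 (measurable_funM mc me)).
  rewrite (ger0_norm C0) -mulrA EFinM -muleA; apply: lee_wpmul2l; first by rewrite lee_fin.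
  apply: le_trans (Lnorm_hoelder mu p10 q10 r0 e1 mc me) _.
  apply: le_trans (lee_pmul (Lnorm_ge0 _ _ _) (Lnorm_ge0 _ _ _) (Hc _ bf) (He _ bDg)) _.
  rewrite muleACA -EFinM; exact: lexx.
apply: le_trans (leeD n1 (leeD n2 (leeD n3 n4))) _.
set a := C * Ca * Cb in z1 *; set b := C * Cc * Ce in z2 *.
apply: (@le_trans _ _ ((1 + a)%:E * X + (1 + b)%:E * Y)%E).
  rewrite !EFinD !ge0_muleDl ?lee_fin// !mul1e.
  by rewrite le_eqVlt; apply/orP; left; apply/eqP; rewrite addeA (addeC Y) addeACA (addeC X) -?addeA; congr (_ + _)%E; rewrite addeCA.
rewrite ge0_muleDr//; apply: leeD; apply: lee_wpmul2r => //; rewrite lee_fin; lra.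
Qed.

End kato_ponce.
End maximal_Lnorm.

(** * The vector-valued Kato-Ponce inequality *)

Section vector_kato_ponce.
Variables (R : realType) (d n : nat).
Local Notation V := 'rV[R]_d.
Local Notation mu := (lebesgue_rV R d).
Implicit Types (f g : 'I_n -> V -> R) (p q : \bar R).

Lemma decay_Lnorm_fin p (h : V -> R) K : (1 <= p)%E -> measurable_fun setT h ->
  (forall x, `|h x| <= K * wt x ^- 2) -> (Lnorm mu p (EFin \o h) < +oo)%E.
Proof.
move=> p1 mh hK.
have K0 : 0 <= K.
  by have := le_trans (normr_ge0 _) (hK 0); rewrite pmulr_lge0// wtV_gt0.
case: p p1 => [p||]//; last first.
  move=> _; rewrite unlock /Lnorm; case: ifPn => [_|]; last by rewrite ltry.
  apply: (@le_lt_trans _ _ K%:E); last exact: ltry.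
  apply/ess_supP; apply: nearW => x /=; rewrite lee_fin.
  by apply: le_trans (hK x) _; rewrite ler_piMr// wtV_le1.
rewrite lee_fin => p1; have p0 : 0 < p by exact: lt_le_trans ltr01 p1.
rewrite (Lnorm_fin mu _ (erefl p%:E)); apply: poweR_lty.
apply: (@le_lt_trans _ _ (\int[mu]_x ((K `^ p) * wt x ^- 2)%:E)%E).
  apply: ge0_le_integralT => x; first exact: poweR_ge0.
  rewrite /= lee_fin; apply: (@le_trans _ _ ((K * wt x ^- 2) `^ p)).
    by apply: ge0_ler_powR; rewrite ?nnegrE ?(ltW p0) ?mulr_ge0 ?wtV_ge0.
  rewrite powRM ?wtV_ge0//; apply: ler_wpM2l; first exact: powR_ge0.
  rewrite -[leRHS]powRr1 ?wtV_ge0//; apply: ger_powR => //.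
  by rewrite wtV_gt0 wtV_le1.
have i2 := intgZ (K `^ p) (intg_wt2 R d).
by rewrite -(EFin_Rint i2) ltry.
Qed.

Lemma nice_Lnorm_fin p (h : V -> R) : (1 <= p)%E -> nice h ->
  (Lnorm mu p (EFin \o h) < +oo)%E.
Proof.
move=> p1 nh; have [_ [K [_ hK]] _] := nh.
exact: decay_Lnorm_fin (nice_measurable nh) hK.
Qed.

Lemma measurable_cos_edot (xi : V) (th : R) :
  measurable_fun setT (fun y : V => cos (2 * pi * edot y xi + th)).
Proof.
have ml : measurable_fun setT (fun y : V => 2 * pi * edot y xi + th).
  apply: measurable_funD => //; apply: measurable_funM => //.
  apply: measurable_sum => i; apply: measurable_funM => //; exact: measurable_rV_coord.
exact: (measurableT_comp (@measurable_cos R) ml).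
Qed.

(** Needed because a vanishing L^q0 norm only says that a combination of the g_i is 0 almost
    everywhere, whereas D of it has to be 0 everywhere. *)
Lemma mult_ae m (h1 h2 : V -> R) x : measurable_fun setT h1 -> measurable_fun setT h2 ->
  (\forall y \ae mu, h1 y = h2 y) -> mult m h1 x = mult m h2 x.
Proof.
move=> m1 m2 h12; rewrite /mult; apply: eq_Rint => xi; congr (_ * _).
rewrite /Cf /Tr /Rintegral; congr fine; apply: ae_eq_integral => //.
- apply/measurable_EFinP; apply: measurable_funM => //; exact: measurable_cos_edot.
- apply/measurable_EFinP; apply: measurable_funM => //; exact: measurable_cos_edot.
by move: h12; apply: filterS => y h _; rewrite /= h.
Qed.

(** A possibly infinite factor N is replaced by the reals below it, which can be moved inside a
    norm. *)
Lemma mule_le_sup (N a Z : \bar R) : (0 <= N)%E -> (0 <= a)%E -> (0 <= Z)%E ->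
  (forall b : R, 0 <= b -> (b%:E <= N)%E -> (b%:E * a <= Z)%E) -> (N * a <= Z)%E.
Proof.
case: N => [N||]//; first by rewrite lee_fin => N0 _ _ /(_ N N0 (lexx _)).
move=> _ a0 Z0 H; have [->|an0] := eqVneq a 0%E; first by rewrite mule0.
have ap : (0 < a)%E by rewrite lt0e an0.
rewrite gt0_mulye//; case: Z Z0 H => [z||]//; rewrite lee_fin => z0 H; exfalso.
case: a a0 ap an0 H => [a||]//.
- rewrite !lee_fin !lte_fin => _ a0 _ H.
  have := H ((z + 1) / a) _ _; rewrite -EFinM lee_fin divfK ?gt_eqF// => h.
  have : z + 1 <= z by apply: h; rewrite ?leey// divr_ge0// ?addr_ge0// ltW.
  by rewrite gerDl ler10.
- by move=> _ _ _ /(_ 1 ler01 (leey _)); rewrite mul1e.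
Qed.

Lemma ereal_distr (k c1 c2 e : R) (I0 I1 : \bar R) :
  0 <= k -> 0 <= c1 -> 0 <= c2 -> 0 <= e -> (0 <= I0)%E -> (0 <= I1)%E ->
  (k%:E * (c1%:E * I0 + c2%:E * (I1 + e%:E)) =
   (k * c1)%:E * I0 + (k * c2)%:E * I1 + (k * c2 * e)%:E)%E.
Proof.
move=> k0 c10 c20 e0 I00 I10.
have a1 : (0 <= c1%:E * I0)%E by rewrite mule_ge0.
have a2 : (0 <= c2%:E * I1)%E by rewrite mule_ge0.
have a3 : (0 <= (c2 * e)%:E)%E by rewrite lee_fin mulr_ge0.
have a12 := adde_ge0 a1 a2.
have h : (c2%:E * (I1 + e%:E) = c2%:E * I1 + (c2 * e)%:E)%E by rewrite ge0_muleDr.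
have h2 : (k%:E * (c1%:E * I0 + c2%:E * I1 + (c2 * e)%:E) =
   k%:E * (c1%:E * I0 + c2%:E * I1) + k%:E * (c2 * e)%:E)%E by rewrite ge0_muleDr.
have h3 : (k%:E * (c1%:E * I0 + c2%:E * I1) = k%:E * (c1%:E * I0) + k%:E * (c2%:E * I1))%E.
  by rewrite ge0_muleDr.
by rewrite h addeA h2 h3 !muleA -!EFinM mulrA.
Qed.

Section symbol.
Variables (m : V -> R) (p0 q0 p1 q1 r : \bar R) (C0 : R).
Hypothesis pm : polyg m.
Hypotheses (p0_gt1 : (1 < p0)%E) (q0_gt1 : (1 < q0)%E) (p1_gt1 : (1 < p1)%E)
  (q1_gt1 : (1 < q1)%E) (r_gt0 : (0 < r)%E) (C0_gt0 : 0 < C0).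
Hypothesis scalar_kp : forall f g : V -> R, nice f -> nice g ->
  (Lnorm mu r (EFin \o mult m (fun y => f y * g y)%R) <=
   C0%:E * (Lnorm mu p0 (EFin \o mult m f) * Lnorm mu q0 (EFin \o g) +
           Lnorm mu p1 (EFin \o f) * Lnorm mu q1 (EFin \o mult m g)))%E.

Local Notation D := (mult m).
Let K0 : R := quasi_const q0.
Let K1 : R := quasi_const q1.
Let Kp : R := quasi_const p1.
Let Kr : R := quasi_const r.
Let B0 : R := (3 * K0) ^+ n.
Let B1 : R := (3 * (K1 + 1)) ^+ n.

Lemma gt1_gt0 p : (1 < p)%E -> (0 < p)%E. Proof. exact: lt_trans. Qed.

Lemma perturbed_quasi_norm (H : 'I_n -> V -> R) (eps : R) : 0 < eps ->
  (forall i, measurable_fun setT (H i)) ->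
  quasi_norm (K1 + 1) (fun a : 'rV[R]_n => Lnorm mu q1 (EFin \o vcomb a H) + (eps * `|a|)%:E)%E.
Proof.
move=> e0 mH; have [k1 N0 NZ ND] := vcomb_quasi_norm mu (gt1_gt0 q1_gt1) mH.
have k1' : 1 <= K1 := k1.
split.
- by rewrite lerDr; exact: le_trans ler01 k1'.
- by move=> v; rewrite adde_ge0// lee_fin mulr_ge0// ltW.
- move=> c v; rewrite NZ ge0_muleDr// ?lee_fin ?mulr_ge0 ?(ltW e0)//.
  by congr (_ + _)%E; rewrite normrZ -EFinM mulrCA.
- move=> u v; rewrite EFinD.
  apply: (@le_trans _ _ ((K1 + 1)%:E * (Lnorm mu q1 (EFin \o vcomb u H) + Lnorm mu q1 (EFin \o vcomb v H))
     + (K1 + 1)%:E * (eps * `|u| + eps * `|v|)%:E)%E).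
    apply: leeD.
      apply: le_trans (ND _ _) _; apply: lee_wpmul2r; first exact: adde_ge0.
      by rewrite lee_fin lerDl.
    rewrite -EFinM lee_fin -mulrDr.
    have h : eps * `|u + v| <= eps * (`|u| + `|v|) by rewrite ler_wpM2l ?(ltW e0)// ler_normD.
    apply: le_trans h _; rewrite ler_peMl ?mulr_ge0 ?(ltW e0)//.
    by rewrite lerDr; exact: le_trans ler01 k1'.
  rewrite -ge0_muleDr ?adde_ge0 ?lee_fin ?addr_ge0 ?mulr_ge0 ?(ltW e0)//.
  by rewrite EFinD addeACA.
Qed.

(* The term with the derivative on the second factor, for one element [b] of the
   second basis. *)
Lemma second_term (F H : 'I_n -> V -> R) (eps : R) (b : 'rV[R]_n) (psi : 'cV[R]_n)
    (X : V -> \bar R) (S : V -> R) : 0 < eps ->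
  (forall i, measurable_fun setT (F i)) -> (forall i, measurable_fun setT (H i)) ->
  measurable_fun setT S -> (forall x, 0 <= S x) ->
  (forall x, `|(\row_k F k x : 'rV[R]_n)| <= S x) ->
  (forall x, X x = Lnorm mu q1 (EFin \o vcomb (\row_k F k x) H)) ->
  (forall w, `|ap psi w|%:E * (Lnorm mu q1 (EFin \o vcomb b H) + (eps * `|b|)%:E) <=
     B1%:E * (Lnorm mu q1 (EFin \o vcomb w H) + (eps * `|w|)%:E))%E ->
  (Lnorm mu p1 (fun x => (ap psi (\row_k F k x))%:E) * Lnorm mu q1 (EFin \o vcomb b H) <=
   B1%:E * (Kp%:E * (Lnorm mu p1 X + eps%:E * Lnorm mu p1 (EFin \o S))))%E.
Proof.
move=> e0 mF mH mS S0 FS XE hpsi.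
have p10 := gt1_gt0 p1_gt1; have kp : 1 <= Kp := quasi_const_ge1 p10.
have kq : 1 <= K1 := quasi_const_ge1 (gt1_gt0 q1_gt1).
have B10 : 0 < B1 by rewrite exprn_gt0// mulr_gt0// addr_gt0// (lt_le_trans ltr01 kq).
have Kp0 : 0 < Kp by exact: lt_le_trans ltr01 kp.
have X0 x : (0 <= X x)%E by rewrite XE Lnorm_ge0.
have mP := measurable_ap psi mF.
have Z0 : (0 <= Lnorm mu p1 X + eps%:E * Lnorm mu p1 (EFin \o S))%E.
  by rewrite adde_ge0 ?mule_ge0 ?Lnorm_ge0// lee_fin ltW.
rewrite muleC; apply: mule_le_sup; rewrite ?Lnorm_ge0//.
  by rewrite !mule_ge0// lee_fin ltW.
move=> c c0 cN.
pose P x : R := ap psi (\row_k F k x).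
rewrite -(LnormZ_real mu p10 c0 mP).
pose Y x : R := B1^-1 * `|c * P x|.
have mY : measurable_fun setT Y.
  by apply: measurable_funM => //; apply: measurableT_comp => //; exact: measurable_funM.
have Y0 x : 0 <= Y x by rewrite mulr_ge0// invr_ge0 ltW.
have YX x : ((Y x)%:E <= X x + (eps * S x)%:E)%E.
  rewrite /Y EFinM lee_pdivrMl//.
  apply: (@le_trans _ _ (B1%:E * (X x + (eps * `|(\row_k F k x : 'rV[R]_n)|)%:E))%E); last first.
    apply: lee_wpmul2l; first by rewrite lee_fin ltW.
    by apply: leeD2l; rewrite lee_fin ler_wpM2l// ltW.
  rewrite XE; apply: le_trans (hpsi _); rewrite normrM (ger0_norm c0) mulrC EFinM.
  apply: lee_wpmul2l; first by rewrite lee_fin.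
  by apply: le_trans cN _; rewrite leeDl// lee_fin mulr_ge0// ltW.
(* The inner norm X is not known to be measurable in x, so the quasi-triangle inequality cannot be
   applied to X + eps S. The splitting is done on the measurable side: Y <= Y' + eps S with Y' <=
   X. *)
pose Y' x : R := Num.max (Y x - eps * S x) 0.
have mY' : measurable_fun setT Y'.
  apply: measurable_maxr => //; apply: measurable_funB => //; exact: measurable_funM.
have YX' x : (`|(Y' x)%:E| <= `|X x|)%E.
  rewrite (gee0_abs (X0 x)) gee0_abs ?lee_fin ?le_max ?lexx ?orbT// /Y'.
  have h : ((Y x - eps * S x)%:E <= X x)%E by rewrite EFinB leeBlDr.
  by case: (leP (Y x - eps * S x) 0) => _; [exact: X0|exact: h].
have YY x : Y x <= Y' x + eps * S x.
  by rewrite -lerBlDr le_max lexx.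
have -> : Lnorm mu p1 (fun x => (c * ap psi (\row_k F k x))%:E) =
    (B1%:E * Lnorm mu p1 (EFin \o Y))%E.
  have mN : measurable_fun setT (fun x => `|c * P x|) :=
    measurableT_comp (@normr_measurable R setT) (measurable_funM (measurable_cst c) mP).
  rewrite /Y (LnormZ_norm mu B1^-1 p10 mN) gtr0_norm ?invr_gt0// muleA -EFinM divff ?gt_eqF// mul1e.
  by apply: eq_Lnorm_norm => // x; rewrite normr_id.
apply: lee_wpmul2l; first by rewrite lee_fin ltW.
apply: (@le_trans _ _ (Lnorm mu p1 (fun x => (Y' x + eps * S x)%:E))).
  by apply: le_Lnorm => // x; rewrite lee_fin ger0_norm//; apply: le_trans (YY x) (ler_norm _).
apply: le_trans (LnormD_quasi mu p10 mY' (measurable_funM (measurable_cst eps) mS)) _.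
apply: lee_wpmul2l; first by rewrite lee_fin ltW.
apply: leeD; first exact: le_Lnorm.
by rewrite LnormZ_norm// gtr0_norm.
Qed.

Lemma vcomb_nice (v : 'rV[R]_n) g : (forall i, nice (g i)) -> nice (vcomb v g).
Proof. by move=> ng; exact: nice_lin. Qed.

Lemma mult_vcomb (v : 'rV[R]_n) g x : (forall i, nice (g i)) ->
  D (vcomb v g) x = vcomb v (fun i => D (g i)) x.
Proof. by move=> ng; exact: mult_lin. Qed.

(** Each product P l * Q l of the final decomposition goes through the scalar inequality. Its second
    term is controlled by adaptedness of the second basis ([second_term]), its first by the sup-norm
    bounds of that basis combined with adaptedness of the first. The perturbation survives only as
    eps times the finite norm of S. *)
Theorem vector_kato_ponce : exists2 C : R, 0 < C & forall f g,
  (forall i, nice (f i)) -> (forall i, nice (g i)) ->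
  (Lnorm mu r (fun x => (D (fun z => vdot f g z z) x)%:E) <=
   C%:E * (iter_Lnorm mu mu p0 q0 (vdot (fun i => D (f i)) g) +
           iter_Lnorm mu mu p1 q1 (vdot f (fun i => D (g i)))))%E.
Proof.
have p00 := gt1_gt0 p0_gt1; have q00 := gt1_gt0 q0_gt1.
have p10 := gt1_gt0 p1_gt1; have q10 := gt1_gt0 q1_gt1.
have kq0 : 1 <= K0 := quasi_const_ge1 q00; have kq1 : 1 <= K1 := quasi_const_ge1 q10.
have kp1 : 1 <= Kp := quasi_const_ge1 p10; have kr : 1 <= Kr := quasi_const_ge1 r_gt0.
have B00 : 0 < B0 by rewrite exprn_gt0// mulr_gt0// (lt_le_trans ltr01 kq0).
have B10 : 0 < B1 by rewrite exprn_gt0// mulr_gt0// addr_gt0// (lt_le_trans ltr01 kq1).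
have Kr0 : 0 < Kr ^+ n by rewrite exprn_gt0// (lt_le_trans ltr01 kr).
have K00 : 0 < K0 ^+ n by rewrite exprn_gt0// (lt_le_trans ltr01 kq0).
have Kp0 : 0 < Kp by exact: lt_le_trans ltr01 kp1.
pose c1 : R := B1 * B0 * (K0 ^+ n * n%:R); pose c2 : R := B1 * Kp.
have c10 : 0 <= c1 by rewrite !mulr_ge0// ltW.
have c20 : 0 < c2 by rewrite mulr_gt0.
exists (Kr ^+ n * (n%:R * (C0 * (c1 + c2))) + 1).
  by rewrite ltr_pwDr// !mulr_ge0 ?(ltW Kr0) ?(ltW C0_gt0)// addr_ge0// ltW.
move=> f g nf ng.
have mf i : measurable_fun setT (f i) := nice_measurable (nf i).
have mg i : measurable_fun setT (g i) := nice_measurable (ng i).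
have fg i : (Lnorm mu q0 (EFin \o g i) < +oo)%E by apply: nice_Lnorm_fin => //; exact: ltW.
have [e [phi [h1 h2 h3]]] := vcomb_basis q00 mg fg.
pose a i : R := fine (Lnorm mu q0 (EFin \o vcomb (e i) g)).
have a0 i : 0 <= a i by rewrite fine_ge0// Lnorm_ge0.
have aE i : Lnorm mu q0 (EFin \o vcomb (e i) g) = (a i)%:E by rewrite fineK.
(* a vanishing norm gives G i = 0, since 0^-1 = 0 *)
pose F i : V -> R := vcomb (\row_k (a i * phi i k ord0)) f.
pose G i : V -> R := fun y => (a i)^-1 * vcomb (e i) g y.
have apF i x : ap (phi i) (\row_k f k x) * a i = F i x.
  rewrite apE /F /vcomb mulr_suml; apply: eq_bigr => k _; rewrite !mxE; ring.
have nF i : nice (F i) by exact: vcomb_nice.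
have nG i : nice (G i) by apply: niceZ; exact: vcomb_nice.
have mF i := nice_measurable (nF i); have mG i := nice_measurable (nG i).
have bDf i := BM_mult pm (nf i); have bDg i := BM_mult pm (ng i).
have bDF i := BM_mult pm (nF i); have bDG i := BM_mult pm (nG i).
have mDf i : measurable_fun setT (D (f i)) by have [] := bDf i.
have mDg i : measurable_fun setT (D (g i)) by have [] := bDg i.
have mDF i : measurable_fun setT (D (F i)) by have [] := bDF i.
have mDG i : measurable_fun setT (D (G i)) by have [] := bDG i.
have DF i x : D (F i) x = ap (phi i) (\row_k D (f k) x) * a i.
  rewrite mult_vcomb// apE /vcomb mulr_suml; apply: eq_bigr => k _; rewrite !mxE; ring.
have ez i : a i = 0 -> \forall y \ae mu, vcomb (e i) g y = 0.
  by move=> ai; apply: (Lnorm0_ae q00 (measurable_vcomb (e i) mg)); rewrite aE ai.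
have Dez i x : a i = 0 -> D (vcomb (e i) g) x = 0.
  move=> ai; rewrite (@mult_ae m _ (fun=> 0)) ?mult0//; first exact: measurable_vcomb.
  exact: ez.
have G1 i : (Lnorm mu q0 (EFin \o G i) <= 1)%E.
  rewrite LnormZ_norm//; last exact: measurable_vcomb.
  rewrite aE ger0_norm ?invr_ge0// -EFinM lee_fin.
  by have [->|ai] := eqVneq (a i) 0; rewrite ?mulr0 ?mulVf.
have FG : \forall y \ae mu, vdot f g y y = \sum_(i < n) F i y * G i y.
  have : \forall y \ae mu, forall i, a i = 0 -> vcomb (e i) g y = 0.
    apply: filter_forall => i; have [/ez|ai] := eqVneq (a i) 0.
      by apply: filterS => y h _.
    by apply: nearW => y ai'; move: ai; rewrite ai' eqxx.
  apply: filterS => y hy.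
  have -> : vdot f g y y = vcomb (\row_k f k y) g y by exact: vdot_row.
  rewrite -(dual_decomp (\row_k f k y) g y h1); apply: eq_bigr => i _.
  rewrite -apF /G; have [ai|ai] := eqVneq (a i) 0; first by rewrite (hy i ai) !mulr0.
  by rewrite -mulrA mulVKf.
(* Where a i = 0 the i-th term is lost on the left; on the right it is 0 as well, because e_i.g then
   vanishes almost everywhere and so D of it vanishes. *)
have FDG x y : \sum_(i < n) F i x * D (G i) y = vdot f (fun i => D (g i)) x y.
  have -> : vdot f (fun i => D (g i)) x y = vcomb (\row_k f k x) (fun i => D (g i)) y by exact: vdot_row.
  rewrite -(dual_decomp (\row_k f k x) (fun i => D (g i)) y h1); apply: eq_bigr => i _.
  rewrite -apF /G multZ//; last exact: vcomb_nice.
  have [ai|ai] := eqVneq (a i) 0.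
    by rewrite ai mulr0 mul0r -mult_vcomb// (Dez i y ai) mulr0.
  by rewrite -mulrA mulVKf// mult_vcomb.
have FDGv x y : vdot f (fun i => D (g i)) x y = vcomb (\row_k F k x) (fun i => D (G i)) y.
  by rewrite -FDG; apply: eq_bigr => i _; rewrite mxE.
pose S x : R := \sum_(i < n) `|F i x|.
have mS : measurable_fun setT S by apply: measurable_sum => i; exact: measurableT_comp.
have S0 x : 0 <= S x by apply: sumr_ge0.
have FS x : `|(\row_k F k x : 'rV[R]_n)| <= S x.
  rewrite norm_mxE mx_normrE; apply: bigmax_le => // -[j k] _ /=.
  by rewrite mxE /S (bigD1 k)//= lerDl sumr_ge0.
have Sfin : (Lnorm mu p1 (EFin \o S) < +oo)%E.
  have H i : exists Ki, forall x, `|F i x| <= Ki * wt x ^- 2.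
    by have [_ [Ki [_ hK]] _] := nF i; exists Ki.
  have {H}[Ki hK] := choice H.
  apply: (@decay_Lnorm_fin p1 S (\sum_i Ki i)); rewrite ?(ltW p1_gt1)// => x.
  by rewrite ger0_norm// /S mulr_suml; apply: ler_sum => i _.
set I0 := iter_Lnorm mu mu p0 q0 _; set I1 := iter_Lnorm mu mu p1 q1 _.
have I00 : (0 <= I0)%E by exact: Lnorm_ge0.
have I10 : (0 <= I1)%E by exact: Lnorm_ge0.
have main (eps : R) : 0 < eps ->
  (Lnorm mu r (fun x => (D (fun z => vdot f g z z) x)%:E) <=
   (Kr ^+ n * (n%:R * C0))%:E * (c1%:E * I0 + c2%:E * (I1 + eps%:E * Lnorm mu p1 (EFin \o S))))%E.
  move=> eps0.
  have qn := perturbed_quasi_norm eps0 mDG.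
  (* The perturbation is at least eps on unit vectors, so near-minimizers exist whether or not the
     norms of the D (G i) are finite. *)
  have nm : near_min (fun a : 'rV[R]_n => Lnorm mu q1 (EFin \o vcomb a (fun i => D (G i))) + (eps * `|a|)%:E)%E.
    apply: near_min_pos => [v|s _]; first by case: qn.
    right; exists eps => // w _ w1; by rewrite w1 mulr1 leeDr ?Lnorm_ge0.
  have [b [psi [hb1 hb2 hb3]]] := adapted_basis qn nm (erefl #|[set: 'I_n]%SET|).
  have sT (w : 'rV[R]_n) : supp_in [set: 'I_n]%SET w by move=> i; rewrite finset.inE.
  have iT (i : 'I_n) : i \in [set: 'I_n]%SET by rewrite finset.inE.
  rewrite finset.cardsT card_ord -/B1 in hb3.
  have hb w : \sum_(i < n) ap (psi i) w *: b i = w.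
    by rewrite -[RHS](hb2 w (sT w)); apply: eq_bigl => i; rewrite iT.
  pose P l : V -> R := vcomb (\row_k psi l k ord0) F.
  pose Q l : V -> R := vcomb (b l) G.
  have PE l x : P l x = ap (psi l) (\row_k F k x).
    by rewrite apE; apply: eq_bigr => k _; rewrite !mxE mulrC.
  have DPE l x : D (P l) x = ap (psi l) (\row_k D (F k) x).
    by rewrite mult_vcomb// apE; apply: eq_bigr => k _; rewrite !mxE mulrC.
  have nP l : nice (P l) by exact: vcomb_nice.
  have nQ l : nice (Q l) by exact: vcomb_nice.
  have nPQ l := nice_mul (nP l) (nQ l).
  have E x : D (fun z => vdot f g z z) x = \sum_(l < n) D (fun z => P l z * Q l z) x.
    rewrite -mult_sum//; apply: mult_ae.
    - by apply: measurable_sum => i; exact: measurable_funM.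
    - by apply: measurable_sum => i; exact: (nice_measurable (nPQ i)).
    move: FG; apply: filterS => y ->.
    under [RHS]eq_bigr => l _ do rewrite PE.
    by rewrite (dual_decomp (\row_k F k y) G y hb); apply: eq_bigr => i _; rewrite mxE.
  under eq_Lnorm => x do rewrite E.
  have mDPQ l : measurable_fun setT (D (fun z => P l z * Q l z)) by have [] := BM_mult pm (nPQ l).
  apply: le_trans (Lnorm_sum_quasi mu r_gt0 mDPQ) _.
  rewrite EFinM -muleA; apply: lee_wpmul2l; first by rewrite lee_fin ltW.
  set Z := (c1%:E * I0 + _)%E.
  have Z0 : (0 <= Z)%E.
    by rewrite adde_ge0 ?mule_ge0 ?adde_ge0 ?mule_ge0 ?Lnorm_ge0 ?lee_fin ?(ltW c20) ?(ltW eps0).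
  apply: (@le_trans _ _ (\sum_(l < n) (C0%:E * Z))%E); last first.
    by rewrite sume_const_ord ?mule_ge0 ?lee_fin ?(ltW C0_gt0)// EFinM muleA.
  apply: lee_sum => l _; apply: le_trans (scalar_kp (nP l) (nQ l)) _.
  apply: lee_wpmul2l; first by rewrite lee_fin ltW.
  have [_ bl1] := (0%N, hb1 l (iT l)).
  apply: leeD; last first.
    have -> : (EFin \o P l) = (fun x => (ap (psi l) (\row_k F k x))%:E).
      by apply/funext => x /=; rewrite PE.
    have -> : (EFin \o D (Q l)) = EFin \o vcomb (b l) (fun i => D (G i)).
      by apply/funext => x /=; rewrite mult_vcomb.
    rewrite /c2 EFinM -muleA.
    apply: (second_term (X := fun x => Lnorm mu q1 (fun y => (vdot f (fun i => D (g i)) x y)%:E)) eps0 mF mDG mS S0 FS).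
      by move=> x; apply: eq_Lnorm => y; exact: (congr1 EFin (FDGv x y)).
    by move=> w; have [_] := hb3 w l (sT w) (iT l).
  have mDP l' : measurable_fun setT (D (P l')) by have [] := BM_mult pm (nP l').
  (* [b l] has coordinates at most 1 and every G i has norm at most 1, whatever the second norm
     is. *)
  have hQ : (Lnorm mu q0 (EFin \o Q l) <= (K0 ^+ n * n%:R)%:E)%E.
    apply: le_trans (Lnorm_sum_quasi mu q00 (F := fun i y => b l ord0 i * G i y) _) _.
      by move=> i; exact: measurable_funM.
    rewrite EFinM; apply: lee_wpmul2l; first by rewrite lee_fin ltW.
    rewrite -[leRHS]mule1 -sume_const_ord//; apply: lee_sum => i _.
    rewrite LnormZ_norm//; apply: le_trans (lee_wpmul2l _ (G1 i)) _; first by rewrite lee_fin.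
    by rewrite mule1 lee_fin -bl1 le_norm_coord.
  (* The functional [psi l] is bounded by B1 times the sup norm of the vector of the D (F k) x, and
     each of these is bounded by B0 times the inner norm through the first basis. *)
  have hP : (Lnorm mu p0 (EFin \o D (P l)) <= (B1 * B0)%:E * I0)%E.
    apply: Lnorm_le_scaled => //.
    - by rewrite mulr_gt0.
    - move=> x; rewrite DPE; have [hpsi _] := hb3 (\row_k D (F k) x) l (sT _) (iT l).
      rewrite EFinM -muleA; apply: (@le_trans _ _ (B1 * `|(\row_k D (F k) x : 'rV[R]_n)|)%:E).
        by rewrite lee_fin.
      rewrite EFinM; apply: lee_wpmul2l; first by rewrite lee_fin ltW.
      set Nx := Lnorm mu q0 _.
      have Nx0 : (0 <= B0%:E * Nx)%E by rewrite mule_ge0 ?Lnorm_ge0// lee_fin ltW.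
      have coord k : (`|D (F k) x|%:E <= B0%:E * Nx)%E.
        rewrite DF normrM (ger0_norm (a0 k)) EFinM -aE.
        apply: le_trans (h3 k _) _; rewrite le_eqVlt; apply/orP; left; apply/eqP.
        congr (_ * _)%E; apply: eq_Lnorm => y /=; congr EFin; by rewrite vdot_row.
      case: (B0%:E * Nx)%E Nx0 coord => [z z0 coord|_ _|//]; last exact: leey.
      rewrite lee_fin in z0; rewrite lee_fin.
      rewrite norm_mxE mx_normrE; apply: bigmax_le => // -[j k] _ /=.
      by rewrite mxE; have := coord k; rewrite lee_fin.
    - by move=> x; exact: Lnorm_ge0.
  apply: le_trans (lee_pmul _ _ hP hQ) _; rewrite ?Lnorm_ge0//.
  by rewrite muleAC -EFinM /c1.
set L := Lnorm mu r _ in main *.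
set sS := Lnorm mu p1 (EFin \o S) in Sfin main.
have sS0 : (0 <= sS)%E by exact: Lnorm_ge0.
set k := Kr ^+ n * (n%:R * C0) in main.
have k0 : 0 <= k by rewrite !mulr_ge0 ?(ltW Kr0) ?(ltW C0_gt0).
have kE : Kr ^+ n * (n%:R * (C0 * (c1 + c2))) = k * (c1 + c2) by rewrite /k; ring.
rewrite kE.
apply: (@le_trans _ _ ((k * (c1 + c2))%:E * (I0 + I1))%E); last first.
  apply: lee_wpmul2r; first exact: adde_ge0.
  by rewrite lee_fin lerDl.
apply/lee_addgt0Pr => eta eta0.
have sSf : sS \is a fin_num by rewrite ge0_fin_numE.
pose sr := fine sS; have sr0 : 0 <= sr by exact: fine_ge0.
pose eps := eta / (k * c2 * sr + 1).
have den : 0 < k * c2 * sr + 1 by rewrite ltr_pwDr// !mulr_ge0// ltW.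
have eps0 : 0 < eps by rewrite divr_gt0.
apply: le_trans (main eps eps0) _.
rewrite -(fineK sSf) -/sr -EFinM
  (ereal_distr k0 c10 (ltW c20) (mulr_ge0 (ltW eps0) sr0) I00 I10).
apply: leeD.
  rewrite ge0_muleDr//; apply: leeD; apply: lee_wpmul2r => //; rewrite lee_fin ler_wpM2l//.
    by rewrite lerDl ltW.
  by rewrite lerDr.
rewrite lee_fin /eps.
have -> : k * c2 * (eta / (k * c2 * sr + 1) * sr) = eta * ((k * c2 * sr) / (k * c2 * sr + 1)).
  by field; rewrite gt_eqF.
by rewrite ler_piMr ?(ltW eta0)// ler_pdivrMr// mul1r lerDl.
Qed.

End symbol.
End vector_kato_ponce.

(** * The choice of exponents and the two operators *)

Section exponents.
Variable R : realType.
Implicit Types (p q r : \bar R) (a b s : R).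

(* [1/u] and [1/v] lie strictly between [1/p0], [1/q0] and [1], and add up to [1 + lam]. *)
Lemma exponents (d : nat) a b s : (1 <= d)%N -> 0 <= a -> a < 1 -> 0 <= b -> b < 1 ->
  d%:R * Num.max (a + b - 1) 0 < s ->
  exists lam u v, [/\ 0 <= lam, d%:R * lam < s, 1 <= u /\ 1 <= v, u^-1 + v^-1 = 1 + lam &
    a < u^-1 /\ b < v^-1].
Proof.
move=> d1 a0 a1 b0 b1; set w := Num.max _ _ => ws.
have D0 : 0 < d%:R :> R by rewrite ltr0n.
have w0 : 0 <= w by rewrite le_max lexx orbT.
have wr : a + b - 1 <= w by rewrite le_max lexx.
have w1 : w < 1 by rewrite gt_max ltr01 andbT; lra.
(* lam = w + th is pushed strictly above a + b - 1, while the two entries of the minimum keep lam <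
   1 and d lam < s. *)
pose th := Num.min ((1 - w) / 2) ((s - d%:R * w) / (2 * d%:R)).
have th0 : 0 < th by rewrite lt_min; apply/andP; split; apply: divr_gt0; lra.
have th1 : th <= (1 - w) / 2 by rewrite ge_min lexx.
have th2 : d%:R * th <= (s - d%:R * w) / 2.
  have : th <= (s - d%:R * w) / (2 * d%:R) by rewrite ge_min lexx orbT.
  move=> /(ler_wpM2l (ltW D0)) h; apply: le_trans h _; rewrite le_eqVlt; apply/orP; left; apply/eqP.
  by field; rewrite gt_eqF.
(* a and b are moved towards 1 by the same fraction t, chosen so that the results add up to 1 +
   lam. *)
pose lam := w + th; pose t := (1 + lam - (a + b)) / (2 - (a + b)).
have den : 0 < 2 - (a + b) by lra.
have t0 : 0 < t by rewrite divr_gt0// /lam; lra.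
have t1 : t < 1 by rewrite ltr_pdivrMr// mul1r /lam; lra.
have tE : t * (2 - (a + b)) = 1 + lam - (a + b) by rewrite /t divfK// gt_eqF.
have xa : 0 < t * (1 - a) by apply: mulr_gt0; lra.
have xb : 0 < t * (1 - b) by apply: mulr_gt0; lra.
have xa1 : t * (1 - a) <= 1 - a by apply: ler_piMl; lra.
have xb1 : t * (1 - b) <= 1 - b by apply: ler_piMl; lra.
exists lam, (a + t * (1 - a))^-1, (b + t * (1 - b))^-1; rewrite !invrK; split.
- by rewrite /lam; lra.
- by rewrite /lam mulrDr; lra.
- by split; rewrite invf_ge1; lra.
- have -> : a + t * (1 - a) + (b + t * (1 - b)) = a + b + t * (2 - (a + b)) by ring.
  rewrite tE; lra.
- by split; lra.
Qed.

Lemma inve_gt1 p : (1 < p)%E -> exists a, [/\ 0 <= a, a < 1, (p^-1)%E = a%:E &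
  forall u : R, 1 <= u -> a < u^-1 -> (u%:E < p)%E].
Proof.
case: p => [p||]//.
- rewrite lte_fin => p1; have p0 : 0 < p by lra.
  exists p^-1; split; first by rewrite invr_ge0 ltW.
  + by rewrite invf_lt1.
  + by rewrite inver gt_eqF.
  + by move=> u u1; rewrite lte_fin ltf_pV2// posrE; lra.
- move=> _; exists 0; split; [exact: lexx|exact: ltr01|by rewrite invey|].
  by move=> u _ _; rewrite ltry.
Qed.

End exponents.

Section operators.
Variables (R : realType) (d : nat).
Local Notation V := 'rV[R]_d.
Local Notation mu := (lebesgue_rV R d).
Implicit Types (s : R) (f g : V -> R).

Lemma enorm_sq (xi : V) : enorm ((2 * pi) *: xi) ^+ 2 = 4 * pi ^+ 2 * sq xi.
Proof.
rewrite /enorm sqr_sqrtr; first by rewrite -[edot _ _]/(sq _) sqZ exprMn; congr (_ * _ * _); ring.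
exact: sq_ge0.
Qed.

Lemma bessel_opE s f x : nice f -> bessel_op s f x = mult (mB s) f x.
Proof.
move=> nf; rewrite /bessel_op multiplierE; last exact: nice_intg.
by apply: eq_mult => xi; rewrite enorm_sq.
Qed.

Lemma riesz_opE s f x : nice f -> riesz_op s f x = mult (mE s 0) f x.
Proof.
move=> nf; rewrite /riesz_op multiplierE; last exact: nice_intg.
apply: eq_mult => xi; rewrite /mE add0r -enorm_sq -powR_mulrn; last exact: sqrtr_ge0.
by rewrite -powRrM; congr (_ `^ _); field.
Qed.

(** The case s = 0, which the even exponents include: both operators are the identity and the first
    term alone suffices, by Hölder. *)
Lemma id_scalar_kp (m : V -> R) (p0 q0 p1 q1 r : \bar R) : (forall xi, m xi = 1) ->
  (0 < p0)%E -> (0 < q0)%E -> (0 < r)%E -> (p0^-1 + q0^-1 = r^-1)%E ->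
  forall f g, nice f -> nice g ->
  (Lnorm mu r (EFin \o mult m (fun y => f y * g y)%R) <=
   1%:E * (Lnorm mu p0 (EFin \o mult m f) * Lnorm mu q0 (EFin \o g) +
           Lnorm mu p1 (EFin \o f) * Lnorm mu q1 (EFin \o mult m g)))%E.
Proof.
move=> m1 p00 q00 r0 e0 f g nf ng.
have id h : nice h -> mult m h = h.
  move=> nh; apply/funext => x; rewrite -[RHS](nice_inversion x nh).
  by apply: eq_mult => xi; rewrite m1.
rewrite (id _ (nice_mul nf ng)) (id f nf) (id g ng) mul1e.
apply: (le_trans (Lnorm_hoelder mu p00 q00 r0 e0 (nice_measurable nf) (nice_measurable ng))).
by rewrite leeDl// mule_ge0 ?Lnorm_ge0.
Qed.

Lemma symbols_scalar_kp s (p0 q0 p1 q1 r : \bar R) : (1 <= d)%N ->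
  (1 < p0)%E -> (1 < q0)%E -> (1 < p1)%E -> (1 < q1)%E -> (0 < r)%E ->
  (r^-1 = p0^-1 + q0^-1)%E -> (r^-1 = p1^-1 + q1^-1)%E ->
  ((d%:R%:E * maxe (r^-1 - 1) 0 < s%:E)%E \/ (exists m : nat, s = (2 * m)%:R)) ->
  forall m : V -> R, m = mB s \/ m = mE s 0 -> polyg m /\
  exists2 C : R, 0 < C & forall f g, nice f -> nice g ->
  (Lnorm mu r (EFin \o mult m (fun y => f y * g y)%R) <=
   C%:E * (Lnorm mu p0 (EFin \o mult m f) * Lnorm mu q0 (EFin \o g) +
           Lnorm mu p1 (EFin \o f) * Lnorm mu q1 (EFin \o mult m g)))%E.
Proof.
move=> d1 p01 q01 p11 q11 r0 e0 e1 hs m hm.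
have gt0 (p : \bar R) : (1 < p)%E -> (0 < p)%E by exact: lt_trans.
have [a [a0 a1 aE ha]] := inve_gt1 p01; have [b [b0 b1 bE hb]] := inve_gt1 q01.
have [[s0|s0] hpl] : (s = 0 \/ 0 < s) /\ (0 < s -> exists u v,
    [/\ 1 <= u, 1 <= v, pointwise_leibniz d s u v, (u%:E < p0)%E & (v%:E < q0)%E]).
  case: hs => [hs|[M sM]].
    have {}hs : d%:R * Num.max (a + b - 1) 0 < s.
      have E : (d%:R%:E * maxe (a%:E + b%:E - 1) 0 = (d%:R * Num.max (a + b - 1) 0)%:E)%E.
        by rewrite EFinM EFin_max EFinB EFinD.
      by move: hs; rewrite e0 aE bE E lte_fin.
    have s0 : 0 < s.
      by apply: le_lt_trans hs; apply: mulr_ge0 => //; rewrite le_max lexx orbT.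
    split; first by right.
    move=> _; have [lam [u [v [l0 l1 [u1 v1] uv [ua vb]]]]] := exponents d1 a0 a1 b0 b1 hs.
    exists u, v; split => //; [exact: (leibniz_fractional s0 u1 v1 l0 uv l1)|exact: ha|exact: hb].
  split; first by case: M sM => [|M] ->; [left|right; rewrite ltr0n].
  move=> s0; exists 1, 1; split => //; exact: (leibniz_even d s0 (lexx 1) (lexx 1) sM).
  (* The power with exponent 0 is 1 also at the base 0, so the Riesz symbol is 1 at the origin
     too. *)
  have m1 xi : m xi = 1 by case: hm => ->; rewrite /mB /mE s0 mul0r powRr0.
  split; first by apply: (@polyg_bounded _ _ _ 1) => [|xi]; [rewrite (_ : m = cst 1)//; apply/funext => xi; rewrite m1|rewrite m1 normr1].
  exists 1 => //; apply: id_scalar_kp => //; rewrite ?gt0//.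
have pm : polyg m.
  by case: hm => ->; [apply: polyg_mB; exact: ltW|exact: polyg_mE].
split => //; have [u [v [u1 v1 hl hu hv]]] := hpl s0.
have pl : pleib m u v by case: hm => ->; [exact: pleib_bessel|exact: pleib_riesz].
by apply: (scalar_kato_ponce pm u1 v1 pl).
Qed.

End operators.

Theorem corollary1p17 (R : realType) (n : nat) (n_ge1 : (1 <= n)%N) :
  (forall (p q r : \bar R),
     (0 < p)%E -> (0 < q)%E -> (0 < r)%E ->
     (p^-1 + q^-1 = r^-1)%E ->
     exists C : R, 0 < C /\
       forall (disp : measure_display) (T : measurableType disp)
              (mu : {measure set T -> \bar R}) (f g : 'I_n -> T -> R),
         (forall i, inLp mu p (f i)) -> (forall i, inLp mu q (g i)) ->
         (Lnorm mu r (fun x => (vdot f g x x)%:E) <=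
            C%:E * iter_Lnorm mu mu p q (vdot f g))%E)
  /\
  (forall (d : nat) (p0 q0 p1 q1 r : \bar R) (s : R),
     (1 <= d)%N ->
     (1 < p0)%E -> (1 < q0)%E -> (1 < p1)%E -> (1 < q1)%E ->
     ((2^-1)%:E < r)%E ->
     (r^-1 = p0^-1 + q0^-1)%E -> (r^-1 = p1^-1 + q1^-1)%E ->
     ((d%:R%:E * maxe (r^-1 - 1) 0 < s%:E)%E \/ (exists m : nat, s = (2 * m)%:R)) ->
     exists C : R, 0 < C /\
       forall Ds : ('rV[R]_d -> R) -> 'rV[R]_d -> R,
         Ds = riesz_op s \/ Ds = bessel_op s ->
       forall f g : 'I_n -> 'rV[R]_d -> R,
         (forall i, schwartz (f i)) -> (forall i, schwartz (g i)) ->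
         let mu := lebesgue_rV R d in
         (Lnorm mu r (fun x => (Ds (fun z => vdot f g z z) x)%:E) <=
            C%:E * (iter_Lnorm mu mu p0 q0 (vdot (fun i => Ds (f i)) g) +
                    iter_Lnorm mu mu p1 q1 (vdot f (fun i => Ds (g i)))))%E).
Proof.
split.
- move=> p q r p0 q0 r0 pqr.
  have kr := quasi_const_ge1 r0; have kq := quasi_const_ge1 q0.
  exists (quasi_const r ^+ n * n%:R * (3 * quasi_const q) ^+ n); split.
    by rewrite !mulr_gt0 ?exprn_gt0 ?mulr_gt0 ?ltr0n//; lra.
  by move=> disp T mu f g fp gq; exact: vector_hoelder.
- move=> d p0 q0 p1 q1 r s d1 p01 q01 p11 q11 r2 e0 e1 hs.
  have r0 : (0 < r)%E by apply: lt_trans r2; rewrite lte_fin invr_gt0.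
  have H := symbols_scalar_kp d1 p01 q01 p11 q11 r0 e0 e1 hs.
  have [pb [Cb Cb0 Hb]] := H _ (or_introl erefl); have [pz [Cz Cz0 Hz]] := H _ (or_intror erefl).
  have [C1 C10 H1] := vector_kato_ponce n pb p01 q01 p11 q11 r0 Cb0 Hb.
  have [C2 C20 H2] := vector_kato_ponce n pz p01 q01 p11 q11 r0 Cz0 Hz.
  (* The constant is fixed before the operator is chosen, so it has to serve both. *)
  exists (C1 + C2); split; first exact: addr_gt0.
  move=> Ds hDs f g sf sg; cbv zeta; pose mu := lebesgue_rV R d; rewrite -/mu.
  have nf i := schwartz_nice (sf i); have ng i := schwartz_nice (sg i).
  have nfg : nice (fun z => vdot f g z z) by apply: nice_sum => i; exact: nice_mul.
  have key (m : 'rV[R]_d -> R) (C : R) : 0 <= C -> C <= C1 + C2 ->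
      (forall h, nice h -> Ds h = mult m h) ->
      (Lnorm mu r (fun x => (mult m (fun z => vdot f g z z) x)%:E) <=
       C%:E * (iter_Lnorm mu mu p0 q0 (vdot (fun i => mult m (f i)) g) +
               iter_Lnorm mu mu p1 q1 (vdot f (fun i => mult m (g i)))))%E ->
      (Lnorm mu r (fun x => (Ds (fun z => vdot f g z z) x)%:E) <=
       (C1 + C2)%:E * (iter_Lnorm mu mu p0 q0 (vdot (fun i => Ds (f i)) g) +
               iter_Lnorm mu mu p1 q1 (vdot f (fun i => Ds (g i)))))%E.
    move=> C0 CC DE; rewrite (DE _ nfg).
    have -> : (fun i => Ds (f i)) = (fun i => mult m (f i)) by apply/funext => i; rewrite DE.
    have -> : (fun i => Ds (g i)) = (fun i => mult m (g i)) by apply/funext => i; rewrite DE.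
    move=> h; apply: (le_trans h); apply: lee_wpmul2r; last by rewrite lee_fin.
    exact: adde_ge0 (Lnorm_ge0 _ _ _) (Lnorm_ge0 _ _ _).
  case: hDs => DsE.
    apply: (key (mE s 0) C2) => //; [exact: ltW|by rewrite lerDr ltW| |exact: H2].
    by move=> h nh; rewrite DsE; apply/funext => x; exact: riesz_opE.
  apply: (key (mB s) C1) => //; [exact: ltW|by rewrite lerDl ltW| |exact: H1].
  by move=> h nh; rewrite DsE; apply/funext => x; exact: bessel_opE.
Qed.
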